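(* Let $D_0$ be a properly embedded disc in the oriented (connected) 4-manifold $M$, and let $\mathcal{D}$ be the set of isotopy classes rel $\partial$ of properly embedded discs homotopic rel $\partial$ to $D_0$. Then there is a canonical function $\phi_{D_0}:\mathcal{D}\to\mathbb{Z}[\pi_1(M)\setminus 1]/D(I_0)$ (the one constructed in the context; in particular it is well defined on isotopy classes) such that if $D$ is an embedded disc homotopic rel $\partial$ to $D_0$, then $\phi_{D_0}([D])\neq 0$ implies that $D$ is not isotopic to $D_0$ rel $\partial$.
   Context: Everything is smooth unless stated otherwise; $I=[0,1]$. View $D_0$ as $I\times I$ with its product foliation $\mathcal{F}_0$ by arcs $I\times v$, and let $I_0=I\times 1/2$, an oriented properly embedded arc in $M$ (denoting also its parametrization). $\mathrm{Emb}(I,M;I_0)$ (resp. $\mathrm{Maps}(I,M;I_0)$) is the space, based at $I_0$, of proper smooth embeddings (resp. proper continuous maps) $I\to M$ that coincide with $I_0$ near $\partial I$. $\pi_1^D(\mathrm{Emb}(I,M;I_0))\subset\pi_1(\mathrm{Emb}(I,M;I_0))$ is the subgroup of classes of loops null homotopic in $\mathrm{Maps}(I,M;I_0)$. $I_0$ is the basepoint for $\pi_1(M)$, $x_0=I_0(1/2)$, and $\mathbb{Z}[\pi_1(M)\setminus 1]$ is the free abelian group on the nontrivial elements of $\pi_1(M)$. The loop of a disc. Let $D$ be a properly embedded disc with $\partial D=\partial D_0$. Isotope $D$ rel $\partial$ to coincide with $D_0$ near $\partial D_0$, and view $D=I\times I$ with foliation $\mathcal{F}$ coinciding with $\mathcal{F}_0$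 near $\partial D_0$. Let $\beta_t$, $t\in[0,1]$, be the loop of embedded arcs: $\beta_t=I\times(1/2-2t)$ in $\mathcal{F}_0$ for $t\in[0,1/4]$; $\beta_t=I\times(2t-1/2)$ in $\mathcal{F}$ for $t\in[1/4,3/4]$; $\beta_t=I\times(5/2-2t)$ in $\mathcal{F}_0$ for $t\in[3/4,1]$. Naturally modify the ends of each $\beta_t$, using $D_0$, to coincide with $I_0$ near its endpoints. This gives a class $[\phi_{D_0}(D)]\in\pi_1(\mathrm{Emb}(I,M;I_0))$, which lies in $\pi_1^D(\mathrm{Emb}(I,M;I_0))$ when $D$ is homotopic to $D_0$ rel $\partial$. The map $d$. Given a loop $\alpha_t$ in $\mathrm{Emb}(I,M;I_0)$ and a null homotopy $\alpha_{t,u}\in\mathrm{Maps}(I,M;I_0)$ ($\alpha_{t,u}=I_0$ for $u$ near $0$, $=\alpha_t$ for $u$ near $1$, and $=I_0$ at $t=0,1$), let $F_0:I\times I^2\to M\times I^2$, $F_0(s,t,u)=(\alpha_{t,u}(s),t,u)$, perturbed away from the boundary to an immersion with finitely many, transverse, double points and no triple points. For a double point $x=F_0(p,t,u)=F_0(q,t,u)$, $p<q$, let $g_x\in\pi_1(M,I_0)$ be the class of $\alpha_{t,u}|_{[0,p]}*\alpha_{t,u}|_{[q,1]}$ and let $\sigma_x=\pm1$ compare the orientation of $DF_0(T_{(p,t,u)}I^3)\oplus DF_0(T_{(q,t,u)}I^3)$ with that of $T_x(M\times I^2)$. Put $d(\alpha_{t,u})=\sum_{g_x\ne1}\sigma_xg_x$.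 Families with $\alpha_{t,u}=I_0$ for $u$ near $0$ and near $1$ represent, up to homotopy rel boundary, the elements of $\pi_3(M,x_0)$, and $d$ of such families defines a homomorphism $d_3:\pi_3(M,x_0)\to\mathbb{Z}[\pi_1(M)\setminus 1]$ with image $D(I_0)$, the Dax kernel. The assignment $[\alpha_t]\mapsto d(\alpha_{t,u})$ mod $D(I_0)$ is the canonical (Dax) isomorphism $d:\pi_1^D(\mathrm{Emb}(I,M;I_0))\to\mathbb{Z}[\pi_1(M)\setminus 1]/D(I_0)$. The function. $\phi_{D_0}([D])$ denotes $d([\phi_{D_0}(D)])\in\mathbb{Z}[\pi_1(M)\setminus 1]/D(I_0)$. *)

(* Defs.v *)
From HB Require Import structures.
From mathcomp Require Import all_boot all_order all_algebra.
From mathcomp Require Import all_classical all_reals all_analysis.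
From mathcomp.multinomials Require Import freeg.
Set Implicit Arguments.
Unset Strict Implicit.
Unset Printing Implicit Defensive.
Import Order.TTheory GRing.Theory Num.Theory.
Import numFieldNormedType.Exports.
Local Open Scope classical_set_scope.
Local Open Scope ring_scope.

Section Smooth.
Variable R : realType.

Definition vec2 (x y : R) : 'rV[R]_2 := \row_(i < 2) [:: x; y]`_i.
Definition vec3 (x y z : R) : 'rV[R]_3 := \row_(i < 3) [:: x; y; z]`_i.

Definition cube (n : nat) : set 'rV[R]_n :=
  [set x | forall i, 0 <= x 0 i <= 1].

Definition unit_itv : set R := [set t | 0 <= t <= 1].

Fixpoint Ck (n m k : nat) (U : set 'rV[R]_n) (g : 'rV[R]_n -> 'rV[R]_m) : Prop :=
  (forall x, U x -> {for x, continuous g}) /\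
  (if k is k'.+1 then
     forall v, (forall x, U x -> derivable g x v) /\ Ck k' U (fun x => 'D_v g x)
   else True).

Definition Cinfty (n m : nat) (U : set 'rV[R]_n) (g : 'rV[R]_n -> 'rV[R]_m) :=
  forall k, Ck k U g.

(* Near [x], the restriction of [f] to [A] extends to a smooth map on an open
   set, with differential [v |-> v *m J] at [x]. This is the usual notion of
   smoothness on cubes, discs and half-spaces, where [J] does not depend on the
   extension. *)
Definition diff_on (n m : nat) (f : 'rV[R]_n -> 'rV[R]_m) (A : set 'rV[R]_n)
    (x : 'rV[R]_n) (J : 'M[R]_(n, m)) : Prop :=
  exists U g, [/\ open_nbhs x U, Cinfty U g,
    (forall y, U y -> A y -> g y = f y) &
    (forall v, 'D_v g x = v *m J)].

Definition smooth_fun (f : R -> R) : Prop :=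
  forall (k : nat) (x : R), derivable (derive1n k f) x 1.

End Smooth.

Arguments cube {R} n.
Arguments unit_itv {R}.

Section Manifold.
Variable R : realType.

Record chart (T : Type) := Chart {
  chart_dom : set T;
  chart_fun :> T -> 'rV[R]_4;
  chart_inv : 'rV[R]_4 -> T }.

Definition half_space : set 'rV[R]_4 := [set y | 0 <= y 0 0].

(* a homeomorphism from an open set onto a relatively open set of the
   half-space *)
Definition is_chart (T : topologicalType) (c : chart T) : Prop :=
  [/\ open (chart_dom c),
      (exists2 V, open V & c @` chart_dom c = V `&` half_space),
      (forall x, chart_dom c x -> chart_inv c (c x) = x),
      {within chart_dom c, continuous c} &
      {within c @` chart_dom c, continuous (chart_inv c)}].

Definition positive_transition (T : topologicalType) (c d : chart T) : Prop :=
  forall x, chart_dom c x -> chart_dom d x ->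
  exists2 J : 'M[R]_4,
    diff_on (fun y => d (chart_inv c y)) (c @` (chart_dom c `&` chart_dom d))
      (c x) J &
    0 < \det J.

(* Oriented smooth 4-manifolds with (possibly empty) boundary; the orientation
   is carried by the atlas. *)
Record oriented_manifold4 := OrientedManifold4 {
  carrier :> topologicalType;
  atlas : set (chart carrier);
  manifold_hausdorff : hausdorff_space carrier;
  manifold_second_countable : @second_countable carrier;
  atlas_cover : forall x, exists2 c, atlas c & chart_dom c x;
  atlas_chart : forall c, atlas c -> is_chart c;
  atlas_positive : forall c d, atlas c -> atlas d -> positive_transition c d }.

Variable M : oriented_manifold4.

Definition boundary : set M :=
  [set x | exists c, [/\ atlas c, chart_dom c x & c x 0 0 = 0]].

(* [J] is the differential of [f : A -> M] at [x], read in the chart [c]. *)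
Definition mdiff (n : nat) (f : 'rV[R]_n -> M) (A : set 'rV[R]_n)
    (x : 'rV[R]_n) (c : chart M) (J : 'M[R]_(n, 4)) : Prop :=
  [/\ atlas c, (\forall y \near within A (nbhs x), chart_dom c (f y)) &
      diff_on (fun y => c (f y)) A x J].

Definition msmooth (n : nat) (f : 'rV[R]_n -> M) (A : set 'rV[R]_n) : Prop :=
  forall x, A x -> exists c J, mdiff f A x c J.

(* Proper smooth embeddings of a compact [A] with boundary [B]: injective
   immersions [f] with [f @^-1` boundary = B], transverse to the boundary
   along [B] (the first chart coordinate has nonzero differential there). *)
Definition proper_embedding (n : nat) (A B : set 'rV[R]_n) (f : 'rV[R]_n -> M) :
    Prop :=
  [/\ set_inj A f,
      (forall x, A x -> exists c J, mdiff f A x c J /\ row_free J),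
      (forall x, A x -> (boundary (f x) <-> B x)) &
      (forall x, B x -> forall c J, mdiff f A x c J -> exists i, J i 0 != 0)].

End Manifold.

Arguments boundary {R M}.

Section Arcs.
Variables (R : realType) (M : oriented_manifold4 R).

Definition proper_arc (f : R -> M) : Prop :=
  proper_embedding (cube 1) [set x | x 0 0 = 0 \/ x 0 0 = 1]
    (fun x : 'rV[R]_1 => f (x 0 0)).

Variable I0 : R -> M.

Definition agrees_near_ends (f : R -> M) : Prop :=
  exists2 e : R, 0 < e &
    forall s, 0 <= s <= 1 -> s <= e \/ 1 - e <= s -> f s = I0 s.

Definition Emb (f : R -> M) : Prop := proper_arc f /\ agrees_near_ends f.

Definition Maps (f : R -> M) : Prop :=
  [/\ {within unit_itv, continuous f},
      (forall s, 0 <= s <= 1 -> (boundary (f s) <-> s = 0 \/ s = 1)) &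
      agrees_near_ends f].

(* [a t s] is the point of parameter [s] of the arc [a t]. *)
Definition Emb_loop (a : R -> R -> M) : Prop :=
  [/\ msmooth (fun x : 'rV[R]_2 => a (x 0 1) (x 0 0)) (cube 2),
      (forall t, 0 <= t <= 1 -> Emb (a t)) &
      (forall s, 0 <= s <= 1 -> a 0 s = I0 s /\ a 1 s = I0 s)].

(* equality in [pi_1 (Emb (I, M; I0))] *)
Definition Emb_loop_homotopic (a b : R -> R -> M) : Prop :=
  [/\ Emb_loop a, Emb_loop b &
   exists K : R -> R -> R -> M,
     [/\ msmooth (fun x : 'rV[R]_3 => K (x 0 2) (x 0 1) (x 0 0)) (cube 3),
         (forall r, 0 <= r <= 1 -> Emb_loop (K r)) &
         (forall t s, 0 <= t <= 1 -> 0 <= s <= 1 ->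
            K 0 t s = a t s /\ K 1 t s = b t s)]].

(* The map [(s, t, u) |-> A t u s]. *)
Definition family3 (A : R -> R -> R -> M) (x : 'rV[R]_3) : M :=
  A (x 0 1) (x 0 2) (x 0 0).

Definition null_homotopy (a : R -> R -> M) (A : R -> R -> R -> M) : Prop :=
  [/\ {within cube 3, continuous (family3 A)},
      (forall t u, 0 <= t <= 1 -> 0 <= u <= 1 -> Maps (A t u)),
      (exists2 e : R, 0 < e & forall t u s,
         0 <= t <= 1 -> 0 <= u <= 1 -> 0 <= s <= 1 ->
         (u <= e -> A t u s = I0 s) /\ (1 - e <= u -> A t u s = a t s)) &
      (forall u s, 0 <= u <= 1 -> 0 <= s <= 1 ->
         A 0 u s = I0 s /\ A 1 u s = I0 s)].

(* [pi_1 (M, I0)]: paths with endpoints on the arc [I0], up to homotopies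
   keeping the endpoints on [I0]. *)
Definition based_path (g : R -> M) : Prop :=
  [/\ {within unit_itv, continuous g},
      (I0 @` unit_itv) (g 0) & (I0 @` unit_itv) (g 1)].

Definition based_homotopic (g h : R -> M) : Prop :=
  exists H : R -> R -> M,
    [/\ {within unit_itv `*` unit_itv, continuous (fun x : R * R => H x.1 x.2)},
        (forall r, 0 <= r <= 1 -> based_path (H r)) &
        (forall s, 0 <= s <= 1 -> H 0 s = g s /\ H 1 s = h s)].

Definition pi1_class (g : R -> M) : set (R -> M) :=
  [set h | based_path h /\ based_homotopic g h].

Definition is_nontrivial_class (X : set (R -> M)) : bool :=
  `[< exists g, [/\ based_path g, X = pi1_class g & ~ based_homotopic I0 g] >].

Definition pi1_nontrivial := {X : set (R -> M) | is_nontrivial_class X}.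

(* Z[pi_1(M) \ 1] *)
Definition Zpi1 := {freeg pi1_nontrivial / int}.
HB.instance Definition _ := GRing.Zmodule.on Zpi1.

(* The immersion [F (s, t, u) = (A t u s, t, u)] into [M x I^2] has
   differential [lift_diff J], where [J] is that of [family3 A]. *)
Definition lift_diff (J : 'M[R]_(3, 4)) : 'M[R]_(3, 4 + 2) :=
  row_mx J (\matrix_(i < 3, j < 2) (i == j.+1 :> nat)%:R).

(* [(p, q, t, u)] with [p < q] and [F (p, t, u) = F (q, t, u)] *)
Definition double_points (A : R -> R -> R -> M) : set (R * R * R * R) :=
  [set x | let: (p, q, t, u) := x in
    [/\ 0 <= p, p < q, q <= 1, 0 <= t <= 1 & 0 <= u <= 1] /\
    A t u p = A t u q].

(* [dp_det A x e]: [e] is the determinant, in an oriented chart, of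
   [DF (T_(p, t, u) I^3) (+) DF (T_(q, t, u) I^3)]. *)
Definition dp_det (A : R -> R -> R -> M) (x : R * R * R * R) (e : R) : Prop :=
  let: (p, q, t, u) := x in
  exists c J1 J2,
    [/\ mdiff (family3 A) (cube 3) (vec3 p t u) c J1,
        mdiff (family3 A) (cube 3) (vec3 q t u) c J2 &
        e = \det (col_mx (lift_diff J1) (lift_diff J2) : 'M[R]_6)].

Definition generic (A : R -> R -> R -> M) : Prop :=
  [/\ (forall x, cube 3 x -> exists c J,
         mdiff (family3 A) (cube 3) x c J /\ row_free (lift_diff J)),
      finite_set (double_points A),
      (forall x, double_points A x -> exists2 e, dp_det A x e & e != 0) &
      (forall p q r t u, double_points A (p, q, t, u) ->
         ~ double_points A (q, r, t, u))].

(* the concatenation of [f] on [[0, p]] with [f] on [[q, 1]] *)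
Definition shortcut (f : R -> M) (p q : R) (s : R) : M :=
  if s <= 2^-1 then f (2 * s * p) else f (q + (2 * s - 1) * (1 - q)).

Definition dp_sign (A : R -> R -> R -> M) (x : R * R * R * R) : int :=
  if `[< exists2 e, dp_det A x e & 0 < e >] then 1 else -1.

(* [sigma_x g_x], or [0] when [g_x = 1] *)
Definition dp_term (A : R -> R -> R -> M) (x : R * R * R * R) : Zpi1 :=
  let: (p, q, t, u) := x in
  if insub (pi1_class (shortcut (A t u) p q)) is Some g
  then << dp_sign A x *g (g : pi1_nontrivial) >> else 0.

Definition dax_sum (A : R -> R -> R -> M) : Zpi1 :=
  \sum_(x \in double_points A) dp_term A x.

(* The values [d (A)] for the generic null homotopies [A] of the loop [a];
   there are none unless [a] is null homotopic in [Maps]. *)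
Definition dax_value (a : R -> R -> M) : set Zpi1 :=
  [set z | exists A, [/\ null_homotopy a A, generic A & z = dax_sum A]].

(* The families representing elements of [pi_3 (M)] are the null homotopies of
   the constant loop. *)
Definition dax_kernel : set Zpi1 := dax_value (fun _ => I0).

Definition dax_quotient :=
  {X : set Zpi1 | exists z : Zpi1, X = [set z + k | k in dax_kernel]}.

Definition dax_coset (z : Zpi1) : dax_quotient :=
  exist _ [set z + k | k in dax_kernel] (ex_intro _ z erefl).

End Arcs.

Arguments dax_value {R M} I0 a _.
Arguments dax_coset {R M} I0 z.

Section Discs.
Variables (R : realType) (M : oriented_manifold4 R).
Implicit Types D : 'rV[R]_2 -> M.

Definition disc : set 'rV[R]_2 := [set x | x 0 0 ^+ 2 + x 0 1 ^+ 2 <= 1].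
Definition circle : set 'rV[R]_2 := [set x | x 0 0 ^+ 2 + x 0 1 ^+ 2 = 1].

Definition proper_disc D : Prop := proper_embedding disc circle D.

(* The elliptical grid map, a smooth homeomorphism from [I x I] onto the unit
   disc which is a diffeomorphism away from the corners. Through it a disc is
   viewed as [I x I], foliated by the arcs [I x v]. *)
Definition square_disc (s v : R) : 'rV[R]_2 :=
  let x := 2 * s - 1 in let y := 2 * v - 1 in
  vec2 (x * Num.sqrt (1 - y ^+ 2 / 2)) (y * Num.sqrt (1 - x ^+ 2 / 2)).

Definition core_arc D (s : R) : M := D (square_disc s 2^-1).

(* Isotopy rel boundary of discs as submanifolds: the final embedding may
   differ from [D'] by a reparametrization, and so may the initial one
   from [D]. *)
Definition isotopic_discs D D' : Prop :=
  exists H : R -> 'rV[R]_2 -> M,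
    [/\ msmooth (fun x : 'rV[R]_3 => H (x 0 2) (vec2 (x 0 0) (x 0 1)))
          [set x | disc (vec2 (x 0 0) (x 0 1)) /\ 0 <= x 0 2 <= 1],
        (forall r, 0 <= r <= 1 -> proper_disc (H r)),
        (forall r x, 0 <= r <= 1 -> circle x -> H r x = D x /\ H r x = D' x),
        H 0 @` disc = D @` disc & H 1 @` disc = D' @` disc].

Variable D0 : 'rV[R]_2 -> M.

Definition disc_homotopic D : Prop :=
  proper_disc D /\
  exists H : R -> 'rV[R]_2 -> M,
    [/\ {within unit_itv `*` disc,
           continuous (fun x : R * 'rV[R]_2 => H x.1 x.2)},
        (forall r x, 0 <= r <= 1 -> circle x -> H r x = D0 x),
        (forall x, disc x -> H 0 x = D0 x) &
        (forall x, disc x -> H 1 x = D x)].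

Definition disc_isotopy_class :=
  {X : set ('rV[R]_2 -> M) | exists2 D, disc_homotopic D &
     X = [set D' | disc_homotopic D' /\ isotopic_discs D D']}.

Definition class_of_disc D (hD : disc_homotopic D) : disc_isotopy_class :=
  exist _ [set D' | disc_homotopic D' /\ isotopic_discs D D']
    (ex_intro2 _ _ D hD erefl).

Definition agrees_on_collar (e : R) D : Prop :=
  forall s v, 0 <= s <= 1 -> 0 <= v <= 1 ->
    [\/ s <= e, 1 - e <= s, v <= e | 1 - e <= v] ->
    D (square_disc s v) = D0 (square_disc s v).

Definition sweep_height (t : R) : R :=
  if t <= 4^-1 then 2^-1 - 2 * t
  else if t <= 3 / 4 then 2 * t - 2^-1 else 5 / 2 - 2 * t.

(* The arc [beta_t] of the disc [D], for [D] equal to [D0] on the collar of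
   width [e]: it lies in the leaf of height [v = sweep_height t] rescaled to
   [[e, 1 - e]], since the leaves of height 0 and 1 lie in the boundary of
   [M]; and where [rho] vanishes, near the endpoints, it is [core_arc D0]. *)
Definition beta (e : R) (rho : R -> R) D (t s : R) : M :=
  let E := if 4^-1 <= t <= 3 / 4 then D else D0 in
  E (square_disc s (2^-1 + (1 - 2 * e) * rho s * (sweep_height t - 2^-1))).

Definition end_cutoff (e : R) (rho : R -> R) : Prop :=
  [/\ smooth_fun rho, (forall s, 0 <= rho s <= 1),
      (forall s, e <= s <= 1 - e -> rho s = 1) &
      (exists2 h : R, 0 < h & forall s, s <= h \/ 1 - h <= s -> rho s = 0)].

(* A reparametrization of [[0, 1]], stationary near 1/4 and 3/4, which makes
   the piecewise defined loop [beta] smooth in [t]. *)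
Definition time_change (tau : R -> R) : Prop :=
  [/\ smooth_fun tau, tau 0 = 0, tau 1 = 1,
      {homo tau : x y / x <= y} &
      (exists2 h : R, 0 < h & forall t,
         (`|t - 4^-1| < h -> tau t = 4^-1) /\
         (`|t - 3 / 4| < h -> tau t = 3 / 4))].

(* the loops in the class [[phi_D0 (D)]] of [pi_1 (Emb (I, M; I0))] *)
Definition disc_loop D (a : R -> R -> M) : Prop :=
  exists D' e rho tau,
    [/\ proper_disc D', isotopic_discs D D', 0 < e < 2^-1 /\ agrees_on_collar e D',
        end_cutoff e rho /\ time_change tau &
        Emb_loop_homotopic (core_arc D0) (fun t => beta e rho D' (tau t)) a].

(* [phi] is the function [[D] |-> d [phi_D0 (D)] mod D(I0)]: the construction
   can be carried out for every [D], and [phi] takes the value it gives for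
   every choice made in it. *)
Definition is_phi
    (phi : disc_isotopy_class -> dax_quotient (core_arc D0)) : Prop :=
  forall D (hD : disc_homotopic D),
    [/\ (exists a, disc_loop D a),
        (forall a, disc_loop D a -> exists z, dax_value (core_arc D0) a z) &
        (forall a z, disc_loop D a -> dax_value (core_arc D0) a z ->
           phi (class_of_disc hD) = dax_coset (core_arc D0) z)].

End Discs.

(* Main.v *)
Require Import Defs.
From HB Require Import structures.
From mathcomp Require Import all_boot all_order all_algebra.
From mathcomp Require Import all_classical all_reals all_analysis.
From mathcomp.multinomials Require Import freeg.
From mathcomp Require Import ring lra zify.
Set Implicit Arguments.
Unset Strict Implicit.
Unset Printing Implicit Defensive.
Import Order.TTheory GRing.Theory Num.Theory.
Import numFieldNormedType.Exports.
Local Open Scope classical_set_scope.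
Local Open Scope ring_scope.

(* The value of a loop is the signed count of the double points of a generic null
   homotopy.  Generic null homotopies of two homotopic loops glue, in the
   direction [u], to a sphere, so that their counts differ by an element of the
   Dax kernel.  Generic families are obtained by small translations in charts, with
   Sard's theorem; a double point created by a small perturbation has the group
   element of a coincidence of the original family.

   An arc in an embedded disc [D] with boundary that of [D0] is tame: the shortcut at a
   coincidence is the image of a path of the disc, which can be pushed into the
   circle, so that its group element is trivial.  Hence a homotopy of loops which
   sweeps isotopic discs contributes nothing, and the value depends only on the
   isotopy class.  A disc is isotopic to one which agrees with [D0] near the
   circle: the two are interpolated in the charts of a collar, with a cutoff slow
   enough for the differential to stay injective. *)

(** Only Sard's theorem for maps between spaces of equal dimension is used, and every general
    position condition is brought to that form. A pair of points of one arc has four parameters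
    [(p, q, t, u)], as many as the coordinates of a chart, so that transversality of the double
    points becomes regularity of a value of a quotient. Conditions with fewer parameters (immersed
    arcs, no triple points) are padded with idle variables: the Jacobian is then singular
    everywhere, and a regular value is one that is not attained.

    The arcs of [Maps] must agree with the base arc near their ends and meet the boundary only
    there, while the homotopies swept by discs only fix the endpoints. The agreement is forced by
    inserting at both ends a short excursion along the base arc and back (a hair); contact with the
    boundary is removed by the smoothing. A homotopy of discs and an isotopy go through the same
    construction, a proposition [b] recording whether the arcs are known to be tame: the first
    yields the existence of values, the second their invariance. *)

HB.instance Definition _ (R : realType) (n : nat) := Complete.on 'rV[R]_n.+1.

Section Dax.
Variable R : realType.
Local Notation "''R_' n" := 'rV[R]_n (at level 0, n at level 2).
Local Notation itv t := (0 <= (t : R) <= 1).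
Local Notation Q := (@cube R 3).
Local Notation disc := (@disc R).
Local Notation circle := (@circle R).
Local Notation w2 := (Num.sqrt (2 : R)).
Local Notation dom := chart_dom.
Implicit Types T : topologicalType.

(** * Elementary continuity *)

Lemma itv0 : itv 0. Proof. lra. Qed.
Lemma itv1 : itv 1. Proof. lra. Qed.

Lemma nbhsO T (U : set T) x : open U -> U x -> nbhs x U.
Proof. by move=> oU Ux; exact: open_nbhs_nbhs. Qed.

Lemma gt_near (a b : R) : a < b -> nbhs b [set x | a < x].
Proof. by move=> ab; exact: nbhsO (@open_gt R a) ab. Qed.

Lemma lt_near (a b : R) : a < b -> nbhs a [set x | x < b].
Proof. by move=> ab; exact: nbhsO (@open_lt R b) ab. Qed.

Lemma open_pre (S T : topologicalType) (f : S -> T) (V : set T) : continuous f -> open V -> open (f @^-1` V).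
Proof. by move=> cf; apply: open_comp => x _. Qed.

Lemma cont_cst (S T : topologicalType) (a : T) : continuous (fun _ : S => a).
Proof. by exact: cst_continuous. Qed.

Lemma cont_id T : continuous (fun x : T => x). Proof. by move=> x. Qed.

Lemma cont_fst (S T : topologicalType) : continuous (@fst S T). Proof. by move=> z; exact: cvg_fst. Qed.

Lemma cont_snd (S T : topologicalType) : continuous (@snd S T). Proof. by move=> z; exact: cvg_snd. Qed.

Lemma cont_lin T (f g : T -> R) : continuous f -> continuous g -> continuous (fun x => f x + g x).
Proof. by move=> cf cg x; exact: (@continuousD R R T f g x (cf x) (cg x)). Qed.

Lemma cont_mul T (f g : T -> R) : continuous f -> continuous g -> continuous (fun x => f x * g x).
Proof. by move=> cf cg x; exact: (@continuousM R T f g x (cf x) (cg x)). Qed.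

Lemma cont_opp T (f : T -> R) : continuous f -> continuous (fun x => - f x).
Proof. by move=> cf x; exact: (@continuousN R R T f x (cf x)). Qed.

Lemma cont_o (S T U : topologicalType) (f : S -> T) (g : T -> U) :
 continuous f -> continuous g -> continuous (fun x => g (f x)).
Proof. by move=> cf cg x; exact: (continuous_comp (cf x) (cg (f x))). Qed.

Lemma cont_pairg (S T U : topologicalType) (f : S -> T) (g : S -> U) :
 continuous f -> continuous g -> continuous (fun x => (f x, g x)).
Proof.
by move=> cf cg x; exact: (@cvg_pair _ _ _ (nbhs x) (nbhs (f x)) (nbhs (g x)) _ _ _ f g (cf x) (cg x)).
Qed.

Lemma cont_add T (W : normedModType R) (f g : T -> W) :
 continuous f -> continuous g -> continuous (fun x => f x + g x).
Proof. by move=> cf cg x; exact: (continuousD (cf x) (cg x)). Qed.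

Lemma cont_scaleg T (W : normedModType R) (a : T -> R) (f : T -> W) :
 continuous a -> continuous f -> continuous (fun x => a x *: f x).
Proof. by move=> ca cf x; exact: (cvgZ (ca x) (cf x)). Qed.

Lemma cont_min T (f g : T -> R) :
 continuous f -> continuous g -> continuous (fun x => Num.min (f x) (g x)).
Proof. by move=> cf cg x; exact: (@continuous_min R T f g x (cf x) (cg x)). Qed.

Lemma cont_max T (f g : T -> R) :
 continuous f -> continuous g -> continuous (fun x => Num.max (f x) (g x)).
Proof. by move=> cf cg x; exact: (@continuous_max R T f g x (cf x) (cg x)). Qed.

Lemma cont_sqr T (f : T -> R) : continuous f -> continuous (fun x => f x ^+ 2).
Proof. by move=> cf; apply: (cont_mul). Qed.

Lemma cont_sqrt T (f : T -> R) : continuous f -> continuous (fun x => Num.sqrt (f x)).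
Proof. by move=> cf; apply: (cont_o cf); exact: sqrt_continuous. Qed.

Lemma cont_norm T (f : T -> R) : continuous f -> continuous (fun x => `|f x|).
Proof. by move=> cf; apply: (cont_o cf); exact: norm_continuous. Qed.

Lemma cont_inv T (f : T -> R) : continuous f -> (forall x, f x != 0) -> continuous (fun x => (f x)^-1).
Proof. by move=> cf f0 x; exact: (@continuousV R T f x (f0 x) (cf x)). Qed.

#[local] Hint Resolve openT itv0 itv1 : core.
#[local] Hint Extern 0 (continuous_at _ _) =>
 solve [exact: cont_cst | exact: cont_id | exact: cont_fst | exact: cont_snd] : core.

(** * Calculus of functions of class C^k, flat functions and the smooth step *)

Section SmoothCalculus.
Implicit Types (n m k : nat).

Lemma is_derive_line (V : normedModType R) (f : V -> R) (x v : V) (t : R) :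
 derivable f (x + t *: v) v ->
 is_derive t 1 (fun s : R => f (x + s *: v)) ('D_v f (x + t *: v)).
Proof.
move=> df.
have E : (fun h : R => h^-1 *: (((fun s : R => f (x + s *: v)) \o shift t) (h *: 1)
   - f (x + t *: v))) =
 (fun h => h^-1 *: ((f \o shift (x + t *: v)) (h *: v) - f (x + t *: v))).
 apply/funext => h /=; congr (_ *: (f _ - _)).
 by rewrite /= scaler1 scalerDl addrCA.
by apply: DeriveDef; rewrite /derivable /derive E.
Qed.

Lemma mvt_line (V : normedModType R) (f : V -> R) (x v : V) :
 (forall t, 0 <= t <= 1 -> derivable f (x + t *: v) v) ->
 exists2 c : R, 0 < c < 1 & f (x + v) - f x = 'D_v f (x + c *: v).
Proof.
move=> df; have d t : 0 <= t <= 1 -> _ := fun ht => is_derive_line (df t ht).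
have [||c] := @MVT R (fun s => f (x + s *: v)) (fun t => 'D_v f (x + t *: v)) 0 1
 ltr01.
- by move=> t; rewrite in_itv/= => /andP[/ltW t0 /ltW t1]; apply: d; rewrite t0.
- apply: continuous_in_subspaceT => t; rewrite inE/= in_itv/= => t01.
 apply: differentiable_continuous; apply/derivable1_diffP.
 by have [] := d t t01.
rewrite subr0 mulr1 scale1r scale0r addr0 => c01 E; by exists c.
Qed.

(** Scalar counterpart of [Ck]. The calculus is done for real-valued functions and transferred to
    maps, coordinate by coordinate, with [Ck_coordP]. *)
Fixpoint ck n k (U : set 'R_n) (f : 'R_n -> R) : Prop :=
 (forall x, U x -> {for x, continuous f}) /\
 (if k is k'.+1 then
   forall v, (forall x, U x -> derivable f x v) /\ ck k' U (fun x => 'D_v f x)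
  else True).

Lemma ck_cont n k U (f : 'R_n -> R) x : ck k U f -> U x -> {for x, continuous f}.
Proof. by case: k => [|k] [h _]; apply: h. Qed.

Lemma ckW n k U (f : 'R_n -> R) : ck k.+1 U f -> ck k U f.
Proof.
elim: k f => [|k IH] f [c h]; split=> // v; have [d D] := h v; split=> //.
exact: IH.
Qed.

Lemma ck_sub n k (U V : set 'R_n) (f : 'R_n -> R) :
 V `<=` U -> ck k U f -> ck k V f.
Proof.
move=> VU; elim: k f => [|k IH] f [c h]; split=> //.
- by move=> x /VU; apply: c.
- by move=> x /VU; apply: c.
move=> v; have [d D] := h v; split; last exact: IH.
by move=> x /VU; apply: d.
Qed.

Lemma open_near T (U : set T) (P : T -> Prop) x :
 open U -> U x -> (forall y, U y -> P y) -> \near x, P x.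
Proof. by move=> oU Ux h; apply: filterS h _; apply: open_nbhs_nbhs. Qed.

Lemma open_eq_near T (S : Type) (U : set T) (f g : T -> S) x :
 open U -> U x -> (forall y, U y -> f y = g y) -> {near x, f =1 g}.
Proof. by move=> oU Ux h; apply: open_near oU Ux h. Qed.

Lemma near_eq_cont (S T : topologicalType) (f g : S -> T) x :
 {near x, f =1 g} -> {for x, continuous f} -> {for x, continuous g}.
Proof.
move=> fg c; rewrite /prop_for /continuous_at -(nbhs_singleton fg).
by apply: cvg_trans c; apply: near_eq_cvg.
Qed.

Lemma ck_ext n k (U : set 'R_n) (f g : 'R_n -> R) :
 open U -> (forall x, U x -> f x = g x) -> ck k U f -> ck k U g.
Proof.
move=> oU; elim: k f g => [|k IH] f g fg [c h]; (split;
 first by move=> x Ux; exact: near_eq_cont (open_eq_near oU Ux fg) (c x Ux)).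
 by [].
move=> v; have [d D] := h v; split.
 by move=> x Ux; exact: near_eq_derivable (open_eq_near oU Ux fg) (d x Ux).
apply: IH D => x Ux; apply: near_eq_derive; exact: open_eq_near oU Ux fg.
Qed.

Lemma ck_cst n k U (a : R) : ck k U (fun _ : 'R_n => a).
Proof.
elim: k a => [|k IH] a; split=> //.
- by move=> x _; apply: cst_continuous.
- by move=> x _; apply: cst_continuous.
move=> v; split; first by move=> x _; apply: derivable_cst.
by rewrite [X in ck k U X](_ : _ = fun=> 0) //; apply/funext => x; apply: derive_cst.
Qed.

Lemma ckD n k U (f g : 'R_n -> R) : open U ->
 ck k U f -> ck k U g -> ck k U (fun x => f x + g x).
Proof.
move=> oU; elim: k f g => [|k IH] f g [cf hf] [cg hg]; (split; last first).
- by [].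
- by move=> x Ux; apply: continuousD; [apply: cf|apply: cg].
- move=> v; have [df Df] := hf v; have [dg Dg] := hg v; split.
  by move=> x Ux; apply: derivableD; [apply: df|apply: dg].
 apply: ck_ext (IH _ _ Df Dg) => // x Ux.
 by rewrite deriveD //; [apply: df|apply: dg].
- by move=> x Ux; apply: continuousD; [apply: cf|apply: cg].
Qed.

Lemma ckM n k U (f g : 'R_n -> R) : open U ->
 ck k U f -> ck k U g -> ck k U (fun x => f x * g x).
Proof.
move=> oU; elim: k f g => [|k IH] f g kf kg; have [cf hf] := kf; have [cg hg] := kg;
 (split; last first).
- by [].
- by move=> x Ux; apply: continuousM; [apply: cf|apply: cg].
- move=> v; have [df Df] := hf v; have [dg Dg] := hg v; split.
  by move=> x Ux; apply: (@derivableM _ _ f g); [apply: df|apply: dg].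
 have := ckD oU (IH _ _ (ckW kf) Dg) (IH _ _ (ckW kg) Df).
 apply: ck_ext => // x Ux.
 by rewrite deriveM //; [apply: df|apply: dg].
- by move=> x Ux; apply: continuousM; [apply: cf|apply: cg].
Qed.

Lemma ck_sum n k U (I : Type) (r : seq I) (f : I -> 'R_n -> R) : open U ->
 (forall i, ck k U (f i)) -> ck k U (fun x => \sum_(i <- r) f i x).
Proof.
move=> oU h; elim: r => [|i r IH].
 by apply: ck_ext (ck_cst k U 0) => // x _; rewrite big_nil.
by apply: ck_ext (ckD oU (h i) IH) => // x _; rewrite big_cons.
Qed.

Lemma ck_prod n k U (I : Type) (r : seq I) (f : I -> 'R_n -> R) : open U ->
 (forall i, ck k U (f i)) -> ck k U (fun x => \prod_(i <- r) f i x).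
Proof.
move=> oU h; elim: r => [|i r IH].
 by apply: ck_ext (ck_cst k U 1) => // x _; rewrite big_nil.
by apply: ck_ext (ckM oU (h i) IH) => // x _; rewrite big_cons.
Qed.

Lemma is_derive_coord n (i : 'I_n) (x v : 'R_n) :
 is_derive x v (fun y : 'R_n => y 0 i) (v 0 i).
Proof.
have d : derivable (fun y : 'R_n => y 0 i) x v by apply: diff_derivable; exact: differentiable_coord.
apply: DeriveDef => //.
have /(congr1 (fun A : 'R_n => A 0 i)) := @derive_mx R 'R_n 1 n id x v (@derivable_id _ _ x v).
by rewrite derive_id mxE => ->.
Qed.

Lemma ck_coord n k U (i : 'I_n) : ck k U (fun y : 'R_n => y 0 i).
Proof.
have c (x : 'R_n) : {for x, continuous (fun y : 'R_n => y 0 i)}.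
 exact: coord_continuous.
case: k => [|k]; split=> // v; split=> [x _|]; first by have [] := is_derive_coord i x v.
rewrite [X in ck k U X](_ : _ = fun=> v 0 i); first exact: ck_cst.
by apply/funext => x; have [] := is_derive_coord i x v.
Qed.

Lemma mvt_dir (V : normedModType R) (f : V -> R) (x v : V) (a : R) :
 (forall t, `|t| <= `|a| -> derivable f (x + t *: v) v) ->
 exists2 c : R, `|c| <= `|a| & f (x + a *: v) - f x = a * 'D_v f (x + c *: v).
Proof.
move=> df; have d t : `|t| <= `|a| -> _ := fun ht => is_derive_line (df t ht).
have cont (t : R) : `|t| <= `|a| -> {for t, continuous (fun s : R => f (x + s *: v))}.
 move=> ht; apply: differentiable_continuous; apply/derivable1_diffP.
 by have [] := d t ht.
have [a0|a0] := leP 0 a.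
 have inb t : t \in `[0, a] -> `|t| <= `|a| by rewrite in_itv/= => /andP[t0 ta]; rewrite !ger0_norm.
 have [||c] := @MVT_segment R (fun s => f (x + s *: v))
  (fun t => 'D_v f (x + t *: v)) 0 a a0.
 - by move=> t ht; apply: d; apply: inb; apply: subset_itv_oo_cc ht.
 - by apply: continuous_in_subspaceT => t; rewrite inE/= => /inb; apply: cont.
 by move=> /inb ca; rewrite subr0 scale0r addr0 mulrC => E; exists c.
have inb t : t \in `[a, 0] -> `|t| <= `|a| by rewrite in_itv/= => /andP[t0 ta]; rewrite !ler0_norm ?lerN2// ltW.
have [||c] := @MVT_segment R (fun s => f (x + s *: v))
  (fun t => 'D_v f (x + t *: v)) a 0 (ltW a0).
- by move=> t ht; apply: d; apply: inb; apply: subset_itv_oo_cc ht.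
- by apply: continuous_in_subspaceT => t; rewrite inE/= => /inb; apply: cont.
move=> /inb ca; rewrite scale0r addr0 sub0r mulrN mulrC => E; exists c => //.
by rewrite -[RHS]opprK -E opprB.
Qed.

Lemma differentiable_o0 (V : normedModType R) (r : V -> R) x :
 (forall e, 0 < e -> \forall h \near (0 : V), `|r (h + x) - r x| <= e * `|h|) ->
 differentiable r x.
Proof.
move=> H.
have E : r \o shift x = cst (r x) + (\0 : V -> R) +o_ 0 id.
 apply/eqaddoP => e e0; near=> h; rewrite /= !fctE /= addr0.
 by near: h; apply: H.
have c0 : continuous (\0 : V -> R) by [].
have D := @diff_unique R _ _ r \0 x c0 E.
by apply/diff_locallyP; rewrite D.
Unshelve. all: end_near. Qed.

Lemma near_forall T (I : finType) (P : I -> T -> Prop) (x : T) :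
 (forall i, \forall y \near x, P i y) -> \forall y \near x, forall i, P i y.
Proof. by apply: filter_forall. Qed.

Definition row_upto n (k : nat) (v : 'R_n) : 'R_n :=
 \row_i (if (i < k)%N then v 0 i else 0).

Lemma row_uptoS n (i : 'I_n) (v : 'R_n) :
 row_upto i.+1 v = row_upto i v + v 0 i *: 'e_i.
Proof.
apply/rowP => j; rewrite !mxE ltnS leq_eqVlt /=.
have [->|ji] := eqVneq j i; first by rewrite eqxx ltnn mulr1 add0r.
rewrite (negPf (_ : val j != val i)) //= mulr0 addr0 //.
Qed.

Lemma norm_row_le n (v : 'R_n) (a : R) : 0 <= a ->
 (forall i, `|v 0 i| <= a) -> `|v| <= a.
Proof.
move=> a0 h; rewrite /Num.Def.normr/= mx_normrE; apply: bigmax_le => // -[i j] _.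
by rewrite /= (ord1 i).
Qed.

Lemma norm_coord_le n (v : 'R_n) i : `|v 0 i| <= `|v|.
Proof.
rewrite [leRHS]/Num.Def.normr/= mx_normrE.
by apply: (le_bigmax _ (fun ij : 'I_1 * 'I_n => `|v ij.1 ij.2|) (0, i)).
Qed.

Lemma norm_row_upto n k (v : 'R_n) : `|row_upto k v| <= `|v|.
Proof.
apply: norm_row_le => // i; rewrite mxE; case: ifP => _; last by rewrite normr0.
exact: norm_coord_le.
Qed.

(** The increment is telescoped through the points [x + row_upto i v], which change one coordinate
    at a time; on each leg the mean value theorem replaces it by a partial derivative at a point
    near [x], and the partial derivatives are continuous. *)
Lemma ck1_diff n (U : set 'R_n) f x : open U -> ck 1 U f -> U x ->
 differentiable f x.
Proof.
move=> oU kf Ux; have [_ h] := kf.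
pose a i := 'D_('e_i) f x.
pose g (y : 'R_n) := \sum_i y 0 i * a i.
have dg : differentiable g x.
 rewrite (_ : g = \sum_i (fun y : 'R_n => y 0 i * a i)); last first.
  by rewrite fct_sumE.
 apply: differentiable_sum => i; apply: differentiableM => //.
 exact: differentiable_coord.
suff : differentiable (f - g) x.
 by move=> /differentiableD /(_ dg); rewrite subrK.
apply: differentiable_o0 => e e0.
have ne0 : 0 < e / (n%:R + 1) by rewrite divr_gt0.
have H : \forall y \near x, U y /\ forall i, `|'D_('e_i) f y - a i| <= e / (n%:R + 1).
 apply: filterI; first by apply: open_nbhs_nbhs.
 apply: (@near_forall 'R_n 'I_n (fun i y => `|'D_('e_i) f y - a i| <= e / (n%:R + 1))).
 move=> i; have [_ [c _]] := h 'e_i.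
 have /cvgrPdist_le /(_ _ ne0) := c x Ux.
 by apply: filterS => y; rewrite distrC.
have /nbhs_normP[d /= d0 Hd] := H.
apply/nbhs_normP; exists (d / 2); first by rewrite /= divr_gt0.
move=> v; rewrite /ball_/= sub0r normrN => vd.
have dP k i c : `|c| <= `|v| ->
  ball_ Num.Def.normr x d (x + row_upto k v + c *: ('e_i : 'R_n)).
 move=> cv; rewrite /ball_/= -addrA opprD addrA subrr sub0r normrN.
 apply: le_lt_trans (_ : `|v| + `|v| < _); last by rewrite [ltRHS]splitr ltrD.
 apply: le_trans (ler_normD _ _) _; apply: lerD; first exact: norm_row_upto.
 rewrite normrZ; apply: le_trans (_ : `|c| * 1 <= _); last by rewrite mulr1.
 apply: ler_wpM2l => //; apply: norm_row_le => // j; rewrite mxE /=.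
 by case: (_ == _); rewrite ?normr0 ?normr1.
have r0 : row_upto 0 v = 0 by apply/rowP => i; rewrite !mxE.
have rn : row_upto n v = v by apply/rowP => i; rewrite !mxE ltn_ord.
have T : f (v + x) - f x = \sum_(i < n) (f (x + row_upto i.+1 v) - f (x + row_upto i v)).
 rewrite -(big_mkord xpredT (fun i => f (x + row_upto i.+1 v) - f (x + row_upto i v))).
 by rewrite (telescope_sumr (fun i => f (x + row_upto i v))) // r0 rn addr0 [v + x]addrC.
have -> : (f - g) (v + x) - (f - g) x = f (v + x) - f x + (g x - g (v + x)).
 by rewrite -![(f - g) _]/(f _ - g _); ring.
rewrite T.
have -> : g x - g (v + x) = \sum_(i < n) - (v 0 i * a i).
 rewrite -sumrB; apply: eq_bigr => i _; rewrite !mxE mulrDl opprD addrA.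
 by rewrite addrAC subrr add0r.
rewrite -big_split /=.
apply: le_trans (ler_norm_sum _ _ _) _.
apply: le_trans (_ : \sum_(i < n) (e / (n%:R + 1) * `|v|) <= _); last first.
 rewrite sumr_const card_ord -[X in X <= _]mulr_natl.
 have -> : n%:R * (e / (n%:R + 1) * `|v|) = n%:R / (n%:R + 1) * (e * `|v|).
  by rewrite !mulrA; congr (_ * _); rewrite mulrAC.
 apply: ler_piMl; first by rewrite mulr_ge0 // ltW.
 by rewrite ler_pdivrMr // mul1r lerDl.
apply: ler_sum => i _; rewrite row_uptoS addrA.
have [|c cv ->] := @mvt_dir _ f (x + row_upto i v) 'e_i (v 0 i).
 move=> t tv; have [d1 _] := h 'e_i; apply: d1.
 by have [] := Hd _ (dP i i t (le_trans tv (norm_coord_le _ _))).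
rewrite -mulrN -mulrDr normrM mulrC; apply: ler_pM => //.
 by have [_ ] := Hd _ (dP i i c (le_trans cv (norm_coord_le _ _))).
exact: norm_coord_le.
Qed.

Lemma ck_derive n (U : set 'R_n) f x v : open U -> ck 1 U f -> U x ->
 'D_v f x = \sum_i v 0 i * 'D_('e_i) f x.
Proof.
move=> oU kf Ux; have df := ck1_diff oU kf Ux.
rewrite deriveE // {1}(row_sum_delta v) linear_sum; apply: eq_bigr => i _.
by rewrite linearZ /= deriveE.
Qed.

Lemma Ck_cont n m k U (f : 'R_n -> 'R_m) x :
 Ck k U f -> U x -> {for x, continuous f}.
Proof. by case: k => [|k] [h _]; apply: h. Qed.

Lemma row_contP (S : topologicalType) m (h : S -> 'R_m) (x : S) :
 {for x, continuous h} <-> forall j, {for x, continuous (fun y => h y 0 j)}.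
Proof.
split=> [c j|c].
 exact: (@continuous_comp _ _ _ h (fun A : 'R_m => A 0 j) x c (@coord_continuous _ _ _ _ _ _)).
apply/cvgrPdist_le => e e0; near=> y; apply: norm_row_le; first exact: ltW.
move=> j; rewrite !mxE.
move: j; near: y; apply: near_forall => j.
by have /cvgrPdist_le := c j; apply.
Unshelve. all: end_near. Qed.

Lemma Ck_coordP n m k (U : set 'R_n) (f : 'R_n -> 'R_m) : open U ->
 Ck k U f <-> forall j, ck k U (fun x => f x 0 j).
Proof.
move=> oU.
elim: k f => [|k IH] f.
 split=> [[c _] j|h]; first by split=> // x Ux; apply: (row_contP _ _).1; apply: c.
 by split=> // x Ux; apply/row_contP => j; have [c _] := h j; apply: c.
split=> [[c h] j|h].
 split; first by move=> x Ux; apply: (row_contP _ _).1; apply: c.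
 move=> v; have [d D] := h v; split.
  by move=> x Ux; apply: (derivable_mxP _ _ _).1; apply: d.
 apply: (ck_ext oU _ ((IH _).1 D j)) => x Ux.
 by rewrite derive_mx ?mxE//; apply: d.
split.
 by move=> x Ux; apply/row_contP => j; have [c _] := h j; apply: c.
move=> v; have d x : U x -> derivable f x v.
 move=> Ux; apply/derivable_mxP => i j; rewrite (ord1 i).
 by have [_ /(_ v)[d _]] := h j; apply: d.
split=> //; apply/IH => j; have [_ /(_ v)[_ D]] := h j.
apply: (ck_ext oU _ D) => x Ux; by rewrite derive_mx ?mxE//; apply: d.
Unshelve. all: end_near. Qed.

Lemma Ck1_diff n m (U : set 'R_n) (f : 'R_n -> 'R_m) x :
 open U -> Ck 1 U f -> U x -> differentiable f x.
Proof.
move=> oU /(Ck_coordP _ _ oU) h Ux.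
rewrite (_ : f = \sum_j (fun y => f y 0 j *: 'e_j)); last first.
 by apply/funext => y; rewrite fct_sumE [LHS]row_sum_delta.
by apply: differentiable_sum => j; apply: differentiableZl; apply: ck1_diff (h j) Ux.
Qed.

Lemma derive_comp_coord n m (V : set 'R_m) (g : 'R_m -> R)
  (f : 'R_n -> 'R_m) x v :
 open V -> ck 1 V g -> V (f x) -> differentiable f x ->
 'D_v (g \o f) x = \sum_j 'D_v (fun y => f y 0 j) x * 'D_('e_j) g (f x).
Proof.
move=> oV kg Vf df; have dg := ck1_diff oV kg Vf.
rewrite deriveE; last exact: differentiable_comp.
rewrite diff_comp //= -deriveE // -deriveE // (ck_derive _ oV kg Vf).
by apply: eq_bigr => j _; rewrite derive_mx ?mxE //; exact: diff_derivable.
Qed.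

Lemma ck_comp n m k (U : set 'R_n) (V : set 'R_m) (g : 'R_m -> R)
  (f : 'R_n -> 'R_m) : open U -> open V -> (forall x, U x -> V (f x)) ->
 ck k V g -> Ck k U f -> ck k U (g \o f).
Proof.
move=> oU oV UV; elim: k g => [|k IH] g kg kf; have [cf hf] := kf; have [cg hg] := kg.
 by split=> // x Ux; apply: continuous_comp; [exact: cf|apply: cg; apply: UV].
have kfc := (Ck_coordP _ _ oU).1 kf.
have kf' : Ck k U f := (Ck_coordP _ _ oU).2 (fun j => ckW (kfc j)).
have dfU x : U x -> differentiable f x.
 move=> Ux; apply: Ck1_diff oU _ Ux; split=> // v; have [d D] := hf v.
 by split; [exact: d | split; [move=> y Uy; exact: Ck_cont D Uy|]].
have kg1 : ck 1 V g.
 split; first exact: cg.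
 move=> v; have [d D] := hg v; split; first exact: d.
 by split; [move=> y Vy; exact: ck_cont D Vy|].
split; first by move=> x Ux; apply: continuous_comp; [exact: cf|apply: cg; apply: UV].
move=> v; split.
 move=> x Ux; apply: diff_derivable; apply: differentiable_comp; first exact: dfU.
 by apply: ck1_diff oV kg1 _; apply: UV.
apply: (ck_ext oU _ (_ : ck k U (fun x => \sum_j
  'D_v (fun y => f y 0 j) x * ('D_('e_j) g \o f) x))).
 by move=> x Ux; rewrite (derive_comp_coord _ oV kg1) //; [exact: UV|exact: dfU].
apply: ck_sum => // j; apply: ckM => //.
 by have [_ /(_ v)[]] := kfc j.
by apply: IH; have [] := hg 'e_j.
Qed.

Lemma Ck_comp n m l k (U : set 'R_n) (V : set 'R_m) (g : 'R_m -> 'R_l)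
  (f : 'R_n -> 'R_m) : open U -> open V -> (forall x, U x -> V (f x)) ->
 Ck k V g -> Ck k U f -> Ck k U (g \o f).
Proof.
move=> oU oV UV /(Ck_coordP _ _ oV) kg kf; apply/(Ck_coordP _ _ oU) => j.
exact: ck_comp UV (kg j) kf.
Qed.

Lemma ckN n k U (f : 'R_n -> R) : open U -> ck k U f -> ck k U (fun x => - f x).
Proof.
move=> oU kf; apply: (ck_ext (f := fun x => -1 * f x)) => //; first by move=> x _; rewrite mulN1r.
by apply: ckM => //; exact: ck_cst.
Qed.

Lemma ckB n k U (f g : 'R_n -> R) : open U -> ck k U f -> ck k U g -> ck k U (fun x => f x - g x).
Proof. by move=> oU kf kg; apply: ckD => //; exact: ckN. Qed.

Lemma ckV n k U (f : 'R_n -> R) : open U -> (forall x, U x -> f x != 0) ->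
 ck k U f -> ck k U (fun x => (f x)^-1).
Proof.
move=> oU f0; elim: k => [|k IH] kf; have [c h] := kf; split=> //.
- by move=> x Ux; apply: continuousV; [exact: f0|exact: c].
- by move=> x Ux; apply: continuousV; [exact: f0|exact: c].
move=> v; have [d D] := h v; split.
 by move=> x Ux; apply: derivableV; [exact: f0|exact: d].
have kV := IH (ckW kf).
apply: (ck_ext oU _ (ckM oU (ckM oU (ck_cst k U (-1)) (ckM oU kV kV)) D)) => x Ux.
rewrite (deriveV (f0 x Ux) (d x Ux)) /= mulN1r; congr (- _ * _).
lra.
Qed.

Lemma is_derive_comp1 (V : normedModType R) (h : R -> R) (f : V -> R) x v (dh : R) :
 is_derive (f x) 1 h dh -> derivable f x v ->
 is_derive x v (h \o f) (dh * 'D_v f x).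
Proof.
move=> [hh dhE] df; pose p (s : R) := f (x + s *: v).
have p0 : p 0 = f x by rewrite /p scale0r addr0.
have dp : is_derive (0 : R) 1 p ('D_v f x) by have := @is_derive_line _ f x v 0; rewrite scale0r addr0; apply.
have hp : is_derive (p 0) 1 h dh by rewrite p0.
have [d D] := @is_derive1_comp R h p 0 dh _ hp dp.
have E : (fun s : R => s^-1 *: ((h \o f \o shift x) (s *: v) - (h \o f) x)) =
  (fun s => s^-1 *: (((h \o p) \o shift 0) (s *: 1) - (h \o p) 0)).
 by apply/funext => s; rewrite /= p0 /p addr0 scaler1 [x + _]addrC.
by apply: DeriveDef; rewrite /derivable /derive E.
Qed.

Lemma ck_sqrt n k U (f : 'R_n -> R) : open U -> (forall x, U x -> 0 < f x) ->
 ck k U f -> ck k U (fun x => Num.sqrt (f x)).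
Proof.
move=> oU f0.
have cs x : U x -> {for x, continuous f} -> {for x, continuous (fun x => Num.sqrt (f x))}.
 by move=> Ux c; apply: (continuous_comp c); exact: sqrt_continuous.
elim: k => [|k IH] kf; have [c h] := kf; split=> //.
- by move=> x Ux; apply: cs (c x Ux).
- by move=> x Ux; apply: cs (c x Ux).
move=> v; have [d D] := h v.
have E x : U x -> is_derive x v (fun x => Num.sqrt (f x)) ((2 * Num.sqrt (f x))^-1 * 'D_v f x).
 by move=> Ux; apply: (@is_derive_comp1 _ Num.sqrt); [apply: is_derive1_sqrt; exact: f0|exact: d].
split; first by move=> x /E[].
have s0 x : U x -> 2 * Num.sqrt (f x) != 0 by move=> Ux; rewrite mulf_neq0 ?pnatr_eq0// gt_eqF// sqrtr_gt0 f0.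
have := ckM oU (ckV oU s0 (ckM oU (ck_cst k U 2) (IH (ckW kf)))) D.
by apply: (ck_ext oU) => x /E[].
Qed.

(** Smoothness stated as what it is needed for: postcomposition preserves [ck] on every open set in
    every dimension. It agrees with [smooth_fun] by [smooth_fun_smooth1] and
    [smooth1_smooth_fun]. *)
Definition smooth1 (h : R -> R) := forall n k U (f : 'R_n -> R),
 open U -> ck k U f -> ck k U (h \o f).

Lemma smooth1_derive (h dh : R -> R) :
 (forall x : R, is_derive x 1 h (dh x)) -> forall n k U (f : 'R_n -> R), open U ->
 ck k.+1 U f -> ck k U (dh \o f) -> ck k.+1 U (h \o f).
Proof.
move=> D n k U f oU kf kd; have [c hf] := kf.
split.
 move=> x Ux; apply: continuous_comp; first exact: c.
 by apply: differentiable_continuous; apply/derivable1_diffP.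
move=> v; have [d Dv] := hf v.
have E x : U x -> is_derive x v (h \o f) (dh (f x) * 'D_v f x) by move=> Ux; apply: is_derive_comp1; exact: d.
split; first by move=> x /E[].
apply: (ck_ext oU _ (ckM oU kd Dv)) => x /E[_ E1]; by rewrite E1.
Qed.

(** Meant for functions whose derivatives stay in the algebra generated by a family, such as all
    iterated derivatives of one function: the induction on [k] runs over the whole family at
    once. *)
Lemma smooth1_family (I : Type) (h dh : I -> R -> R) :
 (forall i (x : R), is_derive x 1 (h i) (dh i x)) ->
 (forall n k U (f : 'R_n -> R), open U -> (forall i, ck k U (h i \o f)) ->
   forall i, ck k U (dh i \o f)) ->
 forall i, smooth1 (h i).
Proof.
move=> D H i n k U f oU; elim: k i => [|k IH] i kf.
 split=> // x Ux; have [c _] := kf; apply: continuous_comp; first exact: c.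
 by apply: differentiable_continuous; apply/derivable1_diffP.
apply: smooth1_derive (D i) _ _ _ _ _ _ _ => //.
by apply: H => // j; apply: IH; exact: ckW.
Qed.

Lemma smooth_fun_smooth1 h : smooth_fun h -> smooth1 h.
Proof.
move=> sh; apply: (@smooth1_family nat (fun k => derive1n k h)
 (fun k => derive1n k.+1 h) _ _ 0%N) => //.
move=> k x; apply: DeriveDef; first exact: sh.
by rewrite -derive1E.
Qed.

Lemma is_derive_coord1 (h : R -> R) (F : 'R_1 -> R) (t : R) :
 (forall x, F x = h (x 0 0)) -> derivable F (t *: const_mx 1) (const_mx 1) ->
 is_derive t 1 h ('D_(const_mx 1) F (t *: const_mx 1)).
Proof.
move=> E d; have := @is_derive_line _ F 0 (const_mx 1) t; rewrite !add0r => /(_ d).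
rewrite (_ : (fun s : R => F (0 + s *: const_mx 1)) = h) //.
by apply/funext => s; rewrite E add0r !mxE mulr1.
Qed.

Lemma smooth1_smooth_fun h : smooth1 h -> smooth_fun h.
Proof.
move=> sh; have {sh} : forall k, ck k setT (fun x : 'R_1 => h (x 0 0)).
 by move=> k; apply: (sh 1%N k setT (fun x => x 0 0)) => //; exact: ck_coord.
move=> sh k; elim: k h sh => [|k IH] h sh x.
 have [_ /(_ (const_mx 1))[d _]] := sh 1%N.
 by have [] := is_derive_coord1 (fun x => erefl) (d (x *: const_mx 1) I).
rewrite derive1Sn; apply: IH => {}k.
have [_ /(_ (const_mx 1))[d D]] := sh k.+1.
apply: (ck_ext openT _ D) => y _.
have yE : y = y 0 0 *: const_mx 1 by apply/rowP => i; rewrite !mxE mulr1 (ord1 i).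
rewrite derive1E.
have [_ ->] := is_derive_coord1 (fun x => erefl) (d (y 0 0 *: const_mx 1) I).
by rewrite -yE.
Qed.

(** Contains the standard flat function at [n = 0]; the powers of [x^-1] are there so that
    derivatives are again linear combinations of members of the family. *)
Definition flat (n : nat) (x : R) : R :=
 if 0 < x then (x^-1) ^+ n * expR (- x^-1) else 0.

(** From [y < expR y] at [y = x^-1 / m], raised to the power [m = n + 1]. It gives the derivative 0
    at the origin, where the difference quotient of [flat n] is [flat n.+1]. *)
Lemma flat_bound n : exists2 C : R, 0 < C & forall x, `|flat n x| <= C * `|x|.
Proof.
pose m : R := n.+1%:R; have m0 : 0 < m by rewrite ltr0n.
exists (m ^+ n.+1); first by rewrite exprn_gt0.
move=> x; rewrite /flat; case: ltP => x0; last by rewrite normr0 mulr_ge0 // exprn_ge0 // ltW.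
have xi : 0 < x^-1 by rewrite invr_gt0.
rewrite ger0_norm; last by rewrite mulr_ge0 ?exprn_ge0 // ltW.
rewrite (gtr0_norm x0).
rewrite expRN -ler_pdivlMr ?invr_gt0 ?expR_gt0 // invrK.
have E : (x^-1 / m) ^+ n.+1 <= expR (x^-1).
 have -> : expR (x^-1) = expR (x^-1 / m) ^+ n.+1 by rewrite -expRM_natl mulrC divfK // gt_eqF.
 apply: lerXn2r; rewrite ?nnegrE ?divr_ge0 ?expR_ge0 ?ltW //.
 by apply: lt_le_trans (expR_ge1Dx _); rewrite ltrDr.
apply: le_trans (_ : m ^+ n.+1 * x * (x^-1 / m) ^+ n.+1 <= _); last first.
 by apply: ler_wpM2l => //; rewrite mulr_ge0 ?exprn_ge0 // ltW.
rewrite expr_div_n (mulrC (m ^+ _)) -mulrA (mulrCA (m ^+ _)) divff ?mulr1; last first.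
 by rewrite expf_neq0 // gt_eqF.
by rewrite exprS mulrA divff ?mul1r // gt_eqF.
Qed.

Lemma is_derive_flat n (x : R) : is_derive x 1 (flat n) (- n%:R * flat n.+1 x + flat n.+2 x).
Proof.
have [x0|x0|<-] := ltgtP 0 x; last first.
- have E h : h^-1 *: ((flat n \o shift 0) (h *: 1) - flat n 0) = flat n.+1 h.
  rewrite /= addr0 scaler1 /flat ltxx subr0; case: ltP => _; last by rewrite scaler0.
  by rewrite /= -[LHS]/(_ * _) mulrA exprS.
 have L : flat n.+1 h @[h --> (0 : R)^'] --> (0 : R).
  have [C C0 B] := flat_bound n.+1.
  apply/cvgrPdist_le => e e0; near=> h; rewrite sub0r normrN.
  apply: le_trans (B h) _; rewrite -ler_pdivlMl // mulrC.
  by near: h; apply: dnbhs0_le; rewrite divr_gt0.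
 have F0 m : flat m 0 = 0 by rewrite /flat ltxx.
 rewrite !F0 mulr0 addr0.
 apply: DeriveDef; rewrite /derivable /derive.
  by apply/cvg_ex; exists 0; under eq_fun do rewrite E.
 by apply/cvg_lim => //; under eq_fun do rewrite E.
- have F0 m : flat m x = 0 by rewrite /flat ltNge ltW.
 rewrite !F0 mulr0 addr0.
 apply: near_eq_is_derive (_ : is_derive x 1 (cst 0) 0).
 near=> y; rewrite /flat ltNge ltW //; near: y; exact: lt_nbhsl.
have xn0 : x != 0 by lra.
rewrite /flat x0.
apply: (@near_eq_is_derive _ _ _ (fun y : R => (y^-1) ^+ n * expR (- y^-1))).
 near=> y; rewrite ifT //; near: y; exact: lt_nbhsr.
have dV : is_derive x 1 (fun y : R => y^-1) (- (x ^- 2)).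
 have [d D] := (@derivableV _ _ id x 1 xn0 (@derivable_id _ _ x 1), @deriveV _ _ id x 1 xn0 (@derivable_id _ _ x 1)).
 by apply: DeriveDef => //; rewrite D derive_id scaler1.
have dX := @is_deriveX R R (fun y : R => y^-1) n x 1 _ dV.
have dE : is_derive x 1 (fun y : R => expR (- y^-1)) (expR (- x^-1) * x ^- 2).
 have := @is_derive1_comp R expR (fun y => - y^-1) x _ _ (is_derive_expR _) (is_deriveN dV).
 by rewrite opprK.
rewrite (_ : (fun y : R => _) = (@GRing.inv R) ^+ n * (fun y : R => expR (- y^-1))); last first.
 by rewrite exprfctE.
apply: (is_derive_eq (is_deriveM dX dE)).
rewrite -!exprVn; set y := x^-1; rewrite -![_ *: _]/(_ * _).
rewrite exprfctE -[in LHS]/y {dX}.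
case: n => [|n] /=; first by rewrite expr2; ring.
by rewrite !exprS; ring.
Unshelve. all: end_near. Qed.

Lemma smooth1_flat n : smooth1 (flat n).
Proof.
apply: (smooth1_family is_derive_flat) => m k U f oU h i.
apply: (ckD oU) (h _); exact: ckM (ck_cst _ _ _) (h _).
Qed.

Lemma flat_gt0 n x : 0 < x -> 0 < flat n x.
Proof. by move=> x0; rewrite /flat x0 mulr_gt0 ?expR_gt0 ?exprn_gt0 ?invr_gt0. Qed.

Lemma flat_le0 n x : x <= 0 -> flat n x = 0.
Proof. by move=> x0; rewrite /flat ltNge x0. Qed.

Lemma flat_ge0 n x : 0 <= flat n x.
Proof. by have [/(flat_le0 n)->//|/(flat_gt0 n)/ltW] := leP x 0. Qed.

Lemma flat_homo x y : x <= y -> flat 0 x <= flat 0 y.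
Proof.
move=> xy; have [x0|x0] := leP x 0; first by rewrite flat_le0 // flat_ge0.
have y0 := lt_le_trans x0 xy.
by rewrite /flat x0 y0 !mul1r ler_expR lerN2 lef_pV2.
Qed.

Definition step (x : R) : R := flat 0 x / (flat 0 x + flat 0 (1 - x)).

Lemma step_den x : 0 < flat 0 x + flat 0 (1 - x).
Proof.
have [x0|x0] := leP x 0; last by rewrite ltr_pwDl ?flat_gt0 ?flat_ge0.
by rewrite ltr_wpDl ?flat_ge0 // flat_gt0 // subr_gt0 (le_lt_trans x0).
Qed.

Lemma step_le0 x : x <= 0 -> step x = 0.
Proof. by move=> x0; rewrite /step flat_le0 // mul0r. Qed.

Lemma step_ge1 x : 1 <= x -> step x = 1.
Proof.
move=> x1; have := step_den x.
by rewrite /step (@flat_le0 _ (1 - x)) ?subr_le0 // addr0 => /gt_eqF h; rewrite divff ?h.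
Qed.

Lemma step01 x : 0 <= step x <= 1.
Proof.
have d := step_den x; rewrite /step divr_ge0 ?flat_ge0 ?(ltW d) //=.
by rewrite ler_pdivrMr // mul1r lerDl flat_ge0.
Qed.

Lemma step_gt0 x : 0 < x -> 0 < step x.
Proof. by move=> x0; rewrite divr_gt0 ?flat_gt0 ?step_den. Qed.

Lemma step_homo : {homo step : x y / x <= y}.
Proof.
move=> x y xy; rewrite /step ler_pdivrMr ?step_den // mulrAC ler_pdivlMr ?step_den //.
rewrite !mulrDr [X in X + _ <= _]mulrC lerD2l.
apply: ler_pM; rewrite ?flat_ge0 //; apply: flat_homo => //.
lra.
Qed.

Lemma smooth1_step : smooth1 step.
Proof.
move=> n k U f oU kf.
have k1 : ck k U (fun x => 1 - f x) by exact: ckB (ck_cst _ _ _) kf.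
apply: (ckM oU); first exact: (smooth1_flat 0).
apply: (ckV oU) => [x _|]; first by rewrite gt_eqF // step_den.
by apply: (ckD oU); [exact: (smooth1_flat 0)|exact: (smooth1_flat 0 oU k1)].
Qed.

End SmoothCalculus.

#[local] Hint Resolve ck_cst ck_coord : core.

Ltac smooth := repeat first [done | apply: ckB | apply: ckD | apply: ckM].

(** * Differentials of maps on subsets *)

Section DiffOn.

Lemma Cinfty_sub n m (U V : set 'R_n) (g : 'R_n -> 'R_m) :
 open U -> open V -> V `<=` U -> Cinfty U g -> Cinfty V g.
Proof.
move=> oU oV VU h k; apply/(Ck_coordP _ _ oV) => j; apply: (ck_sub VU).
by apply: (Ck_coordP _ _ oU).1.
Qed.

Lemma Cinfty_ext n m (U : set 'R_n) (f g : 'R_n -> 'R_m) :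
 open U -> (forall x, U x -> f x = g x) -> Cinfty U f -> Cinfty U g.
Proof.
move=> oU fg h k; apply/(Ck_coordP _ _ oU) => j.
have := (Ck_coordP _ _ oU).1 (h k) j; apply: ck_ext => // x Ux; by rewrite fg.
Qed.

Lemma Cinfty_comp n m l (U : set 'R_n) (V : set 'R_m)
  (g : 'R_m -> 'R_l) (f : 'R_n -> 'R_m) :
 open U -> open V -> (forall x, U x -> V (f x)) ->
 Cinfty V g -> Cinfty U f -> Cinfty U (g \o f).
Proof. by move=> oU oV UV hg hf k; apply: (Ck_comp oU oV UV). Qed.

Lemma Cinfty_diff n m (U : set 'R_n) (f : 'R_n -> 'R_m) x :
 open U -> Cinfty U f -> U x -> differentiable f x.
Proof. by move=> oU h; apply: Ck1_diff oU (h 1%N). Qed.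

Lemma Cinfty_cont n m (U : set 'R_n) (f : 'R_n -> 'R_m) x :
 Cinfty U f -> U x -> {for x, continuous f}.
Proof. by move=> h; apply: Ck_cont (h 0%N). Qed.

Lemma open_preimage (S T : topologicalType) (U : set S) (V : set T) (f : S -> T) :
 open U -> open V -> (forall x, U x -> {for x, continuous f}) ->
 open (U `&` f @^-1` V).
Proof.
move=> oU oV c; rewrite openE => x [Ux Vx]; apply: filterI.
 exact: open_nbhs_nbhs.
by apply: (c x Ux); exact: open_nbhs_nbhs.
Qed.

Lemma nbhsS3 T (x : T) (A B C P : set T) :
 nbhs x A -> nbhs x B -> nbhs x C -> (forall y, A y -> B y -> C y -> P y) -> nbhs x P.
Proof. by move=> nA nB nC h; apply: filterS3 h nA nB nC. Qed.

Lemma nbhs_openP T (x : T) (A : set T) :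
 nbhs x A -> exists2 U, open_nbhs x U & U `<=` A.
Proof. by rewrite nbhsE => -[U oU UA]; exists U. Qed.

Lemma within_openP T (x : T) (A P : set T) :
 (\forall y \near within A (nbhs x), P y) ->
 exists2 U, open_nbhs x U & forall y, U y -> A y -> P y.
Proof. by move=> /nbhs_openP[U oU UA]; exists U. Qed.

Lemma diff_on_comp n m l (g : 'R_m -> 'R_l) (f : 'R_n -> 'R_m)
  (A : set 'R_n) (B : set 'R_m) x J K :
 A x -> (\forall y \near within A (nbhs x), B (f y)) ->
 diff_on f A x J -> diff_on g B (f x) K -> diff_on (g \o f) A x (J *m K).
Proof.
move=> Ax /within_openP[W [oW Wx] WB] [U [f1 [[oU Ux] sf fE Jf]]].
move=> [V [g1 [[oV Vy] sg gE Kg]]].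
have f1x : f1 x = f x by apply: fE.
pose U' := (U `&` f1 @^-1` V) `&` W.
have oU2 : open (U `&` f1 @^-1` V) by apply: open_preimage => // y Uy; exact: Cinfty_cont sf Uy.
have oU' : open U' by apply: openI.
have U'x : U' x by split=> //; rewrite /= f1x.
exists U', (g1 \o f1); split=> //.
- apply: (Cinfty_comp oU' oV) sg _; first by move=> y [[]].
 by apply: Cinfty_sub sf => // y [[]].
- by move=> y [[Uy Vfy] Wy] Ay; rewrite /= // gE //; rewrite fE //; exact: WB.
move=> v; have df := Cinfty_diff oU sf Ux.
have dg : differentiable g1 (f1 x) by rewrite f1x; exact: Cinfty_diff oV sg Vy.
rewrite deriveE; last exact: differentiable_comp.
by rewrite diff_comp //= -deriveE // -deriveE // f1x Jf mulmxA.
Qed.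

Lemma diff_on_eq n m (f g : 'R_n -> 'R_m) (A : set 'R_n) x J :
 (\forall y \near within A (nbhs x), f y = g y) ->
 diff_on f A x J -> diff_on g A x J.
Proof.
move=> /within_openP[W [oW Wx] WE] [U [f1 [[oU Ux] sf fE Jf]]].
exists (U `&` W), f1; split=> //.
- by split; [exact: openI|].
- by apply: (Cinfty_sub oU _ _ sf); [exact: openI|move=> y []].
- by move=> y [Uy Wy] Ay; rewrite fE // WE.
Qed.

Lemma diff_on_Cinfty n m (f : 'R_n -> 'R_m) (U A : set 'R_n) x :
 open U -> U x -> Cinfty U f -> exists J, diff_on f A x J.
Proof.
move=> oU Ux sf; exists (jacobian f x); exists U, f; split=> // v.
by apply: deriveEjacobian; exact: Cinfty_diff sf Ux.
Qed.

Lemma diff_on_nbhs n m (f : 'R_n -> 'R_m) (A : set 'R_n) x J :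
 nbhs x A -> diff_on f A x J ->
 exists U, [/\ open_nbhs x U, Cinfty U f & forall v, 'D_v f x = v *m J].
Proof.
move=> /nbhs_openP[W [oW Wx] WA] [U [f1 [[oU Ux] sf fE Jf]]].
have oUW : open (U `&` W) by exact: openI.
have E y : (U `&` W) y -> f1 y = f y by move=> [Uy Wy]; apply: fE => //; exact: WA.
exists (U `&` W); split=> //.
 by apply: Cinfty_ext E _ => //; apply: Cinfty_sub sf => // y [].
by move=> v; rewrite -Jf; apply: near_eq_derive; apply: open_eq_near oUW _ _ => // y /E.
Qed.

Lemma line_near (V : normedModType R) (x v : V) (P : set V) :
 nbhs x P -> \forall s \near (0 : R), P (x + s *: v).
Proof.
move=> xP; have : (fun s : R => x + s *: v) @ (0 : R) --> x + (0 : R) *: v.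
 by apply: cvgD; [exact: cvg_cst|exact: scalel_continuous].
by rewrite scale0r addr0 => /(_ P xP).
Qed.

(** Difference quotients at small positive [t] only involve values of [f] on [A], so that all smooth
    extensions have the same derivative in a direction pointing into [A]. *)
Lemma diff_on_inward n m (f : 'R_n -> 'R_m) (A : set 'R_n) x v J K :
 A x -> (exists2 e, 0 < e & forall t, 0 < t < e -> A (x + t *: v)) ->
 diff_on f A x J -> diff_on f A x K -> v *m J = v *m K.
Proof.
move=> Ax [e e0 Av] [U [f1 [[oU Ux] sf fE <-]]] [V [f2 [[oV Vx] sg gE <-]]].
have [d1 d2] : derivable f1 x v /\ derivable f2 x v.
 split; apply: diff_derivable; [exact: Cinfty_diff sf Ux|exact: Cinfty_diff sg Vx].
have q1 := cvg_dnbhs_at_right d1; have q2 := cvg_dnbhs_at_right d2.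
apply: (cvg_unique _ q1); first exact: norm_hausdorff.
apply: cvg_trans q2; apply: near_eq_cvg; near=> t.
have te : 0 < t < e by apply/andP; split; near: t; [exact: nbhs_right_gt|exact: nbhs_right_lt].
have UV : (U `&` V) (x + t *: v).
 near: t; apply: cvg_within; apply: line_near.
 by apply: nbhsO; [exact: openI|].
have Atv := Av _ te; case: UV => Ut Vt.
by rewrite /= [t *: v + x]addrC (fE _ Ut Atv) (gE _ Vt Atv) fE // gE.
Unshelve. all: end_near. Qed.

Lemma diff_on_basis n m (f : 'R_n -> 'R_m) (A : set 'R_n) x J K :
 A x -> (forall i, exists2 a : R, a != 0 &
  exists2 e, 0 < e & forall t, 0 < t < e -> A (x + t *: (a *: 'e_i))) ->
 diff_on f A x J -> diff_on f A x K -> J = K.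
Proof.
move=> Ax h dJ dK; apply/row_matrixP => i; rewrite !rowE.
have [a a0 hA] := h i; have := diff_on_inward Ax hA dJ dK.
by rewrite -!scalemxAl => /(scalerI a0).
Qed.

End DiffOn.

Variable M : oriented_manifold4 R.
Local Notation family := ('R_3 -> M).

(** * Maps into the manifold, read in charts *)

Section MDiff.
Implicit Types (c d : chart R M).

Lemma mdiff_comp n l (f : 'R_n -> M) (A : set 'R_n) (s : 'R_l -> 'R_n)
  (B : set 'R_l) x c J S :
 B x -> (\forall y \near within B (nbhs x), A (s y)) ->
 diff_on s B x S -> mdiff f A (s x) c J -> mdiff (f \o s) B x c (S *m J).
Proof.
move=> Bx sA ds [ac dc dJ]; split => //.
 have [W [oW Ws] WE] := within_openP dc.
 have [V [oV Vx] VE] := within_openP sA.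
 have [U [s1 [[oU Ux] ss sE _]]] := ds.
 have oU1 : open (U `&` s1 @^-1` W) by apply: open_preimage => // y Uy; exact: Cinfty_cont ss Uy.
 have : nbhs x ((U `&` s1 @^-1` W) `&` V).
  apply: nbhsO; first exact: openI.
  by rewrite /= sE.
 by apply: filterS => y [[Uy Wy] Vy] By /=; apply: WE; [rewrite -sE|exact: VE].
exact: (diff_on_comp Bx sA ds dJ).
Qed.

Lemma mdiff_eq n (f g : 'R_n -> M) (A : set 'R_n) x c J :
 (\forall y \near within A (nbhs x), f y = g y) -> mdiff f A x c J -> mdiff g A x c J.
Proof.
move=> fg [ac dc dJ]; split=> //.
 by apply: filterS2 fg dc => y /= ->.
by apply: diff_on_eq dJ; apply: filterS fg => y /= ->.
Qed.

Lemma mdiff_dom n (f : 'R_n -> M) (A : set 'R_n) x c J :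
 A x -> mdiff f A x c J -> dom c (f x).
Proof. by move=> Ax [_ dc _]; exact: (nbhs_singleton (dc : nbhs x (fun y => A y -> dom c (f y)))) Ax. Qed.

Lemma chart_open c : atlas c -> open (dom c).
Proof. by move=> /atlas_chart[]. Qed.

Lemma chart_nbhs c x : atlas c -> dom c x -> nbhs x (dom c).
Proof. by move=> ac; apply: nbhsO; exact: chart_open. Qed.

Lemma chartK c x : atlas c -> dom c x -> chart_inv c (c x) = x.
Proof. by move=> /atlas_chart[_ _ + _ _]; apply. Qed.

Lemma chart_cont c x : atlas c -> dom c x -> {for x, continuous c}.
Proof.
move=> ac cx; have [oc _ _ h _] := atlas_chart ac.
by move: h; rewrite continuous_open_subspace // => /(_ x); apply; rewrite inE.
Qed.

Lemma chart_comp_cont T (f : T -> M) c x : {for x, continuous f} -> atlas c -> dom c (f x) ->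
 {for x, continuous (fun y => c (f y))}.
Proof. by move=> cf ac cx; apply: (continuous_comp cf); exact: chart_cont. Qed.

Lemma mdiff_cont n (f : 'R_n -> M) (A : set 'R_n) x c J :
 A x -> mdiff f A x c J -> f y @[y --> within A (nbhs x)] --> f x.
Proof.
move=> Ax dm; have [ac dc [U [g [[oU Ux] sg gE _]]]] := dm.
have fx := mdiff_dom Ax dm.
have [_ [V oV cV] cK _ cc] := atlas_chart ac.
move=> P /= fP.
have : nbhs (c (f x)) (fun y => (c @` dom c) y -> P (chart_inv c y)).
 have /subspace_continuousP/(_ (c (f x)) (ex_intro2 _ _ _ fx erefl)) := cc.
 by rewrite /from_subspace (cK _ fx) => /(_ P fP).
move=> nP; have cg : {for x, continuous g} by exact: Cinfty_cont sg Ux.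
rewrite -(gE x Ux Ax) in nP; have {}nP := cg _ nP.
have nU : nbhs x U by exact: open_nbhs_nbhs.
suff H : nbhs x (fun y => A y -> P (f y)) by exact: H.
have nP' : nbhs x (fun y => (c @` dom c) (g y) -> P (chart_inv c (g y))) := nP.
have dc' : nbhs x (fun y => A y -> dom c (f y)) := dc.
apply: (nbhsS3 nP' nU dc') => y h1 Uy h2 Ay.
have dy := h2 Ay; rewrite -(cK _ dy) -(gE y Uy Ay); apply: h1.
by rewrite gE.
Qed.

(** The matrix depends on the charts and the point only, not on the map. Its positive determinant is
    where the orientation of [M] enters, and makes the signs of double points independent of the
    chart. *)
Lemma chart_change c d x : atlas c -> atlas d -> dom c x -> dom d x ->
 exists2 T : 'M[R]_4, 0 < \det T &
  forall n (f : 'R_n -> M) (A : set 'R_n) y J, A y -> f y = x ->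
   mdiff f A y c J -> mdiff f A y d (J *m T).
Proof.
move=> ac ad cx dx; have [T dT T0] := atlas_positive ac ad cx dx.
exists T => // n f A y J Ay fy dm; have [_ dc dJ] := dm.
have nd : \forall z \near within A (nbhs y), (dom c `&` dom d) (f z).
 have nb : nbhs (f y) (dom c `&` dom d) by rewrite fy; apply: nbhsO => //; apply: openI; exact: chart_open.
 exact: (mdiff_cont Ay dm nb).
split=> //; first by apply: filterS nd => z /= [].
have dT' : diff_on (fun z => d (chart_inv c z)) (c @` (dom c `&` dom d))
  (c (f y)) T by rewrite fy.
apply: diff_on_eq (diff_on_comp Ay _ dJ dT').
 by apply: filterS nd => z /= [h _]; rewrite chartK.
by apply: filterS nd => z /= h; exists (f z).
Qed.

End MDiff.

(** * Coordinates, cubes and affine changes of the homotopy parameter *)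

Lemma I3_ind (P : 'I_3 -> Prop) : P 0 -> P 1 -> P 2 -> forall j, P j.
Proof.
move=> p0 p1 p2 [[|[|[|//]]] j].
- by rewrite (_ : Ordinal j = 0) //; apply: val_inj.
- by rewrite (_ : Ordinal j = 1) //; apply: val_inj.
- by rewrite (_ : Ordinal j = 2) //; apply: val_inj.
Qed.

Lemma I2_ind (P : 'I_2 -> Prop) : P 0 -> P 1 -> forall j, P j.
Proof.
move=> p0 p1 [[|[|//]] j].
- by rewrite (_ : Ordinal j = 0) //; apply: val_inj.
- by rewrite (_ : Ordinal j = 1) //; apply: val_inj.
Qed.

Lemma vec3_0 (x y z : R) : vec3 x y z 0 0 = x. Proof. by rewrite mxE. Qed.
Lemma vec3_1 (x y z : R) : vec3 x y z 0 1 = y. Proof. by rewrite mxE. Qed.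
Lemma vec3_2 (x y z : R) : vec3 x y z 0 2 = z. Proof. by rewrite mxE. Qed.
Lemma vec2_0 (x y : R) : vec2 x y 0 0 = x. Proof. by rewrite mxE. Qed.
Lemma vec2_1 (x y : R) : vec2 x y 0 1 = y. Proof. by rewrite mxE. Qed.
Definition vecE := (vec3_0, vec3_1, vec3_2, vec2_0, vec2_1).

Lemma vec3_eta (x : 'R_3) : x = vec3 (x 0 0) (x 0 1) (x 0 2).
Proof. by apply/rowP => j; elim/I3_ind: j; rewrite vecE. Qed.

Lemma vec2_eta (x : 'R_2) : x = vec2 (x 0 0) (x 0 1).
Proof. by apply/rowP => j; elim/I2_ind: j; rewrite vecE. Qed.

Lemma cube3P (x : 'R_3) : cube 3 x <->
 [/\ 0 <= x 0 0 <= 1, 0 <= x 0 1 <= 1 & 0 <= x 0 2 <= 1].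
Proof. by split=> [h|[h0 h1 h2] j]; [split; apply: h|elim/I3_ind: j]. Qed.

Lemma cube2P (x : 'R_2) : cube 2 x <-> 0 <= x 0 0 <= 1 /\ 0 <= x 0 1 <= 1.
Proof. by split=> [h|[h0 h1] j]; [split; apply: h|elim/I2_ind: j]. Qed.

Lemma cube1P (x : 'R_1) : cube 1 x <-> 0 <= x 0 0 <= 1.
Proof. by split=> [h|h j]; [apply: h|rewrite (ord1 j)]. Qed.

Lemma Cinfty_row n m (U : set 'R_n) (f : 'R_n -> 'R_m) : open U ->
 (forall j k, ck k U (fun x => f x 0 j)) -> Cinfty U f.
Proof. by move=> oU h k; apply/(Ck_coordP _ _ oU) => j. Qed.

Lemma Cinfty_vec3 n (U : set 'R_n) (f g h : 'R_n -> R) : open U ->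
 (forall k, ck k U f) -> (forall k, ck k U g) -> (forall k, ck k U h) ->
 Cinfty U (fun x => vec3 (f x) (g x) (h x)).
Proof.
move=> oU hf hg hh; apply: Cinfty_row => // j k.
elim/I3_ind: j; [apply: ck_ext (hf k)|apply: ck_ext (hg k)|apply: ck_ext (hh k)] => //;
 by move=> x _; rewrite vecE.
Qed.

Lemma Cinfty_vec2 n (U : set 'R_n) (f g : 'R_n -> R) : open U ->
 (forall k, ck k U f) -> (forall k, ck k U g) ->
 Cinfty U (fun x => vec2 (f x) (g x)).
Proof.
move=> oU hf hg; apply: Cinfty_row => // j k.
elim/I2_ind: j; [apply: ck_ext (hf k)|apply: ck_ext (hg k)] => //;
 by move=> x _; rewrite vecE.
Qed.

Lemma cube_inward n (x : 'R_n) (i : 'I_n) : cube n x -> exists2 a : R, a != 0 &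
 exists2 e, 0 < e & forall t, 0 < t < e -> cube n (x + t *: (a *: 'e_i)).
Proof.
move=> cx; have [x1|x1] := ltP (x 0 i) 1.
 exists 1; rewrite //; exists (1 - x 0 i); first by rewrite subr_gt0.
 move=> t /andP[t0 te] j; rewrite !mxE /=; have [->|ji] := eqVneq j i.
  by rewrite !mulr1; have := cx i; lra.
 by rewrite !mulr0 addr0.
exists (-1); rewrite //; exists 1 => // t /andP[t0 te] j.
rewrite !mxE /=; have [->|ji] := eqVneq j i; first by rewrite mulr1; have := cx i; lra.
by rewrite !mulr0 addr0.
Qed.

Lemma derive_affine (V W : normedModType R) (f : V -> W) x v L :
 (forall h : R, f (h *: v + x) - f x = h *: L) -> 'D_v f x = L.
Proof.
move=> h; apply/cvg_lim => //.
apply: cvg_trans (_ : cst L @ (0 : R)^' --> L); last exact: cvg_cst.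
apply: near_eq_cvg; near=> t; rewrite /= h scalerA mulVf ?scale1r //.
by near: t; exact: nbhs_dnbhs_neq.
Unshelve. all: end_near. Qed.

(** Affine substitution in the homotopy parameter [u]: [k = -1] reverses a homotopy, [k = 2] selects
    one half of a concatenation, [k = 0] freezes it. *)
Definition aff (k b : R) (x : 'R_3) : 'R_3 := vec3 (x 0 0) (x 0 1) (k * x 0 2 + b).
Definition Saff (k : R) : 'M[R]_3 := diag_mx (vec3 1 1 k).

Lemma Cinfty_aff k b U : open U -> Cinfty U (aff k b).
Proof.
move=> oU; apply: Cinfty_vec3 => // m; try exact: ck_coord.
by smooth.
Qed.

Lemma diff_on_aff k b (B : set 'R_3) x : diff_on (aff k b) B x (Saff k).
Proof.
exists setT, (aff k b); split=> //; first exact: Cinfty_aff.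
move=> v.
apply: derive_affine => h; apply/rowP => j; rewrite mul_mx_diag !mxE.
by elim/I3_ind: j; rewrite /=; ring.
Qed.

(** The substitution multiplies each of the two blocks by [Saff k], a factor [k * k]; restoring the
    columns that record [t] and [u] costs a factor [k^-1]. Reversing a homotopy therefore changes
    the signs, and rescaling it does not. *)
Lemma det_lift_aff (k : R) (J1 J2 : 'M[R]_(3, 4)) : k != 0 ->
 \det (col_mx (lift_diff (Saff k *m J1)) (lift_diff (Saff k *m J2)) : 'M[R]_6) =
 k * \det (col_mx (lift_diff J1) (lift_diff J2) : 'M[R]_6).
Proof.
move=> k0.
pose Q : 'M[R]_(4 + 2) := block_mx 1%:M 0 0 (diag_mx (vec2 1 k^-1)).
have E J : lift_diff (Saff k *m J) = Saff k *m lift_diff J *m Q.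
 rewrite /lift_diff mul_mx_row mul_row_block !mulmx1 !mulmx0 addr0 add0r.
 congr row_mx; rewrite mul_mx_diag mul_diag_mx; apply/matrixP => i j; rewrite !mxE.
 elim/I3_ind: i; elim/I2_ind: j; rewrite /= ?mulr0 ?mulr1 ?mul0r //.
 by rewrite mulfV.
have -> : (col_mx (lift_diff (Saff k *m J1)) (lift_diff (Saff k *m J2)) : 'M[R]_6) =
  (block_mx (Saff k) 0 0 (Saff k) : 'M[R]_6) *m
  (col_mx (lift_diff J1) (lift_diff J2) : 'M[R]_6) *m (Q : 'M[R]_6).
 rewrite !E -mul_col_mx; congr (_ *m _).
 have H := mul_block_col (Saff k) 0 0 (Saff k) (lift_diff J1) (lift_diff J2).
 by rewrite !mul0mx addr0 add0r in H.
have D1 : \det (block_mx (Saff k) 0 0 (Saff k)) = k * k.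
 by rewrite det_ublock !det_diag !big_ord_recl !big_ord0 !mxE /= !mul1r !mulr1.
have D2 : \det Q = k^-1 by rewrite det_ublock det1 det_diag !big_ord_recl !big_ord0 !mxE /= !mul1r !mulr1.
transitivity (k * k * \det (col_mx (lift_diff J1) (lift_diff J2) : 'M[R]_6) * k^-1).
 rewrite det_mulmx [X in X * _ = _]det_mulmx.
 by congr (_ * _ * _).
by rewrite mulrAC mulfK //.
Qed.

(** The columns added by [lift_diff] separate the directions [t] and [u], so that the lift is
    immersed exactly when the arc has nonzero velocity. *)
Lemma lift_diff_free (J : 'M[R]_(3, 4)) : row_free (lift_diff J) <-> row 0 J != 0.
Proof.
split=> [fr|r0].
 apply/eqP => J0.
 pose e0 : 'R_3 := delta_mx 0 0.
 have E : e0 *m lift_diff J = 0 *m lift_diff J.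
  rewrite mul0mx -rowE; apply/rowP => j; rewrite !mxE.
  case: split_ordP => k kE; last by rewrite !mxE.
  by have := congr1 (fun A : 'R_4 => A 0 k) J0; rewrite !mxE.
 have /rowP/(_ 0) := row_free_inj fr E.
 by rewrite !mxE => /eqP; rewrite oner_eq0.
apply: inj_row_free => v; rewrite mul_mx_row -row_mx0 => /eq_row_mx[vJ vE].
have v1 : v 0 1 = 0.
 have /rowP/(_ 0) := vE; rewrite !mxE !big_ord_recl big_ord0 !mxE /=.
 by rewrite !mulr0 mulr1 !addr0 add0r => <-; congr (v _ _); apply: val_inj.
have v2 : v 0 2 = 0.
 have /rowP/(_ 1) := vE; rewrite !mxE !big_ord_recl big_ord0 !mxE /=.
 by rewrite !mulr0 mulr1 !addr0 !add0r => <-; congr (v _ _); apply: val_inj.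
have vd : v = v 0 0 *: delta_mx 0 0 by apply/rowP => j; elim/I3_ind: j; rewrite !mxE /= ?mulr1 ?mulr0.
move: vJ; rewrite vd -scalemxAl -rowE => /eqP; rewrite scaler_eq0 (negPf r0) orbF.
by move=> /eqP->; rewrite scale0r.
Qed.

(** * Reversing and concatenating generic homotopies *)

Section Gluing.
Variable I0 : R -> M.
Implicit Types (A B C : R -> R -> R -> M).

Lemma cube_mdiff_uniq n (f : 'R_n -> M) x c J K : cube n x ->
 mdiff f (cube n) x c J -> mdiff f (cube n) x c K -> J = K.
Proof.
move=> cx [_ _ dJ] [_ _ dK]; apply: (diff_on_basis cx _ dJ dK) => i.
exact: cube_inward.
Qed.

(** On [V], [C] is [A] after the substitution of [k * u + b] for [u]. The last condition brings
    double points of [A] back into the unit interval. *)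
Definition piece A C (k b : R) (V : set R) : Prop :=
 [/\ k != 0, open V,
  (forall u, itv u -> V u -> itv (k * u + b) /\
    forall t s, itv t -> itv s -> C t u s = A t (k * u + b) s) &
  (forall u, itv u -> V ((u - b) / k) -> itv ((u - b) / k))].

Lemma aff_mdiff A C k b x c J : cube 3 x ->
 (\forall y \near within (cube 3) (nbhs x),
   cube 3 (aff k b y) /\ family3 C y = family3 A (aff k b y)) ->
 mdiff (family3 A) (cube 3) (aff k b x) c J ->
 mdiff (family3 C) (cube 3) x c (Saff k *m J).
Proof.
move=> cx h dA.
apply: mdiff_eq (mdiff_comp cx _ (diff_on_aff k b (cube 3) x) dA).
 by apply: filterS h => y [_ ->].
by apply: filterS h => y [].
Qed.

Lemma near_coord n (x : 'R_n) i (V : set R) : open V -> V (x 0 i) ->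
 nbhs x (fun y : 'R_n => V (y 0 i)).
Proof.
by move=> oV Vx; have /(_ V) := @coord_continuous R 1 n 0 i x; apply; exact: open_nbhs_nbhs.
Qed.

Lemma piece_mdiff A C k b V x c J : piece A C k b V -> cube 3 x -> V (x 0 2) ->
 mdiff (family3 A) (cube 3) (aff k b x) c J ->
 mdiff (family3 C) (cube 3) x c (Saff k *m J).
Proof.
move=> [k0 oV h1 h2] cx Vx; apply: aff_mdiff => //.
have nV := near_coord oV Vx.
apply: filterS nV => y Vy /cube3P[y0 y1 y2].
have [i E] := h1 _ y2 Vy; split; last by rewrite /family3 !vecE E.
by apply/cube3P; rewrite !vecE.
Qed.

Lemma affK' (k b : R) (x : 'R_3) : k != 0 -> aff k^-1 (- b / k) (aff k b x) = x.
Proof.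
move=> k0; rewrite /aff !vecE [RHS]vec3_eta; congr vec3.
by field.
Qed.

Lemma piece_mdiff_inv A C k b V x c J : piece A C k b V -> cube 3 x -> V (x 0 2) ->
 mdiff (family3 C) (cube 3) x c J ->
 mdiff (family3 A) (cube 3) (aff k b x) c (Saff k^-1 *m J).
Proof.
move=> [k0 oV h1 h2] cx Vx dC; have /cube3P[x0 x1 x2] := cx.
have cx' : cube 3 (aff k b x) by apply/cube3P; rewrite !vecE; have [] := h1 _ x2 Vx.
apply: (@aff_mdiff C A k^-1 (- b / k)); rewrite ?affK' //.
have cf : {for (aff k b x), continuous (fun y : 'R_3 => (y 0 2 - b) / k)}.
 apply: continuousM; last exact: cst_continuous.
 by apply: continuousB; [exact: coord_continuous|exact: cst_continuous].
have : nbhs (aff k b x) (fun y : 'R_3 => V ((y 0 2 - b) / k)).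
 apply: cf; apply: open_nbhs_nbhs; split=> //=; rewrite vecE.
 by rewrite addrK mulrAC divff // mul1r.
apply: filterS => y Vy /cube3P[y0 y1 y2].
have E : k^-1 * y 0 2 + - b / k = (y 0 2 - b) / k by rewrite mulrBl mulNr mulrC.
have i := h2 _ y2 Vy; have [_ E'] := h1 _ i Vy.
split; first by apply/cube3P; rewrite !vecE E.
rewrite /family3 !vecE E E' //; congr (A _ _ _).
by rewrite mulrCA divff // mulr1 subrK.
Qed.

Lemma row0_Saff k (J : 'M[R]_(3, 4)) : row 0 (Saff k *m J) = row 0 J.
Proof. by apply/rowP => j; rewrite mul_diag_mx !mxE /= mul1r. Qed.

Lemma dp_det_itv A p q t u : double_points A (p, q, t, u) ->
 cube 3 (vec3 p t u) /\ cube 3 (vec3 q t u).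
Proof.
move=> [[p0 pq q1 t01 u01] _]; split; apply/cube3P; rewrite !vecE; split=> //; lra.
Qed.

Lemma aff_vec3 k b (p t u : R) : aff k b (vec3 p t u) = vec3 p t (k * u + b).
Proof. by rewrite /aff !vecE. Qed.

Lemma piece_dp A C k b V p q t u : piece A C k b V -> V u ->
 double_points C (p, q, t, u) -> double_points A (p, q, t, k * u + b).
Proof.
move=> [k0 oV h1 h2] Vu [[p0 pq q1 t01 u01] E].
have [i E'] := h1 _ u01 Vu; split=> //.
by rewrite -!E' //; lra.
Qed.

Lemma piece_dp_inv A C k b V p q t u : piece A C k b V -> V u ->
 double_points A (p, q, t, k * u + b) -> double_points C (p, q, t, u).
Proof.
move=> [k0 oV h1 h2] Vu [[p0 pq q1 t01 u01] E].
have uE : (k * u + b - b) / k = u by rewrite addrK mulrAC divff // mul1r.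
have ui : itv u by have := h2 _ u01; rewrite uE; apply.
have [i E'] := h1 _ ui Vu; split=> //.
by rewrite !E' //; lra.
Qed.

Lemma piece_det A C k b V p q t u e : piece A C k b V -> V u ->
 double_points C (p, q, t, u) ->
 dp_det A (p, q, t, k * u + b) e -> dp_det C (p, q, t, u) (k * e).
Proof.
move=> pc Vu dC [c [J1 [J2 [d1 d2 ->]]]]; have [c1 c2] := dp_det_itv dC.
have [k0 _ _ _] := pc.
exists c, (Saff k *m J1), (Saff k *m J2); split; last by rewrite det_lift_aff.
 by apply: (piece_mdiff pc); rewrite ?vecE ?aff_vec3.
by apply: (piece_mdiff pc); rewrite ?vecE ?aff_vec3.
Qed.

Lemma piece_det_inv A C k b V p q t u e : piece A C k b V -> V u ->
 double_points C (p, q, t, u) ->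
 dp_det C (p, q, t, u) e -> dp_det A (p, q, t, k * u + b) (k^-1 * e).
Proof.
move=> pc Vu dC [c [J1 [J2 [d1 d2 ->]]]]; have [c1 c2] := dp_det_itv dC.
have [k0 _ _ _] := pc.
exists c, (Saff k^-1 *m J1), (Saff k^-1 *m J2); split; last by rewrite det_lift_aff ?invr_eq0.
 by rewrite -aff_vec3; apply: (piece_mdiff_inv pc); rewrite ?vecE.
by rewrite -aff_vec3; apply: (piece_mdiff_inv pc); rewrite ?vecE.
Qed.

(** Both blocks of the determinant get multiplied on the right by the same block matrix, of
    determinant [\det T], positive by [chart_change]. *)
Lemma dp_det_sign A x e e' : double_points A x -> dp_det A x e -> dp_det A x e' ->
 0 < e -> 0 < e'.
Proof.
case: x => [[[p q] t] u] dA; have [cp cq] := dp_det_itv dA; have [_ Epq] := dA.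
move=> [c [J1 [J2 [d1 d2 ->]]]] [c' [K1 [K2 [k1 k2 ->]]]].
have fp : family3 A (vec3 p t u) = A t u p by rewrite /family3 !vecE.
have fq : family3 A (vec3 q t u) = A t u p by rewrite /family3 !vecE.
have cx := mdiff_dom cp d1; have cx' := mdiff_dom cp k1.
have [ac _ _] := d1; have [ac' _ _] := k1.
rewrite fp in cx cx'.
have [T T0 hT] := chart_change ac ac' cx cx'.
have K1E := cube_mdiff_uniq cp k1 (hT _ _ _ _ _ cp fp d1).
have K2E := cube_mdiff_uniq cq k2 (hT _ _ _ _ _ cq fq d2).
pose Q : 'M[R]_(4 + 2) := block_mx T 0 0 1%:M.
have E J : lift_diff (J *m T) = lift_diff J *m Q by rewrite mul_row_block !mulmx1 !mulmx0 addr0 add0r.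
have DQ : \det Q = \det T by rewrite det_ublock det1 mulr1.
have -> : \det (col_mx (lift_diff K1) (lift_diff K2) : 'M[R]_6) =
  \det (col_mx (lift_diff J1) (lift_diff J2) : 'M[R]_6) * \det T.
 rewrite K1E K2E !E -mul_col_mx; etransitivity; first exact: det_mulmx.
 by congr (_ * _).
by move=> h; rewrite mulr_gt0.
Qed.

Lemma piece_sign A C k b V p q t u : piece A C k b V -> V u ->
 double_points C (p, q, t, u) ->
 (exists2 e, dp_det A (p, q, t, k * u + b) e & e != 0) ->
 dp_sign C (p, q, t, u) = (if 0 < k then 1 else -1) * dp_sign A (p, q, t, k * u + b).
Proof.
move=> pc Vu dC [e de e0]; have [k0 _ _ _] := pc.
have dA := piece_dp pc Vu dC; have dCe := piece_det pc Vu dC de.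
rewrite /dp_sign; have [kp|kn] := ltP 0 k.
 have H : (exists2 z, dp_det C (p, q, t, u) z & 0 < z) <->
   (exists2 z, dp_det A (p, q, t, k * u + b) z & 0 < z).
  split=> -[z dz z0].
   exists (k^-1 * z); first exact: (piece_det_inv pc Vu dC).
   by rewrite mulr_gt0 ?invr_gt0.
  by exists (k * z); [exact: (piece_det pc Vu dC)|rewrite mulr_gt0].
 by rewrite mul1r (asbool_equiv_eq H).
have {}kn : k < 0 by lra.
have [ep|en] := ltP 0 e.
 rewrite [X in _ * (if X then _ else _)]asboolT; last by exists e.
 rewrite asboolF // => -[z dz z0].
 have := dp_det_sign dC dz dCe z0; nra.
have {}en : e < 0 by lra.
rewrite [X in _ * (if X then _ else _)]asboolF; last first.
 by move=> -[z dz z0]; have := dp_det_sign dA dz de z0; lra.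
by rewrite asboolT //; exists (k * e) => //; nra.
Qed.

Lemma pi1_class_eq (g h : R -> M) : (forall s, itv s -> g s = h s) ->
 pi1_class I0 g = pi1_class I0 h.
Proof.
move=> E; rewrite /pi1_class; apply/seteqP; split=> f [bf [H [Hc Hb Hs]]];
 split=> //; exists H; split=> // s si; have [H0 H1] := Hs s si; split=> //.
 by rewrite -E.
by rewrite E.
Qed.

Lemma shortcut_eq (f g : R -> M) p q : 0 <= p -> p < q -> q <= 1 ->
 (forall s, itv s -> f s = g s) -> forall s, itv s -> shortcut f p q s = shortcut g p q s.
Proof.
move=> p0 pq q1 E s si; rewrite /shortcut; case: leP => s2; apply: E; nra.
Qed.

Lemma piece_term A C k b V p q t u : piece A C k b V -> V u ->
 double_points C (p, q, t, u) ->
 (exists2 e, dp_det A (p, q, t, k * u + b) e & e != 0) ->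
 dp_term I0 C (p, q, t, u) =
  if 0 < k then dp_term I0 A (p, q, t, k * u + b) else - dp_term I0 A (p, q, t, k * u + b).
Proof.
move=> pc Vu dC hA; have S := piece_sign pc Vu dC hA.
have [k0 oV h1 h2] := pc; have [[p0 pq q1 t01 u01] _] := dC.
have [i E] := h1 _ u01 Vu.
rewrite /dp_term (pi1_class_eq (shortcut_eq p0 pq q1 (fun s si => E t s t01 si))).
case: insub => [g|]; last by rewrite oppr0 if_same.
by rewrite S; case: ifP => _; rewrite ?mul1r // mulN1r freegUN.
Qed.

(** Generic homotopies between two loops, constant in [u] near both ends so that concatenations stay
    smooth. With the constant loop at [u = 0] they are the null homotopies of [dax_value]. *)
Definition GH (a b : R -> R -> M) A : Prop :=
 [/\ {within cube 3, continuous (family3 A)},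
   (forall t u, itv t -> itv u -> Maps I0 (A t u)),
   (exists2 e : R, 0 < e & forall t u s, itv t -> itv u -> itv s ->
     (u <= e -> A t u s = a t s) /\ (1 - e <= u -> A t u s = b t s)),
   (forall u s, itv u -> itv s -> A 0 u s = I0 s /\ A 1 u s = I0 s) &
   generic A].

Lemma dax_valueE a z : dax_value I0 a z <-> exists2 A, GH (fun=> I0) a A & z = dax_sum I0 A.
Proof.
split=> [[A [[h1 h2 h3 h4] g ->]]|[A [h1 h2 h3 h4 g] ->]].
 by exists A.
by exists A.
Qed.

Definition rev_family A t u s := A t (1 - u) s.

Lemma piece_rev A : piece A (rev_family A) (-1) 1 setT.
Proof.
split; [by rewrite oppr_eq0|exact: openT| |].
 move=> u ui _; split=> [|t s _ _]; first by lra.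
 by rewrite mulN1r addrC.
by move=> u ui _; lra.
Qed.

Definition dp_map (k b : R) (x : R * R * R * R) : R * R * R * R :=
 let: (p, q, t, u) := x in (p, q, t, k * u + b).

Lemma dp_mapE k b p q t u : dp_map k b (p, q, t, u) = (p, q, t, k * u + b).
Proof. by []. Qed.

Lemma dp_map_inj k b : k != 0 -> injective (dp_map k b).
Proof.
move=> k0 [[[p q] t] u] [[[p' q'] t'] u'] /= [-> -> -> /addIr /(mulfI k0) ->] //.
Qed.

Definition generic_at A (x : 'R_3) :=
 exists c J, mdiff (family3 A) (cube 3) x c J /\ row_free (lift_diff J).

Lemma piece_generic A C k b V x : piece A C k b V -> cube 3 x -> V (x 0 2) ->
 generic_at A (aff k b x) -> generic_at C x.
Proof.
move=> pc cx Vx [c [J [dJ fJ]]]; exists c, (Saff k *m J).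
split; first exact: (piece_mdiff pc).
by apply/lift_diff_free; rewrite row0_Saff; apply/lift_diff_free.
Qed.

Lemma msmooth_cont n (f : 'R_n -> M) : msmooth f (cube n) ->
 {within cube n, continuous f}.
Proof.
move=> h; apply/subspace_continuousP => x cx; have [c [J d]] := h x cx.
exact: mdiff_cont cx d.
Qed.

Lemma generic_cont A : (forall x, cube 3 x -> generic_at A x) ->
 {within cube 3, continuous (family3 A)}.
Proof. by move=> h; apply: msmooth_cont => x /h[c [J [d _]]]; exists c, J. Qed.

Lemma fsumN (T : choiceType) (V : zmodType) (D : set T) (f : T -> V) : finite_set D ->
 \sum_(x \in D) - f x = - \sum_(x \in D) f x.
Proof.
move=> fD; apply/eqP; rewrite -addr_eq0 -fsbig_split //=; apply/eqP.
by apply: fsbig1 => x _; rewrite addNr.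
Qed.

(** The group elements do not change and all signs do, the substitution having [k = -1]. *)
Lemma GH_rev a b A : GH a b A -> GH b a (rev_family A) /\
 dax_sum I0 (rev_family A) = - dax_sum I0 A.
Proof.
move=> [cA mA [e e0 hA] sA [g1 g2 g3 g4]]; have pc := piece_rev A.
have fE x : family3 (rev_family A) x = family3 A (aff (-1) 1 x) by rewrite /family3 !vecE mulN1r addrC.
have cubeA x : cube 3 x -> cube 3 (aff (-1) 1 x).
 by move=> /cube3P[x0 x1 x2]; apply/cube3P; rewrite !vecE; split=> //; lra.
have dpE : double_points (rev_family A) = dp_map (-1) 1 @` double_points A.
 apply/seteqP; split=> [[[[p q] t] u] d|_ [[[[p q] t] u] d <-]].
  exists (p, q, t, -1 * u + 1); first exact: (piece_dp pc).
  by congr (_, _, _, _); ring.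
 rewrite dp_mapE; apply: (piece_dp_inv pc) => //.
 by rewrite (_ : -1 * (-1 * u + 1) + 1 = u) //; ring.
split; last first.
 rewrite /dax_sum dpE fsbig_image; last first.
  by move=> x y _ _; apply: dp_map_inj.
 rewrite -fsumN //; apply: eq_fsbigr => -[[[p q] t] u]; rewrite inE => d.
 rewrite (piece_term pc I); last 2 first.
 - by rewrite dpE; exists (p, q, t, u).
 - by rewrite (_ : -1 * (-1 * u + 1) + 1 = u); [exact: g3|ring].
 rewrite ltr0N1.
 by congr (- dp_term _ _ (_, _, _, _)); ring.
have gc x : cube 3 x -> generic_at (rev_family A) x.
 by move=> cx; apply: (piece_generic pc) => //; apply: g1; exact: cubeA.
split.
- exact: generic_cont.
- by move=> t u ti ui; apply: mA; lra.
- exists e => // t u s ti ui si; rewrite /rev_family.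
 have [|h1 h2] := hA t (1 - u) s ti _ si; first by lra.
 by split=> h; [apply: h2; lra|apply: h1; lra].
- by move=> u s ui si; apply: sA; lra.
split.
- by [].
- by rewrite dpE; apply: finite_image.
- rewrite dpE => _ [[[[p q] t] u] d <-]; rewrite dp_mapE.
 have d' : double_points (rev_family A) (p, q, t, -1 * u + 1) by rewrite dpE; exists (p, q, t, u).
 have [z dz z0] := g3 _ d.
 exists (-1 * z); last by rewrite mulN1r oppr_eq0.
 by apply: (piece_det pc) => //; rewrite (_ : -1 * (-1 * u + 1) + 1 = u) //; ring.
move=> p q r t u d1 d2.
exact: g4 (piece_dp pc I d1) (piece_dp pc I d2).
Qed.

Definition glue_family A B t u s := if u <= 2^-1 then A t (2 * u) s else B t (2 * u - 1) s.

Lemma piece_glueL A B : piece A (glue_family A B) 2 0 [set u | u < 2^-1].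
Proof.
split; [by rewrite pnatr_eq0|exact: open_lt| |].
 move=> u ui /= ul; split=> [|t s _ _]; first by lra.
 by rewrite /glue_family ltW // addr0.
by move=> u ui /=; lra.
Qed.

Lemma piece_glueR A B : piece B (glue_family A B) 2 (-1) [set u | 2^-1 < u].
Proof.
split; [by rewrite pnatr_eq0|exact: open_gt| |].
 move=> u ui /= ul; split=> [|t s _ _]; first by lra.
 by rewrite /glue_family leNgt ul.
by move=> u ui /=; lra.
Qed.

(** Injectivity of the arcs [b t] excludes double points at [u = 1/2], the only place where neither
    half describes the family on a neighbourhood. The double points are then those of the two
    halves, with their signs. *)
Lemma GH_glue a b c A B : GH a b A -> GH b c B ->
 (forall t, itv t -> set_inj unit_itv (b t)) ->
 GH a c (glue_family A B) /\
 dax_sum I0 (glue_family A B) = dax_sum I0 A + dax_sum I0 B.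
Proof.
move=> [cA mA [e e0 hA] sA [g1 g2 g3 g4]] [cB mB [e' e'0 hB] sB [g1' g2' g3' g4']] bi.
have pL := piece_glueL A B; have pR := piece_glueR A B.
set C := glue_family A B.
have A1 t s : itv t -> itv s -> A t 1 s = b t s by move=> ti si; have [_ h] := hA t 1 s ti itv1 si; apply: h; lra.
have B0 t s : itv t -> itv s -> B t 0 s = b t s.
 by move=> ti si; have [h _] := hB t 0 s ti itv0 si; apply: h; exact: ltW.
have sep p q t : 0 <= p -> p < q -> q <= 1 -> itv t -> b t p = b t q -> False.
 move=> p0 pq q1 ti /(bi t ti p q); rewrite !inE /unit_itv /= => E.
 by have pq' : p = q; [apply: E; lra|lra].
have nohalf p q t u : double_points C (p, q, t, u) -> u != 2^-1.
 move=> [[p0 pq q1 t01 u01] E]; apply/eqP => u2; move: E.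
 by rewrite /C /glue_family u2 lexx divff ?pnatr_eq0 // !A1; [exact: sep|lra..].
have dpE : double_points C =
  dp_map 2^-1 0 @` double_points A `|` dp_map 2^-1 2^-1 @` double_points B.
 apply/seteqP; split=> [[[[p q] t] u] d|_ [] [[[[p q] t] u] d <-]].
 - have [uL|uR|u2] := ltgtP u 2^-1; last by have := nohalf _ _ _ _ d; rewrite u2 eqxx.
   left; exists (p, q, t, 2 * u + 0); first exact: (piece_dp pL).
   by congr (_, _, _, _); lra.
  right; exists (p, q, t, 2 * u + -1); first exact: (piece_dp pR).
  by congr (_, _, _, _); lra.
 - rewrite dp_mapE; apply: (piece_dp_inv pL); last by rewrite (_ : 2 * (2^-1 * u + 0) + 0 = u) //; lra.
  rewrite /=; have [[p0 pq q1 t01 u01] E] := d.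
  have [|/eqP u1] : u < 1 \/ u == 1; [|lra|].
   by case: (ltgtP u 1) => [_|?|_]; [left|lra|right].
  by exfalso; move: E; rewrite u1 !A1; [exact: sep|lra..].
 rewrite dp_mapE; apply: (piece_dp_inv pR); last by rewrite (_ : 2 * (2^-1 * u + 2^-1) + -1 = u) //; lra.
 rewrite /=; have [[p0 pq q1 t01 u01] E] := d.
 have [|/eqP u1] : 0 < u \/ u == 0; [|lra|].
  by case: (ltgtP u 0) => [?|_|_]; [lra|left|right].
 by exfalso; move: E; rewrite u1 !B0; [exact: sep|lra..].
have inA p q t u : double_points A (p, q, t, u) -> 2^-1 * u + 0 < 2^-1.
 move=> d; have dC : double_points C (p, q, t, 2^-1 * u + 0).
  by rewrite dpE; left; exists (p, q, t, u).
 by have := nohalf _ _ _ _ dC; have [[_ _ _ _ ui] _] := d; lra.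
have inB p q t u : double_points B (p, q, t, u) -> 2^-1 < 2^-1 * u + 2^-1.
 move=> d; have dC : double_points C (p, q, t, 2^-1 * u + 2^-1).
  by rewrite dpE; right; exists (p, q, t, u).
 by have := nohalf _ _ _ _ dC; have [[_ _ _ _ ui] _] := d; lra.
have EA u : 2 * (2^-1 * u + 0) + 0 = u :> R by lra.
have EB u : 2 * (2^-1 * u + 2^-1) + -1 = u :> R by lra.
split; last first.
 rewrite /dax_sum dpE fsbigU0; [|exact: finite_image|exact: finite_image|]; last first.
  move=> _ [[[[[p q] t] u] d <-] [[[[p' q'] t'] u'] d' []]] /= _ _ _ E.
  by have := inA _ _ _ _ d; have := inB _ _ _ _ d'; lra.
 rewrite !fsbig_image; try by move=> x y _ _; apply: dp_map_inj.
 congr (_ + _); apply: eq_fsbigr => -[[[p q] t] u]; rewrite inE => d.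
  rewrite (piece_term pL); [|exact: inA d| |by rewrite EA; exact: g3].
   by rewrite ltr0n EA.
  by rewrite dpE; left; exists (p, q, t, u).
 rewrite (piece_term pR); [|exact: inB d| |by rewrite EB; exact: g3'].
  by rewrite ltr0n EB.
 by rewrite dpE; right; exists (p, q, t, u).
have gc x : cube 3 x -> generic_at C x.
 move=> cx; have /cube3P[x0 x1 x2] := cx.
 have [uL|uR|u2] := ltgtP (x 0 2) 2^-1.
 - apply: (piece_generic pL) => //; apply: g1.
  by apply/cube3P; rewrite !vecE; split=> //; lra.
 - apply: (piece_generic pR) => //; apply: g1'.
  by apply/cube3P; rewrite !vecE; split=> //; lra.
 (* Around [u = 1/2] both halves are constant in [u], equal to the loop [b]: locally the family is
    [A] after projection to [u = 1], which is [aff 0 1]. *)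
 have [|c0 [J [dJ fJ]]] := g1 (aff 0 1 x).
  by apply/cube3P; rewrite !vecE; split=> //; lra.
 exists c0, (Saff 0 *m J); split; last first.
  by apply/lift_diff_free; rewrite row0_Saff; apply/lift_diff_free.
 apply: aff_mdiff dJ => //.
 pose V := [set u : R | 2^-1 - e / 2 < u] `&` [set u | u < 2^-1 + e' / 2].
 have oV : open V by apply: openI.
 have Vx : V (x 0 2) by rewrite u2; split=> /=; lra.
 apply: filterS (near_coord oV Vx) => y [/= V1 V2] /cube3P[y0 y1 y2].
 split; first by apply/cube3P; rewrite !vecE; split=> //; lra.
 rewrite /family3 !vecE mul0r add0r /C /glue_family.
 have [|_ ->] := hA (y 0 1) 1 (y 0 0) y1 _ y0; [lra| |lra].
 case: leP => y2'.
  by have [|_ E1] := hA (y 0 1) (2 * y 0 2) (y 0 0) y1 _ y0; [lra|by apply: E1; lra].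
 by have [|E1 _] := hB (y 0 1) (2 * y 0 2 - 1) (y 0 0) y1 _ y0; [lra|by apply: E1; lra].
split.
- exact: generic_cont.
- by move=> t u ti ui; rewrite /C /glue_family; case: leP => u2; [apply: mA|apply: mB] => //; lra.
- exists (Num.min 2^-1 (Num.min e e') / 2).
  by rewrite divr_gt0 // !lt_min e0 e'0 invr_gt0 ltr0n.
 have m1 : Num.min 2^-1 (Num.min e e') <= 2^-1 by rewrite ge_min lexx.
 have m2 : Num.min 2^-1 (Num.min e e') <= e by rewrite !ge_min lexx !orbT.
 have m3 : Num.min 2^-1 (Num.min e e') <= e' by rewrite !ge_min lexx !orbT.
 set m := Num.min _ _ in m1 m2 m3 *.
 move=> t u s ti ui si; rewrite /C /glue_family; split=> h.
  by case: leP => u2; [have [|E1 _] := hA t (2 * u) s ti _ si; [lra|by apply: E1; lra]|exfalso; lra].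
 by case: leP => u2; [exfalso; lra|have [|_ E1] := hB t (2 * u - 1) s ti _ si; [lra|by apply: E1; lra]].
- by move=> u s ui si; rewrite /C /glue_family; case: leP => u2; [apply: sA|apply: sB] => //; lra.
split=> //.
- by rewrite dpE finite_setU; split; apply: finite_image.
- rewrite dpE => _ [] [[[[p q] t] u] d <-]; rewrite dp_mapE.
  have dC : double_points C (p, q, t, 2^-1 * u + 0) by rewrite dpE; left; exists (p, q, t, u).
  have [z dz z0] := g3 _ d; exists (2 * z); last by rewrite mulf_neq0.
  by apply: (piece_det pL) => //; [exact: inA d|rewrite EA].
 have dC : double_points C (p, q, t, 2^-1 * u + 2^-1) by rewrite dpE; right; exists (p, q, t, u).
 have [z dz z0] := g3' _ d; exists (2 * z); last by rewrite mulf_neq0.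
 by apply: (piece_det pR) => //; [exact: inB d|rewrite EB].
move=> p q r t u d1 d2; have := nohalf _ _ _ _ d1.
have [uL _|uR _|//] := ltgtP u 2^-1.
 exact: g4 (piece_dp pL uL d1) (piece_dp pL uL d2).
exact: g4' (piece_dp pR uR d1) (piece_dp pR uR d2).
Qed.

End Gluing.

Lemma within_all T (x : T) (A P : set T) :
 (forall y, A y -> P y) -> \forall y \near within A (nbhs x), P y.
Proof. by apply: filterE => y /h. Qed.

Lemma all_near T (x : T) (A P : set T) :
 (forall y, P y) -> \forall y \near within A (nbhs x), P y.
Proof. by move=> h; apply: within_all. Qed.

(** * Isotopies of loops, and the Dax kernel as a subgroup *)

Section EmbHomotopy.
Variable I0 : R -> M.
Implicit Types (A B C : R -> R -> R -> M) (f : R -> M) (a b : R -> R -> M).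

Lemma const_mx1_cont : continuous (fun s : R => const_mx s : 'R_1).
Proof.
move=> s; apply/row_contP => j.
rewrite (_ : (fun y : R => (const_mx y : 'R_1) 0 j) = id); first by move=> ?.
by apply/funext => y; rewrite mxE.
Qed.

Lemma arc_continuous f : msmooth (fun x : 'R_1 => f (x 0 0)) (cube 1) ->
 {within unit_itv, continuous f}.
Proof.
move=> /msmooth_cont/subspace_continuousP h; apply/subspace_continuousP => s si.
have cs : cube 1 (const_mx s : 'R_1) by apply/cube1P; rewrite mxE.
move=> P fP; have E0 : (const_mx s : 'R_1) 0 0 = s by rewrite mxE.
have {}h : nbhs (f ((const_mx s : 'R_1) 0 0)) P ->
 nbhs (const_mx s : 'R_1) (fun x => cube 1 x -> P (f (x 0 0))) := h _ cs P.
rewrite E0 in h; have := const_mx1_cont (h fP).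
suff H : (fun y : R => cube 1 (const_mx y : 'R_1) -> P (f ((const_mx y : 'R_1) 0 0)))
  `<=` (fun y => unit_itv y -> P (f y)) by exact: filterS H.
by move=> y /= + yi; rewrite !mxE; apply; apply/cube1P; rewrite mxE.
Qed.

Lemma proper_arc_smooth f : proper_arc f -> msmooth (fun x : 'R_1 => f (x 0 0)) (cube 1).
Proof. by move=> [_ h _ _] x /h[c [J [d _]]]; exists c, J. Qed.

Lemma set_inj_itv f p q : set_inj unit_itv f -> itv p -> itv q -> f p = f q -> p = q.
Proof. by move=> h pi qi; apply: h; rewrite inE. Qed.

Lemma proper_arc_inj f : proper_arc f -> set_inj unit_itv f.
Proof.
move=> [h _ _ _] s t; rewrite !inE => si ti E.
have := h (const_mx s) (const_mx t); rewrite !inE !mxE.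
move=> /(_ _ _ E)/rowP/(_ 0); rewrite !mxE; apply; apply/cube1P; rewrite mxE //.
Qed.

Lemma Emb_Maps f : Emb I0 f -> Maps I0 f.
Proof.
move=> [pf ae]; have [_ _ fb _] := pf; split=> //.
 exact: arc_continuous (proper_arc_smooth pf).
move=> s si; have := fb (const_mx s); rewrite /= !mxE; apply.
by apply/cube1P; rewrite mxE.
Qed.

Definition slice (t u : R) (y : 'R_1) : 'R_3 := vec3 (y 0 0) t u.

Lemma diff_on_slice t u (B : set 'R_1) y : diff_on (slice t u) B y (delta_mx 0 0).
Proof.
exists setT, (slice t u); split=> //; first exact: Cinfty_vec3.
move=> v; apply: derive_affine => h.
have E : v *m delta_mx 0 0 = vec3 (v 0 0) 0 0.
 apply/rowP => j; rewrite mxE big_ord1 mxE.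
 by elim/I3_ind: j; rewrite vecE /= ?mulr1 ?mulr0.
by rewrite E; apply/rowP => j; elim/I3_ind: j; rewrite !mxE /=; ring.
Qed.

Lemma slice_mdiff A p t u c J : cube 3 (vec3 p t u) ->
 mdiff (family3 A) (cube 3) (vec3 p t u) c J ->
 mdiff (fun y : 'R_1 => A t u (y 0 0)) (cube 1) (const_mx p) c (row 0 J).
Proof.
move=> /cube3P; rewrite !vecE => -[pi ti ui] dA.
have E : slice t u (const_mx p) = vec3 p t u by rewrite /slice mxE.
have cp : cube 1 (const_mx p : 'R_1) by apply/cube1P; rewrite mxE.
rewrite -E in dA; rewrite rowE.
apply: mdiff_eq (mdiff_comp cp _ (diff_on_slice t u _ _) dA).
 by apply: all_near => y; rewrite /family3 /= !vecE.
by apply: within_all => y cy; apply/cube3P; rewrite !vecE.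
Qed.

Lemma slice_immersed A p t u c J : cube 3 (vec3 p t u) ->
 mdiff (family3 A) (cube 3) (vec3 p t u) c J -> proper_arc (A t u) ->
 row_free (lift_diff J).
Proof.
move=> cp dA [_ im _ _]; apply/lift_diff_free.
have /cube3P := cp; rewrite !vecE => -[pi ti ui].
have c1 : cube 1 (const_mx p : 'R_1) by apply/cube1P; rewrite mxE.
have [c' [J' [dJ' fJ']]] := im _ c1.
have dJ := slice_mdiff cp dA.
have [ac _ _] := dJ; have [ac' _ _] := dJ'.
have [T T0 hT] := chart_change ac ac' (mdiff_dom c1 dJ) (mdiff_dom c1 dJ').
have E := cube_mdiff_uniq c1 dJ' (hT _ _ _ _ _ c1 erefl dJ).
apply/eqP => r0; move: fJ'; rewrite E r0 mul0mx /row_free mxrank0.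
by [].
Qed.

(** An isotopy has no double points, so that it is generic as it stands once [step (3 * u - 1)] has
    made it stationary near [u = 0] and [u = 1]. *)
Lemma GH_Emb a b : Emb_loop_homotopic I0 a b -> exists2 A, GH I0 a b A & dax_sum I0 A = 0.
Proof.
move=> [_ _ [K [sK eK hK]]].
pose r (u : R) := step (3 * u - 1).
pose A t u s := K (r u) t s.
have ri u : itv (r u) by exact: step01.
have EA t u : itv t -> Emb I0 (A t u) by have [_ h _] := eK _ (ri u); exact: h.
have dp0 : double_points A = set0.
 apply/seteqP; split=> [[[[p q] t] u] [[p0 pq q1 ti ui] E]|//].
 have [pa _] := EA t u ti; have : p = q; last by move: pq; lra.
 by apply: set_inj_itv E; [exact: proper_arc_inj|lra|lra].
pose sig (x : 'R_3) : 'R_3 := vec3 (x 0 0) (x 0 1) (r (x 0 2)).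
have cr k : ck k setT (fun x : 'R_3 => r (x 0 2)).
 apply: (@smooth1_step) => //.
 by smooth.
have ss : Cinfty setT sig.
 exact: Cinfty_vec3.
have gc x : cube 3 x -> generic_at A x.
 move=> cx; have /cube3P[x0 x1 x2] := cx.
 have cs : cube 3 (sig x) by apply/cube3P; rewrite !vecE.
 have [c [J dJ]] := sK _ cs.
 have [S dS] := @diff_on_Cinfty 3 3 sig setT (cube 3) x openT I ss.
 have dA : mdiff (family3 A) (cube 3) x c (S *m J).
  apply: mdiff_eq (mdiff_comp cx _ dS dJ).
   by apply: all_near => y; rewrite /= !vecE.
  by apply: within_all => y /cube3P[y0 y1 y2]; apply/cube3P; rewrite !vecE.
 exists c, (S *m J); split=> //.
 rewrite (vec3_eta x) in dA; have [pa _] := EA (x 0 1) (x 0 2) x1.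
 by apply: slice_immersed dA pa; rewrite -vec3_eta.
exists A; last by rewrite /dax_sum dp0 fsbig_set0.
split.
- exact: generic_cont.
- by move=> t u ti ui; apply: Emb_Maps; exact: EA.
- exists 3^-1 => //.
 move=> t u s ti ui si; have [h0 h1] := hK t s ti si; split=> hu.
  by rewrite /A /r step_le0 //; lra.
 by rewrite /A /r step_ge1 //; lra.
- by move=> u s ui si; have [_ _ h] := eK _ (ri u); exact: h.
split=> //.
- by rewrite dp0.
- by rewrite dp0.
- by rewrite dp0.
Qed.

Lemma dax_valueB a z z' : (forall t, itv t -> set_inj unit_itv (a t)) ->
 dax_value I0 a z -> dax_value I0 a z' -> dax_kernel (z - z').
Proof.
move=> ai /dax_valueE[B hB ->] /dax_valueE[B' hB' ->].
have [hR ER] := GH_rev hB'; have [hC E] := GH_glue hB hR ai.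
by apply/dax_valueE; exists (glue_family B (rev_family B')); rewrite // E ER.
Qed.

Hypothesis I0_loop : Emb_loop I0 (fun=> I0).

Lemma I0_inj : set_inj unit_itv I0.
Proof.
have [_ h _] := I0_loop; have [|pa _] := h 0 => //.
exact: proper_arc_inj.
Qed.

Lemma Emb_loop_refl a : Emb_loop I0 a -> Emb_loop_homotopic I0 a a.
Proof.
move=> ea; split=> //; exists (fun=> a); split=> //.
have [sa _ _] := ea => x cx; have /cube3P[x0 x1 x2] := cx.
pose pr (x : 'R_3) : 'R_2 := vec2 (x 0 0) (x 0 1).
have spr : Cinfty setT pr.
 exact: Cinfty_vec2.
have cpr : cube 2 (pr x) by apply/cube2P; rewrite !vecE.
have [c [J dJ]] := sa _ cpr.
have [S dS] := @diff_on_Cinfty 3 2 pr setT (cube 3) x openT I spr.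
exists c, (S *m J); apply: mdiff_eq (mdiff_comp cx _ dS dJ).
 by apply: all_near => y; rewrite /= !vecE.
by apply: within_all => y /cube3P[y0 y1 y2]; apply/cube2P; rewrite !vecE.
Qed.

Lemma dax_kernel0 : dax_kernel (0 : Zpi1 I0).
Proof.
have [A hA A0] := GH_Emb (Emb_loop_refl I0_loop).
by apply/dax_valueE; exists A.
Qed.

Lemma dax_kernelB (z z' : Zpi1 I0) : dax_kernel z -> dax_kernel z' -> dax_kernel (z - z').
Proof. by apply: dax_valueB => t _; exact: I0_inj. Qed.

(** Cosets are compared as sets, which needs the kernel to be a subgroup: it contains 0 and is
    closed under differences. *)
Lemma dax_coset_eq (z z' : Zpi1 I0) : dax_kernel (z - z') -> dax_coset I0 z = dax_coset I0 z'.
Proof.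
have N (y : Zpi1 I0) : dax_kernel y -> dax_kernel (- y) by rewrite -sub0r; apply: dax_kernelB; exact: dax_kernel0.
have Dk (y y' : Zpi1 I0) : dax_kernel y -> dax_kernel y' -> dax_kernel (y + y').
 by move=> ky /N ky'; rewrite -[y']opprK; exact: dax_kernelB.
move=> kz; apply: (eq_sig_hprop (fun _ => @Prop_irrelevance _)); apply/seteqP; split=> _ [k hk <-].
 by exists (z - z' + k); [exact: Dk|rewrite addrA [z' + _]addrC subrK].
exists (- (z - z') + k); [by apply: Dk => //; exact: N|].
by rewrite opprB addrA addrA [z + z']addrC addrK.
Qed.

End EmbHomotopy.

(** * Sard's theorem and common regular values *)

Definition jac n m (g : 'R_n -> 'R_m) (z : 'R_n) : 'M[R]_(n, m) :=
 \matrix_(i, j) 'D_('e_i) (fun y => g y 0 j) z.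

Lemma norm_coord_ex n (v : 'R_n.+1) : exists i, `|v| = `|v 0 i|.
Proof.
have [->|v0] := eqVneq v 0; first by exists ord0; rewrite mxE !normr0.
have : mx_norm v != 0 by rewrite -[mx_norm v]/(`|v|) normr_eq0.
by move=> /mx_norm_neq0[[i j]] /=; rewrite (ord1 i) => E; exists j.
Qed.

Lemma row_dot_le n (v w : 'R_n) (a b : R) : 0 <= a -> 0 <= b ->
 (forall i, `|v 0 i| <= a) -> (forall i, `|w 0 i| <= b) ->
 `|\sum_i v 0 i * w 0 i| <= n%:R * (a * b).
Proof.
move=> a0 b0 va wb; apply: le_trans (ler_norm_sum _ _ _) _.
apply: le_trans (_ : \sum_(i < n) a * b <= _).
 by apply: ler_sum => i _; rewrite normrM ler_pM.
by rewrite sumr_const card_ord mulr_natl.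
Qed.

Lemma mvt_seg n (U : set 'R_n) (f : 'R_n -> R) x y : open U -> ck 1 U f ->
 (forall t, 0 <= t <= 1 -> U (x + t *: (y - x))) ->
 exists2 c : R, 0 < c < 1 &
  f y - f x = \sum_i (y - x) 0 i * 'D_('e_i) f (x + c *: (y - x)).
Proof.
move=> oU kf hU; have [|c c01 E] := @mvt_line _ f x (y - x).
 by move=> t ti; have [_ /(_ (y - x))[d _]] := kf; apply: d; exact: hU.
exists c => //; rewrite -(ck_derive _ oU kf); last by apply: hU; case/andP: c01 => /ltW-> /ltW->.
by rewrite -E [x + _]addrC subrK.
Qed.

Lemma ball_seg (V : normedModType R) (x0 x y : V) (d t : R) : `|x - x0| < d -> `|y - x0| < d ->
 0 <= t <= 1 -> `|x + t *: (y - x) - x0| < d.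
Proof.
move=> hx hy /andP[t0 t1].
have -> : x + t *: (y - x) - x0 = (1 - t) *: (x - x0) + t *: (y - x0).
 have -> : y - x = (y - x0) - (x - x0) by rewrite opprB addrA subrK.
 by rewrite scalerBr scalerBl scale1r addrAC -[RHS]addrA [- _ + _]addrC.
apply: le_lt_trans (ler_normD _ _) _; rewrite !normrZ (ger0_norm t0) ger0_norm ?subr_ge0 //.
have [->|tn] := eqVneq t 0; first by rewrite subr0 mul1r mul0r addr0.
have tp : 0 < t by lra.
apply: lt_le_trans (_ : (1 - t) * d + t * d <= d); last by rewrite -mulrDl subrK mul1r.
by apply: ler_ltD; [apply: ler_wpM2l; rewrite ?subr_ge0 ?(ltW hx)|rewrite ltr_pM2l].
Qed.

(** The linear approximation is uniform in both points because the differential is taken at [z] and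
    not at [z0]: by the mean value theorem the error is controlled by the oscillation of the partial
    derivatives near [z0]. *)
Lemma strict_diff n (U : set 'R_n) (g : 'R_n -> 'R_n) z0 (e : R) :
 open U -> Ck 1 U g -> U z0 -> 0 < e ->
 exists2 d, 0 < d & forall z z', `|z - z0| < d -> `|z' - z0| < d ->
  forall j, `|(g z' - g z - (z' - z) *m jac g z) 0 j| <= e * `|z' - z|.
Proof.
move=> oU kg Uz0 e0.
have kj j : ck 1 U (fun y => g y 0 j) := (Ck_coordP _ _ oU).1 kg j.
pose e' := e / (n%:R + 1) / 2; have e'0 : 0 < e' by rewrite !divr_gt0.
have H : nbhs z0 (fun y => U y /\ forall ij : 'I_n * 'I_n,
  `|'D_('e_(ij.1)) (fun x => g x 0 ij.2) y - 'D_('e_(ij.1)) (fun x => g x 0 ij.2) z0| <= e').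
 apply: filterI; first exact: open_nbhs_nbhs.
 apply: (@near_forall 'R_n ('I_n * 'I_n)%type (fun ij y =>
  `|'D_('e_(ij.1)) (fun x => g x 0 ij.2) y - 'D_('e_(ij.1)) (fun x => g x 0 ij.2) z0| <= e')).
 move=> [i j] /=; have [_ /(_ 'e_i)[_ [c _]]] := kj j.
 by have /cvgrPdist_le /(_ _ e'0) := c z0 Uz0; apply: filterS => y; rewrite distrC.
have /nbhs_normP[d /= d0 Hd] := H.
exists d => // z z' hz hz' j.
have Hb y : `|y - z0| < d -> U y /\ forall ij : 'I_n * 'I_n,
  `|'D_('e_(ij.1)) (fun x => g x 0 ij.2) y - 'D_('e_(ij.1)) (fun x => g x 0 ij.2) z0| <= e'.
 by move=> hy; apply: Hd; rewrite /ball_/= distrC.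
have [|c /andP[c0 c1] E] := mvt_seg (x := z) (y := z') oU (kj j).
 by move=> t ti; have [] := Hb _ (ball_seg hz hz' ti).
rewrite !mxE E -sumrB.
have -> : \sum_i ((z' - z) 0 i * 'D_'e_i (fun y => g y 0 j) (z + c *: (z' - z)) -
   (z' - z) 0 i * jac g z i j) = \sum_i (z' - z) 0 i * (\row_i
   ('D_'e_i (fun y => g y 0 j) (z + c *: (z' - z)) - jac g z i j)) 0 i.
 by apply: eq_bigr => i _; rewrite [in RHS]mxE mulrBr.
apply: le_trans (@row_dot_le n _ _ `|z' - z| (e' + e') _ _ _ _) _ => //.
- by rewrite addr_ge0 // ltW.
- by exact: norm_coord_le.
- move=> i; rewrite !mxE.
 have cz : `|z + c *: (z' - z) - z0| < d by apply: ball_seg => //; rewrite !ltW.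
 have [_ /(_ (i, j)) /= h1] := Hb _ cz; have [_ /(_ (i, j)) /= h2] := Hb _ hz.
 rewrite -(subrKA ('D_'e_i (fun x => g x 0 j) z0)); apply: le_trans (ler_normD _ _) _.
 by apply: lerD => //; rewrite distrC.
rewrite mulrCA mulrC; apply: ler_wpM2r => //.
have -> : n%:R * (e' + e') = e * (n%:R / (n%:R + 1)) by rewrite /e'; field.
by apply: ler_piMr; [exact: ltW|rewrite ler_pdivrMr // mul1r lerDl].
Qed.

(** Turns a threshold that may depend on the point into a common one on a compact set, provided that
    the property holds at all nearby points for all smaller thresholds. Most uniform constants below
    come from it. *)
Lemma compact_small (V : normedModType R) (K : set V) (P : R -> V -> Prop) : compact K ->
 (forall z0, K z0 -> exists2 d, 0 < d & forall z e, `|z - z0| < d -> 0 < e < d -> P e z) ->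
 exists2 e, 0 < e & forall z, K z -> P e z.
Proof.
move=> /compact_near_coveringP cK h.
have /(_ _)H := cK R (0 : R)^'+ P _; have {}H : \forall e \near (0 : R)^'+, forall z, K z -> P e z.
 apply: H => z0 Kz0; have [d d0 hd] := h z0 Kz0.
 exists ([set z | `|z - z0| < d], [set e | 0 < e < d]) => /=; last first.
  by move=> [z e] /= [hz he]; exact: hd.
 split; first by apply/nbhs_normP; exists d => //= z; rewrite /ball_/= distrC.
 by near=> e; apply/andP; split; near: e; [exact: nbhs_right_gt|exact: nbhs_right_lt].
have [e [e0 He]] : exists e, 0 < e /\ forall z, K z -> P e z.
 near (0 : R)^'+ => e; exists e; split; first by near: e; exact: nbhs_right_gt.
 by near: e.
by exists e.
Unshelve. all: end_near. Qed.

Lemma compact_large (V : normedModType R) (K : set V) (P : nat -> V -> Prop) : compact K ->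
 (forall z0, K z0 -> exists2 d, 0 < d & exists n0, forall z n, `|z - z0| < d ->
   (n0 <= n)%N -> P n z) ->
 exists n, forall z, K z -> P n z.
Proof.
move=> /compact_near_coveringP cK h.
have H := cK nat \oo P _; have {}H : \forall n \near \oo, forall z, K z -> P n z.
 apply: H => z0 Kz0; have [d d0 [n0 hd]] := h z0 Kz0.
 exists ([set z | `|z - z0| < d], [set n | (n0 <= n)%N]) => /=; last first.
  by move=> [z e] /= [hz he]; exact: hd.
 split; first by apply/nbhs_normP; exists d => //= z; rewrite /ball_/= distrC.
 by exists n0.
by have [n0 _ Hn] := H; exists n0; apply: Hn => /=.
Qed.

Lemma truncn_close (a b : R) : 0 <= a -> 0 <= b -> Num.truncn a = Num.truncn b ->
 `|a - b| < 1.
Proof.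
move=> a0 b0 E; have /andP[a1 a2] := truncn_itv a0; have /andP[b1 b2] := truncn_itv b0.
by rewrite ltr_norml; rewrite E in a1 a2; lra.
Qed.

Lemma truncn_ltn (a : R) k : 0 <= a -> a < k.+1%:R -> (Num.truncn a < k.+1)%N.
Proof.
move=> a0 ak; have /andP[a1 _] := truncn_itv a0.
by rewrite -(ltr_nat R); exact: le_lt_trans ak.
Qed.

Lemma div_shift (x a s N : R) : 0 < s -> `|x| <= a -> (a + a) / s < N ->
 0 <= (x + a) / s < N.
Proof.
move=> s0; rewrite ler_norml => /andP[x1 x2] aN; apply/andP; split.
 by apply: divr_ge0; [rewrite -lerBlDr sub0r|exact: ltW].
by apply: le_lt_trans aN; rewrite ler_pM2r ?invr_gt0 // lerD2r.
Qed.

(* Pigeonhole: a fine lattice in a ball has more points than there are small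
  cells, because a cell of side [h] meeting the critical set is mapped into a
  slab of thickness [O(e h)]. *)
Lemma sard_compact n (U C : set 'R_n.+1) (g : 'R_n.+1 -> 'R_n.+1) :
 open U -> Ck 1 U g -> compact C -> C `<=` U ->
 (forall z, C z -> \det (jac g z) = 0) ->
 forall l0 rho, 0 < rho -> exists2 l, `|l - l0| <= rho & ~ (g @` C) l.
Proof.
move=> oU kg cC CU crit l0 rho rho0; apply: contrapT => noex.
have full l : `|l - l0| <= rho -> exists2 z, C z & g z = l by move=> hl; apply: contrapT => h; apply: noex; exists l.
have kj j : ck 1 U (fun y => g y 0 j) := (Ck_coordP _ _ oU).1 kg j.
have [m hm] : exists m : nat, forall z, C z -> forall i, `|z 0 i| <= m%:R.
 apply: compact_large => // z0 Cz0; exists 1 => //; exists (Num.truncn `|z0|).+2 => z k hz hk i.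
 apply: le_trans (norm_coord_le _ _) _.
 have h1 : `|z| <= `|z0| + 1 by rewrite -(subrK z0 z); apply: le_trans (ler_normD _ _) _; rewrite addrC lerD2l ltW.
 apply: le_trans h1 _; have /andP[_ h2] := truncn_itv (normr_ge0 z0).
 apply: le_trans (_ : (Num.truncn `|z0|).+2%:R <= _); last by rewrite ler_nat.
 by rewrite -[X in _ <= X]natr1 lerD2r ltW.
have [L0 hL0] : exists L0 : nat, forall z, C z -> forall i j, `|jac g z i j| <= L0%:R.
 apply: compact_large => // z0 Cz0.
 have H : nbhs z0 (fun y => forall ij : 'I_n.+1 * 'I_n.+1,
   `|jac g y ij.1 ij.2 - jac g z0 ij.1 ij.2| <= 1).
  apply: (@near_forall 'R_n.+1 ('I_n.+1 * 'I_n.+1)%type (fun ij y =>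
   `|jac g y ij.1 ij.2 - jac g z0 ij.1 ij.2| <= 1)) => -[i j].
  have [_ /(_ 'e_i)[_ [c _]]] := kj j.
  have /cvgrPdist_le /(_ _ ltr01) := c z0 (CU _ Cz0).
  by apply: filterS => y; rewrite distrC !mxE.
 have /nbhs_normP[d /= d0 Hd] := H.
 exists d => //; exists (Num.truncn (\sum_i \sum_j `|jac g z0 i j|)).+2 => z k hz hk i j.
 have /Hd/(_ (i, j)) /= h1 : ball_ Num.Def.normr z0 d z by rewrite /ball_/= distrC.
 have S0 : 0 <= \sum_i \sum_j `|jac g z0 i j| by apply: sumr_ge0 => ? _; apply: sumr_ge0.
 have h2 : `|jac g z0 i j| <= \sum_i \sum_j `|jac g z0 i j|.
  rewrite (bigD1 i) //= (bigD1 j) //= -addrA lerDl.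
  by rewrite addr_ge0 // sumr_ge0 // => ? _; apply: sumr_ge0.
 have /andP[_ h3] := truncn_itv S0.
 apply: le_trans (_ : (Num.truncn (\sum_i \sum_j `|jac g z0 i j|)).+2%:R <= _); last by rewrite ler_nat.
 rewrite -natr1 -(subrK (jac g z0 i j) (jac g z i j)).
 by apply: le_trans (ler_normD _ _) _; rewrite addrC; apply: lerD => //; exact: ltW (le_lt_trans h2 h3).
pose q := n.+1; pose L := (q * L0)%N.
have [r0 hr0] : exists r0 : nat, (0 < r0)%N /\ r0%:R^-1 <= rho.
 exists (Num.truncn rho^-1).+1; split=> //.
 have ri : 0 <= rho^-1 by rewrite invr_ge0 ltW.
 have /andP[_ h] := truncn_itv ri.
 by rewrite invf_ple ?posrE // ltW.
have [r0p r0r] := hr0.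
pose Z := (2 * q).+1.
(* The lattice has [(e * d) ^ q] points, and the codes number at most [(3 * m.+1 * r0 * d) ^ q * (3
   * L.+1 * e) ^ n * Z]. As [q = n + 1], the powers of [d] cancel and one factor [e] remains, which
   is chosen larger than the other constants. *)
pose e := (Z * (3 * m.+1 * r0) ^ q * (3 * L.+1) ^ n).+1.
have [d [d1 hd]] : exists d : nat, (0 < d)%N /\ forall z z', C z -> `|z' - z| < (r0 * d)%:R^-1 ->
  C z' -> forall j, `|(g z' - g z - (z' - z) *m jac g z) 0 j| <= e%:R^-1 * `|z' - z|.
 have [dl dl0 hdl] : exists2 dl, 0 < dl & forall z, C z -> forall z', `|z' - z| < dl ->
   forall j, `|(g z' - g z - (z' - z) *m jac g z) 0 j| <= e%:R^-1 * `|z' - z|.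
  apply: compact_small => // z0 Cz0.
  have [|dd dd0 hdd] := strict_diff (e := e%:R^-1) oU kg (CU _ Cz0).
   by rewrite invr_gt0.
  exists (dd / 2); first lra.
  move=> z dl hz /andP[_ dlh] z' hz'; apply: hdd.
   by apply: lt_trans hz _; rewrite ltr_pdivrMr // mulr_natr ltrDl.
  rewrite -(subrKA z); apply: le_lt_trans (ler_normD _ _) _.
  by rewrite [ltRHS]splitr ltrD // (lt_trans hz').
 exists (Num.truncn dl^-1).+1; split=> // z z' Cz hz' _; apply: hdl => //.
 apply: lt_le_trans hz' _.
 have ri : 0 <= dl^-1 by rewrite invr_ge0 ltW.
 have /andP[_ h] := truncn_itv ri.
 rewrite invf_ple ?posrE ?ltr0n ?muln_gt0 ?r0p //.
 apply: le_trans (ltW h) _; rewrite ler_nat.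
 by rewrite leq_pmull.
pose h : R := (r0 * d)%:R^-1; have h0 : 0 < h by rewrite invr_gt0 ltr0n muln_gt0 r0p.
pose P := (e * d)%N; pose s : R := h / e%:R.
have s0 : 0 < s by rewrite divr_gt0 //.
pose w (k : {ffun 'I_q -> 'I_P}) : 'R_q := l0 + \row_i (s * (k i)%:R).
have wl k : `|w k - l0| <= rho.
 rewrite addrAC subrr add0r; apply: norm_row_le; first exact: ltW.
 move=> i; rewrite mxE ger0_norm; last by rewrite mulr_ge0 // ltW.
 apply: le_trans r0r.
 apply: le_trans (_ : s * P%:R <= _).
  by rewrite ler_pM2l // ler_nat ltnW.
 rewrite /s /h !natrM invfM.
 have -> : r0%:R^-1 / d%:R / e%:R * (e%:R * d%:R) = r0%:R^-1 :> R by field; rewrite !pnatr_eq0 -!lt0n r0p.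
 done.
have /choice[zz hzz] : forall k, exists z, C z /\ g z = w k by move=> k; have [z Cz gz] := full _ (wl k); exists z.
pose N := (2 * m * (r0 * d)).+1.
pose cell (z : 'R_q) : {ffun 'I_q -> 'I_N} :=
 [ffun i => inord (Num.truncn ((z 0 i + m%:R) * (r0 * d)%:R))].
have cell_close z z' : C z -> C z' -> cell z = cell z' -> `|z - z'| < h.
 move=> Cz Cz' E.
 have key i : `|z 0 i - z' 0 i| < h.
  have /ffunP/(_ i) := E; rewrite !ffunE => /(congr1 val).
  have b y : C y -> 0 <= (y 0 i + m%:R) * (r0 * d)%:R <= (2 * m * (r0 * d))%:R.
   move=> Cy; have := hm _ Cy i; rewrite ler_norml => /andP[y1 y2].
   rewrite mulr_ge0 //=; last by rewrite -lerBlDr sub0r.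
   by rewrite [X in _ <= X]natrM ler_wpM2r // mul2n -addnn natrD lerD2r.
  have [b1 b2] := andP (b _ Cz); have [b1' b2'] := andP (b _ Cz').
  rewrite /= !inordK; last 2 first.
  - by apply: (truncn_ltn b1'); apply: (le_lt_trans b2'); rewrite ltr_nat.
  - by apply: (truncn_ltn b1); apply: (le_lt_trans b2); rewrite ltr_nat.
  move=> /(truncn_close b1 b1'); rewrite -mulrBl opprD addrACA subrr addr0.
  by rewrite normrM (ger0_norm (ler0n _ _)) -ltr_pdivlMr ?ltr0n ?muln_gt0 ?r0p // mul1r.
 by have [i ->] := norm_coord_ex (z - z'); rewrite !mxE.
pose rep (c : {ffun 'I_q -> 'I_N}) : 'R_q :=
 if [pick k | cell (zz k) == c] is Some k then zz k else l0.
have repP k : C (rep (cell (zz k))) /\ cell (rep (cell (zz k))) = cell (zz k).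
 rewrite /rep; case: pickP => [k' /eqP E|/(_ k)]; last by rewrite eqxx.
 by have [] := hzz k'.
(* A linear form that vanishes on the image of the singular differential, scaled so that its largest
   coefficient, at index [l.1], is 1. *)
have /choice[ll hll] : forall z, exists l : 'I_q * 'cV[R]_q, C z ->
  [/\ jac g z *m l.2 = 0, l.2 l.1 0 = 1 & forall i, `|l.2 i 0| <= 1].
 move=> z; have [Cz|nC] := pselect (C z); last by exists (ord0, 0).
 have : \det (jac g z)^T == 0 by rewrite det_tr crit.
 move=> /det0P[v vn0 vJ]; have [j vE] := norm_coord_ex v.
 have v0 : 0 < `|v| by rewrite normr_gt0.
 have vj0 : v 0 j != 0 by rewrite -normr_gt0 -vE.
 exists (j, (v 0 j)^-1 *: v^T) => _ /=; split.
 - by rewrite -scalemxAr -[jac g z]trmxK -trmx_mul vJ trmx0 scaler0.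
 - by rewrite !mxE mulVf.
 by move=> k; rewrite !mxE normrM normfV -vE mulrC ler_pdivrMr // mul1r norm_coord_le.
pose A := (2 * (L.+1 * e)).+1.
pose dv k := w k - g (rep (cell (zz k))).
pose lv k := \sum_i dv k 0 i * (ll (rep (cell (zz k)))).2 i 0.
(* The code of a lattice point: the cell of a preimage; up to [s], the displacement from the image
   of the representative of the cell, without its coordinate of index [l.1]; and the value of the
   linear form, for which [Z] numbers suffice and which restores the missing coordinate. *)
pose code k : {ffun 'I_q -> 'I_N} * ({ffun 'I_n -> 'I_A} * 'I_Z) :=
 (cell (zz k), ([ffun j => @inord (2 * (L.+1 * e)) (Num.truncn
   ((dv k 0 (@fintype.lift n.+1 (ll (rep (cell (zz k)))).1 j) + L.+1%:R * h) / s))],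
  @inord (2 * q) (Num.truncn ((lv k + q%:R * s) / s)))).
have bnd k : [/\ (forall j, `|dv k 0 j| <= L.+1%:R * h) & `|lv k| <= q%:R * s].
 have [Cr cr] := repP k; have [Cz gz] := hzz k; set r := rep _ in Cr cr *.
 have zr : `|zz k - r| < h by apply: cell_close.
 have E j : `|(dv k - (zz k - r) *m jac g r) 0 j| <= s.
  have [_ H] := conj I (@hd r (zz k) Cr zr Cz).
  rewrite /dv -gz; apply: le_trans (H j) _.
  by rewrite mulrC ler_pM2r ?invr_gt0 // ltW.
 have sh : s <= h by rewrite ler_pdivrMr //; apply: ler_peMr; [exact: ltW|rewrite ler1n].
 split=> [j|].
  rewrite -(subrK (((zz k - r) *m jac g r) 0 j) (dv k 0 j)).
  apply: le_trans (ler_normD _ _) _; rewrite -natr1 mulrDl mul1r addrC; apply: lerD.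
   rewrite mxE; apply: le_trans (_ : q%:R * (h * L0%:R) <= _); last first.
    by rewrite natrM mulrA mulrAC.
   have := @row_dot_le q (zz k - r) (\row_i jac g r i j) h L0%:R (ltW h0) (ler0n _ _).
   under eq_bigr => i _ do rewrite [X in _ * X]mxE.
   apply=> i; first by apply: le_trans (norm_coord_le _ _) (ltW zr).
   by rewrite mxE; exact: hL0.
  by apply: le_trans sh; have := E j; rewrite !mxE.
 have [lJ l1 lb] := hll r Cr.
 have -> : lv k = \sum_i (dv k - (zz k - r) *m jac g r) 0 i * ((ll r).2)^T 0 i.
  rewrite -/r; transitivity ((dv k *m (ll r).2) 0 0); first by rewrite [RHS]mxE.
  transitivity (((dv k - (zz k - r) *m jac g r) *m (ll r).2) 0 0).
   by rewrite (mulmxBl (dv k)) -mulmxA lJ mulmx0 subr0.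
  by rewrite [LHS]mxE; apply: eq_bigr => i _; congr (_ * _); rewrite [RHS]mxE.
 have := @row_dot_le q (dv k - (zz k - r) *m jac g r) ((ll r).2)^T s 1 (ltW s0) ler01 E.
 by rewrite mulr1; apply=> i; rewrite mxE.
have sne : s != 0 by rewrite gt_eqF.
have hs : h / s = e%:R by rewrite /s; field; rewrite (gt_eqF h0) pnatr_eq0.
have ordE (k k' : 'I_P) : `|s * k%:R - s * k'%:R| / s < 1 -> k = k'.
 rewrite -mulrBr normrM (gtr0_norm s0) mulrAC mulfV // mul1r => hk.
 apply: val_inj => /=; apply/eqP; rewrite eqn_leq; apply/andP.
 move: hk; rewrite ltr_norml => /andP[h1 h2].
 by split; rewrite -ltnS -(ltr_nat R); clear -h1 h2; lra.
have inj : injective code.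
 move=> k k' [ce de le]; have [b1 b2] := bnd k; have [b1' b2'] := bnd k'.
 have rE : rep (cell (zz k)) = rep (cell (zz k')) by rewrite ce.
 rewrite -rE in de le; set r := rep _ in rE de le.
 have dvB j : dv k 0 j - dv k' 0 j = s * (k j)%:R - s * (k' j)%:R by rewrite /dv -rE !mxE; ring.
 have [Cr _] := repP k; have [_ l1 _] := hll r Cr.
 have kl (j : 'I_n) : k (@fintype.lift n.+1 (ll r).1 j) = k' (@fintype.lift n.+1 (ll r).1 j).
  have /ffunP/(_ j) := de; rewrite !ffunE => /(congr1 val) /=.
  have bb (x : R) : `|x| <= L.+1%:R * h -> 0 <= (x + L.+1%:R * h) / s < A%:R.
   move=> xa; apply: (div_shift s0 xa); rewrite mulrDl -!mulrA hs -natrM -natrD ltr_nat /A.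
   by rewrite mul2n addnn.
  have /andP[u1 u2] := bb _ (b1 (@fintype.lift n.+1 (ll r).1 j)).
  have /andP[u1' u2'] := bb _ (b1' (@fintype.lift n.+1 (ll r).1 j)).
  rewrite !inordK; [|exact: truncn_ltn..] => /(truncn_close u1 u1').
  rewrite -mulrBl opprD addrACA subrr addr0 dvB normrM normfV (gtr0_norm s0).
  exact: ordE.
 have kk : k (ll r).1 = k' (ll r).1.
  have lvB : lv k - lv k' = s * (k (ll r).1)%:R - s * (k' (ll r).1)%:R.
   rewrite /lv -rE -/r -sumrB (bigD1 (ll r).1) //= l1 !mulr1 dvB big1 ?addr0 // => i ni.
   rewrite -mulrBl dvB; case: (@fintype.unliftP n.+1 (ll r).1 i) ni => [j -> _|->]; last by rewrite eqxx.
   by rewrite kl subrr mul0r.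
  move: le => /(congr1 val) /=.
  have bb (x : R) : `|x| <= q%:R * s -> 0 <= (x + q%:R * s) / s < Z%:R.
   move=> xa; apply: (div_shift s0 xa); rewrite mulrDl mulfK // -natrD ltr_nat /Z.
   by rewrite addnn mul2n.
  have /andP[u1 u2] := bb _ b2; have /andP[u1' u2'] := bb _ b2'.
  rewrite !inordK; [|exact: truncn_ltn..] => /(truncn_close u1 u1').
  rewrite -mulrBl opprD addrACA subrr addr0 lvB normrM normfV (gtr0_norm s0).
  exact: ordE.
 apply/ffunP => i; case: (@fintype.unliftP n.+1 (ll r).1 i) => [j ->|->] //.
have := leq_card code inj; rewrite !card_prod !card_ffun !card_ord.
rewrite leqNgt => /negP; apply.
have NB : (N <= 3 * m.+1 * r0 * d)%N.
 rewrite /N; have : (0 < r0 * d)%N by rewrite muln_gt0 r0p.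
 by nia.
have AB : (A <= 3 * L.+1 * e)%N by rewrite /A -mulnA; have : (0 < L.+1 * e)%N by []; lia.
have leX (x y k : nat) : (x <= y)%N -> (x ^ k <= y ^ k)%N by case: k => // k xy; rewrite leq_exp2r.
apply: leq_ltn_trans (_ : ((3 * m.+1 * r0 * d) ^ q * ((3 * L.+1 * e) ^ n * Z) < _)%N).
 by apply: leq_mul; [exact: leX|apply: leq_mul => //; exact: leX].
have -> : (P ^ q = e * (e ^ n * d ^ q))%N by rewrite expnMn [(e ^ q)%N]expnS mulnA.
rewrite [((3 * m.+1 * r0 * d) ^ q)%N]expnMn [((3 * L.+1 * e) ^ n)%N]expnMn.
have -> : ((3 * m.+1 * r0) ^ q * d ^ q * ((3 * L.+1) ^ n * e ^ n * Z) =
  Z * (3 * m.+1 * r0) ^ q * (3 * L.+1) ^ n * (e ^ n * d ^ q))%N by ring.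
rewrite ltn_pmul2r => //.
by rewrite muln_gt0 !expn_gt0 d1.
Qed.

(** If [P K] failed, the sets containing the complement in [K] of some set with [P] would form a
    proper filter, and the local hypothesis at one of its cluster points gives a contradiction. *)
Lemma compact_ind T (K : set T) (P : set T -> Prop) : compact K ->
 P set0 -> (forall A B, A `<=` B -> P B -> P A) ->
 (forall A B, P A -> P B -> P (A `|` B)) ->
 (forall x, K x -> exists2 A, nbhs x A & P A) -> P K.
Proof.
move=> cK P0 PS PU PL; apply: contrapT => nPK.
pose F : set (set T) := [set B | exists2 A, P A & K `\` A `<=` B].
have PF : ProperFilter F.
 apply: Build_ProperFilter; last first.
  split.
  - by exists set0.
  - move=> A B [A' PA hA] [B' PB hB]; exists (A' `|` B'); first exact: PU.
   by move=> x [Kx /not_orP[nA nB]]; split; [apply: hA|apply: hB].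
  - by move=> A B AB [A' PA hA]; exists A' => //; exact: subset_trans AB.
 move=> [A PA hA]; apply: nPK; apply: PS PA => x Kx.
 by apply: contrapT => nA; exact: (hA x (conj Kx nA)).
have [|x [Kx Cx]] := cK F PF; first by exists set0 => // x [].
have [A nA PA] := PL _ Kx.
have FA : F (K `\` A) by exists A.
by have [y [[_ nAy] Ay]] := Cx _ _ FA nA.
Qed.

Lemma open_normP (V : normedModType R) (A : set V) :
 (forall z, A z -> exists2 d, 0 < d & forall w, `|w - z| < d -> A w) -> open A.
Proof.
move=> h; rewrite openE => z /h[d d0 hd]; suff : nbhs z A by [].
by apply/nbhs_normP; exists d => // w; rewrite /ball_/= distrC; exact: hd.
Qed.

(** The usual exhaustion of an open set by compact sets. *)
Definition exhaust n (U : set 'R_n) (m : nat) : set 'R_n :=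
 [set z | `|z| <= m%:R /\ forall y, `|y - z| < m.+1%:R^-1 -> U y].

Lemma exhaust_sub n (U : set 'R_n) m : exhaust U m `<=` U.
Proof. by move=> z [_ h]; apply: h; rewrite subrr normr0. Qed.

Lemma exhaust_ex n (U : set 'R_n) z : open U -> U z -> exists m, exhaust U m z.
Proof.
move=> oU Uz; have : nbhs z U by exact: open_nbhs_nbhs.
move=> /nbhs_normP[d /= d0 hd].
exists (maxn (Num.truncn `|z|).+1 (Num.truncn d^-1)); split.
 have /andP[_ h] := truncn_itv (normr_ge0 z); apply: le_trans (ltW h) _.
 by rewrite ler_nat leq_maxl.
move=> y hy; apply: hd; rewrite /ball_/= distrC; apply: lt_le_trans hy _.
have d1 : 0 <= d^-1 by rewrite invr_ge0 ltW.
have /andP[_ h] := truncn_itv d1; rewrite invf_ple ?posrE //; apply: le_trans (ltW h) _.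
by rewrite ler_nat ltnS leq_maxr.
Qed.

Lemma exhaust_compact n (U : set 'R_n.+1) m : compact (exhaust U m).
Proof.
apply: bounded_closed_compact.
 exists m%:R; split; first exact: num_real.
 by move=> B hB z [hz _]; apply: le_trans hz (ltW hB).
have -> : exhaust U m = ~` [set z | m%:R < `|z| \/ exists2 y, ~ U y & `|y - z| < m.+1%:R^-1].
 apply/seteqP; split=> [z [h1 h2] [|[y nU hy]]|z nz].
 - lra.
 - exact: nU (h2 _ hy).
 split; first by rewrite leNgt; apply/negP => h; apply: nz; left.
 by move=> y hy; apply: contrapT => nU; apply: nz; right; exists y.
apply: open_closedC; apply: open_normP => z [hz|[y nU hy]].
 exists (`|z| - m%:R); first by rewrite /= subr_gt0.
 move=> w; rewrite distrC => hw; left.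
 have := ler_normD (z - w) w; rewrite subrK => h; rewrite -(ltrD2r (`|z| - m%:R)).
 lra.
exists (m.+1%:R^-1 - `|y - z|); first by rewrite /= subr_gt0.
move=> w; rewrite distrC => hw; right; exists y => //.
rewrite -(subrKA z); apply: le_lt_trans (ler_normD _ _) _.
by rewrite -ltrBrDl.
Qed.

Lemma det_jac_ck n (U : set 'R_n) (g : 'R_n -> 'R_n) : open U -> Ck 1 U g ->
 ck 0 U (fun z => \det (jac g z)).
Proof.
move=> oU kg; have kj j : ck 1 U (fun y => g y 0 j) := (Ck_coordP _ _ oU).1 kg j.
have H i j : ck 0 U (fun x => jac g x i j).
 have h : ck 0 U (fun x => 'D_('e_i) (fun y => g y 0 j) x) by have [_ /(_ 'e_i)[]] := kj j.
 by apply: (ck_ext oU _ h) => x _; rewrite mxE.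
rewrite /determinant; apply: ck_sum => // s; apply: ckM => //.
by apply: ck_prod => // i.
Qed.

Lemma crit_image_closed n (U : set 'R_n.+1) (g : 'R_n.+1 -> 'R_n.+1) m :
 open U -> Ck 1 U g ->
 let C := exhaust U m `&` [set z | \det (jac g z) = 0] in
 compact C /\ closed (g @` C).
Proof.
move=> oU kg C.
have cC : compact C.
 apply: (subclosed_compact _ (@exhaust_compact _ U m)); last by move=> z [].
 move=> z Cz; have Ez : exhaust U m z.
  apply: (compact_closed (@norm_hausdorff _ _) (@exhaust_compact _ U m)).
  by move=> B /Cz[w [[Ew _] Bw]]; exists w.
 split=> //=; apply: contrapT => dz.
 have Uz := exhaust_sub Ez.
 have [cd _] := det_jac_ck oU kg.
 have : nbhs z (fun y => \det (jac g y) != 0).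
  have := cd z Uz; move=> /(_ [set y | y != 0]); apply.
  exact: open_nbhs_nbhs (conj (@open_neq R 0) (introN eqP dz)).
 by move=> /Cz[w [[_ /= ->] /eqP]].
split=> //; apply: compact_closed; first exact: norm_hausdorff.
apply: continuous_compact => //; apply: continuous_in_subspaceT => z /set_mem[Ez _].
exact: Ck_cont kg (exhaust_sub Ez).
Qed.

(** For each map and each compact piece of its domain the critical values form a closed set, with
    dense complement by [sard_compact]; Baire's theorem treats the countably many pieces at once.
    For a map that ignores one of its variables the determinant is 0 everywhere, and the conclusion
    says that [l] is not a value. *)
Lemma avoid n (U : nat -> set 'R_n.+1) (g : nat -> 'R_n.+1 -> 'R_n.+1) :
 (forall k, open (U k)) -> (forall k, Ck 1 (U k) (g k)) -> forall e, 0 < e ->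
 exists2 l, `|l| < e & forall k z, U k z -> g k z = l -> \det (jac (g k) z) != 0.
Proof.
move=> oU kg e e0.
pose C k m := exhaust (U k) m `&` [set z | \det (jac (g k) z) = 0].
pose F (i : nat) : set 'R_n.+1 :=
 if @unpickle (nat * nat)%type i is Some km then ~` (g km.1 @` C km.1 km.2) else setT.
have FP i : open (F i) /\ dense (F i).
 rewrite /F; case: unpickle => [[k m]|] /=; last first.
  by split; [exact: openT|move=> O nO _; rewrite setIT].
 have [cC clC] := crit_image_closed m (oU k) (kg k).
 split; first exact: closed_openC.
 move=> O [l0 Ol0] oO; have /nbhs_normP[d /= d0 hd] : nbhs l0 O by exact: open_nbhs_nbhs.
 have CU : C k m `<=` U k by move=> z [/exhaust_sub].
 have Cd z : C k m z -> \det (jac (g k) z) = 0 by case.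
 have d2 : 0 < d / 2 by lra.
 have [l hl nl] := sard_compact (oU k) (kg k) cC CU Cd l0 d2.
 exists l; split=> //; apply: hd; rewrite /ball_/= distrC; apply: le_lt_trans hl _.
 lra.
have dF : dense (\bigcap_i F i) := Baire FP.
have [||l [hl Fl]] := dF [set l | `|l| < e].
- by exists 0; rewrite /= normr0.
- apply: open_normP => l /= hl; exists (e - `|l|); first by rewrite /= subr_gt0.
 move=> w; rewrite distrC => hw; rewrite -(subrK l w); apply: le_lt_trans (ler_normD _ _) _.
 by rewrite distrC -ltrBrDr.
exists l => // k z Uz gz; apply/eqP => dz.
have [m Em] := exhaust_ex (oU k) Uz.
have := Fl (pickle (k, m)) I; rewrite /F pickleK /=; apply.
by exists z.
Qed.

(** * Clamping, pasting and bump functions *)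

Lemma near_all T (x : T) (P : T -> Prop) :
 (forall y, P y) -> \forall y \near x, P y.
Proof. by apply: filterE. Qed.

(** Retraction onto the unit interval. Composing with it turns functions continuous on the interval,
    or on a product of intervals, into globally continuous ones, to which the continuity lemmas
    apply directly. *)
Definition clamp (x : R) : R := Num.max 0 (Num.min x 1).

Lemma clamp_itv x : itv (clamp x).
Proof. by rewrite le_max lexx /= ge_max ler01 ge_min lexx orbT. Qed.

Lemma clamp_id (x : R) : itv x -> clamp x = x.
Proof. by move=> /andP[x0 x1]; rewrite /clamp min_l // max_r. Qed.

Lemma clamp_le0 x : x <= 0 -> clamp x = 0.
Proof. by move=> x0; rewrite /clamp min_l ?max_l // (le_trans x0). Qed.

Lemma clamp_ge1 x : 1 <= x -> clamp x = 1.
Proof. by move=> x1; rewrite /clamp min_r // max_r. Qed.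

Lemma clamp0 : clamp 0 = 0. Proof. exact: clamp_le0. Qed.
Lemma clamp1 : clamp 1 = 1. Proof. exact: clamp_ge1. Qed.

Lemma clamp_homo : {homo clamp : x y / x <= y}.
Proof. by move=> x y xy; rewrite ge_max le_max /= le_max !le_min; case: (leP x 1) => h /=; rewrite ?xy ?lexx //= ?(ltW (lt_le_trans h xy)) ?orbT // h orbT. Qed.

Lemma mixE (nu a b : R) : itv nu -> itv a -> itv b -> itv ((1 - nu) * a + nu * b).
Proof.
move=> /andP[n0 n1] /andP[a0 a1] /andP[b0 b1].
have s1 : 0 <= 1 - nu by lra.
rewrite addr_ge0 ?(mulr_ge0 s1 a0) ?(mulr_ge0 n0 b0) //=.
have h1 := ler_wpM2l s1 a1; have h2 := ler_wpM2l n0 b1.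
lra.
Qed.

Lemma cont_clamp : continuous clamp.
Proof.
move=> x; rewrite (_ : clamp = (cst 0 : R -> R^o) \max ((id : R -> R^o) \min cst 1)) //.
apply: (@continuous_max R R); first exact: cst_continuous.
by apply: (@continuous_min R R); [exact: cvg_id|exact: cst_continuous].
Qed.

Lemma cont_coord n (i : 'I_n) : continuous (fun x : 'R_n => x 0 i).
Proof. by move=> x; apply: differentiable_continuous; exact: differentiable_coord. Qed.

#[local] Hint Extern 0 (continuous_at _ _) => solve [exact: cont_clamp | exact: cont_coord] : core.

Lemma within_comp (S T X : topologicalType) (A : set S) (f : S -> T) (g : X -> S) x :
 {within A, continuous f} -> A (g x) -> (\forall y \near x, A (g y)) ->
 {for x, continuous g} -> {for x, continuous (f \o g)}.
Proof.
move=> /subspace_continuousP cf Agx Ag cg P /= fP.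
have h : nbhs (g x) (fun y => A y -> P (f y)) := cf _ Agx P fP.
have h1 : nbhs x (fun y => A (g y) -> P (f (g y))) := cg _ h.
by apply: (@filterS2 _ (nbhs x) _ _ _ _ _ Ag h1) => y Ay; apply.
Qed.

Lemma cont_clamp_itv T (f : R -> T) :
 {within unit_itv, continuous f} -> continuous (f \o clamp).
Proof.
move=> cf x; apply: within_comp cf _ _ _; first exact: clamp_itv.
 by apply: filterE => y; exact: clamp_itv.
exact: cont_clamp.
Qed.

Lemma paste_cont (S T : topologicalType) (l : S -> R) (f g : S -> T) :
 continuous l -> continuous f -> continuous g -> (forall x, l x = 0 -> f x = g x) ->
 continuous (fun x => if l x <= 0 then f x else g x).
Proof.
move=> cl cf cg fg x; have [lx|lx|lx] := ltgtP (l x) 0.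
- have h0 : nbhs (l x) [set a | a < 0] by exact: lt_near.
 have h : nbhs x [set y | l y < 0] := cl x _ h0.
 apply: (near_eq_cont); last exact: cf.
 by apply: filterS h => y /= /ltW ->.
- have h0 : nbhs (l x) [set a | 0 < a] by exact: gt_near.
 have h : nbhs x [set y | 0 < l y] := cl x _ h0.
 apply: (near_eq_cont); last exact: cg.
 by apply: filterS h => y /=; rewrite leNgt => ->.
move=> P /=; rewrite lx lexx => fP; have gP := fP; rewrite (fg _ lx) in gP.
have fP' := cf x _ fP; have gP' := cg x _ gP.
apply: (@filterS2 _ (nbhs x) _ _ _ _ _ fP' gP') => y /= h1 h2.
by case: ifP.
Qed.

Lemma derive_row n m (f : 'R_n -> 'R_m) x v j : derivable f x v ->
 ('D_v f x) 0 j = 'D_v (fun y => f y 0 j) x.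
Proof. by move=> df; rewrite derive_mx // !mxE. Qed.

Lemma derive_jac n m (U : set 'R_n) (f : 'R_n -> 'R_m) x v :
 open U -> Ck 1 U f -> U x -> 'D_v f x = v *m jac f x.
Proof.
move=> oU kf Ux; have df := @diff_derivable _ _ _ _ _ v (Ck1_diff oU kf Ux).
apply/rowP => j; rewrite derive_row // (ck_derive v oU ((Ck_coordP _ _ oU).1 kf j) Ux) mxE.
by apply: eq_bigr => i _; rewrite mxE.
Qed.

Lemma min_derive0 n (U : set 'R_n) (f : 'R_n -> R) x v : open U -> ck 1 U f -> U x ->
 (forall y, U y -> f x <= f y) -> 'D_v f x = 0.
Proof.
move=> oU kf Ux fx; have [_ /(_ v)[df _]] := kf.
have : \forall s \near (0 : R), U (x + s *: v) by apply: line_near; exact: open_nbhs_nbhs.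
move=> /nbhs_normP[d /= d0 hd].
have hU t : t \in `]- d, d[%R -> U (x + t *: v).
 by rewrite in_itv /= => /andP[t1 t2]; apply: hd; rewrite /ball_/= sub0r normrN ltr_norml t1.
have D t : t \in `]- d, d[%R -> is_derive t 1 (fun s : R => f (x + s *: v)) ('D_v f (x + t *: v)).
 by move=> /hU Ut; apply: is_derive_line; exact: df.
have z : 0 \in `]- d, d[%R by rewrite in_itv /= oppr_lt0 d0.
have [||||_ E] := @derive1_at_min _ (fun s : R => f (x + s *: v)) (- d) d 0 => //.
- lra.
- by move=> t /D[].
- by move=> t /hU Ut; rewrite scale0r addr0; exact: fx.
by have [_] := D 0 z; rewrite E scale0r addr0.
Qed.

Lemma diff_onD n m (f g : 'R_n -> 'R_m) (A U : set 'R_n) x J :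
 diff_on f A x J -> open U -> U x -> Cinfty U g ->
 diff_on (fun y => f y + g y) A x (J + jac g x).
Proof.
move=> [V [F [[oV Vx] sF Ff dF]]] oU Ux sg.
have oW : open (V `&` U) by exact: openI.
have sF' : Cinfty (V `&` U) F by apply: Cinfty_sub sF => // y [].
have sg' : Cinfty (V `&` U) g by apply: Cinfty_sub sg => // y [].
exists (V `&` U), (fun y => F y + g y); split=> //.
- apply: Cinfty_row => // j k.
 apply: (ck_ext (f := fun y => F y 0 j + g y 0 j)) => //; first by move=> y _; rewrite mxE.
 by apply: ckD => //; apply: (Ck_coordP _ _ oW).1.
- by move=> y [Vy Uy] Ay; rewrite Ff.
move=> v; have Wx : (V `&` U) x by [].
have dFx := @diff_derivable _ _ _ _ _ v (Cinfty_diff oW sF' Wx).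
have dgx := @diff_derivable _ _ _ _ _ v (Cinfty_diff oW sg' Wx).
by rewrite [LHS]deriveD // dF mulmxDr -(derive_jac v oW (sg' 1%N) Wx).
Qed.

Lemma bump_ex n (x0 : 'R_n) (r : R) : 0 < r -> exists phi : 'R_n -> R,
 [/\ forall k, ck k setT phi, forall x, 0 <= phi x <= 1,
   forall x, `|x - x0| < r -> phi x = 1 & forall x, phi x != 0 -> `|x - x0| < 2 * r].
Proof.
move=> r0.
pose b (i : 'I_n) (x : 'R_n) := step (2 - (x 0 i - x0 0 i) / r) * step (2 + (x 0 i - x0 0 i) / r).
have b01 i x : 0 <= b i x <= 1.
 have /andP[h1 h2] := step01 (2 - (x 0 i - x0 0 i) / r).
 have /andP[h3 h4] := step01 (2 + (x 0 i - x0 0 i) / r).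
 by rewrite mulr_ge0 //= mulr_ile1.
exists (fun x => \prod_i b i x); split.
- move=> k; apply: ck_prod => [|i] => //.
 have cc : ck k setT (fun x : 'R_n => (x 0 i - x0 0 i) / r) by smooth.
 apply: ckM => //.
  apply: (smooth1_step openT).
  apply: ckD; [exact: openT|exact: ck_cst|].
  apply: (ck_ext (f := fun x => -1 * ((x 0 i - x0 0 i) / r)) openT); first by move=> x _; rewrite mulN1r.
  by smooth.
 apply: (smooth1_step openT).
 by smooth.
- move=> x; apply: (big_ind (fun z => 0 <= z <= 1)) => [|y z /andP[y0 y1] /andP[z0 z1]|i _] //.
 by rewrite mulr_ge0 //= mulr_ile1.
- move=> x hx; apply: big1 => i _.
 have := le_lt_trans (norm_coord_le (x - x0) i) hx; rewrite !mxE ltr_norml => /andP[h1 h2].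
 have h3 : (x 0 i - x0 0 i) / r <= 1 by rewrite ler_pdivrMr // mul1r ltW.
 have h4 : -1 <= (x 0 i - x0 0 i) / r by rewrite ler_pdivlMr // mulN1r ltW.
 by rewrite /b !step_ge1 //; lra.
move=> x /prodf_neq0 h; have r2 : 0 < 2 * r by rewrite mulr_gt0.
have key i : `|x 0 i - x0 0 i| < 2 * r.
 have := h i isT; rewrite mulf_eq0 negb_or => /andP[h1 h2].
 have h3 : (x 0 i - x0 0 i) / r < 2 by rewrite ltNge; apply/negP => hh; move: h1; rewrite step_le0 ?eqxx // subr_le0.
 have h4 : -2 < (x 0 i - x0 0 i) / r by apply/negP => hh; move: h2; rewrite step_le0 //; lra.
 by move: h3 h4; rewrite ltr_pdivrMr // ltr_pdivlMr // ltr_norml mulNr => -> ->.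
case: n x0 b b01 x h key => [|n] x0 b b01 x h key.
 by rewrite [x - x0](_ : _ = 0) ?normr0 //; apply/rowP => -[].
by have [i ->] := norm_coord_ex (x - x0); rewrite !mxE.
Qed.

Lemma nbhsI2 T (x : T) (A B : set T) :
 nbhs x A -> nbhs x B -> nbhs x (A `&` B).
Proof. exact: filterI. Qed.

Lemma cont_dist T (W : normedModType R)
 (g : T -> W) x (e : R) : {for x, continuous g} -> 0 < e -> nbhs x (fun y => `|g x - g y| < e).
Proof. by move=> cg e0; apply: (@cvgr_dist_lt _ _ _ (nbhs x) _ g (g x) cg _ e0). Qed.

Lemma cont_within (S T : topologicalType) (A : set S) (f : S -> T) :
 continuous f -> {within A, continuous f}.
Proof. by apply: continuous_subspaceT. Qed.

Lemma cont_clampo T (f : T -> R) :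
 continuous f -> continuous (fun x => clamp (f x)).
Proof. by move=> cf; apply: cont_o cf _. Qed.

Lemma cont_vec3 T (f g h : T -> R) :
 continuous f -> continuous g -> continuous h -> continuous (fun x => vec3 (f x) (g x) (h x)).
Proof.
move=> cf cg ch x; apply/row_contP; apply: I3_ind.
- by apply: near_eq_cont (cf x); apply: near_all => y; rewrite vecE.
- by apply: near_eq_cont (cg x); apply: near_all => y; rewrite vecE.
by apply: near_eq_cont (ch x); apply: near_all => y; rewrite vecE.
Qed.

Lemma cont_vec2 T (f g : T -> R) :
 continuous f -> continuous g -> continuous (fun x => vec2 (f x) (g x)).
Proof.
move=> cf cg x; apply/row_contP; apply: I2_ind.
- by apply: near_eq_cont (cf x); apply: near_all => y; rewrite vecE.
by apply: near_eq_cont (cg x); apply: near_all => y; rewrite vecE.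
Qed.

Lemma paste_le (S T : topologicalType) (l r : S -> R) (f g : S -> T) :
 continuous l -> continuous r -> continuous f -> continuous g ->
 (forall x, l x = r x -> f x = g x) -> continuous (fun x => if l x <= r x then f x else g x).
Proof.
move=> cl cr cf cg fg.
rewrite (_ : (fun x => _) = (fun x => if l x - r x <= 0 then f x else g x)); last first.
 by apply/funext => x; rewrite subr_le0.
apply: paste_cont => //; first exact: (cont_lin cl (cont_opp cr)).
by move=> x /subr0_eq; exact: fg.
Qed.

Ltac cont := lazymatch goal with
 | |- forall x, continuous_at x (fun _ => ?a) => exact: cont_cst
 | |- forall x, continuous_at x (fun y => - @?f y) => apply: (@cont_opp _ f); cont
 | |- forall x, continuous_at x (fun y => @?f y + @?g y) =>
   first [apply: (@cont_lin _ f g) | apply: (@cont_add _ _ f g)]; cont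
 | |- forall x, continuous_at x (fun y => @?f y ^+ 2) => apply: (@cont_sqr _ f); cont
 | |- forall x, continuous_at x (fun y => @?f y * @?g y) => apply: (@cont_mul _ f g); cont
 | |- forall x, continuous_at x (fun y => @?f y *: @?g y) => apply: (@cont_scaleg _ _ f g); cont
 | |- forall x, continuous_at x (fun y => Num.min (@?f y) (@?g y)) => apply: (@cont_min _ f g); cont
 | |- forall x, continuous_at x (fun y => Num.max (@?f y) (@?g y)) => apply: (@cont_max _ f g); cont
 | |- forall x, continuous_at x (fun y => Num.sqrt (@?f y)) => apply: (@cont_sqrt _ f); cont
 | |- forall x, continuous_at x (fun y => `|@?f y|) => apply: (@cont_norm _ f); cont
 | |- forall x, continuous_at x (fun y => clamp (@?f y)) => apply: (@cont_clampo _ f); cont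
 | |- forall x, continuous_at x (fun y => (@?f y, @?g y)) => apply: (@cont_pairg _ _ _ f g); cont
 | |- forall x, continuous_at x (fun y => vec2 (@?f y) (@?g y)) => apply: (@cont_vec2 _ f g); cont
 | |- forall x, continuous_at x (fun y => vec3 (@?f y) (@?g y) (@?h y)) => apply: (@cont_vec3 _ f g h); cont
 | |- forall x, continuous_at x (fun y => fst y) => exact: cont_fst
 | |- forall x, continuous_at x (fun y => snd y) => exact: cont_snd
 | |- forall x, continuous_at x (fun y => fst (@?f y)) => apply: (cont_o _ (@cont_fst _ _)); cont
 | |- forall x, continuous_at x (fun y => snd (@?f y)) => apply: (cont_o _ (@cont_snd _ _)); cont
 | |- forall x, continuous_at x (GRing.mul ?a) => apply: (@cont_mul _ (fun=> a) (fun y => y)); cont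
 | |- {for ?x, continuous ?f} => let h := fresh in have h : continuous f; [cont | exact: h]
 | |- _ => first [done |
   match goal with H : forall x, continuous_at x ?f |- forall x, continuous_at x (fun y => ?f (@?g y)) =>
    apply: (@cont_o _ _ _ g f _ H); cont end | idtac]
 end.

(** * Displacements in a chart, and smooth approximation *)

Section Perturb.
Implicit Types c d : chart R M.

Lemma chart_half c x : atlas c -> dom c x -> 0 <= c x 0 0.
Proof.
move=> ac cx; have [_ [V _ cV] _ _ _] := atlas_chart ac.
have : (c @` dom c) (c x) by [].
by rewrite cV => -[].
Qed.

Lemma chart_imageK c v : atlas c -> (c @` dom c) v ->
 dom c (chart_inv c v) /\ c (chart_inv c v) = v.
Proof. by move=> ac [x cx <-]; rewrite chartK. Qed.

Lemma chart_image_nbhs c x : atlas c -> dom c x -> 0 < c x 0 0 ->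
 nbhs (c x) (c @` dom c).
Proof.
move=> ac cx c0; have [_ [V oV cV] _ _ _] := atlas_chart ac; rewrite cV.
have [Vx _] : (V `&` half_space (R := R)) (c x) by rewrite -cV.
have h1 : nbhs (c x) V by exact: open_nbhs_nbhs.
have h0 : nbhs (c x 0 0) [set a | 0 < a] by exact: gt_near.
have h2 : nbhs (c x) [set y : 'R_4 | 0 < y 0 0] := @cont_coord 4 0 (c x) _ h0.
by apply: filterS2 h1 h2 => y Vy /= /ltW.
Qed.

Lemma chart_inv_near c x (A : set M) : atlas c -> dom c x -> nbhs x A ->
 nbhs (c x) (fun y => (c @` dom c) y -> A (chart_inv c y)).
Proof.
move=> ac cx nA; have [_ _ cK _ cc] := atlas_chart ac.
have /subspace_continuousP/(_ (c x) (ex_intro2 _ _ _ cx erefl)) := cc.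
by rewrite /from_subspace (cK _ cx) => /(_ A nA).
Qed.

(* At a boundary point of [d], the first coordinate of a transition map into [d]
  is minimal, so at an interior point of [c] its differential would vanish. *)
Lemma boundary_chart c x : atlas c -> dom c x -> boundary x <-> c x 0 0 = 0.
Proof.
move=> ac cx; split; last by exists c.
move=> [d [ad dx d0]]; apply/eqP; rewrite -[_ == _]negbK; apply/negP => cn0.
have c0 : 0 < c x 0 0 by rewrite lt_neqAle eq_sym cn0 chart_half.
have [J dJ J0] := atlas_positive ac ad cx dx.
set A := c @` _ in dJ.
have nA : nbhs (c x) A.
 have nd : nbhs x (dom c `&` dom d) by apply: nbhsO => //; apply: openI; exact: chart_open.
 apply: filterS2 (chart_image_nbhs ac cx c0) (chart_inv_near ac cx nd) => y cy /(_ cy) dy.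
 by exists (chart_inv c y); case: (chart_imageK ac cy).
have [U [[oU Ux] sU dU]] := diff_on_nbhs nA dJ.
pose f y := d (chart_inv c y).
have oW : open (U `&` A°) by apply: openI => //; exact: open_interior.
have Wx : (U `&` A°) (c x) by [].
have sW : Cinfty (U `&` A°) f by apply: Cinfty_sub sU => // y [].
have J00 i : J i 0 = 0.
 have := derive_row 0 (@diff_derivable _ _ _ _ _ ('e_i : 'R_4) (Cinfty_diff oW sW Wx)).
 rewrite (min_derive0 _ oW ((Ck_coordP _ _ oW).1 (sW 1%N) 0) Wx).
  have -> : 'D_('e_i) f (c x) = 'e_i *m J := dU 'e_i.
  by rewrite -rowE mxE.
 move=> y [_ /interior_subset [z [cz dz] <-]]; rewrite /f !chartK // d0.
 exact: chart_half.
move: J0; rewrite (expand_det_col J 0) big1 ?ltxx // => i _.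
by rewrite J00 mul0r.
Qed.

(** Displacement by [h] in the chart [c]. Outside the domain of the chart the value is left alone,
    which fits together continuously when [h] is supported in a closed set that [f] maps into the
    domain. *)
Definition pert (T : Type) c (f : T -> M) (h : T -> 'R_4) (x : T) : M :=
 if `[< dom c (f x) >] then chart_inv c (c (f x) + h x) else f x.

Lemma pert0 (T : Type) c (f : T -> M) h x : atlas c -> h x = 0 -> pert c f h x = f x.
Proof. by move=> ac hx; rewrite /pert; case: asboolP => // cx; rewrite hx addr0 chartK. Qed.

Lemma pertE (T : Type) c (f : T -> M) h x : atlas c -> dom c (f x) ->
 (c @` dom c) (c (f x) + h x) ->
 dom c (pert c f h x) /\ c (pert c f h x) = c (f x) + h x.
Proof. by move=> ac cx cv; rewrite /pert; case: asboolP => // _; exact: chart_imageK. Qed.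

Lemma pert_continuous T c (f : T -> M) h (K : set T) :
 atlas c -> continuous f -> continuous h -> closed K -> (forall x, ~ K x -> h x = 0) ->
 (forall x, K x -> dom c (f x)) ->
 (forall x, K x -> (c @` dom c) (c (f x) + h x)) -> continuous (pert c f h).
Proof.
move=> ac cf ch clK h0 Kc Kv x.
have [Kx|nKx] := pselect (K x); last first.
 apply: (near_eq_cont); last exact: cf.
 apply: (open_near (closed_openC clK) nKx) => y nKy.
 by rewrite pert0 // h0.
have cx := Kc x Kx.
have nc : nbhs x (fun y => dom c (f y)) by apply: (cf x); exact: chart_nbhs.
apply: (near_eq_cont (f := chart_inv c \o (fun y => c (f y) + h y))).
 by apply: filterS nc => y cy /=; rewrite /pert; case: asboolP.
have [_ _ _ _ cc] := atlas_chart ac.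
apply: within_comp cc _ _ _; first exact: Kv.
 apply: filterS nc => y cy; have [/Kv//|/h0 ->] := pselect (K y).
 by rewrite addr0.
have c1 : {for x, continuous (fun y => c (f y))}.
 exact: (chart_comp_cont (cf _)).
exact: continuousD c1 (ch x).
Qed.

Lemma mdiff_pert n (f : 'R_n -> M) h (A U : set 'R_n) x c J :
 A x -> open U -> U x -> Cinfty U h -> mdiff f A x c J ->
 (\forall y \near within A (nbhs x), (c @` dom c) (c (f y) + h y)) ->
 mdiff (pert c f h) A x c (J + jac h x).
Proof.
move=> Ax oU Ux sh [ac dc dJ] hv.
have H : \forall y \near within A (nbhs x), dom c (pert c f h y) /\
  c (pert c f h y) = c (f y) + h y.
 by apply: filterS2 dc hv => y cy vy; exact: pertE.
split=> //; first by apply: filterS H => y [].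
apply: diff_on_eq (diff_onD dJ oU Ux sh).
by apply: filterS H => y [_ ->].
Qed.

(** [G] is a neighbourhood of the graph of [f]. Chart displacements of size below [e] stay in the
    image of the chart and in [G], uniformly over [K], as long as they respect the half-space; this
    is how later perturbations are kept close to the given map. *)
Lemma chart_room (V : normedModType R) (f : V -> M) (K : set V) c (G : set (V * M)) :
 compact K -> continuous f -> atlas c -> (forall x, K x -> dom c (f x)) ->
 open G -> (forall x, K x -> G (x, f x)) ->
 exists2 e, 0 < e & forall x, K x -> forall v, half_space v -> `|v - c (f x)| < e ->
  (c @` dom c) v /\ G (x, chart_inv c v).
Proof.
move=> cK cf ac Kc oG KG.
have [e e0 he] : exists2 e, 0 < e & forall x, K x -> (fun e x => forall v, half_space v ->
  `|v - c (f x)| < e -> (c @` dom c) v /\ G (x, chart_inv c v)) e x.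
 apply: compact_small => // z0 Kz0; have cz := Kc _ Kz0.
 have [_ [V0 oV cV] _ _ _] := atlas_chart ac.
 have [Vz _] : (V0 `&` half_space (R := R)) (c (f z0)) by rewrite -cV.
 have : nbhs (z0, f z0) G by apply: nbhsO => //; exact: KG.
 move=> [[A B] /= [nA nB] ABG].
 have nV : nbhs (c (f z0)) V0 by exact: open_nbhs_nbhs.
 have nI := nbhsI2 nV (chart_inv_near ac cz nB); move: nI => /nbhs_normP[r /= r0 hr].
 have cc : {for z0, continuous (fun y => c (f y))}.
  exact: (chart_comp_cont (cf _)).
 have r2 : 0 < r / 2 by lra.
 have h2 : nbhs z0 (fun y => `|c (f z0) - c (f y)| < r / 2) by exact: cont_dist cc r2.
 have nI := nbhsI2 nA h2; move: nI => /nbhs_normP[d /= d0 hd].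
 exists (Num.min d (r / 2)); first by rewrite lt_min d0.
 move=> z e; rewrite !lt_min => /andP[zd _] /andP[_ /andP[_ er]] v hv ve.
 have [Az hz] : (A `&` (fun y => `|c (f z0) - c (f y)| < r / 2)) z by apply: hd; rewrite /ball_/= distrC.
 have [Vv Bv] : (V0 `&` (fun y => (c @` dom c) y -> B (chart_inv c y))) v.
  apply: hr; rewrite /ball_/= -(subrKA (c (f z))); apply: le_lt_trans (ler_normD _ _) _.
  by rewrite [ltRHS]splitr ltrD // distrC (lt_trans ve).
 have cv : (c @` dom c) v by rewrite cV.
 by split=> //; apply: ABG; split=> //=; exact: Bv.
by exists e.
Qed.

(** On a compact set sent off the boundary the first chart coordinate is bounded below by a positive
    number, so that small displacements in all directions are allowed. *)
Lemma chart_room_int (V : normedModType R) (f : V -> M) (K : set V) c (G : set (V * M)) :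
 compact K -> continuous f -> atlas c -> (forall x, K x -> dom c (f x)) ->
 (forall x, K x -> ~ boundary (f x)) -> open G -> (forall x, K x -> G (x, f x)) ->
 exists2 e, 0 < e & forall x, K x -> forall v, `|v - c (f x)| < e ->
  [/\ (c @` dom c) v, 0 < v 0 0 & G (x, chart_inv c v)].
Proof.
move=> cK cf ac Kc Kb oG KG.
have [e1 e10 he1] := chart_room cK cf ac Kc oG KG.
have [e2 e20 he2] : exists2 e, 0 < e & forall x, K x -> e <= c (f x) 0 0.
 apply: (compact_small) => // z0 Kz0; have cz := Kc _ Kz0.
 have c0 : 0 < c (f z0) 0 0.
  rewrite lt_neqAle chart_half // andbT eq_sym; apply/eqP => h.
  by apply: (Kb _ Kz0); exists c.
 have cc : {for z0, continuous (fun y => c (f y) 0 0)}.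
  apply: (@continuous_comp _ _ _ (fun y => c (f y)) (fun v => v 0 0)); last exact: cont_coord.
  exact: (chart_comp_cont (cf _)).
 have c2 : 0 < c (f z0) 0 0 / 2 by lra.
 have /nbhs_normP[d /= d0 hd] := cont_dist cc c2.
 exists (Num.min d (c (f z0) 0 0 / 2)); first by rewrite lt_min d0.
 move=> z e; rewrite !lt_min => /andP[zd _] /andP[_ /andP[_ er]].
 have : `|c (f z0) 0 0 - c (f z) 0 0| < c (f z0) 0 0 / 2 by apply: hd; rewrite /ball_/= distrC.
 by rewrite ltr_norml; lra.
exists (Num.min e1 e2); first by rewrite lt_min e10.
move=> x Kx v; rewrite lt_min => /andP[v1 v2].
have v0 : 0 < v 0 0.
 have := le_lt_trans (norm_coord_le (v - c (f x)) 0) v2; have := he2 x Kx.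
 by rewrite !mxE ltr_norml; lra.
by have [|? ?] := he1 x Kx v _ v1; [exact: ltW|].
Qed.

End Perturb.

Lemma truncn_cube (x : R) N : 0 <= x <= 1 ->
 (Num.truncn (N%:R * x) < N.+1)%N /\ `|N%:R * x - (Num.truncn (N%:R * x))%:R| < 1.
Proof.
move=> /andP[x0 x1]; have h : 0 <= N%:R * x by rewrite mulr_ge0.
have /andP[h1 h2] := truncn_itv h; split.
 apply: truncn_ltn => //; apply: (@le_lt_trans _ _ N%:R); last by rewrite ltr_nat.
 by apply: ler_piMr.
by rewrite ltr_norml; lra.
Qed.

(** [g] averages the values of [F] at the nodes of a lattice of mesh [1 / N], with smooth weights
    supported near each node; dividing by the total weight [W], positive on the cube, makes them sum
    to 1. *)
Lemma smooth_approx n m (K : set 'R_n) (F : 'R_n -> 'R_m) (eta : R) :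
 compact K -> K `<=` cube n -> (forall x, K x -> {for x, continuous F}) -> 0 < eta ->
 exists U g, [/\ open U, cube n `<=` U, Cinfty U g & forall x, K x -> `|g x - F x| < eta].
Proof.
move=> cK KQ cF eta0; have eta2 : 0 < eta / 2 by rewrite divr_gt0.
have [e e0 he] : exists2 e, 0 < e & forall x, K x -> forall y, `|y - x| < e -> `|F y - F x| <= eta / 2.
 apply: (compact_small (P := fun e x => forall y, `|y - x| < e -> `|F y - F x| <= eta / 2)) => // z0 Kz0.
 have eta4 : 0 < eta / 4 by lra.
 have /nbhs_normP[d /= d0 hd] := cont_dist (cF _ Kz0) eta4.
 have d2 : 0 < d / 2 by lra.
 exists (d / 2) => // z e' zd /andP[_ e'd] y yz.
 have h1 : `|F z0 - F z| < eta / 4 by apply: hd; rewrite /ball_/= distrC; lra.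
 have h2 : `|F z0 - F y| < eta / 4.
  apply: hd; rewrite /ball_/= distrC -(subrKA z); apply: le_lt_trans (ler_normD _ _) _.
  by rewrite [ltRHS]splitr ltrD // (lt_trans yz).
 rewrite -(subrKA (F z0)); apply: le_trans (ler_normD _ _) _; rewrite [`|F y - _|]distrC; lra.
pose N := (Num.truncn e^-1).+1; have N0 : 0 < N%:R :> R by rewrite ltr0n.
have Ne : N%:R^-1 < e.
 have ei : 0 <= e^-1 by rewrite invr_ge0 ltW.
 by have /andP[_ h] := truncn_itv ei; rewrite invf_plt.
pose b (y : R) := step (1 - y) * step (1 + y).
have b0 y : 0 <= b y by have /andP[h1 _] := step01 (1 - y); have /andP[h2 _] := step01 (1 + y); rewrite mulr_ge0.
have bn y : b y != 0 -> `|y| < 1.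
 rewrite mulf_eq0 negb_or => /andP[h1 h2]; rewrite ltr_norml; apply/andP; split.
  by apply/negP => h; move: h2; rewrite step_le0 ?eqxx //; lra.
 by apply/negP => h; move: h1; rewrite step_le0 //; lra.
have bp y : `|y| < 1 -> 0 < b y by rewrite ltr_norml => /andP[h1 h2]; rewrite mulr_gt0 // step_gt0 //; lra.
pose w (k : {ffun 'I_n -> 'I_N.+1}) (x : 'R_n) := \prod_i b (N%:R * x 0 i - (k i)%:R).
pose W (x : 'R_n) := \sum_k w k x.
have w0 k x : 0 <= w k x by apply: prodr_ge0.
have kw k l : ck l setT (w k).
 have oT : open [set: 'R_n] by [].
 apply: ck_prod => // i.
 have cc : ck l setT (fun x : 'R_n => N%:R * x 0 i - (k i)%:R) by smooth.
 apply: ckM => //.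
  apply: (smooth1_step oT).
  apply: ckD => //.
  apply: (ck_ext (f := fun x => -1 * (N%:R * x 0 i - (k i)%:R)) oT); first by move=> x _; rewrite mulN1r.
  by smooth.
 by apply: (smooth1_step oT); apply: ckD .
have kW l : ck l setT W by apply: ck_sum => [|k].
have cW : continuous W by move=> x; exact: (ck_cont (kW 0%N)).
have W0 x : cube n x -> 0 < W x.
 move=> Qx; pose k : {ffun 'I_n -> 'I_N.+1} := [ffun i => inord (Num.truncn (N%:R * x 0 i))].
 rewrite /W (bigD1 k) //=; apply: ltr_pwDl; last by apply: sumr_ge0.
 apply: prodr_gt0 => i _; rewrite ffunE; have [h1 h2] := truncn_cube N (Qx i).
 by rewrite inordK //; exact: bp.
pose U : set 'R_n := [set x | 0 < W x].
have oU : open U by exact: (open_pre cW (@open_gt R 0)).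
pose node (k : {ffun 'I_n -> 'I_N.+1}) : 'R_n := \row_i ((k i)%:R / N%:R).
pose g (x : 'R_n) : 'R_m := \row_j ((W x)^-1 * \sum_k w k x * F (node k) 0 j).
exists U, g; split=> //.
 apply: Cinfty_row => // j l.
 apply: (ck_ext (f := fun x => (W x)^-1 * \sum_k w k x * F (node k) 0 j)) => //.
  by move=> x _; rewrite mxE.
 apply: ckM => //; first by apply: ckV => // [x /lt0r_neq0 //|]; exact: ck_sub (kW l).
 by apply: ck_sum => // k; apply: ckM => //; exact: ck_sub (kw k l).
move=> x Kx; have Wx := W0 x (KQ x Kx).
apply: le_lt_trans (_ : eta / 2 < _); last by rewrite //; lra.
apply: norm_row_le => [|j]; first exact: ltW.
rewrite !mxE.
have -> : F x 0 j = (W x)^-1 * \sum_k w k x * F x 0 j by rewrite -mulr_suml mulrA mulVf ?mul1r // gt_eqF.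
rewrite -mulrBr -sumrB normrM normfV (gtr0_norm Wx) mulrC ler_pdivrMr //.
apply: le_trans (ler_norm_sum _ _ _) _; rewrite mulr_sumr; apply: ler_sum => k _.
rewrite -mulrBr normrM (ger0_norm (w0 k x)) mulrC.
have [->|wn] := eqVneq (w k x) 0; first by rewrite !mulr0.
apply: ler_wpM2r => //.
apply: le_trans (_ : `|F (node k) - F x| <= _).
 by have := norm_coord_le (F (node k) - F x) j; rewrite !mxE.
apply: he => //; apply: le_lt_trans Ne; apply: norm_row_le => [|i] => //.
have /prodf_neq0/(_ i isT)/bn := wn.
rewrite !mxE => h; rewrite distrC.
have -> : x 0 i - (k i)%:R / N%:R = (N%:R * x 0 i - (k i)%:R) / N%:R by field; rewrite gt_eqF.
by rewrite normrM normfV (gtr0_norm N0) ler_piMl ?invr_ge0 ?ltW.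
Qed.

(** * Successive local perturbations *)

Section Passes.
Implicit Types (f : family) (G : set ('R_3 * M)).

(** Homotopies of families whose graphs stay in [G] and which fix the ends of all arcs. They record
    both the closeness of a perturbation to the original family and a path along which group
    elements can be compared. *)
Definition hom_in G f f' : Prop := exists F : R -> family,
 [/\ continuous (fun z : R * 'R_3 => F z.1 z.2),
   forall x, F 0 x = f x /\ F 1 x = f' x,
   forall r x, 0 <= r <= 1 -> Q x -> G (x, F r x) &
   forall r (x : 'R_3), 0 <= r <= 1 -> x 0 0 = 0 \/ x 0 0 = 1 -> F r x = f x].

Lemma hom_in_refl G f : continuous f -> (forall x, Q x -> G (x, f x)) -> hom_in G f f.
Proof.
move=> cf Gf; exists (fun _ => f); split=> //; last by move=> r x _ /Gf.
exact: (cont_o (@cont_snd _ _) cf).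
Qed.

Lemma hom_in_sub G G' f f' : G `<=` G' -> hom_in G f f' -> hom_in G' f f'.
Proof. by move=> GG [F [cF F0 FG FB]]; exists F; split=> // r x ri /(FG r x ri) /GG. Qed.

Lemma hom_in_graph G f f' : hom_in G f f' -> forall x, Q x -> G (x, f' x).
Proof. by move=> [F [_ F0 FG _]] x Qx; rewrite -(F0 x).2; apply: FG. Qed.

Lemma hom_in_trans G f f' f'' : hom_in G f f' -> hom_in G f' f'' -> hom_in G f f''.
Proof.
move=> [F1 [c1 E1 G1 B1]] [F2 [c2 E2 G2 B2]].
exists (fun r x => if r <= 2^-1 then F1 (2 * r) x else F2 (2 * r - 1) x); split.
- apply: paste_le => //.
 + by apply: (cont_o (f := fun z : R * 'R_3 => (2 * z.1, z.2)) _ c1); cont.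
 + by apply: (cont_o (f := fun z : R * 'R_3 => (2 * z.1 - 1, z.2)) _ c2); cont.
 by move=> z ->; rewrite mulfV // subrr (E1 _).2 (E2 _).1.
- move=> x; rewrite invr_ge0 ler0n mulr0 (E1 x).1; split=> //.
 have -> : (1 <= 2^-1 :> R) = false by lra.
 by rewrite mulr1 (_ : 2 - 1 = 1) ?(E2 x).2 //; lra.
- move=> r x /andP[r0 r1] Qx; case: ifP => h; [apply: G1|apply: G2] => //; lra.
move=> r x /andP[r0 r1] xb; case: ifP => h; first by apply: B1 => //; lra.
rewrite B2 //; last lra.
by rewrite -(E1 x).2 B1 //.
Qed.

(** Local perturbations are performed one after the other over finitely many sets covering [K]. The
    set [A] and the neighbourhood [G0] of the graph are found from [f1] alone, while the
    perturbation has to be available for every [f] with graph in [G0]: the intermediate maps stay in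
    all the sets [G0], so that each pass still applies after the earlier ones. *)
Lemma pass_induction (Inv : family -> Prop) (Step : set 'R_3 -> family -> family -> Prop)
  f1 (K : set 'R_3) : compact K ->
 (forall f, Inv f -> continuous f) ->
 (forall f, Step set0 f f) ->
 (forall A B f f', A `<=` B -> Step B f f' -> Step A f f') ->
 (forall A B f f' f'', Step A f f' -> Step B f' f'' -> Step (A `|` B) f f'') ->
 (forall x0, K x0 -> exists2 A, nbhs x0 A & exists G0, [/\ open G0,
   (forall x, Q x -> G0 (x, f1 x)) & forall f G, Inv f -> open G ->
    (forall x, Q x -> G0 (x, f x) /\ G (x, f x)) ->
    exists f', [/\ Inv f', Step A f f' & hom_in (G0 `&` G) f f']]) ->
 forall G, Inv f1 -> open G -> (forall x, Q x -> G (x, f1 x)) ->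
 exists f', [/\ Inv f', Step K f1 f' & hom_in G f1 f'].
Proof.
move=> cK Ic S0 Ssub Scat loc G If1 oG Gf1.
pose P A := exists G0, [/\ open G0, (forall x, Q x -> G0 (x, f1 x)) & forall f G, Inv f ->
 open G -> (forall x, Q x -> G0 (x, f x) /\ G (x, f x)) ->
 exists f', [/\ Inv f', Step A f f' & hom_in (G0 `&` G) f f']].
have : P K.
 apply: compact_ind => //.
 - exists setT; split=> //.
  move=> f G' If oG' Gf; exists f; split=> //; apply: hom_in_refl; first exact: Ic.
  by [].
 - move=> A B AB [G0 [oG0 G0f h]]; exists G0; split=> // f G' If oG' Gf.
  have [f' [If' Sf' Hf']] := h f G' If oG' Gf; exists f'; split=> //; exact: Ssub Sf'.
 move=> A B [G1 [oG1 G1f h1]] [G2 [oG2 G2f h2]]; exists (G1 `&` G2); split.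
 - exact: openI.
 - by split; [exact: G1f|exact: G2f].
 move=> f G' If oG' Gf.
 have [||f' [If' Sf' Hf']] := h1 f (G2 `&` G') If; first exact: openI.
  by move=> x /Gf[[]].
 have [||f'' [If'' Sf'' Hf'']] := h2 f' (G1 `&` G') If'; first exact: openI.
  by move=> x Qx; have [g1 [g2 g']] := hom_in_graph Hf' Qx.
 exists f''; split=> //; first exact: Scat Sf' Sf''.
 apply: (@hom_in_trans _ _ f').
  by apply: hom_in_sub Hf' => x [g1 [g2 g']].
 by apply: hom_in_sub Hf'' => x [g1 [g2 g']].
move=> [G0 [oG0 G0f h]].
have [|f' [If' Sf' Hf']] := h f1 G If1 oG; first by move=> x Qx; split; [exact: G0f|exact: Gf1].
by exists f'; split=> //; apply: hom_in_sub Hf' => x [].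
Qed.

End Passes.

Lemma cont_scale T (W : normedModType R)
  (a : T -> R) (f : T -> W) z :
 {for z, continuous a} -> {for z, continuous f} -> {for z, continuous (fun x => a x *: f x)}.
Proof. by move=> ca cf; exact: (cvgZ ca cf). Qed.

(** * Smoothing a family and moving it off the boundary *)

Section SmoothPasses.
Implicit Types (f : family) (G : set ('R_3 * M)) (c : chart R M).

Lemma nbhs_norm_lt (V : normedModType R) (x0 : V) (r : R) : 0 < r -> nbhs x0 [set x | `|x - x0| < r].
Proof.
move=> r0; suff [d d0 hd] : exists2 d, 0 < d & forall w, `|w - x0| < d -> `|w - x0| < r.
 by apply/nbhs_normP; exists d => // w; rewrite /ball_/= distrC; exact: hd.
by exists r.
Qed.

Definition cball n (x0 : 'R_n) (r : R) : set 'R_n := [set x | `|x - x0| <= r].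

Lemma cball_closed n (x0 : 'R_n) r : closed (cball x0 r).
Proof.
have -> : cball x0 r = ~` [set x | r < `|x - x0|] by apply/seteqP; split=> x /=; rewrite /cball /= leNgt => /negP.
apply: open_closedC; apply: open_normP => z /= hz.
exists (`|z - x0| - r); first by rewrite subr_gt0.
move=> w hw; have := ler_distD w z x0; rewrite [`|z - w|]distrC; lra.
Qed.

Lemma cball_compact n (x0 : 'R_n.+1) r : compact (cball x0 r).
Proof.
apply: bounded_closed_compact; last exact: cball_closed.
exists (`|x0| + r); split; first exact: num_real.
move=> N hN x hx; apply: ltW; apply: le_lt_trans hN; rewrite -(subrK x0 x) addrC.
by apply: le_trans (ler_normD _ _) _; rewrite lerD2l.
Qed.

Lemma norm_ball_open (V : normedModType R) (x0 : V) r : open [set x | `|x - x0| < r].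
Proof.
apply: open_normP => z /= hz; exists (r - `|z - x0|); first by rewrite subr_gt0.
by move=> w hw; have := ler_distD z w x0; lra.
Qed.

Definition coreo n (e : R) : set 'R_n := [set x | forall i, e < x 0 i < 1 - e].
Definition core n (e : R) : set 'R_n := [set x | forall i, e <= x 0 i <= 1 - e].

Lemma core_itv n e (x : 'R_n.+1) : core e x <-> cball (const_mx 2^-1) (2^-1 - e) x.
Proof.
split=> [h|h i].
 have h0 : 0 <= 2^-1 - e by have := h 0; lra.
 by apply: norm_row_le => // i; rewrite !mxE ler_norml; have := h i; lra.
by have := le_trans (norm_coord_le _ i) h; rewrite !mxE ler_norml; lra.
Qed.

Lemma core_compact n e : compact (@core n.+1 e).
Proof.
rewrite (_ : @core n.+1 e = cball (const_mx 2^-1) (2^-1 - e)); first exact: cball_compact.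
by apply/seteqP; split=> x /core_itv.
Qed.

Lemma cube_compact n : compact (@cube R n.+1).
Proof.
rewrite (_ : @cube R n.+1 = @core n.+1 0); first exact: core_compact.
by apply/seteqP; split=> x h i; have := h i; rewrite subr0.
Qed.

Lemma coreo_open n e : open (@coreo n e).
Proof.
rewrite openE => x hx; suff : nbhs x (@coreo n e) by [].
apply: (@near_forall 'R_n 'I_n (fun i y => e < y 0 i < 1 - e)) => i.
apply: (@near_coord _ x i [set a | e < a < 1 - e]); last exact: hx.
rewrite (_ : [set a | _] = [set a | e < a] `&` [set a | a < 1 - e]).
 by apply: openI.
by apply/seteqP; split=> a /= => [/andP[]|[-> ->]].
Qed.

Lemma coreo_cube n e (x : 'R_n) : 0 <= e -> coreo e x -> cube n x.
Proof. by move=> e0 h i; have := h i; lra. Qed.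

Lemma core_coreo n e e' (x : 'R_n) : e < e' -> core e' x -> coreo e x.
Proof. by move=> ee h i; have := h i; lra. Qed.

Lemma coreo_nbhs e (x : 'R_3) : 0 <= e -> coreo e x -> nbhs x Q.
Proof.
move=> e0 h; apply: filterS (_ : nbhs x (@coreo 3 e)).
 by move=> y; exact: coreo_cube.
by exact: coreo_open.
Qed.

Lemma open_cball n (O : set 'R_n) x0 : open O -> O x0 ->
 exists2 r, 0 < r & cball x0 (2 * r) `<=` O.
Proof.
move=> oO Ox; have nO : nbhs x0 O by exact: open_nbhs_nbhs.
move: nO => /nbhs_normP[d /= d0 hd].
exists (d / 4); first by rewrite divr_gt0.
by move=> x hx; apply: hd; rewrite /ball_/= distrC; move: hx; rewrite /cball /=; lra.
Qed.

Lemma open_imp (V : normedModType R) (K : set V) (D : set M) : closed K -> open D ->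
 open [set z : V * M | K z.1 -> D z.2].
Proof.
move=> cK oD; rewrite (_ : [set z | _] = [set z : V * M | ~ K z.1] `|` [set z | D z.2]).
 apply: openU.
  by exact: (open_pre (@cont_fst V M) (closed_openC cK)).
 by exact: (open_pre (@cont_snd V M) oD).
apply/seteqP; split=> [[x m] /= h|[x m] /= [nK|]] //=.
by have [/h Dm|nK] := pselect (K x); [right|left].
Qed.

Definition smooth_at f x := exists c J, mdiff f Q x c J.

Definition immersed_at f x := exists c J, mdiff f Q x c J /\ row 0 J != 0.

Lemma Ck_local n m k (O : set 'R_n) (g : 'R_n -> 'R_m) :
 (forall x, O x -> exists2 U, U x & Ck k U g) -> Ck k O g.
Proof.
elim: k g => [|k IH] g h.
 by split=> // x /h[U Ux [c _]]; exact: c.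
split=> [x /h[U Ux [c _]]|v]; first exact: c.
split=> [x /h[U Ux [_ /(_ v)[d _]]]|]; first exact: d.
by apply: IH => x /h[U Ux [_ /(_ v)[_ kU]]]; exists U.
Qed.

Lemma mdiff_chart f x c c' J : Q x -> mdiff f Q x c J -> atlas c' -> dom c' (f x) ->
 exists2 T, 0 < \det T & mdiff f Q x c' (J *m T).
Proof.
move=> Qx dm ac' cx'; have [ac _ _] := dm.
have [T T0 hT] := chart_change ac ac' (mdiff_dom Qx dm) cx'.
by exists T => //; exact: hT dm.
Qed.

Lemma immersed_chart f x c J : Q x -> mdiff f Q x c J -> immersed_at f x <-> row 0 J != 0.
Proof.
move=> Qx dm; split=> [[c' [J' [dm' J'0]]]|]; last by exists c, J.
have [ac _ _] := dm; have [T T0 dT] := mdiff_chart Qx dm' ac (mdiff_dom Qx dm).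
have uT : T \in unitmx by rewrite unitmxE unitfE gt_eqF.
rewrite (cube_mdiff_uniq Qx dm dT) row_mul; apply: contra J'0 => /eqP h.
by rewrite -[row 0 J'](mulmxK uT) h mul0mx.
Qed.

Lemma mdiff_open f x c (U : set 'R_3) : atlas c -> open U -> U x ->
 (forall y, U y -> dom c (f y)) -> Cinfty U (fun y => c (f y)) ->
 mdiff f Q x c (jac (fun y => c (f y)) x).
Proof.
move=> ac oU Ux dU sU; split=> //.
 by apply: filterS (open_near oU Ux dU) => y h _.
by exists U, (fun y => c (f y)); split=> // v; rewrite (derive_jac v oU (sU 1%N) Ux).
Qed.

Lemma smooth_chart f c (O : set 'R_3) : continuous f -> open O -> O `<=` Q ->
 (forall x, O x -> smooth_at f x) -> atlas c -> (forall x, O x -> dom c (f x)) ->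
 Cinfty O (fun y => c (f y)).
Proof.
move=> cf oO OQ sO ac cO k; apply: Ck_local => x Ox.
have [c' [J dm]] := sO x Ox; have Qx := OQ x Ox.
have [T _ [_ _ dT]] := mdiff_chart Qx dm ac (cO x Ox).
have nQ : nbhs x Q by apply: filterS OQ _; exact: open_nbhs_nbhs.
have [U [[oU Ux] sU _]] := diff_on_nbhs nQ dT.
by exists U.
Qed.

Record off (f1 f : family) (e : R) : Prop := Off {
 off_cont : continuous f;
 off_eq : forall x, ~ coreo e x -> f x = f1 x }.

(** The state kept by all perturbations that follow the smoothing. Inside the core the boundary of
    [M] is avoided, so that chart displacements are free in all directions. *)
Definition smooth_off f1 e f := [/\ off f1 f e, forall x, Q x -> smooth_at f x &
 forall x, coreo e x -> ~ boundary (f x)].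

Lemma cube_closed n : closed (@cube R n.+1).
Proof. by apply: compact_closed; [exact: norm_hausdorff|exact: cube_compact]. Qed.

Lemma chart_dom_open f c : continuous f -> atlas c -> open [set x | dom c (f x)].
Proof. by move=> cf ac; exact: (open_pre cf (chart_open ac)). Qed.

Lemma hom_in_pert f c (K : set 'R_3) h G : atlas c -> continuous f -> continuous h ->
 closed K -> (forall x, ~ K x -> h x = 0) -> (forall x, K x -> ~ (x 0 0 = 0 \/ x 0 0 = 1)) ->
 (forall x, K x -> dom c (f x)) -> (forall x, Q x -> G (x, f x)) ->
 (forall x (r : R), K x -> 0 <= r <= 1 -> (c @` dom c) (c (f x) + r *: h x) /\
   G (x, chart_inv c (c (f x) + r *: h x))) ->
 continuous (pert c f h) /\ hom_in G f (pert c f h).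
Proof.
move=> ac cf ch cK h0 Kb Kc Gf hr.
have ri : 0 <= (1 : R) <= 1 by [].
split.
 apply: (@pert_continuous _ _ f h K) => // x Kx.
 by have [] := hr x 1 Kx ri; rewrite scale1r.
exists (fun r x => pert c f (fun y => clamp r *: h y) x); split.
- have clK : closed [set z : R * 'R_3 | K z.2].
  by move/closed_comp: cK => /(_ _ (@snd R 'R_3)); apply=> z _; exact: cont_snd.
 apply: (@pert_continuous _ c (f \o snd) (fun z : R * 'R_3 => clamp z.1 *: h z.2)
  [set z | K z.2]) => //.
 + exact: (cont_o (@cont_snd _ _) cf).
 + by cont.
 + by move=> z /h0 ->; rewrite scaler0.
 + by move=> z /Kc.
 by move=> z Kz; have [] := hr z.2 (clamp z.1) Kz (clamp_itv _).
- move=> x; rewrite clamp_le0 // clamp_ge1 //; split; first by rewrite pert0 // scale0r.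
 by congr (pert c f _ x); apply/funext => y; rewrite scale1r.
- move=> r x r01 Qx; rewrite clamp_id //.
 have [Kx|/h0 hx] := pselect (K x); last by rewrite pert0 ?hx ?scaler0 //; exact: Gf.
 have [_ g] := hr x r Kx r01; rewrite /pert; case: asboolP => // nc.
 by case: nc; exact: Kc.
move=> r x r01 xb; have [Kx|/h0 hx] := pselect (K x); first by case: (Kb x Kx).
by rewrite pert0 // hx scaler0.
Qed.

(** A pass gains the two properties on [A] and loses them nowhere. *)
Definition smooth_step (A : set 'R_3) f f' :=
 forall x, Q x -> (A x \/ smooth_at f x -> smooth_at f' x) /\
  (A x \/ ~ boundary (f x) -> ~ boundary (f' x)).

Lemma core_ends e (x : 'R_3) : 0 <= e -> coreo e x -> ~ (x 0 0 = 0 \/ x 0 0 = 1).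
Proof. by move=> e0 /(_ 0) h [E|E]; lra. Qed.

Lemma chart_core_open e f c : continuous f -> atlas c ->
 open (@coreo 3 e `&` [set x | dom c (f x)]).
Proof. by move=> cf ac; apply: openI; [exact: coreo_open|exact: chart_dom_open]. Qed.

Lemma bump_box (r : R) (x0 : 'R_3) : 0 < r -> exists phi : 'R_3 -> R,
 [/\ forall k, ck k setT phi, forall x, 0 <= phi x <= 1,
   forall x, `|x - x0| < r -> phi x = 1, forall x, phi x != 0 -> `|x - x0| < 2 * r &
   forall x, ~ cball x0 (2 * r) x -> phi x = 0].
Proof.
move=> r0; have [phi [kphi phi01 phi1 phi0]] := bump_ex x0 r0.
exists phi; split=> // x nK; apply/eqP; apply/negP => /negP/phi0 h; apply: nK; exact: ltW.
Qed.

Lemma smooth_local e f1 x0 : 0 < e -> continuous f1 -> coreo e x0 ->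
 exists2 A, nbhs x0 A & exists G0, [/\ open G0, (forall x, Q x -> G0 (x, f1 x)) &
  forall f G, off f1 f e -> open G -> (forall x, Q x -> G0 (x, f x) /\ G (x, f x)) ->
  exists f', [/\ off f1 f' e, smooth_step A f f' & hom_in (G0 `&` G) f f']].
Proof.
move=> e0 cf1 xe; have [c ac cx0] := atlas_cover (f1 x0).
have [r r0 KO] := open_cball (chart_core_open cf1 ac) (conj xe cx0).
pose K := cball x0 (2 * r).
have Ke x : K x -> coreo e x by move=> /KO[].
have KQ x : K x -> Q x by move=> /Ke; apply: coreo_cube; exact: ltW.
have cK : compact K by exact: cball_compact.
have clK : closed K by exact: cball_closed.
have [phi [kphi phi01 phi1 phi0 phiK]] := bump_box x0 r0.
exists [set x | `|x - x0| < r]; first exact: nbhs_norm_lt.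
exists [set z | K z.1 -> dom c z.2]; split.
- by apply: open_imp => //; exact: chart_open.
- by move=> x _ /= /KO[].
move=> f G [cf ff1] oG Gf.
have Kc x : K x -> dom c (f x) by move=> Kx; apply: (Gf x (KQ x Kx)).1.
have oG' : open ([set z | K z.1 -> dom c z.2] `&` G) by apply: openI => //; apply: open_imp => //; exact: chart_open.
have [e1 e10 he1] := chart_room cK cf ac Kc oG' (fun x Kx => Gf x (KQ x Kx)).
pose eta := e1 / 3; have eta0 : 0 < eta by rewrite divr_gt0.
have ccf x : dom c (f x) -> {for x, continuous (fun y => c (f y))} := chart_comp_cont (cf x) ac.
have [U [g [oU QU sg gK]]] := smooth_approx cK KQ (fun x Kx => ccf x (Kc x Kx)) eta0.
(* The approximation is moved by [eta] into the open half-space, being [eta]-close to a point with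
   nonnegative first coordinate. The same displacement takes the arcs off the boundary, and the
   total change stays below [2 * eta < e1]. *)
pose g' x := g x + eta *: 'e_0.
have g'0 x : K x -> 0 < g' x 0 0.
 move=> Kx; have := le_lt_trans (norm_coord_le _ 0) (gK x Kx).
 have := chart_half ac (Kc x Kx); rewrite !mxE mulr1 ltr_norml; lra.
have sg' : Cinfty U g'.
 apply: Cinfty_row => // j k; apply: (ck_ext (f := fun x => g x 0 j + (eta *: 'e_0 : 'R_4) 0 j)) => //.
  by move=> x _; rewrite [in RHS]mxE.
 by apply: ckD => //; exact: (Ck_coordP _ _ oU).1.
pose h x := phi x *: (g' x - c (f x)).
have hK x : ~ K x -> h x = 0 by move=> /phiK hx; rewrite /h hx scale0r.
have cphi : continuous phi by move=> x; exact: ck_cont (kphi 0%N) _.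
have ch : continuous h.
 move=> x; have [Kx|nK] := pselect (K x).
  have cg : {for x, continuous g'} by apply: Cinfty_cont sg' _; apply: QU; exact: KQ.
  apply: (@cont_scale _ _ phi (fun y => g' y - c (f y))); first exact: cphi.
  exact: (@continuousB R _ _ g' (fun y => c (f y)) x cg (ccf x (Kc x Kx))).
 apply: (near_eq_cont (f := fun _ => 0)); last exact: cst_continuous.
 by apply: (open_near (closed_openC clK) nK) => y /hK ->.
have hv x s : K x -> 0 <= s <= 1 -> half_space (c (f x) + s *: h x) /\ `|c (f x) + s *: h x - c (f x)| < e1.
 move=> Kx /andP[s0 s1]; have /andP[p0 p1] := phi01 x; split.
  rewrite /half_space /= !mxE; have := g'0 x Kx; have := chart_half ac (Kc x Kx).
  rewrite !mxE; set a := c _ 0 0; set b := g x 0 0 + _ => a0 b0.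
  have -> : a + s * (phi x * (b - a)) = (1 - s * phi x) * a + s * phi x * b by ring.
  have sp : s * phi x <= 1 by rewrite mulr_ile1.
  by apply: addr_ge0; apply: mulr_ge0; rewrite ?subr_ge0 ?mulr_ge0 // ltW.
 rewrite addrAC subrr add0r scalerA normrZ ger0_norm ?mulr_ge0 //.
 apply: le_lt_trans (_ : `|g' x - c (f x)| < _).
  by rewrite ler_piMl // mulr_ile1.
 rewrite addrAC; apply: le_lt_trans (ler_normD _ _) _.
 have : `|eta *: ('e_0 : 'R_4)| <= eta.
  rewrite normrZ gtr0_norm //; apply: ler_piMr; [exact: ltW|apply: norm_row_le => // j].
  by rewrite mxE; case: (_ && _); rewrite ?normr1 ?normr0.
 have := gK x Kx; rewrite /eta; lra.
have hr x s : K x -> 0 <= s <= 1 -> (c @` dom c) (c (f x) + s *: h x) /\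
  ([set z | K z.1 -> dom c z.2] `&` G) (x, chart_inv c (c (f x) + s *: h x)).
 by move=> Kx /(hv x s Kx)[]; exact: he1.
have Kb x : K x -> ~ (x 0 0 = 0 \/ x 0 0 = 1) by move=> /Ke; apply: core_ends; exact: ltW.
have [cf' Hf'] := hom_in_pert ac cf ch clK hK Kb Kc (fun x Qx => Gf x Qx) hr.
have K1 x : K x -> (c @` dom c) (c (f x) + h x) by move=> Kx; have [] := hr x 1 Kx; rewrite ?scale1r //.
have f'E x : phi x = 0 -> pert c f h x = f x by move=> p0; rewrite pert0 // /h p0 scale0r.
exists (pert c f h); split=> //.
 split=> // x nx; rewrite f'E ?ff1 // phiK // => /Ke; exact: nx.
move=> x Qx; split=> [hx|hx]; last first.
 have [p0|pn] := eqVneq (phi x) 0.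
  rewrite f'E //; case: hx => // /phi1 p1.
  by move: (oner_neq0 R); rewrite -p1 p0 eqxx.
 have Kx : K x by apply: contrapT => /phiK; exact/eqP.
 have [cd cE] := pertE ac (Kc x Kx) (K1 x Kx).
 move=> /(boundary_chart ac cd); rewrite cE /h !mxE.
 have := g'0 x Kx; have := chart_half ac (Kc x Kx); rewrite !mxE.
 set a := c _ 0 0; set b := g x 0 0 + _ => a0 b0.
 have /andP[p0 p1] := phi01 x.
 have -> : a + phi x * (b - a) = (1 - phi x) * a + phi x * b by ring.
 apply/eqP; rewrite gt_eqF //; apply: ltr_wpDl; first by rewrite mulr_ge0 ?subr_ge0.
 by rewrite mulr_gt0 // lt_neqAle eq_sym pn.
have [Kx|nKx] := pselect (K x); last first.
 case: hx => [hx|[c' [J dm]]]; first by case: nKx; rewrite /K /cball /=; move: hx => /=; lra.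
 exists c', J; apply: mdiff_eq dm; apply: filterS (open_near (closed_openC clK) nKx (P := fun y => f y = pert c f h y) _).
  by [].
 by move=> y /phiK p0; rewrite f'E.
have [W [oW Wx sW]] : exists W, [/\ open W, W x & Cinfty W (fun y => c (f y) + h y)].
 case: hx => [hx|sx].
  exists (U `&` [set y | `|y - x0| < r]).
  have oUB : open (U `&` [set y | `|y - x0| < r]) by apply: openI => //; exact: norm_ball_open.
  split=> //; first by split=> //; exact: QU.
  apply: (Cinfty_ext oUB); last by apply: Cinfty_sub sg' => // y [].
  by move=> y [_ hy]; rewrite /h phi1 // scale1r addrC subrK.
 have [c' [J dm]] := sx; have [T _ [_ _ dT]] := mdiff_chart Qx dm ac (Kc x Kx).
 have nQ : nbhs x Q by apply: (coreo_nbhs (ltW e0)); exact: Ke.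
 have [V [[oV Vx] sV _]] := diff_on_nbhs nQ dT.
 have oVU : open (V `&` U) by exact: openI.
 exists (V `&` U); split=> //; first by split=> //; exact: QU.
 apply: Cinfty_row => // j k.
 have kc : ck k (V `&` U) (fun y => c (f y) 0 j).
  by apply: ck_sub (_ : V `&` U `<=` V) _ => [y []//|]; exact: (Ck_coordP _ _ oV).1.
 have kg' : ck k (V `&` U) (fun y => g' y 0 j).
  by apply: ck_sub (_ : V `&` U `<=` U) _ => [y []//|]; exact: (Ck_coordP _ _ oU).1.
 have kp : ck k (V `&` U) phi by exact: ck_sub (kphi k).
 apply: (ck_ext (f := fun y => c (f y) 0 j + phi y * (g' y 0 j + -1 * c (f y) 0 j))) => //.
  by move=> y _; rewrite !mxE mulN1r.
 by smooth.
have oW' : open (W `&` [set x | dom c (f x)]) by apply: openI => //; exact: chart_dom_open.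
have H y : (W `&` [set x | dom c (f x)]) y -> dom c (pert c f h y) /\
  c (pert c f h y) = c (f y) + h y.
 move=> [_ cy]; apply: pertE => //.
 by have [/K1//|/hK ->] := pselect (K y); rewrite addr0.
exists c, (jac (fun y => c (pert c f h y)) x).
apply: (mdiff_open (U := W `&` [set x | dom c (f x)])) => //.
- by split=> //; exact: Kc.
- by move=> y /H[].
apply: (Cinfty_ext oW') => [y /H[_ ->] //|].
by apply: Cinfty_sub sW => // y [].
Qed.

Lemma smoothing e e' f1 G : 0 < e -> e < e' -> continuous f1 ->
 (forall x, Q x -> ~ coreo e' x -> smooth_at f1 x) ->
 (forall x, Q x -> boundary (f1 x) -> ~ coreo e' x -> x 0 0 = 0 \/ x 0 0 = 1) ->
 open G -> (forall x, Q x -> G (x, f1 x)) ->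
 exists f, smooth_off f1 e f /\ hom_in G f1 f.
Proof.
move=> e0 ee cf1 sf1 bf1 oG Gf1.
have [||||||f [ofj sf Hf]] := @pass_induction (fun f => off f1 f e) smooth_step f1
 (core e') (@core_compact 2 e') _ _ _ _ _ G _ oG Gf1.
- by move=> f [].
- by split=> -[].
- move=> A B f f' AB h x Qx; have [h1 h2] := h x Qx.
 by split=> -[/AB Bx|?]; [apply: h1; left|apply: h1; right|apply: h2; left|apply: h2; right].
- move=> A B f f' f'' h h' x Qx; have [h1 h2] := h x Qx; have [h1' h2'] := h' x Qx.
 split=> -[[Ax|Bx]|fx]; [apply: h1'|apply: h1'|apply: h1'|apply: h2'|apply: h2'|apply: h2']; try by left.
 + by right; apply: h1; left.
 + by right; apply: h1; right.
 + by right; apply: h2; left.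
 by right; apply: h2; right.
- by move=> x0 /(core_coreo ee); exact: smooth_local.
- by split.
exists f; split=> //; split=> // x.
 move=> Qx; have [h _] := sf x Qx; apply: h.
 have [Ax|nA] := pselect (core e' x); first by left.
 by right; apply: sf1 => // h; apply: nA => i; have := h i; lra.
move=> xe; have Qx : Q x := coreo_cube (ltW e0) xe.
have [_ h] := sf x Qx; apply: h.
have [Ax|nA] := pselect (core e' x); first by left.
right=> /bf1 b; apply: (core_ends (ltW e0) xe); apply: b => // h.
by apply: nA => i; have := h i; lra.
Qed.

End SmoothPasses.

(** * Making the arcs immersed *)

Section BumpPerturbation.
Implicit Types (f : family) (G : set ('R_3 * M)) (c : chart R M).

Definition grad n (psi : 'R_n -> R) x : 'cV[R]_n := \col_i 'D_('e_i) psi x.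

Lemma jac_scale n m (psi : 'R_n -> R) (l : 'R_m) x :
 (forall v, derivable psi x v) -> jac (fun y => psi y *: l) x = grad psi x *m l.
Proof.
move=> dp; apply/matrixP => i j; rewrite !mxE big_ord1 !mxE.
have -> : (fun y => (psi y *: l) 0 j) = (fun y => l 0 j * psi y) by apply/funext => y; rewrite mxE mulrC.
by rewrite (deriveZ (l 0 j) (dp 'e_i)) mulrC.
Qed.

Lemma Cinfty_scale n m (psi : 'R_n -> R) (l : 'R_m) :
 (forall k, ck k setT psi) -> Cinfty setT (fun y => psi y *: l).
Proof.
move=> kp; apply: Cinfty_row => [|j k] => //.
apply: (ck_ext openT) => [y _|]; first by rewrite mxE.
by smooth.
Qed.

(* the effect of adding [psi *: l] in the chart [c], for small [l] *)
Record bumped (e : R) c (K : set 'R_3) (psi : 'R_3 -> R) f1 f (l : 'R_4) f' : Prop := Bumped {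
 bump_off : smooth_off f1 e f';
 bump_dom : forall x, K x -> dom c (f' x);
 bump_val : forall x, K x -> c (f' x) = c (f x) + psi x *: l;
 bump_out : forall x, psi x = 0 -> f' x = f x;
 bump_mdiff : forall x J, K x -> mdiff f Q x c J -> mdiff f' Q x c (J + grad psi x *m l);
 bump_mdiff_out : forall x d J, ~ K x -> mdiff f Q x d J -> mdiff f' Q x d J }.

Lemma bump_perturb e c (K : set 'R_3) psi f1 f G : 0 < e -> atlas c -> compact K ->
 (forall x, K x -> coreo e x) -> (forall k, ck k setT psi) -> (forall x, ~ K x -> psi x = 0) ->
 (forall x, K x -> `|psi x| <= 1) -> smooth_off f1 e f ->
 (forall x, K x -> dom c (f x)) -> open G -> (forall x, Q x -> G (x, f x)) ->
 exists2 e1, 0 < e1 & forall l, `|l| < e1 -> exists f', bumped e c K psi f1 f l f' /\ hom_in G f f'.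
Proof.
move=> e0 ac cK Ke kpsi psi0 psi1 [[cf ff1] sf bf] Kc oG Gf.
have KQ x : K x -> Q x by move=> /Ke; apply: coreo_cube; exact: ltW.
have clK : closed K by apply: compact_closed.
have [e1 e10 he1] := chart_room_int cK cf ac Kc (fun x Kx => bf x (Ke x Kx)) oG (fun x Kx => Gf x (KQ x Kx)).
exists e1 => // l le; pose h x := psi x *: l; pose f' := pert c f h.
have sh : Cinfty setT h by exact: Cinfty_scale.
have hK x : ~ K x -> h x = 0 by move=> /psi0 E; rewrite /h E scale0r.
have ch : continuous h by move=> x; exact: Cinfty_cont sh I.
have hv x s : K x -> 0 <= s <= 1 -> `|c (f x) + s *: h x - c (f x)| < e1.
 move=> Kx /andP[s0 s1]; rewrite addrAC subrr add0r /h scalerA normrZ normrM ger0_norm //.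
 apply: le_lt_trans le; apply: ler_piMl => //; apply: mulr_ile1 => //; exact: psi1.
have Kb x : K x -> ~ (x 0 0 = 0 \/ x 0 0 = 1) by move=> /Ke; apply: core_ends; exact: ltW.
have hr x s : K x -> 0 <= s <= 1 -> (c @` dom c) (c (f x) + s *: h x) /\
  G (x, chart_inv c (c (f x) + s *: h x)).
 by move=> Kx si; have [] := he1 x Kx _ (hv x s Kx si).
have [cf' Hf'] := hom_in_pert ac cf ch clK hK Kb Kc Gf hr.
exists f'; split=> //.
have i1 : 0 <= (1 : R) <= 1 by [].
have K1 x : K x -> (c @` dom c) (c (f x) + h x) by move=> Kx; have [] := hr x 1 Kx i1; rewrite scale1r.
have KE x : K x -> dom c (f' x) /\ c (f' x) = c (f x) + h x by move=> Kx; apply: pertE => //; [exact: Kc|exact: K1].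
have out x : psi x = 0 -> f' x = f x by move=> p0; rewrite /f' pert0 // /h p0 scale0r.
have md x J : K x -> mdiff f Q x c J -> mdiff f' Q x c (J + grad psi x *m l).
 move=> Kx dm; rewrite -jac_scale.
  apply: (mdiff_pert (KQ x Kx) openT I sh dm).
  have nc : nbhs x (fun y => dom c (f y)) by apply: (cf x); apply: chart_nbhs => //; exact: Kc.
  apply: filterS nc => y cy _.
  by have [/K1//|/hK ->] := pselect (K y); rewrite addr0.
 by move=> v; have [_ /(_ v)[d _]] := kpsi 1%N; apply: d.
have mo x d J : ~ K x -> mdiff f Q x d J -> mdiff f' Q x d J.
 move=> nK dm; apply: mdiff_eq dm.
 have h1 := open_near (closed_openC clK) nK (fun y nKy => esym (out y (psi0 y nKy))).
 by apply: filterS h1 => y E _.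
split=> //.
- split.
 + split=> // x nx; rewrite out ?ff1 // psi0 // => /Ke; exact: nx.
 + move=> x Qx; have [c' [J dm]] := sf x Qx.
  have [Kx|nK] := pselect (K x); last by exists c', J; exact: mo.
  have [T _ dT] := mdiff_chart Qx dm ac (Kc x Kx).
  by exists c, (J *m T + grad psi x *m l); exact: md.
 move=> x xe; have [Kx|nK] := pselect (K x); last by rewrite out ?psi0 //; exact: bf.
 have [cd cE] := KE x Kx; move=> /(boundary_chart ac cd); rewrite cE.
 have [_ + _] := he1 x Kx _ (hv x 1 Kx i1); rewrite scale1r => h1 h2.
 by rewrite h2 ltxx in h1.
- by move=> x /KE[].
by move=> x /KE[].
Qed.

Definition proj4 (i j k : 'I_4) (z : 'R_4) : 'R_3 := vec3 (z 0 i) (z 0 j) (z 0 k).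

Lemma Cinfty_proj4 i j k U : open U -> Cinfty U (proj4 i j k).
Proof. by move=> oU; exact: Cinfty_vec3. Qed.

Lemma cont_proj4 i j k : continuous (proj4 i j k).
Proof. by move=> z; apply: (Cinfty_cont (U := setT)) => //; apply: Cinfty_proj4. Qed.

Lemma jac_row0 n m (g : 'R_n -> 'R_m) (U : set 'R_n) z i : open U -> U z ->
 (forall y s, U y -> g (y + s *: 'e_i) = g y) -> row i (jac g z) = 0.
Proof.
move=> oU Uz h; apply/rowP => j; rewrite !mxE; apply: derive_affine => s.
by rewrite [s *: _ + z]addrC h // subrr scaler0.
Qed.

Lemma det_row0 n (A : 'M[R]_n) i : row i A = 0 -> \det A = 0.
Proof.
move=> h; rewrite (expand_det_row A i) big1 // => j _.
by have /rowP/(_ j) := h; rewrite !mxE => ->; rewrite mul0r.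
Qed.

Lemma smooth_core e f1 f c : 0 <= e -> smooth_off f1 e f -> atlas c ->
 Cinfty (@coreo 3 0 `&` [set x | dom c (f x)]) (fun y => c (f y)).
Proof.
move=> e0 [[cf _] sf _] ac; apply: smooth_chart => //.
- exact: chart_core_open.
- by move=> x [/coreo_cube h _]; exact: h.
- by move=> x [/coreo_cube h _]; apply: sf; exact: h.
by move=> x [].
Qed.

Lemma coreo_sub n (e e' : R) (x : 'R_n) : e <= e' -> coreo e' x -> coreo e x.
Proof. by move=> ee h i; have := h i; lra. Qed.

Lemma mdiff_core e f1 f c x : 0 <= e -> smooth_off f1 e f -> atlas c -> coreo 0 x ->
 dom c (f x) -> mdiff f Q x c (jac (fun y => c (f y)) x).
Proof.
move=> e0 sf ac x0 cx; have [[cf _] _ _] := sf.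
apply: (mdiff_open (U := @coreo 3 0 `&` [set x | dom c (f x)])) => //.
- exact: chart_core_open.
- by move=> y [].
exact: smooth_core sf ac.
Qed.

Lemma row0_bump (F : 'R_3 -> 'R_4) (phi : 'R_3 -> R) (l : 'R_4) O x : open O -> Ck 1 O F -> O x ->
 row 0 (jac F x + grad phi x *m l) = 'D_('e_0) F x + 'D_('e_0) phi x *: l.
Proof.
move=> oO kF Ox; rewrite linearD /= row_mul (derive_jac 'e_0 oO kF Ox) -rowE; congr (_ + _).
by apply/rowP => j; rewrite !mxE big_ord1 !mxE.
Qed.

(** Adding [phi x * x 0 0 *: l] changes the velocity of the arcs by [D x *: l], with [D x = 1] near
    [x0]. Where [D x] is nonzero, the new velocity vanishes only if [l] is the value at [x] of a
    certain map of three variables; regarded as a map of four variables it has singular Jacobian,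
    and [avoid] yields a small [l] that is not a value. Where [D x = 0] the velocity is
    unchanged. *)
Lemma immersion_local e f1 f2 x0 : 0 < e -> continuous f2 -> coreo e x0 ->
 exists2 A, nbhs x0 A & exists G0, [/\ open G0, (forall x, Q x -> G0 (x, f2 x)) &
  forall f G, smooth_off f1 e f -> open G -> (forall x, Q x -> G0 (x, f x) /\ G (x, f x)) ->
  exists f', [/\ smooth_off f1 e f',
   (forall x, Q x -> A x \/ immersed_at f x -> immersed_at f' x) & hom_in (G0 `&` G) f f']].
Proof.
move=> e0 cf2 xe; have [c ac cx0] := atlas_cover (f2 x0).
have [r r0 KO] := open_cball (chart_core_open cf2 ac) (conj xe cx0).
pose K := cball x0 (2 * r).
have Ke : K `<=` coreo e by move=> x /KO[].
have KQ x : K x -> Q x by move=> /Ke; apply: coreo_cube; exact: ltW.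
have [phi [kphi phi01 phi1 phi0 phiK]] := bump_box x0 r0.
exists [set x | `|x - x0| < r]; first exact: nbhs_norm_lt.
exists [set z | K z.1 -> dom c z.2]; split.
- by apply: open_imp; [exact: cball_closed|exact: chart_open].
- by move=> x _ /= /KO[].
move=> f G sf oG Gf; have [[cf ff1] smf bf] := sf.
have Kc x : K x -> dom c (f x) by move=> Kx; apply: (Gf x (KQ x Kx)).1.
pose psi (x : 'R_3) := phi x * x 0 0.
have kpsi k : ck k setT psi by smooth.
have psi0 x : ~ K x -> psi x = 0 by move=> /phiK E; rewrite /psi E mul0r.
have psi1 x : K x -> `|psi x| <= 1.
 move=> Kx; have := KQ x Kx 0; have := phi01 x => /andP[p0 p1] /andP[x00 x01].
 by rewrite normrM !ger0_norm // mulr_ile1.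
have oG' : open ([set z | K z.1 -> dom c z.2] `&` G).
 by apply: openI => //; apply: open_imp; [exact: cball_closed|exact: chart_open].
have [e1 e10 he1] := bump_perturb e0 ac (@cball_compact _ x0 (2 * r)) Ke kpsi psi0 psi1 sf Kc oG' Gf.
pose D (x : 'R_3) := 'D_('e_0) psi x.
pose F (y : 'R_3) := c (f y).
pose O := @coreo 3 0 `&` [set x | dom c (f x)].
have oO : open O by exact: chart_core_open.
have sF : Cinfty O F by exact: smooth_core (ltW e0) sf ac.
have kD k : ck k setT D by have [_ /(_ 'e_0)[]] := kpsi k.+1.
have kDF k : Ck k O (fun x => 'D_('e_0) F x) by have [_ /(_ 'e_0)[]] := sF k.+1.
pose pr := proj4 0 1 2.
have cD : continuous D by move=> x; exact: ck_cont (kD 0%N) _.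
pose U : set 'R_4 := pr @^-1` (O `&` [set x | D x != 0]).
have oD : open [set x | D x != 0] := open_pre cD (@open_neq R 0).
have oU : open U := open_pre (@cont_proj4 0 1 2) (openI oO oD).
pose g (z : 'R_4) : 'R_4 := - (D (pr z))^-1 *: 'D_('e_0) F (pr z).
have kg : Ck 1 U g.
 have kpr : Ck 1 U pr by exact: Cinfty_proj4.
 apply/(Ck_coordP _ _ oU) => j.
 apply: (ck_ext (f := (fun x => - 1 * (D x)^-1 * ('D_('e_0) F x) 0 j) \o pr)) => //.
  by move=> z _; rewrite /= mulN1r [in RHS]mxE.
 apply: (ck_comp (V := O `&` [set x | D x != 0])) => //; first exact: openI.
 have oV := openI oO oD.
 apply: ckM => //.
  apply: ckM => //.
  apply: ckV => //; first by move=> x [].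
  exact: ck_sub (kD 1%N).
 by apply: ck_sub (_ : _ `<=` O) _ => [x []//|]; exact: (Ck_coordP _ _ oO).1.
have [l le lU] := avoid (fun _ => oU) (fun _ => kg) e10.
have [f' [bf' Hf']] := he1 l le.
exists f'; split=> //; first exact: bump_off bf'.
move=> x Qx Ax; have [Kx|nK] := pselect (K x); last first.
 case: Ax => [/= Ax|[d [J [dm J0]]]]; first by case: nK; rewrite /K /cball /=; lra.
 by exists d, J; split=> //; exact: bump_mdiff_out bf' _ _ _ nK dm.
have x00 : coreo 0 x by apply: coreo_sub (ltW e0) (Ke x Kx).
have dm := mdiff_core (ltW e0) sf ac x00 (Kc x Kx).
exists c, (jac F x + grad psi x *m l); split; first exact: bump_mdiff bf' _ _ Kx dm.
have r0E : row 0 (jac F x) = 'D_('e_0) F x by rewrite (derive_jac 'e_0 oO (sF 1%N) (conj x00 (Kc x Kx))) -rowE.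
rewrite (row0_bump psi l oO (sF 1%N) (conj x00 (Kc x Kx))) -/(D x).
have [D0|Dn] := eqVneq (D x) 0.
 rewrite D0 scale0r addr0 -r0E; case: Ax => [Ax|]; last by move/(immersed_chart Qx dm).
 have : D x = 1.
  have oB := norm_ball_open x0 r.
  have h : {near x, psi =1 (fun y : 'R_3 => y 0 0)} by apply: (open_near oB Ax) => y /phi1 E; rewrite /psi E mul1r.
  rewrite /D (near_eq_derive _ h).
  by have [_ ->] := @is_derive_coord 3 0 x 'e_0; rewrite mxE.
 by move=> D1; move: (oner_neq0 R); rewrite -D1 D0 eqxx.
apply/eqP => E; pose z : 'R_4 := \row_i [:: x 0 0; x 0 1; x 0 2; 0]`_i.
have prz : pr z = x by rewrite [x]vec3_eta /pr /proj4 !mxE.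
have Uz : U z by rewrite /U /= prz; split=> //; split=> //; exact: Kc.
have gz : g z = l.
 rewrite /g prz; have -> : 'D_('e_0) F x = - (D x *: l) by apply/eqP; rewrite -addr_eq0 E.
 by rewrite scalerN scaleNr opprK scalerA mulVf // scale1r.
have := lU 0%N z Uz gz; rewrite (det_row0 (i := 3)) ?eqxx //.
apply: (jac_row0 oU Uz) => y s _; rewrite /g.
have -> // : pr (y + s *: 'e_3) = pr y by rewrite /pr /proj4 !mxE /= !mulr0 !addr0.
Qed.

End BumpPerturbation.

Lemma I4_ind (P : 'I_4 -> Prop) : P 0 -> P 1 -> P 2 -> P 3 -> forall j, P j.
Proof.
move=> h0 h1 h2 h3 [[|[|[|[|//]]]] h].
- by rewrite (_ : Ordinal h = 0) //; apply: val_inj.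
- by rewrite (_ : Ordinal h = 1) //; apply: val_inj.
- by rewrite (_ : Ordinal h = 2) //; apply: val_inj.
by rewrite (_ : Ordinal h = 3) //; apply: val_inj.
Qed.

Lemma closed_preimage (S T : topologicalType) (f : S -> T) (A : set T) :
 continuous f -> closed A -> closed (f @^-1` A).
Proof. by move=> cf cA; move/closed_comp: cA => /(_ _ f); apply=> x _. Qed.

(** * Transversality at double points *)

Section DoublePoints.
Implicit Types (f : family) (G : set ('R_3 * M)) (c : chart R M).

Definition fib (x y : 'R_3) := x 0 1 = y 0 1 /\ x 0 2 = y 0 2.

Lemma fib_sym x y : fib x y -> fib y x. Proof. by move=> []. Qed.

Lemma fib_norm x y : fib x y -> `|x - y| = `|x 0 0 - y 0 0|.
Proof.
move=> [h1 h2]; apply/eqP; rewrite eq_le; apply/andP; split.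
 by apply: norm_row_le => //; apply: I3_ind; rewrite !mxE ?h1 ?h2 ?subrr ?normr0.
by have := norm_coord_le (x - y) 0; rewrite !mxE.
Qed.

Lemma fib_eq x y : fib x y -> x 0 0 = y 0 0 -> x = y.
Proof. by move=> [h1 h2] h0; rewrite [x]vec3_eta [y]vec3_eta h0 h1 h2. Qed.

(* transversality of the two sheets [(x, J1)] and [(y, J2)] of the lift to
  [M x I^2], whose tangent vectors [a] and [b] agree in the last two coordinates *)
Definition nondeg (J1 J2 : 'M[R]_(3, 4)) := forall a b : 'R_3,
 a 0 1 + b 0 1 = 0 -> a 0 2 + b 0 2 = 0 -> a *m J1 + b *m J2 = 0 -> a = 0 /\ b = 0.

Definition transverse f x y := exists c J1 J2,
 [/\ mdiff f Q x c J1, mdiff f Q y c J2 & nondeg J1 J2].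

Lemma transverse_sym f x y : transverse f x y -> transverse f y x.
Proof.
move=> [c [J1 [J2 [d1 d2 nd]]]]; exists c, J2, J1; split=> // a b h1 h2 h.
by have [|||-> ->] := nd b a; rewrite // addrC.
Qed.

Lemma nondeg_det J1 J2 : nondeg J1 J2 ->
 \det (col_mx (lift_diff J1) (lift_diff J2) : 'M[R]_6) != 0.
Proof.
move=> nd; apply/negP => /det0P[v vn0 v0]; case/negP: vn0.
pose w : 'R_(3 + 3) := v.
have w0 : w *m (col_mx (lift_diff J1) (lift_diff J2) : 'M[R]_(3 + 3, 4 + 2)) = 0 := v0.
have vE : v = row_mx (lsubmx w) (rsubmx w) by rewrite hsubmxK.
move: w0; rewrite -(hsubmxK w) mul_row_col /lift_diff !mul_mx_row add_row_mx.
rewrite -[0](@row_mx0 _ 1 4 2) => /eq_row_mx[h1 /rowP h2].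
set a := lsubmx w in h1 h2 vE *; set b := rsubmx w in h1 h2 vE *.
have E (y : 'R_3) (j : 'I_2) : (y *m \matrix_(i < 3, j < 2) (i == j.+1 :> nat)%:R) 0 j = y 0 (inord j.+1).
 rewrite mxE (bigD1 (inord j.+1)) //= mxE inordK; last by case: j => -[|[]].
 rewrite eqxx mulr1 big1 ?addr0 // => i; rewrite mxE => ni.
 case: eqP => [ij|]; last by rewrite mulr0.
 by case/negP: ni; apply/eqP/val_inj; rewrite /= inordK // -ij.
have i1 : inord 1 = 1 :> 'I_3 by apply: val_inj; rewrite /= inordK.
have i2 : inord 2 = 2 :> 'I_3 by apply: val_inj; rewrite /= inordK.
have [||a0 b0] := nd a b _ _ h1.
- by have := h2 0; rewrite [in LHS]mxE [RHS]mxE !E /= i1.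
- by have := h2 1; rewrite [in LHS]mxE [RHS]mxE !E /= i2.
by rewrite vE a0 b0 !row_mx0.
Qed.

(** Double points have parameters more than [d] apart: a bump with support of diameter below [d]
    then moves at most one of the two sheets. *)
Definition dinj f (d : R) := forall x y, Q x -> Q y -> fib x y -> x != y ->
 `|x 0 0 - y 0 0| <= d -> f x <> f y.

Lemma mvt_fib (U : set 'R_3) (g : 'R_3 -> R) x y : open U -> ck 1 U g -> fib x y ->
 (forall t, 0 <= t <= 1 -> U (x + t *: (y - x))) -> exists2 a : R, 0 < a < 1 &
 g y - g x = (y 0 0 - x 0 0) * 'D_('e_0) g (x + a *: (y - x)).
Proof.
move=> oU kg [h1 h2] hU; have [a a01 ->] := mvt_seg oU kg hU; exists a => //.
rewrite (bigD1 0) //= big1 ?addr0 ?mxE // => i; move: i.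
by apply: I3_ind => // _; rewrite !mxE ?h1 ?h2 subrr mul0r.
Qed.

Lemma cont_gt0_near T (W : normedModType R) (g : T -> W) x : {for x, continuous g} -> g x != 0 ->
 nbhs x (fun y => `|g x| / 2 < `|g y|).
Proof.
move=> cg gx; have g0 : 0 < `|g x| / 2 by rewrite divr_gt0 // normr_gt0.
apply: filterS (cont_dist cg g0) => y hy.
have := ler_normD (g x - g y) (g y); rewrite subrK; lra.
Qed.

(** A chart coordinate whose derivative along the arc does not vanish at a point is injective on the
    arcs nearby, by the mean value theorem; compactness gives a common [d]. *)
Lemma dinj_ex f : (forall x, Q x -> immersed_at f x) -> exists2 d, 0 < d & dinj f d.
Proof.
move=> im.
have [e e0 he] : exists2 e, 0 < e & forall x, Q x -> forall y, Q x -> Q y -> fib x y -> x != y ->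
  `|x 0 0 - y 0 0| < e -> f x <> f y.
 apply: (compact_small); first exact: cube_compact.
 move=> z0 Qz0; have [c [J [[_ _ [U [g [[oU Uz] sg gE gJ]]]] J0]]] := im z0 Qz0.
 have [k Jk] : exists k, J 0 k != 0.
  apply: contrapT => h; case/negP: J0; apply/eqP/rowP => k; rewrite !mxE.
  by apply/eqP/negPn/negP => hk; apply: h; exists k.
 have kk : ck 1 U (fun y => g y 0 k) := (Ck_coordP _ _ oU).1 (sg 1%N) k.
 pose D y := 'D_('e_0) (fun y => g y 0 k) y.
 have Dz : D z0 != 0.
  rewrite /D -derive_row; first by rewrite gJ -rowE mxE.
  exact: diff_derivable (Cinfty_diff oU sg Uz).
 have cD : {for z0, continuous D} by have [_ /(_ 'e_0)[_ [h _]]] := kk; exact: h.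
 have nI := nbhsI2 (nbhsO oU Uz) (cont_gt0_near cD Dz).
 move: nI => /nbhs_normP[d /= d0 hd].
 have hd' w : `|w - z0| < d -> U w /\ D w != 0.
  move=> hw; have [|Uw Dw] := hd w; first by rewrite /ball_/= distrC.
  by split=> //; rewrite -normr_gt0; apply: le_lt_trans Dw.
 exists (d / 2); first lra.
 move=> z e hz /andP[_ ed] y Qz Qy fzy nzy zy fE.
 have zd : `|z - z0| < d by lra.
 have yd : `|y - z0| < d.
  have := ler_distD z y z0; rewrite [`|y - z|]distrC (fib_norm fzy); lra.
 have [|a a01 E] := mvt_fib oU kk fzy.
  by move=> t ti; have [] := hd' _ (ball_seg zd yd ti).
 have gzy : g y 0 k - g z 0 k = 0 by rewrite (gE y (hd' y yd).1 Qy) (gE z (hd' z zd).1 Qz) fE subrr.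
 move: E; rewrite gzy => /esym/eqP; rewrite mulf_eq0 => /orP[|].
  by rewrite subr_eq0 => /eqP h; case/eqP: nzy; exact: fib_eq.
 have ai : 0 <= a <= 1 by case/andP: a01 => /ltW -> /ltW ->.
 by move=> /eqP D0; have [_] := hd' _ (ball_seg zd yd ai); rewrite /D D0 eqxx.
exists (e / 2); first lra.
by move=> x y Qx Qy fxy nxy h; apply: (he x Qx y) => //; lra.
Qed.

Lemma lipschitz_fib (phi : 'R_3 -> R) : ck 1 setT phi -> exists L, 0 < L /\
 (forall x, Q x -> `|'D_('e_0) phi x| <= L) /\
 (forall x y, Q x -> Q y -> fib x y -> `|phi x - phi y| <= L * `|x 0 0 - y 0 0|).
Proof.
move=> kp; have [_ /(_ 'e_0)[_ [cD _]]] := kp.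
(* [compact_small] only produces small numbers; the bound [L] is the inverse of one. *)
have [e e0 he] : exists2 e, 0 < e & forall x, Q x -> e * `|'D_('e_0) phi x| <= 1.
 apply: (compact_small); first exact: cube_compact.
 move=> z0 Qz0; have /nbhs_normP[d /= d0 hd] := cont_dist (cD z0 I) ltr01.
 pose B := `|'D_('e_0) phi z0| + 1; have B0 : 0 < B by rewrite ltr_wpDl.
 exists (Num.min d B^-1); first by rewrite lt_min d0 invr_gt0.
 move=> z e; rewrite !lt_min => /andP[hz _] /andP[e0 /andP[_ eB]].
 have : `|'D_('e_0) phi z0 - 'D_('e_0) phi z| < 1 by apply: hd; rewrite /ball_/= distrC.
 move=> h; have DB : `|'D_('e_0) phi z| <= B.
  have := ler_normD ('D_('e_0) phi z - 'D_('e_0) phi z0) ('D_('e_0) phi z0).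
  by rewrite subrK distrC /B; lra.
 apply: le_trans (_ : B^-1 * B <= 1); last by rewrite mulVf ?gt_eqF.
 by apply: ler_pM => //; exact: ltW.
exists e^-1; split; first by rewrite invr_gt0.
have hD x : Q x -> `|'D_('e_0) phi x| <= e^-1 by rewrite -[X in _ <= X]mul1r ler_pdivlMr // mulrC; exact: he.
split=> // x y Qx Qy fxy.
have [//|a /andP[a0 a1] E] := mvt_fib openT kp fxy.
rewrite distrC E normrM mulrC distrC; apply: ler_wpM2r => //; apply: hD => i.
have ai : itv a by lra.
rewrite !mxE (_ : _ + _ = (1 - a) * x 0 i + a * y 0 i); last by ring.
exact: mixE.
Qed.

(** A row [z] of four entries stands for the pair of points with parameters [z 0 0] and [z 0 1] on
    the arc of index [(z 0 2, z 0 3)]. *)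
Definition pt_l := @proj4 0 2 3.
Definition pt_r := @proj4 1 2 3.

Lemma pt_fib z : fib (pt_l z) (pt_r z).
Proof. by rewrite /fib !vecE. Qed.

Lemma pt_dist (z w : 'R_4) : `|pt_l z - pt_l w| <= `|z - w| /\ `|pt_r z - pt_r w| <= `|z - w|.
Proof.
have H i : `|z 0 i - w 0 i| <= `|z - w| by have := norm_coord_le (z - w) i; rewrite !mxE.
by split; apply: norm_row_le => //; apply: I3_ind; rewrite !mxE /=.
Qed.

Lemma pt_cube z : Q (pt_l z) -> Q (pt_r z) -> cube 4 z.
Proof.
move=> Ql Qr; have := Ql 0; have := Qr 0; have := Ql 1; have := Ql 2.
by rewrite !vecE => h3 h2 h1 h0; apply: I4_ind.
Qed.

Lemma pt_gap z : pt_l z 0 0 - pt_r z 0 0 = z 0 0 - z 0 1.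
Proof. by rewrite !vecE. Qed.

Definition pair4 (x y : 'R_3) : 'R_4 := \row_i [:: x 0 0; y 0 0; x 0 1; x 0 2]`_i.

Lemma pair4K x y : fib x y -> pt_l (pair4 x y) = x /\ pt_r (pair4 x y) = y.
Proof.
move=> [h1 h2]; rewrite /pt_l /pt_r /proj4 [x in _ = x]vec3_eta [y in _ /\ _ = y]vec3_eta.
by rewrite !mxE /= h1 h2.
Qed.

(** A uniform lower bound for the stretching of the arcs in a chart: near the diagonal it comes from
    the velocity, elsewhere from [dinj], and the set of pairs is compact. A displacement with
    Lipschitz constant below [m] along the arcs will preserve both immersions and [dinj]. *)
Lemma immersion_const e f1 f c (K : set 'R_3) d : 0 <= e -> smooth_off f1 e f -> atlas c ->
 compact K -> K `<=` coreo e -> (forall x, K x -> immersed_at f x) -> dinj f d -> 0 < d ->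
 (forall x y, K x -> Q y -> fib x y -> `|x 0 0 - y 0 0| <= d -> dom c (f y)) ->
 exists2 m, 0 < m & (forall x, K x -> m <= `|'D_('e_0) (fun y => c (f y)) x|) /\
  forall x y, K x -> Q y -> fib x y -> `|x 0 0 - y 0 0| <= d ->
   m * `|x 0 0 - y 0 0| <= `|c (f x) - c (f y)|.
Proof.
move=> e0 sf ac cK Ke im dj d0 hc; have [[cf _] _ _] := sf.
have KQ x : K x -> Q x by move=> /Ke; exact: coreo_cube.
have Kc x : K x -> dom c (f x) by move=> Kx; apply: (hc x x) => //; [exact: KQ|rewrite subrr normr0 ltW].
pose F y := c (f y); pose O := @coreo 3 0 `&` [set x | dom c (f x)].
have oO : open O by exact: chart_core_open.
have sF : Cinfty O F by exact: smooth_core e0 sf ac.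
have KO x : K x -> O x by move=> Kx; split; [exact: coreo_sub e0 (Ke x Kx)|exact: Kc].
have cfc y : dom c (f y) -> {for y, continuous F}.
 by move=> cy; apply: (@continuous_comp _ _ _ f c); [exact: cf|exact: chart_cont].
have DF x : K x -> 'D_('e_0) F x != 0.
 move=> Kx; have dm := mdiff_core e0 sf ac (KO x Kx).1 (Kc x Kx).
 have := (immersed_chart (KQ x Kx) dm).1 (im x Kx).
 by rewrite (derive_jac 'e_0 oO (sF 1%N) (KO x Kx)) -rowE.
have kDF : Ck 0 O ('D_('e_0) F) by have [_ /(_ 'e_0)[]] := sF 1%N.
have [m1 m10 hm1] : exists2 m, 0 < m & forall x, K x -> m <= `|'D_('e_0) F x|.
 apply: (compact_small) => // z0 Kz0.
 have cD : {for z0, continuous ('D_('e_0) F)} by exact: Ck_cont kDF (KO _ Kz0).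
 have /nbhs_normP[r /= r0 hr] := cont_gt0_near cD (DF _ Kz0).
 have l0 : 0 < `|'D_('e_0) F z0| / 2 by rewrite divr_gt0 // normr_gt0; exact: DF.
 exists (Num.min r (`|'D_('e_0) F z0| / 2)); first by rewrite lt_min r0.
 move=> z a; rewrite !lt_min => /andP[hz _] /andP[_ /andP[_ ha]].
 have hb : `|'D_('e_0) F z0| / 2 < `|'D_('e_0) F z| by apply: hr; rewrite /ball_/= distrC.
 exact: ltW (lt_trans ha hb).
pose C : set 'R_4 := [set z | [/\ K (pt_l z), Q (pt_r z) & `|z 0 0 - z 0 1| <= d]].
have cC : compact C.
 apply: (subclosed_compact _ (@cube_compact 3)); last first.
  move=> z [Kz Qz _]; have Ql := KQ _ Kz.
  have := Ql 0; have := Qz 0; have := Ql 1; have := Ql 2; rewrite !vecE.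
  by move=> h3 h2 h1 h0; apply: I4_ind.
 have -> : C = pt_l @^-1` K `&` (pt_r @^-1` Q `&` (fun z : 'R_4 => `|z 0 0 - z 0 1|) @^-1` [set a | a <= d]).
  by apply/seteqP; split=> z; [case|case=> ? []].
 apply: closedI; last apply: closedI.
 - by apply: closed_preimage; [exact: cont_proj4|apply: compact_closed => //; exact: norm_hausdorff].
 - apply: closed_preimage; first exact: cont_proj4.
  by exact: cube_closed.
 apply: closed_preimage; last exact: closed_le.
 by cont.
have [m2 m20 hm2] : exists2 m, 0 < m & forall z, C z -> C z ->
  m * `|z 0 0 - z 0 1| <= `|F (pt_l z) - F (pt_r z)|.
 apply: (compact_small) => //.
 move=> z0 Cz0; have [Kz Qz dz] := Cz0.
 have fz := pt_fib z0.
 have zdd : `|pt_l z0 0 0 - pt_r z0 0 0| <= d by rewrite pt_gap.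
 have cr : dom c (f (pt_r z0)) by apply: (hc (pt_l z0)).
 have [E|nE] := eqVneq (pt_l z0) (pt_r z0); last first.
  have nF : F (pt_l z0) - F (pt_r z0) != 0.
   rewrite subr_eq0; apply/eqP => FE.
   apply: (dj _ _ (KQ _ Kz) Qz fz nE zdd).
   by rewrite -(chartK ac (Kc _ Kz)) -(chartK ac cr) -/(F _) FE.
  have cFF : {for z0, continuous (fun z => F (pt_l z) - F (pt_r z))}.
   apply: (@continuousB R _ _ (fun z => F (pt_l z)) (fun z => F (pt_r z))).
    apply: (@continuous_comp _ _ _ pt_l F); first exact: cont_proj4.
    by apply: cfc; exact: Kc.
   apply: (@continuous_comp _ _ _ pt_r F); first exact: cont_proj4.
   exact: cfc.
  have l0 : 0 < `|F (pt_l z0) - F (pt_r z0)| / 2 by rewrite divr_gt0 // normr_gt0.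
  have /nbhs_normP[r /= r0 hr] := cont_gt0_near cFF nF.
  exists (Num.min r (`|F (pt_l z0) - F (pt_r z0)| / 2)); first by rewrite lt_min r0.
  move=> z a; rewrite !lt_min => /andP[hz _] /andP[a0 /andP[_ ha]] [Kz' Qz' _].
  have hb : `|F (pt_l z0) - F (pt_r z0)| / 2 < `|F (pt_l z) - F (pt_r z)| by apply: hr; rewrite /ball_/= distrC.
  have h1 : `|z 0 0 - z 0 1| <= 1.
   have := KQ _ Kz' 0; have := Qz' 0; rewrite /pt_l /pt_r /proj4 !vecE ler_norml; lra.
  apply: le_trans (ltW (lt_trans ha hb)).
  by apply: ler_piMr => //; exact: ltW.
 have Dn := DF _ Kz; have Oz := KO _ Kz.
 have [k Dk] : exists k, ('D_('e_0) F (pt_l z0)) 0 k != 0.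
  apply: contrapT => h; case/negP: Dn; apply/eqP/rowP => k; rewrite [RHS]mxE.
  by apply/eqP/negPn/negP => hk; apply: h; exists k.
 have kk : ck 1 O (fun y => F y 0 k) := (Ck_coordP _ _ oO).1 (sF 1%N) k.
 pose D y := 'D_('e_0) (fun y => F y 0 k) y.
 have Dz : D (pt_l z0) != 0.
  rewrite /D -derive_row //; exact: diff_derivable (Cinfty_diff oO sF Oz).
 have cD : {for pt_l z0, continuous D} by have [_ /(_ 'e_0)[_ [h _]]] := kk; exact: h.
 have nI := nbhsI2 (nbhsO oO Oz) (cont_gt0_near cD Dz).
 move: nI => /nbhs_normP[r /= r0 hr].
 have l0 : 0 < `|D (pt_l z0)| / 2 by rewrite divr_gt0 // normr_gt0.
 have hr' w : `|w - pt_l z0| < r -> O w /\ `|D (pt_l z0)| / 2 < `|D w|.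
  by move=> hw; apply: hr; rewrite /ball_/= distrC.
 exists (Num.min r (`|D (pt_l z0)| / 2)); first by rewrite lt_min r0.
 move=> z a; rewrite !lt_min => /andP[hz _] /andP[a0 /andP[_ ha]] Cz.
 have [d1 d2] := pt_dist z z0; rewrite -E in d2.
 have zl := le_lt_trans d1 hz; have zr := le_lt_trans d2 hz.
 have [|b /andP[b0 b1] Eb] := mvt_fib oO kk (pt_fib z).
  by move=> t ti; have [] := hr' _ (ball_seg zl zr ti).
 have bi : 0 <= b <= 1 by rewrite !ltW.
 have [_ hD] := hr' _ (ball_seg zl zr bi).
 apply: le_trans (_ : `|F (pt_r z) 0 k - F (pt_l z) 0 k| <= _).
  rewrite Eb normrM -/(D _) mulrC [`|pt_r z 0 0 - _|]distrC pt_gap.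
  by apply: ler_wpM2l => //; apply: ltW; apply: lt_trans hD.
 by rewrite distrC; have := norm_coord_le (F (pt_l z) - F (pt_r z)) k; rewrite !mxE.
exists (Num.min m1 m2); first by rewrite lt_min m10.
split=> [x Kx|x y Kx Qy fxy xyd].
 by apply: le_trans (hm1 x Kx); rewrite ge_min lexx.
have [El Er] := pair4K fxy.
have Cp : C (pair4 x y) by rewrite /C /= El Er; rewrite !mxE /=.
have := hm2 _ Cp Cp; rewrite El Er !mxE /=; apply: le_trans.
by apply: ler_wpM2r => //; rewrite ge_min lexx orbT.
Qed.

Definition doubly f1 e d f := [/\ smooth_off f1 e f, forall x, Q x -> immersed_at f x & dinj f d].

Lemma smooth_cont f1 e f : smooth_off f1 e f -> continuous f.
Proof. by case=> [[]]. Qed.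

(** A nonnegative function has zero gradient where it vanishes, so that on the edge of the support
    not only the values but also the differentials are kept. *)
Lemma bumped_keep e c K phi f1 f l f' x d J : bumped e c K phi f1 f l f' -> atlas c ->
 (forall k, ck k setT phi) -> (forall x, 0 <= phi x) -> (forall x, K x -> dom c (f x)) ->
 Q x -> phi x = 0 -> mdiff f Q x d J -> mdiff f' Q x d J.
Proof.
move=> bf ac kphi phi0 Kc Qx p0 dm.
have [Kx|nK] := pselect (K x); last exact: bump_mdiff_out bf _ _ _ nK dm.
have g0 : grad phi x = 0.
 apply/colP => i; rewrite !mxE; apply: (min_derive0 _ openT (kphi 1%N) I) => y _.
 by rewrite p0.
have [T _ dT] := mdiff_chart Qx dm ac (Kc x Kx).
have := bump_mdiff bf Kx dT; rewrite g0 mul0mx addr0 => dT'.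
have [ad _ _] := dm; have dd := mdiff_dom Qx dm.
have [T' _ hT'] := chart_change ac ad (Kc x Kx) dd.
have E := cube_mdiff_uniq Qx dm (hT' _ _ _ _ _ Qx erefl dT).
by rewrite E; apply: hT' dT' => //; rewrite (bump_out bf).
Qed.

Lemma derive_linear_comp (V V' W : normedModType R) (p : V -> V') (h : V' -> W) z v :
 (forall t : R, p (t *: v + z) = t *: p v + p z) -> 'D_v (h \o p) z = 'D_(p v) h (p z).
Proof.
move=> pE.
have E : (fun t : R => t^-1 *: (h (p (t *: v + z)) - h (p z))) =
  (fun t => t^-1 *: (h (t *: p v + p z) - h (p z))) by apply/funext => t; rewrite pE.
exact: (congr1 (fun k : R -> W => lim (k @ 0^')) E).
Qed.

Lemma pt_linear v z (t : R) : pt_l (t *: v + z) = t *: pt_l v + pt_l z /\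
 pt_r (t *: v + z) = t *: pt_r v + pt_r z.
Proof. by split; apply/rowP; apply: I3_ind; rewrite !mxE. Qed.

(** A double point of the perturbed map of which only the point [pt_l z] has moved satisfies [F
    (pt_r z) - F (pt_l z) = phi (pt_l z) *: l], that is, [g z = l]. Differentiating the product of
    [phi] and [g] there expresses the difference of the two perturbed differentials as a nonzero
    multiple of [jac g z]. *)
Lemma quotient_nondeg (F : 'R_3 -> 'R_4) (phi : 'R_3 -> R) O U (g : 'R_4 -> 'R_4) z l :
 open O -> Ck 1 O F -> ck 1 setT phi -> open U -> Ck 1 U g -> U z ->
 (forall w, U w -> [/\ O (pt_l w), O (pt_r w) & phi (pt_l w) *: g w = F (pt_r w) - F (pt_l w)]) ->
 phi (pt_l z) != 0 -> g z = l -> \det (jac g z) != 0 ->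
 nondeg (jac F (pt_l z) + grad phi (pt_l z) *m l) (jac F (pt_r z)).
Proof.
move=> oO kF kp oU kg Uz gE pz gz dg.
have [Ol Or _] := gE z Uz.
have key v : phi (pt_l z) *: (v *m jac g z) =
  pt_r v *m jac F (pt_r z) - pt_l v *m (jac F (pt_l z) + grad phi (pt_l z) *m l).
 have dphi : 'D_v (phi \o pt_l) z = (pt_l v *m grad phi (pt_l z)) 0 0.
  rewrite derive_linear_comp => [|t]; last by have [] := pt_linear v z t.
  by rewrite (ck_derive _ openT kp I) [RHS]mxE; apply: eq_bigr => i _; congr (_ * _); rewrite [RHS]mxE.
 have dl : 'D_v (F \o pt_l) z = pt_l v *m jac F (pt_l z).
  rewrite derive_linear_comp => [|t]; last by have [] := pt_linear v z t.
  exact: derive_jac oO kF Ol.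
 have dr : 'D_v (F \o pt_r) z = pt_r v *m jac F (pt_r z).
  rewrite derive_linear_comp => [|t]; last by have [] := pt_linear v z t.
  exact: derive_jac oO kF Or.
 have ckl : Ck 1 U (F \o pt_l) by apply: (Ck_comp oU oO _ kF (Cinfty_proj4 _ _ _ oU 1%N)) => w /gE[].
 have ckr : Ck 1 U (F \o pt_r) by apply: (Ck_comp oU oO _ kF (Cinfty_proj4 _ _ _ oU 1%N)) => w /gE[].
 have ckp : ck 1 U (phi \o pt_l) by apply: (ck_comp oU openT _ kp (Cinfty_proj4 _ _ _ oU 1%N)).
 apply/rowP => j; rewrite mulmxDr mulmxA opprD addrA.
 have [_ /(_ v)[dgj _]] := (Ck_coordP _ _ oU).1 kg j.
 have [_ /(_ v)[dlj _]] := (Ck_coordP _ _ oU).1 ckl j.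
 have [_ /(_ v)[drj _]] := (Ck_coordP _ _ oU).1 ckr j.
 have [_ /(_ v)[dpj _]] := ckp.
 have E : 'D_v (fun w => phi (pt_l w) * g w 0 j) z = 'D_v (fun w => F (pt_r w) 0 j - F (pt_l w) 0 j) z.
  apply: near_eq_derive; apply: (open_near oU Uz) => w /gE[_ _ /rowP/(_ j)].
  by rewrite !mxE.
 have := @deriveB _ _ _ (fun w => F (pt_r w) 0 j) (fun w => F (pt_l w) 0 j) z v (drj z Uz) (dlj z Uz).
 have := @deriveM _ _ (fun w => phi (pt_l w)) (fun w => g w 0 j) z v (dpj z Uz) (dgj z Uz).
 rewrite [X in X = _ -> _]E => -> E2.
 have e1 : 'D_v (fun w => g w 0 j) z = (v *m jac g z) 0 j.
  by rewrite -(derive_jac v oU kg Uz) derive_row //; exact: diff_derivable (Ck1_diff oU kg Uz).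
 have e2 : 'D_v (fun w => F (pt_r w) 0 j) z = (pt_r v *m jac F (pt_r z)) 0 j.
  by rewrite -dr derive_row //; exact: diff_derivable (Ck1_diff oU ckr Uz).
 have e3 : 'D_v (fun w => F (pt_l w) 0 j) z = (pt_l v *m jac F (pt_l z)) 0 j.
  by rewrite -dl derive_row //; exact: diff_derivable (Ck1_diff oU ckl Uz).
 have e4 : 'D_v (fun w => phi (pt_l w)) z = (pt_l v *m grad phi (pt_l z)) 0 0 by [].
 rewrite e1 e2 e3 e4 gz in E2.
 have PE : (pt_l v *m grad phi (pt_l z) *m l) 0 j = (pt_l v *m grad phi (pt_l z)) 0 0 * l 0 j.
  by rewrite mxE big_ord1.
 move: E2 PE; set A := v *m _; set B := pt_r v *m _; set C := pt_l v *m jac F _.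
 set P := _ *m _ *m l; set D := (_ *m grad _ _) 0 0.
 rewrite -[_ *: A 0 j]/(_ * A 0 j) -[_ *: D]/(_ * D) => E2 PE.
 rewrite [LHS]mxE [RHS]mxE [(B - C) 0 j]mxE [(- C) 0 j]mxE [(- P) 0 j]mxE PE -E2; ring.
move=> a b h1 h2 h.
pose v : 'R_4 := \row_i [:: - a 0 0; b 0 0; b 0 1; b 0 2]`_i.
have vl : pt_l v = - a.
 apply/rowP; apply: I3_ind; rewrite !mxE //=.
  lra.
 lra.
have vr : pt_r v = b by rewrite [RHS]vec3_eta /pt_r /proj4 !mxE.
have := key v; rewrite vl vr mulNmx opprK addrC h => /eqP.
rewrite scaler_eq0 (negbTE pz) /= => /eqP vA.
have uA : jac g z \in unitmx by rewrite unitmxE unitfE.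
have v0 : v = 0 by rewrite -[v](mulmxK uA) vA mul0mx.
split; first by apply/eqP; rewrite -oppr_eq0 -vl v0; apply/eqP/rowP; apply: I3_ind; rewrite !mxE.
by rewrite -vr v0; apply/rowP; apply: I3_ind; rewrite !mxE.
Qed.

Lemma Ck_quotient (U : set 'R_4) (h : 'R_4 -> R) (A B : 'R_4 -> 'R_4) :
 open U -> ck 1 U h -> (forall z, U z -> h z != 0) -> Ck 1 U A -> Ck 1 U B ->
 Ck 1 U (fun z => (h z)^-1 *: (A z - B z)).
Proof.
move=> oU kh h0 kA kB; apply/(Ck_coordP _ _ oU) => j.
have kA' := (Ck_coordP 1 A oU).1 kA j; have kB' := (Ck_coordP 1 B oU).1 kB j.
apply: (ck_ext (f := fun z => (h z)^-1 * (A z 0 j + -1 * B z 0 j)) oU).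
 by move=> z _; rewrite mulN1r !mxE.
apply: (ckM oU (ckV oU h0 kh)); apply: (ckD oU kA').
by apply: (ckM oU) kB'; exact: ck_cst.
Qed.

(** The set [P] where the bump is nonzero has diameter less than [d], so that at a double point at
    most one of the two points moves, by [dinj], and [quotient_nondeg] applies. The sequence [S]
    lists points whose images the moved points of the same arc have to avoid: this condition has one
    free parameter and is again met by [avoid]. Double points not involving [P] keep their
    differentials. *)
Lemma double_local e d f1 f2 x0 : 0 < e -> 0 < d -> coreo e x0 -> continuous f2 ->
 (forall x, Q x -> x 0 0 = 0 \/ x 0 0 = 1 -> boundary (f1 x)) ->
 (exists2 c, atlas c & forall y, Q y -> `|y - x0| <= 2 * d -> dom c (f2 y)) ->
 exists2 A, nbhs x0 A & exists G0, [/\ open G0, (forall x, Q x -> G0 (x, f2 x)) &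
  forall f G (S : seq 'R_3), doubly f1 e d f -> open G ->
   (forall x, Q x -> G0 (x, f x) /\ G (x, f x)) ->
  exists f' (P : set 'R_3), [/\ doubly f1 e d f', hom_in (G0 `&` G) f f', A `<=` P,
   (forall x, ~ P x -> f' x = f x) &
   [/\ (forall x y, Q x -> Q y -> fib x y -> x != y -> f' x = f' y -> P x -> ~ P y /\ transverse f' x y),
    (forall x y, Q x -> Q y -> ~ P x -> ~ P y -> transverse f x y -> transverse f' x y) &
    (forall x y, Q x -> Q y -> y \in S -> fib x y -> P x -> f' x <> f y)]]].
Proof.
move=> e0 d0 xe cf2 bf1 [c ac cx0].
have oO : open (@coreo 3 e `&` [set x | `|x - x0| < d / 2]).
 by apply: openI; [exact: coreo_open|exact: norm_ball_open].
have [|r r0 KO] := open_cball oO (x0 := x0); first by split=> //=; rewrite subrr normr0 divr_gt0.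
pose K := cball x0 (2 * r).
have Ke : K `<=` coreo e by move=> x /KO[].
have Kd x : K x -> `|x - x0| < d / 2 by move=> /KO[].
have KQ x : K x -> Q x by move=> /Ke; apply: coreo_cube; exact: ltW.
have [phi [kphi phi01 phi1 phi0 phiK]] := bump_box x0 r0.
have phiP x : phi x != 0 -> K x by move=> /phi0 /ltW.
pose K2 : set 'R_3 := Q `&` cball x0 (2 * d).
have clK2 : closed K2 by apply: closedI; [exact: cube_closed|exact: cball_closed].
exists [set x | `|x - x0| < r]; first exact: nbhs_norm_lt.
pose G0 : set ('R_3 * M) := [set z | K2 z.1 -> dom c z.2].
have oG0 : open G0 by apply: open_imp => //; exact: chart_open.
exists G0; split=> //; first by move=> x _ [Qx hx] /=; exact: cx0.
move=> f G S [sf im dj] oG Gf; have cf := smooth_cont sf.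
have K2c x : Q x -> `|x - x0| <= 2 * d -> dom c (f x) by move=> Qx hx; apply: (Gf x Qx).1.
have KKc x y : K x -> Q y -> fib x y -> `|x 0 0 - y 0 0| <= d -> dom c (f y).
 move=> /Kd hx Qy fxy xy; apply: K2c => //.
 have := ler_distD x y x0; rewrite [`|y - x|]distrC (fib_norm fxy).
 move: hx xy; clear -d0; lra.
have Kc x : K x -> dom c (f x) by move=> Kx; apply: (KKc x) => //; [exact: KQ|rewrite subrr normr0 ltW].
have cK : compact K by exact: cball_compact.
have [m m0 [hm1 hm2]] := immersion_const (ltW e0) sf ac cK Ke (fun x Kx => im x (KQ x Kx)) dj d0 KKc.
have [L [L0 [hL1 hL2]]] := lipschitz_fib (kphi 1%N).
have psi1 x : K x -> `|phi x| <= 1 by move=> _; have /andP[p0 p1] := phi01 x; rewrite ger0_norm.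
have oG' : open (G0 `&` G) by apply: openI.
have [e1 e10 he1] := bump_perturb e0 ac cK Ke kphi phiK psi1 sf Kc oG' Gf.
pose F (y : 'R_3) := c (f y).
pose O := @coreo 3 0 `&` [set x | dom c (f x)].
have O_o : open O by exact: chart_core_open.
have sF : Cinfty O F by exact: smooth_core (ltW e0) sf ac.
have KO' x : K x -> O x by move=> Kx; split; [exact: coreo_sub (ltW e0) (Ke x Kx)|exact: Kc].
pose O1 := O `&` [set x | phi x != 0].
have cphi : continuous phi by move=> x; exact: ck_cont (kphi 0%N) _.
have oO1 : open O1 by apply: openI => //; exact: (open_pre cphi (@open_neq R 0)).
have O1O : O1 `<=` O by move=> x [].
pose U0 : set 'R_4 := pt_l @^-1` O1 `&` pt_r @^-1` O.
have oU0 : open U0.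
 apply: openI.
  by exact: (open_pre (@cont_proj4 0 2 3) oO1).
 by exact: (open_pre (@cont_proj4 1 2 3) O_o).
pose g0 (z : 'R_4) : 'R_4 := (phi (pt_l z))^-1 *: (F (pt_r z) - F (pt_l z)).
have kpl V : open V -> Ck 1 V pt_l by move=> oV; exact: Cinfty_proj4.
have kpr V : open V -> Ck 1 V pt_r by move=> oV; exact: Cinfty_proj4.
have kg0 : Ck 1 U0 g0.
 apply: Ck_quotient; first exact: oU0.
 - by apply: (ck_comp oU0 openT _ (kphi 1%N) (kpl _ oU0)).
 - by move=> z [[]].
 - by apply: (Ck_comp oU0 O_o _ (sF 1%N) (kpr _ oU0)) => z [].
 by apply: (Ck_comp oU0 O_o _ (sF 1%N) (kpl _ oU0)) => z [/O1O].
pose sl (y : 'R_3) (z : 'R_4) : 'R_3 := vec3 (z 0 0) (y 0 1) (y 0 2).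
have ssl y V : open V -> Cinfty V (sl y) by move=> oV; exact: Cinfty_vec3.
have csl y : continuous (sl y) by move=> z; apply: (Cinfty_cont (U := setT)) => //; apply: ssl.
pose U1 y : set 'R_4 := sl y @^-1` O1.
have oU1 y : open (U1 y) by exact: (open_pre (csl y) oO1).
pose g1 y (z : 'R_4) : 'R_4 := (phi (sl y z))^-1 *: (F y - F (sl y z)).
have kg1 y : Ck 1 (U1 y) (g1 y).
 have ks := ssl y _ (oU1 y) 1%N.
 apply: Ck_quotient; first exact: oU1.
 - by apply: (ck_comp (oU1 y) openT _ (kphi 1%N) ks).
 - by move=> z [].
 - by apply/(Ck_coordP _ _ (oU1 y)) => j.
 by apply: (Ck_comp (oU1 y) O_o _ (sF 1%N) ks) => z /O1O.
(* Index 0 is the quotient for the double points, index [k.+1] the condition for the entry [k] of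
   [S]. *)
pose Uk k := if k is k'.+1 then U1 (nth 0 S k') else U0.
pose gk k := if k is k'.+1 then g1 (nth 0 S k') else g0.
have oUk k : open (Uk k) by case: k => [|k] /=.
have kgk k : Ck 1 (Uk k) (gk k) by case: k => [|k]; [exact: kg0|exact: kg1].
(* With [|l| < m / L] the displacement has Lipschitz constant below [m] along the arcs, as needed
   with [immersion_const]. *)
pose e2 := Num.min e1 (m / L).
have e20 : 0 < e2 by rewrite lt_min e10 divr_gt0.
have [l le lU] := avoid oUk kgk e20.
have [le1 leL] : `|l| < e1 /\ L * `|l| < m by move: le; rewrite lt_min => /andP[-> h]; rewrite mulrC -ltr_pdivlMr.
have [f' [bf' Hf']] := he1 l le1.
have sf' := bump_off bf'; have cf' := smooth_cont sf'.
have out x : phi x = 0 -> f' x = f x := bump_out bf' (x := x).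
have keep x c' J : Q x -> phi x = 0 -> mdiff f Q x c' J -> mdiff f' Q x c' J.
 by apply: (bumped_keep bf') => // y; case/andP: (phi01 y).
have mdK x : K x -> mdiff f' Q x c (jac F x + grad phi x *m l).
 by move=> Kx; apply: (bump_mdiff bf') => //; apply: (mdiff_core (ltW e0) sf); case: (KO' x Kx).
have im' x : Q x -> immersed_at f' x.
 move=> Qx; have [Kx|nK] := pselect (K x); last first.
  have [c' [J [dm J0]]] := im x Qx; exists c', J; split=> //.
  exact: bump_mdiff_out bf' _ _ _ nK dm.
 exists c, (jac F x + grad phi x *m l); split; first exact: mdK.
 rewrite (row0_bump phi l O_o (sF 1%N) (KO' x Kx)).
 apply/eqP => /eqP; rewrite addr_eq0 => /eqP E.
 have := hm1 x Kx; rewrite E normrN normrZ leNgt => /negP; apply.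
 by apply: le_lt_trans leL; apply: ler_wpM2r => //; apply: hL1.
have val x : Q x -> dom c (f x) -> dom c (f' x) /\ c (f' x) = F x + phi x *: l.
 move=> Qx cx; have [Kx|nK] := pselect (K x).
  by split; [exact: bump_dom bf' _ Kx|exact: bump_val bf' _ Kx].
 by have p0 := phiK x nK; rewrite out // p0 scale0r addr0.
have dj' : dinj f' d.
 have H x y : Q x -> Q y -> fib x y -> x != y -> `|x 0 0 - y 0 0| <= d -> phi x != 0 -> f' x <> f' y.
  move=> Qx Qy fxy nxy xyd px E; have Kx := phiP x px.
  have cy := KKc x y Kx Qy fxy xyd.
  have [_ vx] := val x Qx (Kc x Kx); have [_ vy] := val y Qy cy.
  have E' : F x - F y = (phi y - phi x) *: l.
   have /rowP h : F y + phi y *: l = F x + phi x *: l by rewrite -vx E.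
   by apply/rowP => j; have := h j; rewrite !mxE; clear; lra.
  have p0 : 0 < `|x 0 0 - y 0 0|.
   by rewrite normr_gt0 subr_eq0; apply: contra nxy => /eqP h; apply/eqP; exact: fib_eq.
  have := hm2 x y Kx Qy fxy xyd; rewrite E' normrZ leNgt => /negP; apply.
  apply: le_lt_trans (_ : L * `|x 0 0 - y 0 0| * `|l| < _).
   by apply: ler_wpM2r => //; rewrite distrC; exact: hL2.
  by rewrite mulrAC ltr_pM2r.
 move=> x y Qx Qy fxy nxy xyd.
 have [px|px] := eqVneq (phi x) 0; last exact: H.
 have [py|py] := eqVneq (phi y) 0; first by rewrite !out //; exact: dj.
 by move=> /esym; apply: H => //; [exact: fib_sym|rewrite eq_sym|rewrite distrC].
exists f', [set x | phi x != 0]; split=> //.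
- by move=> x /= /phi1 ->.
- by move=> x /negP/negPn/eqP; exact: out.
split; first last.
- move=> x y Qx Qy yS fxy px E; have Kx := phiP x px; have [y1 y2] := fxy.
 have [cx vx] := val x Qx (Kc x Kx).
 pose z : 'R_4 := const_mx (x 0 0).
 have slz : sl y z = x by rewrite /sl mxE -y1 -y2 -vec3_eta.
 have [k kS yE] : exists2 k, (k < size S)%N & nth 0 S k = y by exact/(nthP 0).
 have Uz : Uk k.+1 z by rewrite /= /U1 /= yE slz; split=> //; exact: KO'.
 have gz : gk k.+1 z = l.
  have Fy : F y = F x + phi x *: l by rewrite /F -E.
  by rewrite /= yE /g1 slz Fy addrAC subrr add0r scalerA mulVf // scale1r.
 have := lU _ z Uz gz; rewrite (det_row0 (i := 1)) ?eqxx //.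
 apply: (jac_row0 (oUk k.+1) Uz) => w s _ /=; rewrite /g1.
 by have -> : sl (nth 0 S k) (w + s *: 'e_1) = sl (nth 0 S k) w by rewrite /sl !mxE /= mulr0 addr0.
- move=> x y Qx Qy /negP/negPn/eqP px /negP/negPn/eqP py [c' [J1 [J2 [d1 d2 nd]]]].
 by exists c', J1, J2; split=> //; exact: keep.
move=> x y Qx Qy fxy nxy E px; have Kx := phiP x px.
have xyd : d < `|x 0 0 - y 0 0| by rewrite ltNge; apply/negP => h; exact: (dj' x y Qx Qy fxy nxy h E).
have py : phi y = 0.
 apply/eqP/negPn/negP => /phiP/Kd hy; have hx := Kd _ Kx.
 have := ler_distD x0 x y; rewrite [`|x0 - y|]distrC (fib_norm fxy).
 move: hx hy xyd; clear -d0; lra.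
split; first by apply/negP/negPn; rewrite py.
have Ef : f' x = f y by rewrite E out.
have [cx vx] := val x Qx (Kc x Kx); have cy : dom c (f y) by rewrite -Ef.
(* [f y] is off the boundary because [f' x] is, and therefore [y] is not an end of its arc. *)
have Oy : O y.
 split=> // i; have /andP[yi0 yi1] := Qy i; have xi := Ke x Kx.
 move: i yi0 yi1; apply: I3_ind => yi0 yi1; last 2 first.
 - by have [<- _] := fxy; have := xi 1; clear -e0; lra.
 - by have [_ <-] := fxy; have := xi 2; clear -e0; lra.
 have nb : ~ boundary (f' x) by have [_ _ h] := sf'; exact: h.
 have nf : ~ (y 0 0 = 0 \/ y 0 0 = 1).
  move=> yb; apply: nb; rewrite Ef; have [[_ ff1] _ _] := sf.
  rewrite ff1; first exact: bf1.
  by move=> /(_ 0); case: yb => ->; clear -e0; lra.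
 rewrite subr0 !lt_neqAle yi0 yi1 !andbT; apply/andP; split; apply/eqP => h; apply: nf; [left|right] => //.
have [El Er] := pair4K fxy.
have Uz : Uk 0%N (pair4 x y) by split; rewrite /= ?El ?Er //; split=> //; exact: KO'.
have Fy : F y = F x + phi x *: l by rewrite /F -Ef.
have gz : gk 0%N (pair4 x y) = l by rewrite /= /g0 El Er Fy addrAC subrr add0r scalerA mulVf // scale1r.
have dg := lU 0%N _ Uz gz; rewrite /= in dg.
exists c, (jac F x + grad phi x *m l), (jac F y); split.
- exact: mdK.
- by apply: keep => //; apply: (mdiff_core (ltW e0) sf); case: Oy.
have := @quotient_nondeg F phi O U0 g0 (pair4 x y) l O_o (sF 1%N) (kphi 1%N) oU0 kg0 Uz.
rewrite El Er; apply=> // w [wl wr]; split=> //; first exact: O1O.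
by rewrite scalerA mulfV ?scale1r //; case: wl.
Qed.

End DoublePoints.

(** * Generic approximation of a family *)

Section GenericApproximation.
Implicit Types (f : family) (G : set ('R_3 * M)) (c : chart R M).

Definition all_transverse f := forall x y, Q x -> Q y -> fib x y -> x != y -> f x = f y ->
 transverse f x y.

Definition no_triple (f : family) := forall x y w, Q x -> Q y -> Q w -> fib x y -> fib x w ->
 x != y -> x != w -> y != w -> f x = f y -> f x <> f w.

Lemma closed_eq_hausdorff (S T : topologicalType) (f g : S -> T) : hausdorff_space T ->
 continuous f -> continuous g -> closed [set x | f x = g x].
Proof.
move=> hT cf cg; rewrite -[X in closed X]setCK; apply: open_closedC; rewrite openE => x /= nx.
suff : nbhs x (~` [set x | f x = g x]) by [].
have [[A B] /= [/set_mem Ax /set_mem Bx] [oA oB AB]] : exists2 AB : set T * set T,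
  (f x \in AB.1 /\ g x \in AB.2) & [/\ open AB.1, open AB.2 & AB.1 `&` AB.2 == set0].
 by move: hT; rewrite open_hausdorff => /(_ (f x) (g x)); apply; exact/eqP.
have hA : nbhs x (f @^-1` A) by apply: (cf x); exact: open_nbhs_nbhs.
have hB : nbhs x (g @^-1` B) by apply: (cg x); exact: open_nbhs_nbhs.
apply: filterS2 hA hB => y /= Ay By E; move/eqP/seteqP: AB => [+ _] => /(_ (f y)).
by apply; split=> //; rewrite E.
Qed.

Lemma pt_injective (z w : 'R_4) : pt_l z = pt_l w -> pt_r z = pt_r w -> z = w.
Proof.
move=> /rowP hl /rowP hr; apply/rowP; apply: I4_ind.
- by have := hl 0; rewrite !mxE.
- by have := hr 0; rewrite !mxE.
- by have := hl 1; rewrite !mxE.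
by have := hl 2; rewrite !mxE.
Qed.

Lemma unit_mx_isolated n (A : 'M[R]_n.+1) : \det A != 0 ->
 exists2 e, 0 < e & forall w : 'R_n.+1, (forall j, `|(w *m A) 0 j| <= e * `|w|) -> w = 0.
Proof.
move=> dA; have uA : A \in unitmx by rewrite unitmxE unitfE.
pose b := \sum_i \sum_j `|invmx A i j| + 1.
have S0 : 0 <= \sum_i \sum_j `|invmx A i j| by apply: sumr_ge0 => ? _; apply: sumr_ge0.
have b0 : 0 < b by rewrite ltr_wpDl.
have hb i j : `|invmx A i j| <= b.
 rewrite /b (bigD1 i) //= (bigD1 j) //= -!addrA lerDl.
 by rewrite !addr_ge0 // sumr_ge0 // => ? _; apply: sumr_ge0.
pose N : R := n.+1%:R; have N0 : 0 < N by rewrite ltr0n.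
exists ((N * b)^-1 / 2); first by rewrite divr_gt0 // invr_gt0 mulr_gt0.
move=> w hw; apply/eqP; rewrite -normr_eq0 eq_le normr_ge0 andbT.
suff : `|w| <= `|w| / 2 by have := normr_ge0 w; lra.
apply: norm_row_le => [|j] => //.
have -> : w 0 j = \sum_i (w *m A) 0 i * (\row_i invmx A i j) 0 i.
 by rewrite -{1}[w](mulmxK uA) mxE; apply: eq_bigr => i _; rewrite mxE.
have he : 0 <= (N * b)^-1 / 2 * `|w| by rewrite mulr_ge0 // divr_ge0 // invr_ge0 mulr_ge0 // ltW.
apply: le_trans (row_dot_le he (ltW b0) hw _) _.
 by move=> i; rewrite mxE.
have aux (x y z : R) : 0 < x -> 0 < y -> x * ((x * y)^-1 / 2 * z * y) = z / 2.
 by move=> x0 y0; field; rewrite (gt_eqF x0) (gt_eqF y0).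
by rewrite (aux N b `|w| N0 b0).
Qed.

(** In a chart, double points are zeros of a map between spaces of dimension four, with invertible
    differential at a transverse one; strict differentiability isolates the zero. *)
Lemma double_isolated f z0 : transverse f (pt_l z0) (pt_r z0) -> Q (pt_l z0) -> Q (pt_r z0) ->
 f (pt_l z0) = f (pt_r z0) -> exists2 A, nbhs z0 A & forall z, A z -> Q (pt_l z) -> Q (pt_r z) ->
 f (pt_l z) = f (pt_r z) -> z = z0.
Proof.
move=> [c [J1 [J2 [[_ _ D1] [_ _ D2] nd]]]] Ql Qr fE.
have [U1 [g1 [[oU1 U1z] s1 E1 d1]]] := D1; have [U2 [g2 [[oU2 U2z] s2 E2 d2]]] := D2.
pose U := pt_l @^-1` U1 `&` pt_r @^-1` U2.
have oU : open U.
 apply: openI.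
  by exact: (open_pre (@cont_proj4 0 2 3) oU1).
 by exact: (open_pre (@cont_proj4 1 2 3) oU2).
have Uz : U z0 by [].
pose g z := g1 (pt_l z) - g2 (pt_r z).
have k1 : Ck 1 U (g1 \o pt_l) by apply: (Ck_comp oU oU1 _ (s1 1%N) (Cinfty_proj4 _ _ _ oU 1%N)) => z [].
have k2 : Ck 1 U (g2 \o pt_r) by apply: (Ck_comp oU oU2 _ (s2 1%N) (Cinfty_proj4 _ _ _ oU 1%N)) => z [].
have kg : Ck 1 U g.
 apply/(Ck_coordP _ _ oU) => j.
 have k1j := (Ck_coordP _ _ oU).1 k1 j; have k2j := (Ck_coordP _ _ oU).1 k2 j.
 apply: (ck_ext (f := fun z => (g1 \o pt_l) z 0 j + -1 * (g2 \o pt_r) z 0 j) oU).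
  by move=> z _; rewrite mulN1r !mxE.
 by smooth.
have key v : v *m jac g z0 = pt_l v *m J1 - pt_r v *m J2.
 rewrite -(derive_jac v oU kg Uz).
 have df1 : derivable (g1 \o pt_l) z0 v := @diff_derivable _ _ _ _ _ v (Ck1_diff oU k1 Uz).
 have df2 : derivable (g2 \o pt_r) z0 v := @diff_derivable _ _ _ _ _ v (Ck1_diff oU k2 Uz).
 rewrite [LHS](deriveB df1 df2); congr (_ - _).
  by rewrite derive_linear_comp // => t; have [] := pt_linear v z0 t.
 by rewrite derive_linear_comp // => t; have [] := pt_linear v z0 t.
have dA : \det (jac g z0) != 0.
 apply/negP => /det0P[v vn0 v0]; case/negP: vn0; move: v0; rewrite key => h.
 have [|||a0 b0] := nd (pt_l v) (- pt_r v).
 - by rewrite !mxE subrr.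
 - by rewrite !mxE subrr.
 - by rewrite mulNmx.
 have r0 : pt_r v = 0 by rewrite -[pt_r v]opprK b0 oppr0.
 apply/eqP; apply: pt_injective; rewrite ?a0 ?r0; apply/rowP; apply: I3_ind;
  by rewrite !mxE.
have [e e0 he] := unit_mx_isolated dA.
have [d dd0 hd] := strict_diff oU kg Uz e0.
exists (U `&` [set z | `|z - z0| < d]).
 by apply: nbhsI2; [exact: open_nbhs_nbhs|exact: nbhs_norm_lt].
move=> z [[Uz1 Uz2] hz] Qzl Qzr fzE.
have g0 w : U1 (pt_l w) -> U2 (pt_r w) -> Q (pt_l w) -> Q (pt_r w) -> f (pt_l w) = f (pt_r w) -> g w = 0.
 by move=> h1 h2 h3 h4 h5; rewrite /g E1 // E2 // h5 subrr.
apply/eqP; rewrite -subr_eq0; apply/eqP; apply: he => j.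
have := hd z0 z _ hz j; rewrite subrr normr0 => /(_ dd0).
by rewrite (g0 z) // (g0 z0) // subr0 sub0r mxE normrN.
Qed.

(** By [dinj] the double points are the coincidences with parameters at least [d] apart, a compact
    set, and each of them is isolated. *)
Lemma double_finite f d : 0 < d -> continuous f -> dinj f d -> all_transverse f ->
 finite_set [set z : 'R_4 | [/\ Q (pt_l z), Q (pt_r z), z 0 0 != z 0 1 & f (pt_l z) = f (pt_r z)]].
Proof.
move=> d0 cf dj tr; set D := [set z | _].
pose C : set 'R_4 := [set z | [/\ Q (pt_l z), Q (pt_r z), d <= `|z 0 0 - z 0 1| & f (pt_l z) = f (pt_r z)]].
have DC : D `<=` C.
 move=> z [Ql Qr nz fE]; split=> //; rewrite leNgt; apply/negP => h.
 apply: (dj _ _ Ql Qr (pt_fib z)) fE; last by rewrite pt_gap ltW.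
 by apply: contra nz => /eqP lr; rewrite -subr_eq0 -pt_gap lr subrr.
have CD : C `<=` D.
 move=> z [Ql Qr nz fE]; split=> //; apply/eqP => E; move: nz; rewrite E subrr normr0; lra.
have cC : compact C.
 apply: (subclosed_compact _ (@cube_compact 3)); last first.
  by move=> z [Ql Qr _ _]; exact: pt_cube.
 have -> : C = (pt_l @^-1` Q `&` pt_r @^-1` Q) `&`
   ((fun z : 'R_4 => `|z 0 0 - z 0 1|) @^-1` [set a | d <= a] `&` [set z | f (pt_l z) = f (pt_r z)]).
  by apply/seteqP; split=> z; [case|case=> -[? ?] []].
 have clQ : closed Q by exact: cube_closed.
 apply: closedI; apply: closedI.
 - by apply: closed_preimage => //; exact: cont_proj4.
 - by apply: closed_preimage => //; exact: cont_proj4.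
 - apply: closed_preimage; last exact: closed_ge.
  by cont.
 apply: (closed_eq_hausdorff (f := f \o pt_l) (g := f \o pt_r)); first exact: manifold_hausdorff.
  exact: (cont_o (@cont_proj4 _ _ _) cf).
 exact: (cont_o (@cont_proj4 _ _ _) cf).
suff : finite_set (C `&` C) by apply: sub_finite_set => z /DC Cz.
apply: (compact_ind (P := fun A => finite_set (C `&` A))) => //.
- by rewrite setI0.
- by move=> A B AB; apply: sub_finite_set => z [Cz /AB].
- by move=> A B fA fB; rewrite setIUr finite_setU.
move=> z0 Cz0; have [Ql Qr nz fE] := CD _ Cz0.
have nlr : pt_l z0 != pt_r z0.
 apply: contra nz => /eqP lr; have : pt_l z0 0 0 = pt_r z0 0 0 by rewrite lr.
 by rewrite !vecE => ->.
have [A nA hA] := double_isolated (tr _ _ Ql Qr (pt_fib z0) nlr fE) Ql Qr fE.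
exists A => //; apply: sub_finite_set (finite_set1 z0) => z [[Ql' Qr' _ fE'] Az].
exact: hA.
Qed.

Lemma smooth_off_widen f1 e e' f : 0 < e -> e <= e' -> smooth_off f1 e' f ->
 (forall x, Q x -> boundary (f1 x) -> ~ coreo e' x -> x 0 0 = 0 \/ x 0 0 = 1) -> smooth_off f1 e f.
Proof.
move=> e0 ee [[cf ff1] sf bf] hb; split=> //.
 by split=> // x nx; apply: ff1 => h; apply: nx; exact: coreo_sub h.
move=> x xe; have [h|h] := pselect (coreo e' x); first exact: bf.
rewrite ff1 // => /hb b; apply: (core_ends (ltW e0) xe); apply: b => //.
exact: coreo_cube (ltW e0) xe.
Qed.

Lemma lebesgue_chart f : continuous f -> exists2 d, 0 < d & forall x, Q x ->
 exists2 c, atlas c & forall y, Q y -> `|y - x| <= 2 * d -> dom c (f y).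
Proof.
move=> cf.
have [e e0 he] : exists2 e, 0 < e & forall x, Q x -> exists2 c, atlas c & forall y, Q y -> `|y - x| < e -> dom c (f y).
 apply: (compact_small).
  exact: cube_compact.
 move=> z0 Qz0; have [c ac cz] := atlas_cover (f z0).
 have nc : nbhs z0 (fun y => dom c (f y)) by apply: (cf z0); exact: chart_nbhs.
 move: nc => /nbhs_normP[d /= d0 hd].
 exists (d / 2); first lra.
 move=> z e hz /andP[e0 ed]; exists c => // y Qy hy; apply: hd; rewrite /ball_/= distrC.
 have := ler_distD z y z0; lra.
exists (e / 3); first by rewrite divr_gt0.
move=> x Qx; have [c ac hc] := he x Qx; exists c => // y Qy hy; apply: hc => //; lra.
Qed.

Lemma off_mdiff f1 f e x c J : off f1 f e -> ~ core e x -> mdiff f1 Q x c J -> mdiff f Q x c J.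
Proof.
move=> [_ ff1] nx; apply: mdiff_eq.
have clK : closed (@core 3 e) by apply: compact_closed; [exact: norm_hausdorff|exact: core_compact].
have h := open_near (closed_openC clK) nx (P := fun y => f1 y = f y).
apply: filterS (h _) => [y E _ //|y ny]; rewrite ff1 // => hy; apply: ny => i.
by have := hy i => /andP[/ltW-> /ltW->].
Qed.

Lemma dinj_le f d d' : d' <= d -> dinj f d -> dinj f d'.
Proof. by move=> dd h x y Qx Qy fxy nxy xy; apply: h => //; exact: le_trans dd. Qed.

Definition good_pair f x y := f x = f y -> transverse f x y.

(* [f1] is already generic near the boundary of the cube *)
Record good_off (f1 : family) (e : R) : Prop := GoodOff {
 go_cont : continuous f1;
 go_imm : forall x, Q x -> ~ coreo e x -> immersed_at f1 x;
 go_bnd : forall x, Q x -> ~ coreo e x -> (boundary (f1 x) <-> x 0 0 = 0 \/ x 0 0 = 1);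
 go_inj : forall x y, Q x -> Q y -> fib x y -> ~ coreo e x -> ~ coreo e y -> f1 x = f1 y -> x = y }.

(** Four rounds of passes: smoothness, immersed arcs, transverse double points, no triple points.
    Each round treats the core in which the earlier ones may have altered [f1], and is supported in
    the core of margin smaller by [e], whence [5 * e]. Outside the treated core the map is still
    [f1], and [good_off] takes over. *)
Lemma generic_approx f1 e G : 0 < e -> good_off f1 (5 * e) -> open G ->
 (forall x, Q x -> G (x, f1 x)) -> exists f, [/\ smooth_off f1 e f,
  (forall x, Q x -> immersed_at f x), all_transverse f /\ (exists2 d, 0 < d & dinj f d),
  no_triple f & hom_in G f1 f].
Proof.
move=> e0 [cf1 im1 b1 i1] oG Gf1.
have ends x : Q x -> x 0 0 = 0 \/ x 0 0 = 1 -> boundary (f1 x).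
 move=> Qx h; apply/b1 => //; have e5 : 0 <= 5 * e by lra.
 by move=> hx; exact: core_ends e5 hx h.
have nco (a b : R) x : a <= b -> ~ coreo a x -> ~ coreo b x by move=> ab h hb; apply: h; exact: coreo_sub hb.
have hb a x : a <= 5 * e -> Q x -> boundary (f1 x) -> ~ coreo a x -> x 0 0 = 0 \/ x 0 0 = 1.
 by move=> a5 Qx bx nx; apply/b1 => //; exact: nco nx.
have core_nco a b (x : 'R_3) : a <= b -> ~ core a x -> ~ coreo b x.
 by move=> ab h hx; apply: h => i; have := hx i; lra.
have [||||f2 [sf2 H2]] := @smoothing (4 * e) (5 * e) f1 G _ _ cf1 _ _ oG Gf1; try lra.
- by move=> x Qx /(im1 x Qx)[c [J [dm _]]]; exists c, J.
- by move=> x Qx bx nx; apply: (hb _ _ _ Qx bx nx).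
have G2 := hom_in_graph H2.
have sf2' : smooth_off f1 (3 * e) f2.
 by apply: (smooth_off_widen _ _ sf2) => [||x Qx bx nx]; try lra; apply: (hb _ _ _ Qx bx nx); lra.
have [] := @pass_induction (smooth_off f1 (3 * e))
 (fun A f f' => forall x, Q x -> A x \/ immersed_at f x -> immersed_at f' x) f2
 (core (4 * e)) (@core_compact 2 (4 * e)) _ _ _ _ _ G sf2' oG G2.
- by exact: smooth_cont.
- by move=> f x Qx [].
- by move=> A B f f' AB h x Qx [/AB Ax|fx]; apply: h => //; [left|right].
- move=> A B f f' f'' h h' x Qx [[Ax|Bx]|fx]; apply: h' => //; [|by left|]; right; apply: h => //; [left|right]; done.
- move=> x0 /(core_coreo (e := 3 * e)) h; apply: immersion_local; [lra|exact: smooth_cont sf2|apply: h; lra].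
move=> f3 [sf3 im3 H3].
have {}im3 x : Q x -> immersed_at f3 x.
 move=> Qx; apply: im3 => //; have [h|h] := pselect (core (4 * e) x); [by left|right].
 have [of2 _ _] := sf2; have [|c [J [dm J0]]] := im1 x Qx; first by apply: core_nco h; lra.
 by exists c, J; split=> //; exact: off_mdiff of2 h dm.
have cf3 := smooth_cont sf3.
have [d1 d10 dj1] := dinj_ex im3; have [d2 d20 hd2] := lebesgue_chart cf3.
pose d := Num.min d1 d2; have d0 : 0 < d by rewrite lt_min d10.
have hd x : Q x -> exists2 c, atlas c & forall y, Q y -> `|y - x| <= 2 * d -> dom c (f3 y).
 move=> /hd2[c ac hc]; exists c => // y Qy hy; apply: hc => //; apply: le_trans hy _.
 by rewrite ler_pM2l // ge_min lexx orbT.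
have dj3 : dinj f3 d by apply: dinj_le dj1; rewrite ge_min lexx.
have sf3' : smooth_off f1 (2 * e) f3.
 by apply: (smooth_off_widen _ _ sf3) => [||x Qx bx nx]; try lra; apply: (hb _ _ _ Qx bx nx); lra.
have G3 := hom_in_graph H3.
have ee3 : 2 * e < 3 * e by lra.
have ee2 : e < 2 * e by lra.
have [] := @pass_induction (doubly f1 (2 * e) d)
 (fun A f f' => forall x y, Q x -> Q y -> fib x y -> x != y -> A x \/ A y \/ good_pair f x y -> good_pair f' x y)
 f3 (core (3 * e)) (@core_compact 2 (3 * e)) _ _ _ _ _ G (And3 sf3' im3 dj3) oG G3.
- by move=> f [sf _ _]; exact: smooth_cont sf.
- by move=> f x y Qx Qy fxy nxy [|[]].
- move=> A B f f' AB h x y Qx Qy fxy nxy [/AB Ax|[/AB Ay|g]]; apply: h => //; [by left|by right; left|by right; right].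
- move=> A B f f' f'' h h' x y Qx Qy fxy nxy hh; apply: h' => //.
 have [Bx|nBx] := pselect (B x); [by left|right].
 have [By|nBy] := pselect (B y); [by left|right].
 apply: h => //; case: hh => [[|//]|[[|//]|]]; [by left|by right; left|by right; right].
- move=> x0 /(core_coreo ee3) x0e.
 have Qx0 : Q x0 by apply: coreo_cube x0e; lra.
 have e20 : 0 < 2 * e by lra.
 have [A nA [G0 [oG0 G0f h]]] := double_local e20 d0 x0e cf3 ends (hd x0 Qx0).
 exists A => //; exists G0; split=> // f G' df oG' Gf.
 have [f' [P [df' Hf' AP out [p1 p2 p3]]]] := h f G' [::] df oG' Gf.
 exists f'; split=> // x y Qx Qy fxy nxy hh E.
 have [Px|nPx] := pselect (P x); first by case: (p1 x y Qx Qy fxy nxy E Px).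
 have [Py|nPy] := pselect (P y).
  have nyx : y != x by rewrite eq_sym.
  by have [_ t] := p1 y x Qy Qx (fib_sym fxy) nyx (esym E) Py; exact: transverse_sym.
 apply: p2 => //; case: hh => [/AP//|[/AP//|]]; apply.
 by rewrite -!out.
move=> f4 [df4 tr4 H4].
have {}tr4 : all_transverse f4.
 move=> x y Qx Qy fxy nxy; apply: tr4 => //.
 have [hx|hx] := pselect (core (3 * e) x); [by left|right].
 have [hy|hy] := pselect (core (3 * e) y); [by left|right=> E].
 exfalso; have [[[_ ff1] _ _] _ _] := And3 sf3 im3 dj3.
 have nx : ~ coreo (3 * e) x by move=> h; apply: hx => i; have /andP[/ltW -> /ltW ->] := h i.
 have ny : ~ coreo (3 * e) y by move=> h; apply: hy => i; have /andP[/ltW -> /ltW ->] := h i.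
 move: E; rewrite !ff1 // => E; case/eqP: nxy; apply: i1 => //; [apply: core_nco hx|apply: core_nco hy]; lra.
have [[sf4 im4 dj4] G4] := (df4, hom_in_graph H4).
have [d3 d30 hd3] := lebesgue_chart (smooth_cont sf4).
pose d' := Num.min d d3; have d'0 : 0 < d' by rewrite lt_min d0.
have hd4 x : Q x -> exists2 c, atlas c & forall y, Q y -> `|y - x| <= 2 * d' -> dom c (f4 y).
 move=> /hd3[c ac hc]; exists c => // y Qy hy; apply: hc => //; apply: le_trans hy _.
 by rewrite ler_pM2l // ge_min lexx orbT.
have df4' : doubly f1 e d' f4.
 split=> //; last by apply: dinj_le dj4; rewrite ge_min lexx.
 apply: (smooth_off_widen _ _ sf4) => [||x Qx bx nx]; try lra.
 by apply: (hb _ _ _ Qx bx nx); lra.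
have [] := @pass_induction (fun f => doubly f1 e d' f /\ all_transverse f)
 (fun A f f' => forall x y w, Q x -> Q y -> Q w -> fib x y -> fib x w ->
   x != y -> x != w -> y != w -> (A x \/ A y \/ A w) \/ (f x = f y -> f x <> f w) -> f' x = f' y -> f' x <> f' w)
 f4 (core (2 * e)) (@core_compact 2 (2 * e)) _ _ _ _ _ G (conj df4' tr4) oG G4.
- by move=> f [[sf _ _] _]; exact: smooth_cont sf.
- by move=> f x y w Qx Qy Qw fxy fxw nxy nxw nyw [[|[]]|].
- move=> A B f f' AB h x y w Qx Qy Qw fxy fxw nxy nxw nyw hh; apply: h => //.
 by case: hh => [[/AB ?|[/AB ?|/AB ?]]|?]; [left; left|left; right; left|left; right; right|right].
- move=> A B f f' f'' h h' x y w Qx Qy Qw fxy fxw nxy nxw nyw hh; apply: h' => //.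
 have [[Bx|[By|Bw]]|nB] := pselect (B x \/ B y \/ B w).
 + by left; left.
 + by left; right; left.
 + by left; right; right.
 right; apply: h => //; case: hh => [[[Ax|Bx]|[[Ay|By]|[Aw|Bw]]]|ok].
 + by left; left.
 + by case: nB; left.
 + by left; right; left.
 + by case: nB; right; left.
 + by left; right; right.
 + by case: nB; right; right.
 by right.
- move=> x0 /(core_coreo ee2) x0e.
 have Qx0 : Q x0 by apply: coreo_cube x0e; lra.
 have [A nA [G0 [oG0 G0f h]]] := double_local e0 d'0 x0e (smooth_cont sf4) ends (hd4 x0 Qx0).
 exists A => //; exists G0; split=> // f G' [df tr] oG' Gf.
 have [[[cf _] _ _] _ djf] := df.
 (* [S] contains all points already involved in double points, finitely many by [double_finite]. A
    moved point that avoids their images cannot join an existing double point. *)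
 have [S HS] : exists S : seq 'R_3, forall x y, Q x -> Q y -> fib x y -> x != y -> f x = f y -> x \in S.
  have /finite_seqP[s hs] := double_finite d'0 cf djf tr.
  exists [seq pt_l z | z <- s] => x y Qx Qy fxy nxy E.
  have [El Er] := pair4K fxy; rewrite -El; apply: map_f.
  suff : [set` s] (pair4 x y) by [].
  rewrite -hs /= El Er; split=> //; rewrite !mxE /=; apply: contra nxy => /eqP.
  by move/(fib_eq fxy) => ->.
 have [f' [P [df' Hf' AP out [p1 p2 p3]]]] := h f G' S df oG' Gf.
 exists f'; split=> //.
  split=> // x y Qx Qy fxy nxy E.
  have [Px|nPx] := pselect (P x); first by case: (p1 x y Qx Qy fxy nxy E Px).
  have [Py|nPy] := pselect (P y).
   have nyx : y != x by rewrite eq_sym.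
   by have [_ t] := p1 y x Qy Qx (fib_sym fxy) nyx (esym E) Py; exact: transverse_sym.
  by apply: p2 => //; apply: tr => //; rewrite -!out.
 have main x y w : Q x -> Q y -> Q w -> fib x y -> fib x w -> x != y -> x != w -> y != w ->
   f' x = f' y -> f' x = f' w -> ~ P x.
  move=> Qx Qy Qw fxy fxw nxy nxw nyw Ey Ew Px.
  have [nPy _] := p1 x y Qx Qy fxy nxy Ey Px; have [nPw _] := p1 x w Qx Qw fxw nxw Ew Px.
  have fyw : fib y w by move: fxy fxw => [h1 h2] [h3 h4]; split; congruence.
  have Eyw : f y = f w by rewrite -!out // -Ey.
  by apply: (p3 x y Qx Qy (HS y w Qy Qw fyw nyw Eyw) fxy Px); rewrite Ey out.
 move=> x y w Qx Qy Qw fxy fxw nxy nxw nyw hx Ey Ew.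
 have nPx := main x y w Qx Qy Qw fxy fxw nxy nxw nyw Ey Ew.
 have fyw : fib y w by move: fxy fxw => [h1 h2] [h3 h4]; split; congruence.
 have nPy : ~ P y by apply: (main y x w) => //; [exact: fib_sym|rewrite eq_sym|rewrite -Ey].
 have nPw : ~ P w.
  by apply: (main w x y) => //; [exact: fib_sym|exact: fib_sym|rewrite eq_sym|rewrite eq_sym|rewrite -Ew].
 case: hx => [[/AP//|[/AP//|/AP//]]|]; move=> h3; apply: h3; by rewrite -!out.
move=> f5 [[df5 tr5] nt5 H5]; have [sf5 im5 dj5] := df5.
exists f5; split=> //; first by split=> //; exists d'.
 move=> x y w Qx Qy Qw fxy fxw nxy nxw nyw; apply: nt5 => //.
 have [hx|hx] := pselect (core (2 * e) x); first by left; left.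
 have [hy|hy] := pselect (core (2 * e) y); first by left; right; left.
 right=> E4; exfalso; have [[_ ff1] _ _] := sf4.
 have n2 (v : 'R_3) : ~ core (2 * e) v -> ~ coreo (2 * e) v by move=> h; exact: core_nco (lexx _) h.
 have n5 (v : 'R_3) : ~ core (2 * e) v -> ~ coreo (5 * e) v by move=> h; apply: core_nco h; lra.
 move: E4; rewrite !ff1; [|exact: n2|exact: n2] => E1.
 by case/eqP: nxy; apply: i1 => //; exact: n5.
apply: hom_in_trans H5; apply: hom_in_trans H4; exact: (hom_in_trans H2 H3).
Qed.

End GenericApproximation.

(** * Homotopies of paths with ends on the base arc *)

Section Paths.
Variable I0 : R -> M.
Implicit Types g h k : R -> M.

Lemma clamp_square T (h : R * R -> T) :
 {within unit_itv `*` unit_itv, continuous h} -> continuous (fun x : R * R => h (clamp x.1, clamp x.2)).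
Proof.
move=> ch x; apply: (within_comp (g := fun x : R * R => (clamp x.1, clamp x.2)) ch).
- by split; exact: clamp_itv.
- by apply: near_all => y; split; exact: clamp_itv.
by cont.
Qed.

Lemma bhom_intro (H : R -> R -> M) g h : continuous (fun x : R * R => H x.1 x.2) ->
 (forall r, itv r -> (I0 @` unit_itv) (H r 0) /\ (I0 @` unit_itv) (H r 1)) ->
 (forall s, itv s -> H 0 s = g s /\ H 1 s = h s) -> based_homotopic I0 g h.
Proof.
move=> cH eH gh; exists H; split=> // [|r ri]; first exact: cont_within.
have [h0 h1] := eH r ri; split=> //; apply: cont_within.
apply: (cont_o (f := fun s : R => (r, s))) cH => //.
by cont.
Qed.

Lemma bhom_elim g h : based_homotopic I0 g h -> exists H : R -> R -> M,
 [/\ continuous (fun x : R * R => H x.1 x.2),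
  forall r, (I0 @` unit_itv) (H r 0) /\ (I0 @` unit_itv) (H r 1) &
  (forall s, itv s -> H 0 s = g s /\ H 1 s = h s)].
Proof.
move=> [H [cH bH gh]]; exists (fun r s => H (clamp r) (clamp s)); split.
- exact: (clamp_square cH).
- move=> r; have [_ h0 h1] := bH _ (clamp_itv r).
 by rewrite clamp0 clamp1.
by move=> s si; rewrite clamp0 clamp1 clamp_id //; exact: gh.
Qed.

Lemma bhom_sym g h : based_homotopic I0 g h -> based_homotopic I0 h g.
Proof.
move=> /bhom_elim[H [cH eH gh]].
apply: (bhom_intro (H := fun r s => H (1 - r) s)).
- apply: (cont_o (f := fun x : R * R => (1 - x.1, x.2)) _ cH).
 by cont.
- by [].
by move=> s si; rewrite subr0 subrr; have [-> ->] := gh s si.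
Qed.

Lemma bhom_trans g h k : based_homotopic I0 g h -> based_homotopic I0 h k ->
 based_homotopic I0 g k.
Proof.
move=> /bhom_elim[H [cH eH gh]] /bhom_elim[H' [cH' eH' hk]].
apply: (bhom_intro (H := fun r s => if r <= 2^-1 then H (2 * r) (clamp s) else H' (2 * r - 1) (clamp s))).
- apply: paste_le; [exact: cont_fst|exact: cont_cst| | |].
 + apply: (cont_o (f := fun x : R * R => (2 * x.1, clamp x.2)) _ cH).
  by cont.
 + apply: (cont_o (f := fun x : R * R => (2 * x.1 - 1, clamp x.2)) _ cH').
  by cont.
 move=> x ->; rewrite mulfV // subrr (gh _ (clamp_itv _)).2.
 by rewrite (hk _ (clamp_itv _)).1.
- by move=> r _; rewrite clamp0 clamp1; case: ifP => _.
move=> s si; rewrite invr_ge0 ler0n mulr0 clamp_id // (gh s si).1; split=> //.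
have -> : (1 <= 2^-1 :> R) = false by lra.
by rewrite mulr1 (_ : 2 - 1 = 1) ?(hk s si).2 //; lra.
Qed.

Lemma bhom_reparam g (th : R -> R) : continuous g -> continuous th ->
 th 0 = 0 -> th 1 = 1 -> (I0 @` unit_itv) (g 0) -> (I0 @` unit_itv) (g 1) ->
 based_homotopic I0 g (fun s => g (th s)).
Proof.
move=> cg cth t0 t1 g0 g1.
apply: (bhom_intro (H := fun r s => g ((1 - r) * s + r * th s))).
- by cont.
- by move=> r _; rewrite t0 t1 !mulr0 addr0 !mulr1 subrK.
by move=> s _; rewrite subr0 subrr mul1r !mul0r addr0 add0r mul1r.
Qed.

Lemma bhom_eq g h g' h' : (forall s, itv s -> g s = g' s) -> (forall s, itv s -> h s = h' s) ->
 based_homotopic I0 g h -> based_homotopic I0 g' h'.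
Proof.
move=> gg hh [H [cH bH gh]]; exists H; split=> // s si.
by rewrite -gg // -hh //; exact: gh.
Qed.

Lemma shortcut_continuous k p q : continuous k -> k p = k q -> continuous (shortcut k p q).
Proof.
move=> ck kpq; rewrite /shortcut; apply: paste_le.
- exact: cont_id.
- exact: cont_cst.
- by cont.
- by cont.
by move=> x ->; rewrite mulfV // mul1r subrr mul0r addr0.
Qed.

Lemma shortcut_ends k p q : shortcut k p q 0 = k 0 /\ shortcut k p q 1 = k 1.
Proof.
rewrite /shortcut invr_ge0 ler0n mulr0 mul0r; split=> //.
have -> : (1 <= 2^-1 :> R) = false by lra.
by congr k; lra.
Qed.

(** All coincidences along the path have trivial group element. The case [p = q], where the shortcut
    is a reparametrization of the path, is included: coincidences of perturbed paths may lie close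
    to it, and the set of pairs with [p <= q] is compact. *)
Definition tame k := forall p q, 0 <= p -> p <= q -> q <= 1 -> k p = k q ->
 based_homotopic I0 I0 (shortcut k p q).

End Paths.

(** * Group elements of coincidences under small perturbations *)

Section Persistence.
Variable I0 : R -> M.
Implicit Types (f : family) (G : set ('R_3 * M)).

Definition arc f (x : 'R_3) (s : R) : M := f (vec3 s (x 0 1) (x 0 2)).

Lemma arc_continuous_family f x : continuous f -> continuous (arc f x).
Proof.
move=> cf; apply: (cont_o (f := fun s : R => vec3 s (x 0 1) (x 0 2)) _ cf).
by cont.
Qed.

Lemma arcE f x y : fib x y -> arc f x (y 0 0) = f y.
Proof. by move=> [h1 h2]; rewrite /arc h1 h2 -vec3_eta. Qed.

(** Rests at [1/2] during the middle third: composed with it, a shortcut has room for a short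
    segment in a chart between its two halves. *)
Definition theta3 (s : R) : R := (clamp (3 * s) + clamp (3 * s - 2)) / 2.

Lemma theta3_ends : theta3 0 = 0 /\ theta3 1 = 1.
Proof.
rewrite /theta3 !mulr0 clamp0 clamp_le0 => //.
rewrite clamp_ge1; last by lra.
by rewrite clamp_ge1; [split; lra|lra].
Qed.

Lemma cont_theta3 : continuous theta3.
Proof.
apply: cont_mul => //.
have c3 : continuous (fun s : R => 3 * s) by cont.
apply: cont_lin; first exact: (cont_clampo c3).
by cont.
Qed.

(* [shortcut k p q], with a constant middle third *)
Lemma shortcut_theta3 k p q s : k p = k q :> M -> shortcut k p q (theta3 s) =
 if s <= 3^-1 then k (clamp (3 * s) * p)
 else if s <= 2 / 3 then k p else k (q + clamp (3 * s - 2) * (1 - q)).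
Proof.
move=> kpq; rewrite /shortcut /theta3; have [h1|h1] := leP s 3^-1.
 have -> : clamp (3 * s - 2) = 0 by rewrite clamp_le0 //; lra.
 rewrite addr0; have := clamp_itv (3 * s) => /andP[c0 c1].
 have -> : clamp (3 * s) / 2 <= 2^-1 by lra.
 by congr k; lra.
have -> : clamp (3 * s) = 1 by rewrite clamp_ge1 //; lra.
have [h2|h2] := leP s (2 / 3).
 have -> : clamp (3 * s - 2) = 0 by rewrite clamp_le0 //; lra.
 have -> : (1 + 0) / 2 <= 2^-1 :> R by lra.
 by congr k; lra.
case: ifP => h3; last by congr k; lra.
have cz : clamp (3 * s - 2) = 0 by have := clamp_itv (3 * s - 2) => /andP[c0 c1]; lra.
by rewrite cz addr0 mul0r addr0 -kpq; congr k; lra.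
Qed.

Lemma chart_segment c (P : M) : atlas c -> dom c P -> exists O : set M,
 [/\ open O, O P, O `<=` dom c & forall (v w : M) t, O v -> O w -> itv t ->
  (c @` dom c) ((1 - t) *: c v + t *: c w)].
Proof.
move=> ac cP; have [_ [V oV cV] _ _ _] := atlas_chart ac.
have [VP _] : (V `&` half_space (R := R)) (c P) by rewrite -cV.
have nV : nbhs (c P) V by exact: open_nbhs_nbhs.
move: nV => /nbhs_normP[r /= r0 hr].
exists (dom c `&` [set m | `|c m - c P| < r]); split.
- rewrite openE => m [cm /= hm]; suff : nbhs m (dom c `&` [set m | `|c m - c P| < r]) by [].
 apply: nbhsI2; first by exact: chart_nbhs.
 have nb : nbhs (c m) [set v | `|v - c P| < r] by apply: nbhsO => //; exact: norm_ball_open.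
 exact: (chart_cont ac cm nb).
- by split=> //=; rewrite subrr normr0.
- by [].
move=> v w t [cv /= hv] [cw /= hw] ti.
suff : (V `&` half_space (R := R)) ((1 - t) *: c v + t *: c w) by rewrite -cV.
have E : (1 - t) *: c v + t *: c w = c v + t *: (c w - c v) by apply/rowP => j; rewrite !mxE; ring.
split; first by apply: hr; rewrite /ball_/= distrC E; exact: ball_seg.
rewrite /half_space /= !mxE; have /andP[t0 t1] := ti.
by apply: addr_ge0; apply: mulr_ge0; rewrite ?subr_ge0 //; exact: chart_half.
Qed.

Definition fixes_ends (f : family) := forall x, Q x ->
 (x 0 0 = 0 -> f x = I0 0) /\ (x 0 0 = 1 -> f x = I0 1).

Definition keeps_tame f0 (A : set 'R_4) := exists G0, [/\ open G0, (forall x, Q x -> G0 (x, f0 x)) &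
  forall f, hom_in G0 f0 f -> forall z, A z -> Q (pt_l z) -> Q (pt_r z) -> f (pt_l z) = f (pt_r z) ->
   based_homotopic I0 I0 (shortcut (arc f (pt_l z)) (pt_l z 0 0) (pt_r z 0 0))].

(** Distinct values at [z0] stay distinct nearby. If the values are equal, both points stay in a set
    whose points can be joined by segments in a chart. While the map moves from [f0] to [f] and the
    pair from [z0] to [z], the two values need not coincide in between, and the gap between the
    halves of the shortcut is filled by the chart segment joining them. *)
Lemma persistence_local f0 (z0 : 'R_4) : continuous f0 ->
 fixes_ends f0 ->
 Q (pt_l z0) -> Q (pt_r z0) ->
 (f0 (pt_l z0) = f0 (pt_r z0) ->
   based_homotopic I0 I0 (shortcut (arc f0 (pt_l z0)) (pt_l z0 0 0) (pt_r z0 0 0))) ->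
 exists2 A, nbhs z0 A & keeps_tame f0 A.
Proof.
move=> cf0 e0 Ql Qr triv.
have two (O1 O2 : set M) : open O1 -> open O2 -> O1 (f0 (pt_l z0)) -> O2 (f0 (pt_r z0)) ->
  exists2 r, 0 < r & exists G0, [/\ open G0, forall x, Q x -> G0 (x, f0 x) &
   forall x m, G0 (x, m) -> (`|x - pt_l z0| <= r -> O1 m) /\ (`|x - pt_r z0| <= r -> O2 m)].
 move=> opa opb h1 h2.
 have p1 : open (f0 @^-1` O1) by exact: (open_pre cf0 opa).
 have p2 : open (f0 @^-1` O2) by exact: (open_pre cf0 opb).
 have [r1 r10 hr1] := open_cball p1 h1; have [r2 r20 hr2] := open_cball p2 h2.
 exists (Num.min r1 r2); first by rewrite lt_min r10.
 exists ([set z | cball (pt_l z0) (2 * r1) z.1 -> O1 z.2] `&` [set z | cball (pt_r z0) (2 * r2) z.1 -> O2 z.2]).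
 split.
 - by apply: openI; apply: open_imp => //; exact: cball_closed.
 - by split=> /= h; [exact: hr1|exact: hr2].
 move=> x m [/= g1 g2]; split=> h; [apply: g1|apply: g2]; rewrite /cball /=.
  by have : `|x - pt_l z0| <= r1; [apply: le_trans h _; rewrite ge_min lexx|lra].
 by have : `|x - pt_r z0| <= r2; [apply: le_trans h _; rewrite ge_min lexx orbT|lra].
have [E|nE] := pselect (f0 (pt_l z0) = f0 (pt_r z0)); last first.
 have [[W1 W2] /= [/set_mem h1 /set_mem h2] [opa opb /eqP O12]] : exists2 AB : set M * set M,
   (f0 (pt_l z0) \in AB.1 /\ f0 (pt_r z0) \in AB.2) & [/\ open AB.1, open AB.2 & AB.1 `&` AB.2 == set0].
  have := @manifold_hausdorff _ M; rewrite open_hausdorff => /(_ (f0 (pt_l z0)) (f0 (pt_r z0))).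
  by apply; exact/eqP.
 have [r r0 [G0 [oG0 Gf0 hG]]] := two W1 W2 opa opb h1 h2.
 exists [set z | `|z - z0| < r]; first exact: nbhs_norm_lt.
 exists G0; split=> // f Hf z /= hz Ql' Qr' fE.
 have [d1 d2] := pt_dist z z0.
 have [i1 _] := hG _ _ (hom_in_graph Hf Ql'); have [_ i2] := hG _ _ (hom_in_graph Hf Qr').
 have m1 := i1 (le_trans d1 (ltW hz)); have m2 := i2 (le_trans d2 (ltW hz)).
 move/seteqP: O12 => [/(_ (f (pt_l z))) []]; split=> //; by rewrite fE.
have [c ac cP] := atlas_cover (f0 (pt_l z0)).
have [W [oW OP Oc Oseg]] := chart_segment ac cP.
have OP' : W (f0 (pt_r z0)) by rewrite -E.
have [r r0 [G0 [oG0 Gf0 hG]]] := two W W oW oW OP OP'.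
exists [set z | `|z - z0| < r]; first exact: nbhs_norm_lt.
exists G0; split=> // f [F [cF F01 FG FB]] z /= hz Ql' Qr' fE.
pose zs (a : R) : 'R_4 := z0 + clamp a *: (z - z0).
have czs : continuous zs.
 move=> a; apply: (@continuousD R _ _ (cst z0) (fun a => clamp a *: (z - z0))); first exact: cst_continuous.
 by apply: (cont_scale); [exact: cont_clamp|exact: cst_continuous].
have zs_near a : `|zs a - z0| < r.
 rewrite addrAC subrr add0r normrZ; have /andP[c0 c1] := clamp_itv a.
 by rewrite ger0_norm //; apply: le_lt_trans hz; exact: ler_piMl.
have zs_cube a : cube 4 (zs a).
 move=> i; rewrite /zs !mxE.
 have -> : z0 0 i + clamp a * (z 0 i - z0 0 i) = (1 - clamp a) * z0 0 i + clamp a * z 0 i by ring.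
 by apply: mixE; [exact: clamp_itv|exact: pt_cube Ql Qr i|exact: pt_cube Ql' Qr' i].
have zs0 : zs 0 = z0 by rewrite /zs clamp0 scale0r addr0.
have zs1 : zs 1 = z by rewrite /zs clamp1 scale1r addrC subrK.
pose zc (i : 'I_4) (a : R) : R := zs a 0 i.
have czc i : continuous (zc i) by exact: (cont_o czs (@cont_coord 4 i)).
have zcI i a : itv (zc i a) by exact: zs_cube.
have QP a s : itv s -> Q (vec3 s (zc 2 a) (zc 3 a)) by move=> si; apply/cube3P; rewrite !vecE.
pose X a := F (clamp a) (pt_l (zs a)); pose Y a := F (clamp a) (pt_r (zs a)).
have QX a : Q (pt_l (zs a)) by exact: (QP a (zc 0 a) (zcI 0 a)).
have QY a : Q (pt_r (zs a)) by exact: (QP a (zc 1 a) (zcI 1 a)).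
have OX a : W (X a).
 have [h _] := hG _ _ (FG _ _ (clamp_itv a) (QX a)); apply: h.
 by have [d1 _] := pt_dist (zs a) z0; apply: le_trans d1 _; exact: ltW.
have OY a : W (Y a).
 have [_ h] := hG _ _ (FG _ _ (clamp_itv a) (QY a)); apply: h.
 by have [_ d2] := pt_dist (zs a) z0; apply: le_trans d2 _; exact: ltW.
have cFl (l : R * R -> R) : continuous l -> continuous (fun x : R * R => F (clamp x.1) (vec3 (l x) (zc 2 x.1) (zc 3 x.1))).
 move=> cl; apply: (cont_o (f := fun x : R * R => (clamp x.1, vec3 (l x) (zc 2 x.1) (zc 3 x.1))) _ cF).
 apply: cont_pairg; first by cont.
 by apply: cont_vec3 => //; apply: (cont_o (@cont_fst R R)); exact: czc.
have cXY (w : R -> 'R_3) : continuous w -> (forall a, W (F (clamp a) (w a))) ->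
  continuous (fun a => c (F (clamp a) (w a))).
 move=> cw Ow a; apply: (@continuous_comp _ _ _ (fun a => F (clamp a) (w a)) c).
  apply: (cont_o (f := fun a => (clamp a, w a)) _ cF).
  by cont.
 by apply: chart_cont => //; apply: Oc.
have cX : continuous (fun a => c (X a)) by apply: (cXY (fun a => pt_l (zs a))) => //; exact: (cont_o czs (@cont_proj4 0 2 3)).
have cY : continuous (fun a => c (Y a)) by apply: (cXY (fun a => pt_r (zs a))) => //; exact: (cont_o czs (@cont_proj4 1 2 3)).
pose H a s := if s <= 3^-1 then F (clamp a) (vec3 (clamp (3 * s) * zc 0 a) (zc 2 a) (zc 3 a))
 else if s <= 2 / 3 then chart_inv c ((1 - clamp (3 * s - 1)) *: c (X a) + clamp (3 * s - 1) *: c (Y a))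
 else F (clamp a) (vec3 (zc 1 a + clamp (3 * s - 2) * (1 - zc 1 a)) (zc 2 a) (zc 3 a)).
have c3 (b : R) : continuous (fun x : R * R => clamp (3 * x.2 - b)) by cont.
have c30 : continuous (fun x : R * R => clamp (3 * x.2)) by cont.
have czf i : continuous (fun x : R * R => zc i x.1) by exact: (cont_o (@cont_fst R R) (czc _)).
have XE a : F (clamp a) (vec3 (zc 0 a) (zc 2 a) (zc 3 a)) = X a by [].
have XK a : chart_inv c (c (X a)) = X a by apply: chartK => //; exact: Oc.
have YK a : chart_inv c (c (Y a)) = Y a by apply: chartK => //; exact: Oc.
have cH : continuous (fun x : R * R => H x.1 x.2).
 apply: paste_le; [exact: cont_snd|exact: cont_cst| | |].
 - by apply: cFl; cont.
 - apply: paste_le; [exact: cont_snd|exact: cont_cst| | |].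
  + have [_ _ _ _ cc] := atlas_chart ac.
   move=> x; apply: (within_comp (g := fun x : R * R =>
    (1 - clamp (3 * x.2 - 1)) *: c (X x.1) + clamp (3 * x.2 - 1) *: c (Y x.1)) cc).
   * by apply: Oseg => //; exact: clamp_itv.
   * by apply: near_all => y; apply: Oseg => //; exact: clamp_itv.
   apply: (@continuousD R _ _ (fun x : R * R => (1 - clamp (3 * x.2 - 1)) *: c (X x.1))
    (fun x : R * R => clamp (3 * x.2 - 1) *: c (Y x.1))).
    apply: (cont_scale (a := fun x : R * R => 1 - clamp (3 * x.2 - 1)) (f := fun x : R * R => c (X x.1))).
     by cont.
    exact: (cont_o (@cont_fst R R) cX).
   apply: (cont_scale (a := fun x : R * R => clamp (3 * x.2 - 1)) (f := fun x : R * R => c (Y x.1))).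
    exact: c3.
   exact: (cont_o (@cont_fst R R) cY).
  + by apply: cFl; cont.
  move=> x ->; have -> : clamp (3 * (2 / 3) - 1) = 1 :> R by rewrite clamp_ge1 //; lra.
  have -> : clamp (3 * (2 / 3) - 2) = 0 :> R by rewrite clamp_le0 //; lra.
  by rewrite subrr scale0r add0r scale1r mul0r addr0.
 move=> x ->; have -> : 3^-1 <= 2 / 3 :> R by lra.
 have -> : clamp (3 * 3^-1 - 1) = 0 :> R by rewrite clamp_le0 //; lra.
 have -> : clamp (3 * 3^-1) = 1 :> R by rewrite clamp_ge1 //; lra.
 by rewrite subr0 scale0r addr0 scale1r mul1r.
have H0 s : H 0 s = shortcut (arc f0 (pt_l z0)) (pt_l z0 0 0) (pt_r z0 0 0) (theta3 s).
 have al w : F 0 w = f0 w := (F01 w).1.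
 rewrite shortcut_theta3; last by rewrite !arcE //; exact: pt_fib.
 rewrite /H /X /Y clamp0 !al /zc zs0 -E -scalerDl subrK scale1r.
 rewrite (chartK ac cP) // /arc /pt_l /proj4 !vecE.
 by [].
have H1 s : H 1 s = shortcut (arc f (pt_l z)) (pt_l z 0 0) (pt_r z 0 0) (theta3 s).
 have al w : F 1 w = f w := (F01 w).2.
 rewrite shortcut_theta3; last by rewrite !arcE //; exact: pt_fib.
 have cz : dom c (f (pt_l z)) by apply: Oc; have := OX 1; rewrite /X clamp1 al zs1.
 rewrite /H /X /Y clamp1 !al /zc zs1 -fE -scalerDl subrK scale1r.
 rewrite (chartK ac cz) // /arc /pt_l /proj4 !vecE.
 by [].
have eF a s : itv a -> itv s -> (s = 0 -> F a (vec3 s (zc 2 a) (zc 3 a)) = I0 0) /\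
  (s = 1 -> F a (vec3 s (zc 2 a) (zc 3 a)) = I0 1).
 move=> ai si; have [h0 h1] := e0 _ (QP a s si); rewrite vecE in h0 h1.
 by split=> hs; [rewrite -h0 //|rewrite -h1 //]; apply: FB => //; rewrite vecE; [left|right].
have cf : continuous f.
 have -> : f = (fun w => F 1 w) by apply/funext => w; rewrite (F01 w).2.
 apply: (cont_o (f := fun w : 'R_3 => ((1 : R), w)) _ cF).
 by cont.
have bH : based_homotopic I0 (H 0) (H 1).
 apply: (bhom_intro cH) => // a ai.
 rewrite /H invr_ge0 ler0n mulr0 clamp0 mul0r.
 have -> : (1 <= 3^-1 :> R) = false by lra.
 have -> : (1 <= 2 / 3 :> R) = false by rewrite lt_geF //; lra.
 have -> : clamp (3 * 1 - 2) = 1 :> R by rewrite clamp_ge1 //; lra.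
 rewrite mul1r addrCA subrr addr0 (clamp_id ai).
 by split; [exists 0; [exact: itv0|rewrite (eF a 0 ai itv0).1]|exists 1; [exact: itv1|rewrite (eF a 1 ai itv1).2]].
have rep f' z' : continuous f' -> f' (pt_l z') = f' (pt_r z') -> Q (pt_l z') ->
  fixes_ends f' ->
  based_homotopic I0 (shortcut (arc f' (pt_l z')) (pt_l z' 0 0) (pt_r z' 0 0))
   (fun s => shortcut (arc f' (pt_l z')) (pt_l z' 0 0) (pt_r z' 0 0) (theta3 s)).
 move=> cf' E' Q' ef'; have [t0 t1] := theta3_ends.
 have [s0 s1] := shortcut_ends (arc f' (pt_l z')) (pt_l z' 0 0) (pt_r z' 0 0).
 have Qv s : itv s -> Q (vec3 s (pt_l z' 0 1) (pt_l z' 0 2)).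
  by move=> si; apply/cube3P; have := Q' 1; have := Q' 2; rewrite !vecE.
 apply: bhom_reparam => //.
 - apply: shortcut_continuous; first exact: arc_continuous_family.
  by rewrite !arcE //; exact: pt_fib.
 - exact: cont_theta3.
 - by rewrite s0 /arc; exists 0; [exact: itv0|]; rewrite (ef' _ (Qv 0 itv0)).1 // vecE.
 by rewrite s1 /arc; exists 1; [exact: itv1|]; rewrite (ef' _ (Qv 1 itv1)).2 // vecE.
have ef : fixes_ends f.
 move=> x Qx; have [h0 h1] := e0 x Qx.
 by split=> h; rewrite -(F01 x).2; [rewrite -h0 //|rewrite -h1 //]; apply: FB => //; [left|right].
apply: bhom_trans (triv E) _.
apply: bhom_trans (rep f0 z0 cf0 E Ql e0) _.
apply: (@bhom_trans _ _ (H 1)).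
 by apply: bhom_eq bH => // s _.
apply: bhom_sym.
by apply: bhom_eq (rep f z cf fE Ql' ef) => // s _.
Qed.

Lemma persistence f0 : continuous f0 ->
 fixes_ends f0 ->
 (forall x, Q x -> tame I0 (arc f0 x)) ->
 exists G, [/\ open G, (forall x, Q x -> G (x, f0 x)) &
  forall f, hom_in G f0 f -> forall x y, Q x -> Q y -> fib x y -> x 0 0 < y 0 0 -> f x = f y ->
   based_homotopic I0 I0 (shortcut (arc f x) (x 0 0) (y 0 0))].
Proof.
move=> cf0 e0 tm.
pose C : set 'R_4 := [set z | cube 4 z /\ z 0 0 <= z 0 1].
have cC : compact C.
 apply: (subclosed_compact _ (@cube_compact 3)); last by move=> z [].
 have -> : C = cube 4 `&` (fun z : 'R_4 => z 0 1 - z 0 0) @^-1` [set a | 0 <= a].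
  by apply/seteqP; split=> z [h1 h2]; move: h2; rewrite /= subr_ge0.
 apply: closedI; first by exact: cube_closed.
 apply: closed_preimage; last exact: closed_ge.
 by cont.
suff [G0 [oG Gf h]] : keeps_tame f0 C.
 exists G0; split=> // f Hf x y Qx Qy fxy xy fE.
 have [El Er] := pair4K fxy; have := h f Hf (pair4 x y); rewrite El Er; apply=> //.
 split; last by rewrite !mxE /= ltW.
 have [f1 f2] := fxy.
 by apply: I4_ind; rewrite !mxE /=.
apply: (compact_ind) => //.
- by exists setT.
- by move=> A B AB [G [oG Gf h]]; exists G; split=> // f Hf z /AB; exact: h.
- move=> A B [G1 [opa g1 h1]] [G2 [opb g2 h2]]; exists (G1 `&` G2); split.
 + exact: openI.
 + by split; [exact: g1|exact: g2].
 move=> f Hf z [Az|Bz]; [apply: h1 Az|apply: h2 Bz]; by apply: hom_in_sub Hf => w [].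
move=> z0 [Qz zle].
have Ql : Q (pt_l z0) by apply/cube3P; rewrite !vecE.
have Qr : Q (pt_r z0) by apply/cube3P; rewrite !vecE.
apply: persistence_local => // E; apply: tm => //.
- by have := Ql 0 => /andP[].
- by rewrite !vecE.
- by have := Qr 0 => /andP[].
by rewrite !arcE //; exact: pt_fib.
Qed.

End Persistence.

(** * From generic maps of the cube to generic families *)

Section FamilyOfMap.
Variable I0 : R -> M.
Implicit Types (f : family) (G : set ('R_3 * M)).

Definition of_map f (t u s : R) : M := f (vec3 s t u).

Lemma of_mapE f : family3 (of_map f) = f.
Proof. by apply/funext => x; rewrite /family3 /of_map -vec3_eta. Qed.

Lemma of_map_generic f d : 0 < d -> continuous f -> (forall x, Q x -> immersed_at f x) ->
 all_transverse f -> dinj f d -> no_triple f -> generic (of_map f).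
Proof.
move=> d0 cf im tr dj nt.
have dpE p q t u : double_points (of_map f) (p, q, t, u) ->
  [/\ Q (vec3 p t u), Q (vec3 q t u), vec3 p t u != vec3 q t u & f (vec3 p t u) = f (vec3 q t u)].
 move=> h; have [Qp Qq] := dp_det_itv h; have [[p0 pq q1 ti ui] E] := h.
 by split=> //; apply/eqP => /rowP/(_ 0); rewrite !vecE => pq'; rewrite pq' ltxx in pq.
have fb p q t u : fib (vec3 p t u : 'R_3) (vec3 q t u) by rewrite /fib !vecE.
split.
- move=> x Qx; have [c [J [dm J0]]] := im x Qx; exists c, J; rewrite of_mapE; split=> //.
 exact/lift_diff_free.
- apply: (sub_finite_set _ (finite_image (fun z : 'R_4 => (z 0 0, z 0 1, z 0 2, z 0 3)) (double_finite d0 cf dj tr))).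
 move=> [[[p q] t] u] h; have [Qp Qq npq E] := dpE _ _ _ _ h.
 have [El Er] := pair4K (fb p q t u).
 exists (pair4 (vec3 p t u) (vec3 q t u)); last by rewrite !mxE /=.
 rewrite /= El Er; split=> //; rewrite !mxE /=.
 by apply: contra npq => /eqP ->.
- move=> [[[p q] t] u] h; have [Qp Qq npq E] := dpE _ _ _ _ h.
 have [c [J1 [J2 [d1 d2 nd]]]] := tr _ _ Qp Qq (fb p q t u) npq E.
 exists (\det (col_mx (lift_diff J1) (lift_diff J2) : 'M[R]_6)); last exact: nondeg_det.
 by exists c, J1, J2; rewrite of_mapE.
move=> p q r t u h1 h2; have [Qp Qq npq E1] := dpE _ _ _ _ h1; have [_ Qr nqr E2] := dpE _ _ _ _ h2.
have npr : vec3 p t u != vec3 r t u.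
 apply/eqP => /rowP/(_ 0); rewrite !vecE => pr.
 by have [[_ + _ _ _] _] := h1; have [[_ + _ _ _] _] := h2; lra.
exact: (nt _ _ _ Qp Qq Qr (fb p q t u) (fb p r t u) npq npr nqr E1 (etrans E1 E2)).
Qed.

Lemma dp_term_trivial A p q t u : based_path I0 I0 ->
 based_homotopic I0 I0 (shortcut (A t u) p q) -> dp_term I0 A (p, q, t, u) = 0.
Proof.
move=> bI h; rewrite /dp_term; case: insubP => // X /asboolP[g [bg XE ng]] _.
case: ng; have : pi1_class I0 (shortcut (A t u) p q) I0 by split=> //; exact: bhom_sym.
by rewrite XE => -[_ ]; exact: bhom_sym.
Qed.

End FamilyOfMap.

(** * Forcing agreement with the base arc near the ends *)

Section Hair.
Variable I0 : R -> M.
Hypothesis I0_loop : Emb_loop I0 (fun=> I0).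

Lemma I0_Emb : Emb I0 I0.
Proof. by have [_ h _] := I0_loop; apply: (h 0). Qed.

Lemma I0_continuous : {within unit_itv, continuous I0}.
Proof. by have [pa _] := I0_Emb; apply: arc_continuous; exact: proper_arc_smooth. Qed.

Lemma I0_based : based_path I0 I0.
Proof.
by split; [exact: I0_continuous|exists 0 => //; rewrite /unit_itv /= lexx ler01|exists 1 => //; rewrite /unit_itv /= lexx ler01].
Qed.

Definition I0c (s : R) : M := I0 (clamp s).

Lemma cont_I0c : continuous I0c.
Proof. exact: cont_clamp_itv I0_continuous. Qed.

Definition mu (x : R) : R := step (3 * x - 1).

Lemma mu_itv x : itv (mu x). Proof. exact: step01. Qed.
Lemma mu0 x : x <= 3^-1 -> mu x = 0. Proof. by move=> h; apply: step_le0; lra. Qed.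
Lemma mu1 x : 2 / 3 <= x -> mu x = 1. Proof. by move=> h; apply: step_ge1; lra. Qed.

Lemma smooth1_mu n k U (f : 'R_n -> R) : open U -> ck k U f -> ck k U (fun x => mu (f x)).
Proof.
move=> oU kf; apply: (smooth1_step oU (f := fun x => 3 * f x - 1)).
by smooth.
Qed.

Lemma cont_step : continuous (@step).
Proof.
move=> x; have h := @smooth1_step 1 0 setT (fun y => y 0 0) openT (ck_coord _ _ _).
have := cont_o (@const_mx1_cont) (fun y => ck_cont h I).
by move=> /(_ x); apply: near_eq_cont; apply: near_all => y /=; rewrite mxE.
Qed.

Lemma cont_mu : continuous mu.
Proof.
apply: (cont_o (f := fun x : R => 3 * x - 1)) cont_step.
apply: cont_lin => //.
by cont.
Qed.

Definition plateau (x : R) : R := step (6 * x - 1) * step (5 - 6 * x).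

Lemma plateau_itv x : itv (plateau x).
Proof.
have /andP[a0 a1] := @step01 (6 * x - 1); have /andP[b0 b1] := @step01 (5 - 6 * x).
by rewrite mulr_ge0 //= mulr_ile1.
Qed.

Lemma plateau0 x : x <= 6^-1 \/ 5 / 6 <= x -> plateau x = 0.
Proof. by rewrite /plateau => -[h|h]; [rewrite step_le0 //|rewrite [step (5 - _)]step_le0 //]; lra. Qed.

Lemma plateau1 x : 3^-1 <= x <= 2 / 3 -> plateau x = 1.
Proof. by move=> h; rewrite /plateau !step_ge1 //; lra. Qed.

Lemma cont_plateau : continuous plateau.
Proof.
apply: cont_mul.
 apply: (cont_o (f := fun x : R => 6 * x - 1)) cont_step.
 by cont.
apply: (cont_o (f := fun x : R => 5 - 6 * x)) cont_step.
by cont.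
Qed.

Variable m : R.
Hypothesis m0 : 0 < m.
Hypothesis m4 : m <= 4^-1.

Lemma m_itv : 0 < m <= 4^-1. Proof. by rewrite m0. Qed.

(** Tent of slope 1 truncated at height [k]: it leaves 0 at [s = 0] and is back at [s = m]. *)
Definition zig (k s : R) : R := Num.max 0 (Num.min s (Num.min k (m - s))).

Lemma zig_itv k s : 0 <= zig k s. Proof. by rewrite le_max lexx. Qed.
Lemma zig_le k s : 0 <= s -> zig k s <= s.
Proof. by move=> s0; rewrite ge_max s0 ge_min lexx. Qed.
Lemma zig0 s : zig 0 s = 0.
Proof. by rewrite /zig max_l //; rewrite !ge_min lexx orbT. Qed.
Lemma zig_ge k s : m <= s -> zig k s = 0.
Proof. by move=> h; rewrite /zig max_l // !ge_min subr_le0 h !orbT. Qed.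
Lemma zig_le0 k s : s <= 0 -> zig k s = 0.
Proof. by move=> h; rewrite /zig max_l // ge_min h. Qed.
Lemma zig_id k s : 0 <= s -> s <= k -> s <= m / 2 -> zig k s = s.
Proof.
move=> s0 sk sm; rewrite /zig min_l; last by rewrite le_min sk /=; lra.
by rewrite max_r.
Qed.

(** Between [m] and [1 - m] the whole unit interval is run through; on each end piece the parameter
    makes an excursion from the end, of length at most [k], and comes back. *)
Definition zeta (k s : R) : R := clamp ((s - m) / (1 - 2 * m)) + zig k s - zig k (1 - s).
Definition hth (k r s : R) : R := (1 - r) * s + r * zeta k s.

Lemma zeta_left k s : s <= m -> zeta k s = zig k s.
Proof.
have mi := m_itv.
move=> h; have -> : zeta k s = 0 + zig k s - 0; last by rewrite add0r subr0.
rewrite /zeta [zig k (1 - s)]zig_ge; last by lra.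
by rewrite clamp_le0 // pmulr_lle0 ?invr_gt0; lra.
Qed.

Lemma zeta_right k s : 1 - m <= s -> zeta k s = 1 - zig k (1 - s).
Proof.
have mi := m_itv.
move=> h; rewrite /zeta [zig k s]zig_ge; last by lra.
by rewrite addr0 clamp_ge1 // ler_pdivlMr; lra.
Qed.

Lemma cont_hth T (k r s : T -> R) : continuous k -> continuous r ->
 continuous s -> continuous (fun x => hth (k x) (r x) (s x)).
Proof. by move=> ck cr cs; rewrite /hth /zeta /zig; cont. Qed.

Variables (a b : R -> R -> M) (K : family).
Hypothesis a_loop : Emb_loop I0 a.
Hypothesis b_loop : Emb_loop I0 b.
Hypothesis cK : continuous K.
Hypothesis a_m : forall t s, itv t -> itv s -> s <= m \/ 1 - m <= s -> a t s = I0 s.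
Hypothesis b_m : forall t s, itv t -> itv s -> s <= m \/ 1 - m <= s -> b t s = I0 s.
Hypothesis K_ends : forall t u, itv t -> itv u -> K (vec3 0 t u) = I0 0 /\ K (vec3 1 t u) = I0 1.
Hypothesis K_u : forall t s, itv t -> itv s -> K (vec3 s t 0) = a t s /\ K (vec3 s t 1) = b t s.
Hypothesis K_t : forall u s, itv u -> itv s -> K (vec3 s 0 u) = I0 s /\ K (vec3 s 1 u) = I0 s.

Definition ring (t u : R) : R := plateau t * plateau u.

(** Where [ring] is 1 the arc makes a short excursion along [I0] and back, then follows the arc of
    [K], and finishes with a similar excursion: for [k > 0] it agrees with [I0] near the ends
    although [K] only fixes the endpoints. Where [ring] is 0 it is an arc of [a], of [b] or the arc
    [I0]. For [k = 0] it is a reparametrized arc of [K]. *)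
Definition hair (k : R) (x : 'R_3) : M :=
 let th := hth k (ring (x 0 1) (x 0 2)) (x 0 0) in
 if x 0 0 <= m then I0c th else if 1 - m <= x 0 0 then I0c th
 else K (vec3 th (mu (x 0 1)) (mu (x 0 2))).

Lemma ring_itv t u : itv (ring t u).
Proof.
have /andP[h0 h1] := plateau_itv t; have /andP[h2 h3] := plateau_itv u.
by rewrite mulr_ge0 //= mulr_ile1.
Qed.

(** [ring] is 1 unless [mu] has already sent [t] or [u] to an end of the interval, where the arc of
    [K] is [I0] or an arc of [a] or [b], equal to [I0] on the end pieces. In both cases the pieces
    of [hair] match at [s = m] and [s = 1 - m]. *)
Lemma edge t u : ring t u = 1 \/ forall s, itv s -> s <= m \/ 1 - m <= s ->
 K (vec3 s (mu t) (mu u)) = I0 s.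
Proof.
have [h|h] := leP t 3^-1; first by right=> s si _; rewrite (mu0 h) (K_t (mu_itv _) si).1.
have [h'|h'] := leP (2 / 3) t; first by right=> s si _; rewrite (mu1 h') (K_t (mu_itv _) si).2.
have [g|g] := leP u 3^-1.
 by right=> s si sm; rewrite (mu0 g) (K_u (mu_itv _) si).1 a_m // mu_itv.
have [g'|g'] := leP (2 / 3) u.
 by right=> s si sm; rewrite (mu1 g') (K_u (mu_itv _) si).2 b_m // mu_itv.
by rewrite /ring !plateau1 //; lra.
Qed.

Lemma hth_left k r s : itv r -> 0 <= s -> s <= m -> 0 <= hth k r s <= m.
Proof.
move=> /andP[r0 r1] s0 sm; rewrite /hth zeta_left //.
have h1 := zig_itv k s; have h2 := zig_le k s0.
have e1 : 0 <= (1 - r) * s by rewrite mulr_ge0 // subr_ge0.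
have e2 : 0 <= r * zig k s by rewrite mulr_ge0.
have e3 : r * zig k s <= r * s by rewrite ler_wpM2l.
lra.
Qed.

Lemma hth_right k r s : itv r -> 1 - m <= s -> s <= 1 -> 1 - m <= hth k r s <= 1.
Proof.
move=> /andP[r0 r1] sm s1; rewrite /hth zeta_right //.
have s0 : 0 <= 1 - s by lra.
have h1 := zig_itv k (1 - s); have h2 := zig_le k s0.
have e2 : 0 <= r * zig k (1 - s) by rewrite mulr_ge0.
have e3 : r * zig k (1 - s) <= r * (1 - s) by rewrite ler_wpM2l.
have e4 : 0 <= (1 - r) * (1 - s) by rewrite mulr_ge0 // subr_ge0.
lra.
Qed.

Lemma hair2_cont : continuous (fun z : R * 'R_3 => hair z.1 z.2).
Proof.
have mi := m_itv.
have ci i : continuous (fun z : R * 'R_3 => z.2 0 i).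
 exact: (cont_o (@cont_snd R 'R_3) (@cont_coord 3 i)).
have cp i : continuous (fun z : R * 'R_3 => plateau (z.2 0 i)).
 exact: (cont_o (ci i) cont_plateau).
have cr : continuous (fun z : R * 'R_3 => ring (z.2 0 1) (z.2 0 2)) by apply: cont_mul.
have ct : continuous (fun z : R * 'R_3 => hth z.1 (ring (z.2 0 1) (z.2 0 2)) (z.2 0 0)) by apply: cont_hth .
have cI : continuous (fun z : R * 'R_3 => I0c (hth z.1 (ring (z.2 0 1) (z.2 0 2)) (z.2 0 0))).
 exact: (cont_o ct cont_I0c).
have cm i : continuous (fun z : R * 'R_3 => mu (z.2 0 i)) by exact: (cont_o (ci i) cont_mu).
have cKK : continuous (fun z : R * 'R_3 =>
  K (vec3 (hth z.1 (ring (z.2 0 1) (z.2 0 2)) (z.2 0 0)) (mu (z.2 0 1)) (mu (z.2 0 2)))).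
 by cont.
have junction (z : R * 'R_3) : z.2 0 0 = m \/ z.2 0 0 = 1 - m ->
  I0c (hth z.1 (ring (z.2 0 1) (z.2 0 2)) (z.2 0 0)) =
  K (vec3 (hth z.1 (ring (z.2 0 1) (z.2 0 2)) (z.2 0 0)) (mu (z.2 0 1)) (mu (z.2 0 2))).
 set r := ring _ _; have ri : itv r by exact: ring_itv.
 move=> [->|->].
  have /andP[t0 t1] := hth_left z.1 ri (ltW m0) (lexx m).
  have ti : itv (hth z.1 r m) by lra.
  rewrite /I0c clamp_id //; case: (edge (z.2 0 1) (z.2 0 2)) => [r1|->] //; last by left.
  have -> : hth z.1 r m = 0 by rewrite /hth zeta_left // zig_ge // /r r1; lra.
  by rewrite (K_ends (mu_itv _) (mu_itv _)).1.
 have m1 : 1 - m <= 1 by lra.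
 have /andP[t0 t1] := hth_right z.1 ri (lexx (1 - m)) m1.
 have ti : itv (hth z.1 r (1 - m)) by lra.
 rewrite /I0c clamp_id //; case: (edge (z.2 0 1) (z.2 0 2)) => [r1|->] //; last by right.
 have -> : hth z.1 r (1 - m) = 1 by rewrite /hth zeta_right // zig_ge; [rewrite /r r1; lra|lra].
 by rewrite (K_ends (mu_itv _) (mu_itv _)).2.
apply: paste_le => //.
 apply: paste_le => //.
 by move=> z E; apply: junction; right.
move=> z E; have -> : (1 - m <= z.2 0 0) = false by rewrite E; rewrite lt_geF //; lra.
by apply: junction; left.
Qed.

Lemma hair_cont k : continuous (hair k).
Proof.
apply: (cont_o (f := fun x : 'R_3 => (k, x)) _ hair2_cont).
by cont.
Qed.

Lemma hair_ends k (x : 'R_3) : (x 0 0 = 0 -> hair k x = I0 0) /\ (x 0 0 = 1 -> hair k x = I0 1).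
Proof.
have mi := m_itv.
rewrite /hair; split=> ->.
 rewrite /I0c /hth zeta_left ?(ltW m0) // zig_le0 // !mulr0 addr0.
 by rewrite clamp0.
have -> : (1 <= m) = false by lra.
have -> : 1 - m <= 1 by lra.
rewrite /I0c /hth zeta_right; last by lra.
rewrite zig_le0 // subr0 !mulr1 subrK.
by rewrite clamp1.
Qed.

Lemma hair_near k (x : 'R_3) : Q x -> 0 < k ->
 x 0 0 <= Num.min k (m / 2) \/ 1 - Num.min k (m / 2) <= x 0 0 -> hair k x = I0 (x 0 0).
Proof.
have mi := m_itv.
move=> Qx k0; have xi := Qx 0; have /andP[x0 x1] := xi.
have mk : Num.min k (m / 2) <= k by rewrite ge_min lexx.
have mm : Num.min k (m / 2) <= m / 2 by rewrite ge_min lexx orbT.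
rewrite /hair => -[h|h].
 have -> : x 0 0 <= m by lra.
 rewrite /I0c /hth zeta_left; last by lra.
 have -> : zig k (x 0 0) = x 0 0 by apply: zig_id; lra.
 by rewrite mulrBl mul1r subrK clamp_id.
have -> : (x 0 0 <= m) = false by lra.
have -> : 1 - m <= x 0 0 by lra.
rewrite /I0c /hth zeta_right; last by lra.
have -> : zig k (1 - x 0 0) = 1 - x 0 0 by apply: zig_id; lra.
have -> : (1 - ring (x 0 1) (x 0 2)) * x 0 0 + ring (x 0 1) (x 0 2) * (1 - (1 - x 0 0)) = x 0 0.
 lra.
by rewrite clamp_id.
Qed.

Lemma hth_r0 k s : hth k 0 s = s.
Proof. by rewrite /hth subr0 mul1r mul0r addr0. Qed.

Lemma hair_face k (x : 'R_3) : Q x ->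
 [/\ x 0 1 <= 6^-1 \/ 5 / 6 <= x 0 1 -> hair k x = I0 (x 0 0),
   x 0 2 <= 6^-1 -> hair k x = a (mu (x 0 1)) (x 0 0) &
   5 / 6 <= x 0 2 -> hair k x = b (mu (x 0 1)) (x 0 0)].
Proof.
move=> Qx; have xi := Qx 0; rewrite /hair; split=> h.
- have -> : ring (x 0 1) (x 0 2) = 0 by rewrite /ring plateau0 ?mul0r.
 rewrite hth_r0 /I0c clamp_id //; case: ifP => // _; case: ifP => // _.
 case: h => h; first by rewrite mu0 ?(K_t (mu_itv _) xi).1 //; lra.
 by rewrite mu1 ?(K_t (mu_itv _) xi).2 //; lra.
- have -> : ring (x 0 1) (x 0 2) = 0 by rewrite /ring (plateau0 (or_introl h)) mulr0.
 rewrite hth_r0 /I0c clamp_id //.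
 case: ifP => [sm|_]; first by rewrite a_m ?mu_itv //; left.
 case: ifP => [sm|_]; first by rewrite a_m ?mu_itv //; right.
 by rewrite [mu (x 0 2)]mu0 ?(K_u (mu_itv _) xi).1 //; lra.
have -> : ring (x 0 1) (x 0 2) = 0 by rewrite /ring (plateau0 (or_intror h)) mulr0.
rewrite hth_r0 /I0c clamp_id //.
case: ifP => [sm|_]; first by rewrite b_m ?mu_itv //; left.
case: ifP => [sm|_]; first by rewrite b_m ?mu_itv //; right.
by rewrite [mu (x 0 2)]mu1 ?(K_u (mu_itv _) xi).2 //; lra.
Qed.

Lemma emb_immersed (e : R -> R -> M) x : Emb_loop I0 e -> Q x ->
 immersed_at (fun x : 'R_3 => e (mu (x 0 1)) (x 0 0)) x.
Proof.
move=> [se ee _] Qx; have /cube3P[x0 x1 x2] := Qx.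
pose pr (x : 'R_3) : 'R_2 := vec2 (x 0 0) (mu (x 0 1)).
have spr : Cinfty setT pr.
 apply: Cinfty_vec2 => [|k|k]; [exact: openT|exact: ck_coord|].
 by apply: smooth1_mu.
have cpr y : Q y -> cube 2 (pr y) by move=> /cube3P[y0 y1 y2]; apply/cube2P; rewrite !vecE; split=> //; exact: mu_itv.
have [c [J dJ]] := se _ (cpr x Qx).
have [S dS] := @diff_on_Cinfty 3 2 pr setT Q x openT I spr.
have dm : mdiff (fun x : 'R_3 => e (mu (x 0 1)) (x 0 0)) Q x c (S *m J).
 apply: mdiff_eq (mdiff_comp Qx _ dS dJ).
  by apply: all_near => y; rewrite /= !vecE.
 exact: within_all.
exists c, (S *m J); split=> //; apply/lift_diff_free.
rewrite [x]vec3_eta in dm Qx.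
apply: (slice_immersed (A := fun t u s => e (mu t) s) Qx dm).
by have [] := ee _ (mu_itv (x 0 1)).
Qed.

Lemma Emb_inj f s s' : Emb I0 f -> itv s -> itv s' -> f s = f s' -> s = s'.
Proof. by move=> [pa _] si si'; apply: set_inj_itv => //; exact: proper_arc_inj. Qed.

Lemma Emb_boundary f s : Emb I0 f -> itv s -> (boundary (f s) <-> s = 0 \/ s = 1).
Proof. by move=> /Emb_Maps[_ h _]; exact: h. Qed.

Lemma immersed_near (f g : family) (W : set 'R_3) x : open W -> W x -> (forall y, W y -> Q y -> g y = f y) ->
 immersed_at g x -> immersed_at f x.
Proof.
move=> oW Wx gf [c [J [dm J0]]]; exists c, J; split=> //; apply: mdiff_eq dm.
by apply: filterS (open_near oW Wx gf) => y h.
Qed.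

Lemma coord_lt (i : 'I_3) (r : R) : open [set y : 'R_3 | y 0 i < r].
Proof. exact: (open_pre (@cont_coord 3 i) (@open_lt R r)). Qed.

Lemma coord_gt (i : 'I_3) (r : R) : open [set y : 'R_3 | r < y 0 i].
Proof. exact: (open_pre (@cont_coord 3 i) (@open_gt R r)). Qed.

Lemma not_coreo (e : R) (x : 'R_3) : ~ coreo e x -> exists i, x 0 i <= e \/ 1 - e <= x 0 i.
Proof.
move=> nx; apply: contrapT => h; apply: nx => i; rewrite !ltNge.
by apply/andP; split; apply/negP => hh; apply: h; exists i; [left|right].
Qed.

Lemma coord_cases (P : 'I_3 -> Prop) i : P i -> [\/ P 0, P 1 | P 2].
Proof. by move: i; apply: I3_ind => h; [constructor 1|constructor 2|constructor 3]. Qed.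

(* near the boundary of the cube, [hair k] is a family of embedded arcs *)
Lemma hair_good_off k e : 0 < k -> e < Num.min k (m / 2) -> e < 6^-1 -> 0 <= e -> good_off (hair k) e.
Proof.
move=> k0 ek e6 e0; have Ia := I0_Emb.
have aE t : Emb I0 (a (mu t)) by have [_ h _] := a_loop; apply: h; exact: mu_itv.
have bE t : Emb I0 (b (mu t)) by have [_ h _] := b_loop; apply: h; exact: mu_itv.
have loc x : Q x -> ~ coreo e x -> [/\ immersed_at (hair k) x &
  exists2 f, Emb I0 f & hair k x = f (x 0 0)].
 move=> Qx /not_coreo[i /(coord_cases (P := fun i => x 0 i <= e \/ 1 - e <= x 0 i))[]] h.
 - split; last by exists I0 => //; apply: hair_near => //; lra.
  apply: (immersed_near (openU (@coord_lt 0 (Num.min k (m / 2))) (@coord_gt 0 (1 - Num.min k (m / 2))))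
   (g := fun y => I0 (y 0 0))).
  + by case: h => h; [left|right] => /=; lra.
  + by move=> y /= hy Qy; apply/esym/hair_near => //; case: hy => /ltW hy; [left|right].
  exact: emb_immersed I0_loop Qx.
 - split; last first.
   exists I0 => //; have [h1 _ _] := hair_face k Qx; apply: h1; lra.
  apply: (immersed_near (openU (@coord_lt 1 6^-1) (@coord_gt 1 (5 / 6))) (g := fun y => I0 (y 0 0))).
  + by case: h => h; [left|right] => /=; lra.
  + move=> y /= hy Qy; have [h1 _ _] := hair_face k Qy; apply/esym/h1.
   by case: hy => /ltW hy; [left|right].
  exact: emb_immersed I0_loop Qx.
 case: h => h; split.
 - apply: (immersed_near (@coord_lt 2 6^-1) (g := fun y => a (mu (y 0 1)) (y 0 0))); first by move=> /=; lra.
   by move=> y /= hy Qy; have [_ h1 _] := hair_face k Qy; apply/esym/h1; exact: ltW.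
  exact: emb_immersed a_loop Qx.
 - by exists (a (mu (x 0 1))) => //; have [_ h1 _] := hair_face k Qx; apply: h1; lra.
 - apply: (immersed_near (@coord_gt 2 (5 / 6)) (g := fun y => b (mu (y 0 1)) (y 0 0))); first by move=> /=; lra.
   by move=> y /= hy Qy; have [_ _ h1] := hair_face k Qy; apply/esym/h1; exact: ltW.
  exact: emb_immersed b_loop Qx.
 by exists (b (mu (x 0 1))) => //; have [_ _ h1] := hair_face k Qx; apply: h1; lra.
split.
- exact: hair_cont.
- by move=> x Qx /(loc x Qx)[].
- by move=> x Qx /(loc x Qx)[_ [f ef ->]]; exact: Emb_boundary.
move=> x y Qx Qy [f1 f2] nx ny E; apply: fib_eq => //.
have same (f : R -> M) : Emb I0 f -> hair k x = f (x 0 0) -> hair k y = f (y 0 0) -> x 0 0 = y 0 0.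
 by move=> ef ex ey; apply: (Emb_inj ef (Qx 0) (Qy 0)); rewrite -ex -ey.
have [hx1 hx2 hx3] := hair_face k Qx; have [hy1 hy2 hy3] := hair_face k Qy.
have [h|h] := leP (x 0 1) 6^-1; first by apply: (same I0) => //; [apply: hx1|apply: hy1]; left; rewrite -?f1.
have [h'|h'] := leP (5 / 6) (x 0 1); first by apply: (same I0) => //; [apply: hx1|apply: hy1]; right; rewrite -?f1.
have [g|g] := leP (x 0 2) 6^-1.
 by apply: (same (a (mu (x 0 1)))) => //; [apply: hx2|rewrite f1; apply: hy2; rewrite -f2].
have [g'|g'] := leP (5 / 6) (x 0 2).
 by apply: (same (b (mu (x 0 1)))) => //; [apply: hx3|rewrite f1; apply: hy3; rewrite -f2].
have fin (z : 'R_3) : z 0 1 = x 0 1 -> z 0 2 = x 0 2 -> ~ coreo e z -> z 0 0 <= Num.min k (m / 2) \/ 1 - Num.min k (m / 2) <= z 0 0.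
 move=> z1 z2 /not_coreo[i /(coord_cases (P := fun i => z 0 i <= e \/ 1 - e <= z 0 i))[]] hz.
 - by case: hz => hz; [left|right]; lra.
 - by exfalso; rewrite z1 in hz; lra.
 by exfalso; rewrite z2 in hz; lra.
by apply: (same I0) => //; apply: hair_near => //; apply: fin.
Qed.

(** [hair] is jointly continuous in [k] and the point; by compactness of the cube its graph stays in
    [G] for all small [k], and letting [k] grow from 0 is the homotopy. *)
Lemma hair_hom G : open G -> (forall x, Q x -> G (x, hair 0 x)) ->
 exists2 k0, 0 < k0 & forall k, 0 < k -> k < k0 -> hom_in G (hair 0) (hair k).
Proof.
move=> oG G0.
have [k0 k00 hk0] : exists2 k0, 0 < k0 & forall x, Q x -> forall k, 0 <= k -> k <= k0 -> Q x -> G (x, hair k x).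
 apply: (compact_small).
  exact: cube_compact.
 move=> z0 Qz0.
 have cg : continuous (fun z : R * 'R_3 => (z.2, hair z.1 z.2)) by apply: cont_pairg => //; exact: hair2_cont.
 have nG : nbhs (z0, hair 0 z0) G by apply: nbhsO => //; exact: G0.
 have := cg (0, z0) _ nG; move=> [[A B] /= [nA nB] AB].
 have /nbhs_normP[d1 /= d10 hd1] := nA; have /nbhs_normP[d2 /= d20 hd2] := nB.
 exists (Num.min d1 d2); first by rewrite lt_min d10.
 move=> z e; rewrite !lt_min => /andP[_ hz] /andP[e0 /andP[ed _]] k k0 ke Qz.
 apply: (AB (k, z)); split=> /=.
  by apply: hd1; rewrite /ball_/= sub0r normrN ger0_norm //; exact: le_lt_trans ed.
 by apply: hd2; rewrite /ball_/= distrC.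
exists k0 => // k kp kk; exists (fun r x => hair (r * k) x); split.
- apply: (cont_o (f := fun z : R * 'R_3 => (z.1 * k, z.2)) _ hair2_cont).
 by cont.
- by rewrite mul0r mul1r.
- move=> r x /andP[r0 r1] Qx; apply: hk0 => //; first by rewrite mulr_ge0 // ltW.
 by apply: le_trans (ltW kk); apply: ler_piMl => //; exact: ltW.
move=> r x ri [x0|x1].
 by rewrite !(hair_ends _ x).1.
by rewrite !(hair_ends _ x).2.
Qed.

Lemma tame_reparam (g : R -> M) (th : R -> R) : continuous g -> continuous th ->
 th 0 = 0 -> th 1 = 1 -> {homo th : x y / x <= y} -> g 0 = I0 0 -> g 1 = I0 1 ->
 tame I0 g -> tame I0 (fun s => g (th s)).
Proof.
move=> cg cth t0 t1 hth' g0 g1 tg p q p0 pq q1 E.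
have tp : 0 <= th p by rewrite -t0; apply: hth'.
have tq : th q <= 1 by rewrite -t1; apply: hth'.
apply: bhom_trans (tg _ _ tp (hth' _ _ pq) tq E) _.
have c1r : continuous (fun z : R * R => 1 - z.1) by cont.
pose H r s := if s <= 2^-1 then g ((1 - r) * (2 * s * th p) + r * th (2 * s * p))
 else g ((1 - r) * (th q + (2 * s - 1) * (1 - th q)) + r * th (q + (2 * s - 1) * (1 - q))).
have h12 : (1 <= 2^-1 :> R) = false by lra.
apply: (bhom_intro (H := H)).
- apply: paste_le; [exact: cont_snd|exact: cont_cst| | |].
 + by cont.
 + by cont.
 move=> z ->; rewrite mulfV // !mul1r subrr !mul0r !addr0.
 by rewrite -!mulrDl subrK !mul1r.
- move=> r _; rewrite /H invr_ge0 ler0n h12 !mulr0 !mul0r t0 !mulr0 !addr0 g0.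
 split; first by exists 0; first exact: itv0.
 have -> : 2 * 1 - 1 = 1 :> R by lra.
 rewrite !mul1r !(addrCA (th q)) !(addrCA q) !subrr !addr0 t1.
 by rewrite addrC !mulr1 addrC subrK; exists 1; first exact: itv1.
move=> s _; rewrite /H /shortcut subr0 subrr; split; case: ifP => _; rewrite ?mul1r ?mul0r ?addr0 ?add0r //.
Qed.

Lemma tame_eq (g h : R -> M) : (forall s, itv s -> g s = h s) -> tame I0 g -> tame I0 h.
Proof.
move=> gh tg p q p0 pq q1 E.
have pi : itv p by lra. have qi : itv q by lra.
apply: bhom_eq (tg p q p0 pq q1 _) => //; last by rewrite !gh.
move=> s /andP[s0 s1]; rewrite /shortcut; case: ifP => hs; apply: gh.
 by rewrite !mulr_ge0 //= mulr_ile1 //; lra.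
have e1 : 0 <= (2 * s - 1) * (1 - q) by rewrite mulr_ge0 //; lra.
have e2 : (2 * s - 1) * (1 - q) <= 1 - q by rewrite ler_piMl //; lra.
lra.
Qed.

Lemma hth0_homo r : itv r -> {homo hth 0 r : x y / x <= y}.
Proof.
have mi := m_itv.
move=> /andP[r0 r1] x y xy; rewrite /hth /zeta !zig0 !subr0 !addr0.
apply: lerD; first by rewrite ler_wpM2l // subr_ge0.
apply: ler_wpM2l => //; apply: clamp_homo; rewrite ler_pM2r ?invr_gt0; last by lra.
lra.
Qed.

Lemma hth0_ends r : hth 0 r 0 = 0 /\ hth 0 r 1 = 1.
Proof.
have mi := m_itv.
rewrite /hth /zeta !zig0 !subr0 !addr0; split.
 rewrite clamp_le0 ?mulr0 ?addr0 //.
 by rewrite pmulr_lle0 ?invr_gt0; lra.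
rewrite clamp_ge1 ?mulr1 ?subrK //.
by rewrite ler_pdivlMr; lra.
Qed.

Lemma hair0_tame x : (forall t u, itv t -> itv u -> tame I0 (fun s => K (vec3 s t u))) -> tame I0 (arc (hair 0) x).
Proof.
have mi := m_itv.
move=> tK; set r := ring (x 0 1) (x 0 2); have ri : itv r := ring_itv _ _.
have tKx := tK _ _ (mu_itv (x 0 1)) (mu_itv (x 0 2)).
have [h0 h1] := hth0_ends r; have [K0 K1] := K_ends (mu_itv (x 0 1)) (mu_itv (x 0 2)).
apply: (@tame_eq (fun s => K (vec3 (hth 0 r s) (mu (x 0 1)) (mu (x 0 2))))); last first.
 apply: (tame_reparam (g := fun s => K (vec3 s (mu (x 0 1)) (mu (x 0 2)))) (th := hth 0 r)) => //.
 - by cont.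
 - by apply: cont_hth.
 exact: hth0_homo.
move=> s /andP[s0 s1]; rewrite /arc /hair !vecE -/r.
have hz : s <= m -> hth 0 r s = (1 - r) * s by move=> sm; rewrite /hth zeta_left // zig0 mulr0 addr0.
case: ifP => sm.
 have /andP[t0 t1] := hth_left 0 ri s0 sm.
 have ti : itv (hth 0 r s) by lra.
 rewrite /I0c clamp_id //; case: (edge (x 0 1) (x 0 2)) => [r1|->] //; last by left.
 by rewrite hz // /r r1 subrr mul0r.
case: ifP => sm' //.
have /andP[t0 t1] := hth_right 0 ri sm' s1.
have ti : itv (hth 0 r s) by lra.
rewrite /I0c clamp_id //; case: (edge (x 0 1) (x 0 2)) => [r1|->] //; last by right.
have -> : hth 0 r s = 1 by rewrite /hth zeta_right // zig0 /r r1; lra.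
exact: K1.
Qed.

(** The homotopy is [hair k] for a small [k], made generic away from the boundary of the cube. When
    the arcs of [K] are tame, so are those of [hair 0], and by [persistence] all double points of
    the nearby generic family have trivial group element. *)
Lemma homotopy_GH : exists2 A, GH I0 (fun t => a (mu t)) (fun t => b (mu t)) A &
 (forall t u, itv t -> itv u -> tame I0 (fun s => K (vec3 s t u))) -> dax_sum I0 A = 0.
Proof.
have mi := m_itv.
(* Without tameness nothing is asked of the double points, and the neighbourhood is the whole
   space. *)
have [G [oG G0 triv]] : exists G, [/\ open G, (forall x, Q x -> G (x, hair 0 x)) &
  (forall t u, itv t -> itv u -> tame I0 (fun s => K (vec3 s t u))) ->
  forall f, hom_in G (hair 0) f -> forall x y, Q x -> Q y -> fib x y -> x 0 0 < y 0 0 -> f x = f y ->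
   based_homotopic I0 I0 (shortcut (arc f x) (x 0 0) (y 0 0))].
 have [tK|nt] := pselect (forall t u, itv t -> itv u -> tame I0 (fun s => K (vec3 s t u))).
  have [G [oG G0 h]] := @persistence I0 (hair 0) (@hair_cont 0) (fun x _ => @hair_ends 0 x)
   (fun x _ => @hair0_tame x tK).
  by exists G.
 by exists setT.
have [k0 k00 hk] := hair_hom oG G0.
pose k := k0 / 2; have kp : 0 < k by rewrite divr_gt0.
have Hk : hom_in G (hair 0) (hair k) by apply: hk; rewrite /k; lra.
(* [generic_approx] asks for good behaviour up to the margin [5 * e], which must stay below the
   length [min k (m / 2)] of agreement with [I0] and below the margin [1/6] of [plateau]. *)
pose e := Num.min (Num.min k (m / 2)) 6^-1 / 10.
have mn0 : 0 < Num.min (Num.min k (m / 2)) 6^-1 by rewrite !lt_min; lra.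
have e0 : 0 < e by rewrite divr_gt0.
have e1 : 5 * e < Num.min k (m / 2).
 have : Num.min (Num.min k (m / 2)) 6^-1 <= Num.min k (m / 2) by rewrite ge_min lexx.
 rewrite /e; lra.
have e2 : 5 * e < 6^-1.
 have : Num.min (Num.min k (m / 2)) 6^-1 <= 6^-1 by rewrite ge_min lexx orbT.
 rewrite /e; lra.
have e3 : 0 <= 5 * e by lra.
have go := hair_good_off kp e1 e2 e3.
have [f [sf im [tr [d d0 dj]] nt Hf]] := generic_approx e0 go oG (hom_in_graph Hk).
have [[cf ff1] _ bf] := sf.
have Hf0 := hom_in_trans Hk Hf.
have out x : Q x -> (exists i, x 0 i <= e \/ 1 - e <= x 0 i) -> f x = hair k x.
 by move=> Qx [i hi]; apply: ff1 => h; have := h i; lra.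
have gen := of_map_generic d0 cf im tr dj nt.
have vQ (s t u : R) : itv s -> itv t -> itv u -> Q (vec3 s t u) by move=> si ti ui; apply/cube3P; rewrite !vecE.
exists (of_map f).
 split=> //.
 - by rewrite of_mapE; exact: cont_within.
 - move=> t u ti ui; split.
  + apply: cont_within; apply: (cont_o _ cf).
   by cont.
  + move=> s si; have Qx := vQ s t u si ti ui.
   have [h|h] := pselect (coreo e (vec3 s t u)).
    split; first by move=> /(bf _ h).
    by have := h 0; rewrite vecE => hs [] E; rewrite E in hs; lra.
   rewrite /of_map ff1 //.
   have ne : ~ coreo (5 * e) (vec3 s t u) by move=> h'; apply: h; apply: coreo_sub h'; lra.
   by have := go_bnd go Qx ne; rewrite vecE.
  exists e => // s si hs; have Qx := vQ s t u si ti ui.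
  rewrite /of_map out //; last by exists 0; rewrite vecE.
  have -> : I0 s = I0 (vec3 s t u 0 0) by rewrite vecE.
  by apply: hair_near => //; rewrite vecE; case: hs => hs; [left|right]; lra.
 - exists e => // t u s ti ui si; have Qx := vQ s t u si ti ui.
  have [_ h2 h3] := hair_face k Qx; rewrite !vecE in h2 h3.
  split=> hu.
   by rewrite /of_map out; [apply: h2; lra|done|exists 2; rewrite vecE; left].
  by rewrite /of_map out; [apply: h3; lra|done|exists 2; rewrite vecE; right].
 move=> u s ui si;
 have Q0 := vQ s 0 u si itv0 ui; have Q1 := vQ s 1 u si itv1 ui.
 have [h0 _ _] := hair_face k Q0; have [h1 _ _] := hair_face k Q1; rewrite !vecE in h0 h1.
 split; rewrite /of_map out //; try (by exists 1; [left; lra|right; lra]).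
 - by apply: h0; lra.
 - by exists 1; rewrite vecE; left; lra.
 - by apply: h1; lra.
 by exists 1; rewrite vecE; right; lra.
move=> tK; rewrite /dax_sum; apply: fsbig1 => -[[[p q] t] u] h.
have [Qp Qq] := dp_det_itv h; have [[p0 pq q1 ti ui] E] := h.
apply: dp_term_trivial; first exact: I0_based.
have fb : fib (vec3 p t u : 'R_3) (vec3 q t u) by rewrite /fib !vecE.
have lt : vec3 p t u 0 0 < vec3 q t u 0 0 by rewrite !vecE.
have := triv tK f Hf0 _ _ Qp Qq fb lt E.
have -> : arc f (vec3 p t u) = of_map f t u by apply/funext => s; rewrite /arc !vecE.
by rewrite !vecE.
Qed.

End Hair.

(** * Removing the reparametrization of time *)

Section TimeReparametrization.
Variable I0 : R -> M.

Lemma msmooth_reparam n (a : R -> R -> M) (th : 'R_n.+1 -> R) : Emb_loop I0 a ->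
 (forall k, ck k setT th) -> (forall x, cube n.+1 x -> itv (th x)) ->
 msmooth (fun x : 'R_n.+1 => a (th x) (x 0 0)) (cube n.+1).
Proof.
move=> [sa _ _] sth ith x Qx.
pose pr (x : 'R_n.+1) : 'R_2 := vec2 (x 0 0) (th x).
have spr : Cinfty setT pr.
 exact: Cinfty_vec2.
have cpr y : cube n.+1 y -> cube 2 (pr y) by move=> Qy; apply/cube2P; rewrite !vecE; split; [exact: Qy|exact: ith].
have [c [J dJ]] := sa _ (cpr x Qx).
have [S dS] := @diff_on_Cinfty n.+1 2 pr setT (cube n.+1) x openT I spr.
exists c, (S *m J); apply: mdiff_eq (mdiff_comp Qx _ dS dJ).
 by apply: all_near => y; rewrite /= !vecE.
exact: within_all.
Qed.

Definition mid (r t : R) : R := (1 - r) * t + r * mu t.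

Lemma mid_itv r t : itv r -> itv t -> itv (mid r t).
Proof.
move=> /andP[r0 r1] /andP[t0 t1]; have /andP[m0 m1] := mu_itv t.
have s1 : 0 <= 1 - r by lra.
rewrite /mid addr_ge0 ?(mulr_ge0 s1 t0) ?(mulr_ge0 r0 m0) //=.
have h1 := ler_wpM2l s1 t1; have h2 := ler_wpM2l r0 m1.
lra.
Qed.

Lemma ck_mid n k (f g : 'R_n -> R) : ck k setT f -> ck k setT g ->
 ck k setT (fun x => mid (f x) (g x)).
Proof.
move=> kf kg; apply: ckD; [exact: openT| |]; apply: ckM => //; try exact: openT.
 by smooth.
by apply: smooth1_mu.
Qed.

Lemma Emb_loop_mu a : Emb_loop I0 a -> Emb_loop_homotopic I0 a (fun t => a (mu t)).
Proof.
move=> la; have [_ ea ends] := la.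
have lm r : itv r -> Emb_loop I0 (fun t => a (mid r t)).
 move=> ri; split.
 - apply: (@msmooth_reparam 1 a (fun x => mid r (x 0 1))) => //.
   by move=> k; apply: ck_mid.
  by move=> x Qx; apply: mid_itv.
 - by move=> t ti; apply: ea; exact: mid_itv.
 move=> s si; have m0 : mid r 0 = 0 by rewrite /mid mu0 ?mulr0 ?addr0 // invr_ge0.
 have m1 : mid r 1 = 1 by rewrite /mid mu1 //; lra.
 by rewrite m0 m1; exact: ends.
split=> //.
 have := lm 1 itv1; congr (Emb_loop I0 _); apply/funext => t.
 by rewrite /mid subrr mul0r add0r mul1r.
exists (fun r t s => a (mid r t) s); split=> //.
 apply: (@msmooth_reparam 2 a (fun x => mid (x 0 2) (x 0 1))) => //.
  by move=> k; apply: ck_mid.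
 by move=> x Qx; apply: mid_itv.
by move=> t s _ _; rewrite /mid subr0 subrr !mul0r !mul1r addr0 add0r.
Qed.

(** [homotopy_GH] joins the loops slowed down by [mu]; isotopies of count 0 on both sides lead back
    to [a] and [b]. *)
Lemma dax_homotopy m a b (K : 'R_3 -> M) : Emb_loop I0 (fun=> I0) -> 0 < m -> m <= 4^-1 ->
 Emb_loop I0 a -> Emb_loop I0 b -> continuous K ->
 (forall t s, itv t -> itv s -> s <= m \/ 1 - m <= s -> a t s = I0 s) ->
 (forall t s, itv t -> itv s -> s <= m \/ 1 - m <= s -> b t s = I0 s) ->
 (forall t u, itv t -> itv u -> K (vec3 0 t u) = I0 0 /\ K (vec3 1 t u) = I0 1) ->
 (forall t s, itv t -> itv s -> K (vec3 s t 0) = a t s /\ K (vec3 s t 1) = b t s) ->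
 (forall u s, itv u -> itv s -> K (vec3 s 0 u) = I0 s /\ K (vec3 s 1 u) = I0 s) ->
 exists2 A, GH I0 a b A &
  (forall t u, itv t -> itv u -> tame I0 (fun s => K (vec3 s t u))) -> dax_sum I0 A = 0.
Proof.
move=> lI m0 m4 la lb cK am bm Ke Ku Kt.
have [A hA A0] := homotopy_GH lI m0 m4 la lb cK am bm Ke Ku Kt.
have [B hB B0] := GH_Emb (Emb_loop_mu la); have [C hC C0] := GH_Emb (Emb_loop_mu lb).
have inj e t : Emb_loop I0 e -> itv t -> set_inj unit_itv (e t).
 by move=> [_ he _] ti; have [pa _] := he t ti; exact: proper_arc_inj.
have [hC' EC] := GH_rev hC; have lam := Emb_loop_mu la; have lbm := Emb_loop_mu lb.
have [h1 E1] := GH_glue hB hA (fun t ti => inj _ t (let: And3 _ h _ := lam in h) ti).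
have [h2 E2] := GH_glue h1 hC' (fun t ti => inj _ t (let: And3 _ h _ := lbm in h) ti).
exists (glue_family (glue_family B A) (rev_family C)) => // tK.
by rewrite E2 E1 EC C0 A0 // oppr0 !addr0.
Qed.

End TimeReparametrization.

(** * Tame discs and paths of discs *)

Section DiscPaths.
Variable D0 : 'R_2 -> M.
Local Notation I0 := (core_arc D0).
Implicit Types (D Y H : 'R_2 -> M) (s v : R).

Lemma circle_disc x : circle x -> disc x.
Proof. by rewrite /disc /= => ->. Qed.

Lemma disc_segment (x y : 'R_2) r : disc x -> disc y -> itv r -> disc ((1 - r) *: x + r *: y).
Proof.
rewrite /Defs.disc /= !mxE => hx hy /andP[r0 r1].
set a := x 0 0 in hx *; set b := x 0 1 in hx *; set c := y 0 0 in hy *; set d := y 0 1 in hy *.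
have e1 : 0 <= r * (1 - r) * ((a - c) ^+ 2 + (b - d) ^+ 2) by rewrite !mulr_ge0 ?subr_ge0 // addr_ge0 // sqr_ge0.
have e2 : (1 - r) * (a ^+ 2 + b ^+ 2) <= 1 - r by rewrite ler_piMr // subr_ge0.
have e3 : r * (c ^+ 2 + d ^+ 2) <= r by rewrite ler_piMr.
have -> : ((1 - r) * a + r * c) ^+ 2 + ((1 - r) * b + r * d) ^+ 2 =
 (1 - r) * (a ^+ 2 + b ^+ 2) + r * (c ^+ 2 + d ^+ 2) - r * (1 - r) * ((a - c) ^+ 2 + (b - d) ^+ 2) by ring.
lra.
Qed.

Lemma half_sqr_le1 (y : R) : y ^+ 2 <= 1 -> 0 <= 1 - y ^+ 2 / 2.
Proof. lra. Qed.

Lemma itv_sqr v : itv v -> (2 * v - 1) ^+ 2 <= 1.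
Proof. move=> /andP[v0 v1]; have v1' : 0 <= 1 - v by rewrite subr_ge0.
by have := mulr_ge0 v0 v1'; lra. Qed.

Lemma square_discE s v : itv s -> itv v ->
 (square_disc s v 0 0) ^+ 2 + (square_disc s v 0 1) ^+ 2 =
 1 - (1 - (2 * s - 1) ^+ 2) * (1 - (2 * v - 1) ^+ 2).
Proof.
move=> /itv_sqr hs /itv_sqr hv; rewrite /square_disc !vecE !exprMn !sqr_sqrtr ?half_sqr_le1 //.
by field.
Qed.

Lemma sq_disc_in s v : itv s -> itv v -> disc (square_disc s v).
Proof.
move=> si vi; rewrite /Defs.disc /= square_discE // lerBlDr ler_wpDr // mulr_ge0 // subr_ge0; exact: itv_sqr.
Qed.

Lemma sq_disc_circle s v : itv s -> itv v -> [\/ s = 0, s = 1, v = 0 | v = 1] ->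
 circle (square_disc s v).
Proof.
move=> si vi h; rewrite /Defs.circle /= square_discE //.
have k0 : 1 - (2 * 0 - 1) ^+ 2 = 0 :> R by ring.
have k1 : 1 - (2 * 1 - 1) ^+ 2 = 0 :> R by ring.
by case: h => ->; rewrite ?k0 ?k1 ?mul0r ?mulr0 subr0.
Qed.

Lemma sq_disc_mid s : square_disc s 2^-1 = vec2 (2 * s - 1) 0.
Proof.
rewrite /square_disc divff // subrr expr0n /= !mul0r subr0 sqrtr1 mulr1.
by [].
Qed.

Lemma cont_square_disc T (f g : T -> R) : continuous f -> continuous g ->
 continuous (fun x => square_disc (f x) (g x)).
Proof.
by move=> cf cg; rewrite /square_disc; cont.
Qed.

Definition sq (z : R * R) : 'R_2 := square_disc (clamp z.1) (clamp z.2).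

Lemma sq_disc z : disc (sq z).
Proof. by apply: sq_disc_in; exact: clamp_itv. Qed.

Lemma sqE s v : itv s -> itv v -> sq (s, v) = square_disc s v.
Proof. by move=> si vi; rewrite /sq !clamp_id. Qed.

Lemma cont_sq : continuous sq.
Proof. by apply: cont_square_disc; cont. Qed.

Lemma disc_compact : compact disc.
Proof.
apply: (subclosed_compact _ (@cball_compact 1 0 1)).
 pose n2 (x : 'R_2) := x 0 0 ^+ 2 + x 0 1 ^+ 2.
 have cn : continuous n2 by rewrite /n2; cont.
 have -> : disc = n2 @^-1` [set a | a <= 1] by [].
 by apply: closed_preimage.
move=> x; rewrite /Defs.disc /cball /= subr0 => h; apply: norm_row_le => // i.
have h0 := sqr_ge0 (x 0 0); have h1 := sqr_ge0 (x 0 1).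
have {h} : x 0 i ^+ 2 <= 1 by move: i; apply: I2_ind; lra.
by rewrite ler_norml => h; nra.
Qed.

Lemma disc_cont D : proper_disc D -> {within disc, continuous D}.
Proof.
move=> [_ sm _ _]; apply/subspace_continuousP => x dx; have [c [J [d _]]] := sm x dx.
exact: mdiff_cont dx d.
Qed.

Lemma cont_disc_o (T S : topologicalType) (f : 'R_2 -> S) (w : T -> 'R_2) : {within disc, continuous f} ->
 continuous w -> (forall x, disc (w x)) -> continuous (fun x => f (w x)).
Proof.
move=> cf cw dw x; apply: (within_comp (g := w) cf) => //; last exact: cw.
exact: near_all.
Qed.

(** Tameness of the images of all paths in the disc between the two ends of the horizontal diameter;
    the arcs that sweep a disc are of this kind. *)
Definition tame_disc Y := forall w : R -> 'R_2, continuous w -> (forall s, disc (w s)) ->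
 w 0 = vec2 (-1) 0 -> w 1 = vec2 1 0 -> tame I0 (fun s => Y (w s)).

Lemma disc_chord Y (w w' : R -> 'R_2) : {within disc, continuous Y} -> continuous w -> continuous w' ->
 (forall s, disc (w s)) -> (forall s, disc (w' s)) -> w 0 = w' 0 -> w 1 = w' 1 ->
 Y (w 0) = I0 0 -> Y (w 1) = I0 1 -> based_homotopic I0 (fun s => Y (w s)) (fun s => Y (w' s)).
Proof.
move=> cY cw cw' dw dw' e0 e1 y0 y1.
apply: (bhom_intro (H := fun r s => Y ((1 - clamp r) *: w s + clamp r *: w' s))).
- apply: (cont_disc_o (w := fun x : R * R => (1 - clamp x.1) *: w x.2 + clamp x.1 *: w' x.2) cY).
  by cont.
 by move=> x; apply: disc_segment => //; exact: clamp_itv.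
- move=> r _; rewrite -e0 -e1 -!scalerDl subrK !scale1r y0 y1.
 by split; [exists 0|exists 1] => //; rewrite /unit_itv /= lexx ler01.
move=> s _; rewrite clamp0 clamp1 subr0 subrr.
by rewrite !scale1r !scale0r addr0 add0r.
Qed.

Hypothesis D0_cont : {within disc, continuous D0}.

(* Two points of the arc [Y \o w] with the same image are the same point of the
  disc, so the shortcut is again the image of a path in the disc; it can be
  pushed into the circle, where [Y] is [D0]. *)
Lemma tame_inj Y : {within disc, continuous Y} -> set_inj disc Y -> (forall x, circle x -> Y x = D0 x) ->
 tame_disc Y.
Proof.
move=> cY iY YD w cw dw w0 w1 p q p0 pq q1 E.
have wpq : w p = w q by apply: iY => //; rewrite inE.
pose k s := if s <= 2^-1 then w (2 * s * p) else w (q + (2 * s - 1) * (1 - q)).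
have kE : shortcut (fun s => Y (w s)) p q = (fun s => Y (k s)) by apply/funext => s; rewrite /shortcut /k; case: ifP.
have ck : continuous k.
 apply: paste_le; [by cont..|].
 by move=> x ->; rewrite mulfV // mul1r subrr mul0r addr0.
have dk s : disc (k s) by rewrite /k; case: ifP.
have k0 : k 0 = vec2 (-1) 0 by rewrite /k invr_ge0 ler0n mulr0 mul0r.
have k1 : k 1 = vec2 1 0.
 rewrite /k (_ : (1 <= 2^-1) = false); last by rewrite //; lra.
 by rewrite -w1; congr w; lra.
pose l s : 'R_2 := sq (s, 2^-1); pose c s : 'R_2 := vec2 (2 * clamp s - 1) (Num.sqrt (1 - (2 * clamp s - 1) ^+ 2)).
have cc : continuous c by rewrite /c; cont.
have cl : continuous l by apply: (cont_o _ cont_sq); cont.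
have kc s : circle (c s).
 rewrite /Defs.circle /= !vecE sqr_sqrtr ?subr_ge0 ?itv_sqr ?clamp_itv //; ring.
have i2 : itv 2^-1 by lra.
have lE s : itv s -> l s = square_disc s 2^-1 by move=> si; rewrite /l sqE.
have c0 : c 0 = vec2 (-1) 0 by rewrite /c clamp_id // mulr0 sub0r sqrrN expr1n subrr sqrtr0.
have c1 : c 1 = vec2 1 0 by rewrite /c clamp_id // (_ : 2 * 1 - 1 = 1) ?expr1n ?subrr ?sqrtr0 //; lra.
have l0 : l 0 = vec2 (-1) 0 by rewrite lE // sq_disc_mid mulr0 sub0r.
have l1 : l 1 = vec2 1 0 by rewrite lE // sq_disc_mid; congr vec2; lra.
have I00 : D0 (vec2 (-1) 0) = I0 0 by rewrite -l0 lE.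
have I01 : D0 (vec2 1 0) = I0 1 by rewrite -l1 lE.
have cm : circle (vec2 (-1) 0) by rewrite /Defs.circle /= !vecE; ring.
have cp : circle (vec2 1 0) by rewrite /Defs.circle /= !vecE; ring.
rewrite kE; apply: (bhom_trans (h := fun s => D0 (c s))).
 apply: (bhom_eq (g := fun s => D0 (l s))) => //.
  by move=> s si; rewrite lE.
 apply: disc_chord; rewrite ?l0 ?l1 //; first by move=> s; exact: sq_disc.
 by move=> s; exact: circle_disc.
apply: (bhom_eq (g := fun s => Y (c s))) => //.
 by move=> s _; exact: YD.
apply: disc_chord; rewrite ?c0 ?c1 ?YD //.
by move=> s; exact: circle_disc.
Qed.

Variable b : Prop.

(* [b] asks for the discs of the family to be tame *)
Definition disc_path D D' := exists Y : R -> 'R_2 -> M,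
 [/\ continuous (fun z : R * (R * R) => Y z.1 (sq z.2)),
   (forall r x, circle x -> Y r x = D0 x),
   (forall x, disc x -> Y 0 x = D x), (forall x, disc x -> Y 1 x = D' x) &
   b -> forall r, tame_disc (Y r)].

Lemma disc_path_sym D D' : disc_path D D' -> disc_path D' D.
Proof.
move=> [Y [cY Yc Y0 Y1 tY]]; exists (fun r => Y (1 - r)); split=> //.
- apply: (cont_o (f := fun z : R * (R * R) => (1 - z.1, z.2)) _ cY).
 by cont.
- by move=> r x; exact: Yc.
- by move=> x dx; rewrite subr0 Y1.
- by move=> x dx; rewrite subrr Y0.
by move=> /tY h r.
Qed.

Lemma disc_path_trans D D' D'' : disc_path D D' -> disc_path D' D'' -> disc_path D D''.
Proof.
move=> [Y [cY Yc Y0 Y1 tY]] [X [cX Xc X0 X1 tX]].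
exists (fun r => if r <= 2^-1 then Y (2 * r) else X (2 * r - 1)); split.
- rewrite (_ : (fun z => _) = (fun z => if z.1 <= 2^-1 then Y (2 * z.1) (sq z.2) else X (2 * z.1 - 1) (sq z.2))); last first.
  by apply/funext => z; case: ifP.
 apply: paste_le.
 + exact: cont_fst.
 + exact: cont_cst.
 + apply: (cont_o (f := fun z : R * (R * R) => (2 * z.1, z.2)) _ cY).
  by cont.
 + apply: (cont_o (f := fun z : R * (R * R) => (2 * z.1 - 1, z.2)) _ cX).
  by cont.
 by move=> z ->; rewrite mulfV // subrr Y1 ?X0 //; exact: sq_disc.
- by move=> r x cx; case: ifP => _; [exact: Yc|exact: Xc].
- by move=> x dx; rewrite invr_ge0 ler0n mulr0 Y0.
- move=> x dx; rewrite (_ : (1 <= 2^-1) = false); last by rewrite lt_geF //; lra.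
 by rewrite (_ : 2 * 1 - 1 = 1) ?X1 //; lra.
by move=> hb r; case: ifP => _; [exact: tY|exact: tX].
Qed.

(** [psi] is [H] read in the coordinates of [D], continuous by compactness of the disc. As the disc
    is convex and [psi] fixes the circle, [psi] is joined linearly to the identity. The intermediate
    maps need not be embeddings, but they are [D] composed with self-maps of the disc, which is
    enough for tameness. *)
Lemma disc_path_reparam D H : {within disc, continuous D} -> set_inj disc D ->
 (forall x, circle x -> D x = D0 x) -> {within disc, continuous H} ->
 (forall x, circle x -> H x = D0 x) -> H @` disc = D @` disc -> disc_path D H.
Proof.
move=> cD iD DD cH HD im.
pose psi x := xget (0 : 'R_2) [set y | disc y /\ D y = H x].
have psiP x : disc x -> disc (psi x) /\ D (psi x) = H x.
 move=> dx; rewrite /psi; case: xgetP => [y -> //|] no; exfalso.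
 have [y dy E] : (D @` disc) (H x) by rewrite -im.
 by apply: (no y).
have psi_id x : circle x -> psi x = x.
 move=> cx; have dx := circle_disc cx; have [d E] := psiP x dx.
 by apply: iD; rewrite ?inE // E DD // HD.
have cpsi : {within disc, continuous psi}.
 apply/subspace_continuousP => x dx U nU.
 have [V [oV Vx] VU] := nbhs_openP nU.
 pose C : set 'R_2 := disc `&` ~` V.
 have cC : compact C by apply: compact_closedI; [exact: disc_compact|rewrite closedC].
 have cDC : closed (D @` C).
  apply: compact_closed; first exact: manifold_hausdorff.
  apply: continuous_compact => //; apply: continuous_subspaceW cD.
  by move=> y [].
 have nx : ~ (D @` C) (H x).
  move=> [y [dy nVy] E]; have [d Ex] := psiP x dx.
  by apply: nVy; rewrite (_ : y = psi x) //; apply: iD; rewrite ?inE // Ex.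
 have oC : nbhs (H x) (~` (D @` C)) by apply: nbhsO => //; exact: closed_openC.
 have h : nbhs x (fun y => disc y -> (~` (D @` C)) (H y)) by have /subspace_continuousP/(_ x dx _ oC) := cH.
 suff : nbhs x (fun y => disc y -> U (psi y)) by [].
 apply: filterS h => y hy dy; apply: VU; apply: contrapT => nV; apply: (hy dy).
 by have [d E] := psiP y dy; exists (psi y).
exists (fun r x => D ((1 - clamp r) *: x + clamp r *: psi x)); split.
- apply: (cont_disc_o (w := fun z : R * (R * R) => (1 - clamp z.1) *: sq z.2 + clamp z.1 *: psi (sq z.2)) cD).
  have cs : continuous (fun z : R * (R * R) => sq z.2) := cont_o (@cont_snd _ _) cont_sq.
  have cps : continuous (fun z : R * (R * R) => psi (sq z.2)) by apply: (cont_disc_o cpsi) => // z; exact: sq_disc.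
  by cont.
 move=> z; apply: disc_segment; [exact: sq_disc| |exact: clamp_itv].
 by have [] := psiP (sq z.2) (sq_disc _).
- by move=> r x cx; rewrite psi_id // -scalerDl subrK scale1r DD.
- by move=> x dx; rewrite clamp0 subr0 scale1r scale0r addr0.
- move=> x dx; rewrite clamp1 subrr scale1r scale0r add0r.
 by have [] := psiP x dx.
move=> _ r w cw dw w0 w1.
apply: (tame_inj cD iD DD).
- by have cps := cont_disc_o cpsi cw dw; cont.
- move=> s; apply: disc_segment => //; last exact: clamp_itv.
 by have [] := psiP _ (dw s).
- by rewrite w0 psi_id -?scalerDl ?subrK ?scale1r // /Defs.circle /= !vecE; ring.
by rewrite w1 psi_id -?scalerDl ?subrK ?scale1r // /Defs.circle /= !vecE; ring.
Qed.

End DiscPaths.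

(** * Sweeping arcs in the square *)

Section Sweep.
Variable D0 : 'R_2 -> M.
Local Notation I0 := (core_arc D0).

Lemma isotopic_circle D D' : isotopic_discs D D' -> forall x, circle x -> D x = D' x :> M.
Proof.
move=> [H [_ _ hc _ _]] x cx;
by have [<- <-] := hc 0 x itv0 cx.
Qed.

Lemma homotopic_circle D : disc_homotopic D0 D -> forall x, circle x -> D x = D0 x.
Proof.
move=> [_ [H [_ hc _ h1]]] x cx;
by rewrite -(h1 x (circle_disc cx)) hc.
Qed.

Lemma homotopic_path D : disc_homotopic D0 D -> disc_path D0 False D0 D.
Proof.
move=> [_ [H [cH hc h0 h1]]]; exists (fun r => H (clamp r)); split=> //.
- move=> z; apply: (within_comp (g := fun z : R * (R * R) => (clamp z.1, sq z.2)) cH).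
 + by split; [exact: clamp_itv|exact: sq_disc].
 + by apply: near_all => y; split; [exact: clamp_itv|exact: sq_disc].
 by apply: cont_pairg; [cont|exact: (cont_o (@cont_snd _ _) (@cont_sq))].
- by move=> r x cx; apply: hc => //; exact: clamp_itv.
- by move=> x dx; rewrite clamp0 h0.
by move=> x dx; rewrite clamp1 h1.
Qed.

Hypothesis D0_proper : proper_disc D0.

Lemma proper_disc_inj D : proper_disc D -> set_inj disc (D : _ -> M).
Proof. by case. Qed.

Lemma proper_tame D : proper_disc D -> (forall x, circle x -> D x = D0 x) -> tame_disc D0 D.
Proof.
move=> pD; apply: tame_inj; [exact: disc_cont|exact: disc_cont|exact: proper_disc_inj].
Qed.

(** [isotopic_discs] only prescribes the images at both ends; two outer stages correct the
    parametrizations. *)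
Lemma isotopic_path b D D' : proper_disc D -> proper_disc D' -> (forall x, circle x -> D x = D0 x) ->
 isotopic_discs D D' -> disc_path D0 b D D'.
Proof.
move=> pD pD' DD iso; have [H [sH pH hc im0 im1]] := iso.
have HD r x : itv r -> circle x -> H r x = D0 x by move=> ri cx; rewrite -DD //; have [] := hc r x ri cx.
have cH r : itv r -> {within disc, continuous (H r)} by move=> ri; apply: disc_cont; exact: pH.
have D'D x : circle x -> D' x = D0 x by move=> cx; rewrite -DD // (isotopic_circle iso).
apply: (disc_path_trans (D' := H 0)).
 by apply: disc_path_reparam => //; [exact: disc_cont|exact: disc_cont|exact: proper_disc_inj|exact: cH|move=> x; exact: HD].
apply: (disc_path_trans (D' := H 1)); last first.
 apply: disc_path_sym; apply: disc_path_reparam => //; [exact: disc_cont|exact: disc_cont|exact: proper_disc_inj|exact: cH|move=> x; exact: HD].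
exists (fun r => H (clamp r)); split.
- pose S := [set x : 'R_3 | disc (vec2 (x 0 0) (x 0 1)) /\ itv (x 0 2)].
 have cS : {within S, continuous (fun x : 'R_3 => H (x 0 2) (vec2 (x 0 0) (x 0 1)))}.
  apply/subspace_continuousP => x Sx; have [c [J d]] := sH x Sx.
  exact: mdiff_cont Sx d.
 pose g (z : R * (R * R)) : 'R_3 := vec3 (sq z.2 0 0) (sq z.2 0 1) (clamp z.1).
 have gE z : H (clamp z.1) (sq z.2) = H (g z 0 2) (vec2 (g z 0 0) (g z 0 1)).
  by rewrite /g; move: (sq z.2) => y; rewrite !vecE -vec2_eta.
 have Sg z : S (g z).
  rewrite /S /= /g; have : disc (sq z.2) by exact: sq_disc.
  by move: (sq z.2) => y dy; rewrite !vecE -vec2_eta; split=> //; exact: clamp_itv.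
 rewrite (_ : (fun z => _) = (fun x : 'R_3 => H (x 0 2) (vec2 (x 0 0) (x 0 1))) \o g); last first.
  by apply/funext => z.
 move=> z; apply: within_comp cS _ _ _ => //; first exact: near_all.
 have cs i : continuous (fun z : R * (R * R) => sq z.2 0 i).
  apply: (cont_o (f := fun z : R * (R * R) => sq z.2) _ (@cont_coord 2 i)).
  by apply: (cont_o _ (@cont_sq)); exact: cont_snd.
 by apply: cont_vec3; [exact: cs|exact: cs|cont].
- by move=> r x cx; apply: HD => //; exact: clamp_itv.
- by rewrite clamp0.
- by rewrite clamp1.
move=> _ r; apply: proper_tame; first by apply: pH; exact: clamp_itv.
by move=> x cx; apply: HD => //; exact: clamp_itv.
Qed.

(** [sx] and [sv] are the coordinates in the square of the point [s] of a sweeping arc. At [nu = 0]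
    it is the arc of [beta]. At [nu = 1] it runs along one vertical side of the square from middle
    height to height [h], follows the entire leaf of that height and returns along the opposite
    side. The second form is needed while the disc moves, since the intermediate discs are only
    known to agree with [D0] on the circle. *)
Definition sx (nu e s : R) : R := (1 - nu) * s + nu * clamp ((s - e) / (1 - 2 * e)).
Definition leg (e s : R) : R := clamp (Num.min s (1 - s) / e).
Definition sv (nu e rh s h : R) : R := 2^-1 + ((1 - nu) * (1 - 2 * e) * rh + nu * leg e s) * (h - 2^-1).

Lemma sx_itv nu e s : itv nu -> itv s -> itv (sx nu e s).
Proof. by move=> ni si; apply: mixE => //; exact: clamp_itv. Qed.

Lemma amp_itv nu e rh s : itv nu -> 0 < e < 2^-1 -> itv rh -> itv ((1 - nu) * (1 - 2 * e) * rh + nu * leg e s).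
Proof.
move=> ni ei /andP[r0 r1]; rewrite -mulrA; apply: mixE => //; last exact: clamp_itv.
have e1 : 0 <= 1 - 2 * e by lra.
rewrite mulr_ge0; have := ler_wpM2l e1 r1; lra.
Qed.

Lemma sv_itv nu e rh s h : itv nu -> 0 < e < 2^-1 -> itv rh -> itv h -> itv (sv nu e rh s h).
Proof.
move=> ni ei ri /andP[h0 h1]; rewrite /sv; have /andP[] := amp_itv s ni ei ri.
set c := (_ + _) => c0 c1.
have e1 := ler_wpM2l c0 h1; have e0 := mulr_ge0 c0 h0.
lra.
Qed.

Lemma sv_mid nu e rh s : sv nu e rh s 2^-1 = 2^-1.
Proof. by rewrite /sv subrr mulr0 addr0. Qed.

Lemma sx_ends nu e : 0 < e < 2^-1 -> sx nu e 0 = 0 /\ sx nu e 1 = 1.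
Proof.
move=> ei; rewrite /sx; split.
 by rewrite clamp_le0 ?mulr0 ?addr0 // pmulr_lle0 ?invr_gt0; lra.
rewrite clamp_ge1 ?mulr1 ?subrK // ler_pdivlMr; lra.
Qed.

Lemma leg_ends e : leg e 0 = 0 /\ leg e 1 = 0.
Proof.
rewrite /leg subrr min_l // min_r // mul0r.
by rewrite clamp0.
Qed.

(* On the leaves of height 0 and 1 the path stays in the collar of width
  [(1 - nu) * e], hence in the boundary of the square for [nu = 1]. *)
Lemma sweep_collar nu e rh s h : itv nu -> 0 < e < 2^-1 -> itv s ->
 (nu < 1 -> e <= s <= 1 - e -> rh = 1) -> h = 0 \/ h = 1 ->
 [\/ sx nu e s <= (1 - nu) * e, 1 - (1 - nu) * e <= sx nu e s,
  sv nu e rh s h <= (1 - nu) * e | 1 - (1 - nu) * e <= sv nu e rh s h].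
Proof.
move=> /andP[n0 n1] ei /andP[s0 s1] rhE h01; have s1' : 0 <= 1 - nu by rewrite subr_ge0.
have d0 : 0 < 1 - 2 * e by lra.
have [se|se] := leP s e.
 constructor 1; rewrite /sx clamp_le0 ?mulr0 ?addr0 ?ler_wpM2l //.
 by rewrite pmulr_lle0 ?invr_gt0 //; lra.
have [se'|se'] := leP (1 - e) s.
 constructor 2; rewrite /sx clamp_ge1; last by rewrite ler_pdivlMr //; lra.
 have := ler_wpM2l s1' se'; lra.
have leg1 : leg e s = 1.
 rewrite /leg clamp_ge1 // ler_pdivlMr; last by case/andP: ei.
 by rewrite le_min; lra.
have am : (1 - nu) * (1 - 2 * e) * rh + nu * leg e s = 1 - 2 * ((1 - nu) * e).
 rewrite leg1; have [n1'|] := ltP nu 1; first by rewrite rhE //; [ring|lra].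
 move=> n1'; have -> : nu = 1 by apply/eqP; rewrite eq_le n1.
 by ring.
case: h01 => ->; [constructor 3|constructor 4]; rewrite /sv; lra.
Qed.

Lemma sweep_height_itv t : itv t -> itv (sweep_height t : R).
Proof.
move=> ti; rewrite /sweep_height; case: ifPn => [h|]; first by lra.
by case: ifPn => [h'|]; [lra|rewrite -ltNge => h'; lra].
Qed.

Lemma sweep_height0 : sweep_height 0 = 2^-1 :> R.
Proof. by rewrite /sweep_height invr_ge0 ler0n mulr0 subr0. Qed.

Lemma sweep_height1 : sweep_height 1 = 2^-1 :> R.
Proof.
rewrite /sweep_height ifF; last by rewrite //; lra.
by rewrite ifF; [lra|rewrite //; lra].
Qed.

Lemma sweep_height_quarter : sweep_height 4^-1 = 0 :> R /\ sweep_height (3 / 4) = 1 :> R.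
Proof.
rewrite /sweep_height lexx; split; first by lra.
by rewrite ifF; [rewrite lexx; lra|rewrite //; lra].
Qed.

Lemma cont_sweep_height : continuous (@sweep_height R).
Proof.
apply: paste_le; [by cont|by cont|by cont| |by move=> x ->; rewrite ifT; lra].
by apply: paste_le; [by cont..|move=> x ->; lra].
Qed.

Lemma cont_sx T (nu e s : T -> R) : continuous nu -> continuous e ->
 continuous s -> (forall x, 1 - 2 * e x != 0) -> continuous (fun x => sx (nu x) (e x) (s x)).
Proof.
move=> cn ce cs ne; have ci : continuous (fun x => (1 - 2 * e x)^-1) by apply: cont_inv => //; cont.
by rewrite /sx; cont.
Qed.

Lemma cont_sv T (nu e rh s h : T -> R) : continuous nu -> continuous e ->
 continuous rh -> continuous s -> continuous h -> (forall x, e x != 0) ->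
 continuous (fun x => sv (nu x) (e x) (rh x) (s x) (h x)).
Proof.
by move=> cn ce cr cs ch ne; have ci := cont_inv ce ne; rewrite /sv /leg; cont.
Qed.

Lemma beta_margin e rho D : 0 < e < 2^-1 -> agrees_on_collar D0 e D -> end_cutoff e rho ->
 exists2 h, 0 < h & forall t s, itv s -> s <= h \/ 1 - h <= s -> beta D0 e rho D t s = I0 s.
Proof.
move=> ei ag [_ _ _ [h h0 rh0]]; exists (Num.min h e).
 by rewrite lt_min h0; case/andP: ei.
have mh : Num.min h e <= h by rewrite ge_min lexx.
have me : Num.min h e <= e by rewrite ge_min lexx orbT.
move=> t s si sh; rewrite /beta rh0; last by case: sh => sh; [left|right]; lra.
rewrite mulr0 mul0r addr0; case: ifP => // _; apply: ag => //; first by lra.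
by case: sh => sh; [constructor 1|constructor 2]; lra.
Qed.

End Sweep.

(** * The homotopy of loops swept by a path of discs *)

Section SweepHomotopy.
Variable D0 : 'R_2 -> M.
Local Notation I0 := (core_arc D0).
Hypothesis D0_proper : proper_disc D0.
Hypothesis I0_loop : Emb_loop I0 (fun=> I0).

Lemma smooth_fun_cont (f : R -> R) : smooth_fun f -> continuous f.
Proof.
move=> sf x; have h := @smooth_fun_smooth1 f sf 1 0 setT (fun y => y 0 0) openT (ck_coord _ _ _).
have := cont_o (@const_mx1_cont) (fun y => ck_cont h I).
by move=> /(_ x); apply: near_eq_cont; apply: near_all => y /=; rewrite mxE.
Qed.

Variable b : Prop.
Variables (D1 D2 : 'R_2 -> M) (e1 e2 : R) (rho1 rho2 tau1 tau2 : R -> R).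
Hypothesis path : disc_path D0 b D1 D2.
Hypothesis e1_itv : 0 < e1 < 2^-1.
Hypothesis e2_itv : 0 < e2 < 2^-1.
Hypothesis collar1 : agrees_on_collar D0 e1 D1.
Hypothesis collar2 : agrees_on_collar D0 e2 D2.
Hypothesis cut1 : end_cutoff e1 rho1.
Hypothesis cut2 : end_cutoff e2 rho2.
Hypothesis tch1 : time_change tau1.
Hypothesis tch2 : time_change tau2.
Local Notation b1 := (fun t => beta D0 e1 rho1 D1 (tau1 t)).
Local Notation b2 := (fun t => beta D0 e2 rho2 D2 (tau2 t)).
Hypothesis b1_loop : Emb_loop I0 b1.
Hypothesis b2_loop : Emb_loop I0 b2.

Definition mix (r x y : R) := (1 - r) * x + r * y.
Definition rr (u : R) := clamp (3 * u - 1).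
Definition ee u := mix (rr u) e1 e2.
Definition hh u s := mix (rr u) (rho1 s) (rho2 s).
Definition ta t u := clamp (mix (rr u) (tau1 t) (tau2 t)).
(** Equal to 1 when the disc moves ([1/3 <= u <= 2/3]) and the arc may lie in it
    ([1/4 <= ta <= 3/4]). It vanishes at [u = 0] and [u = 1], where the given loops have to appear,
    and at [ta = 0] and [ta = 1], where the arc has to be [I0]. *)
Definition nu t u := clamp (Num.min (3 * u) (3 - 3 * u)) * clamp (4 * Num.min (ta t u) (1 - ta t u)).
Definition sq_path s t u : R * R :=
 (sx (nu t u) (ee u) (clamp s), sv (nu t u) (ee u) (hh u (clamp s)) (clamp s) (sweep_height (ta t u))).
Definition sweep (Y : R -> 'R_2 -> M) (x : 'R_3) : M :=
 let z := sq (sq_path (x 0 0) (x 0 1) (x 0 2)) in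
 if 4^-1 <= ta (x 0 1) (x 0 2) then
  if ta (x 0 1) (x 0 2) <= 3 / 4 then Y (rr (x 0 2)) z else D0 z
 else D0 z.

Lemma ee_itv u : 0 < ee u < 2^-1.
Proof.
have h1 := e1_itv; have h2 := e2_itv.
have /andP[r0 r1] := clamp_itv (3 * u - 1); rewrite /ee /mix /rr.
move: (clamp _) r0 r1 => r r0 r1.
have [->|rn] := eqVneq r 0; first by rewrite subr0 mul1r mul0r addr0.
have rp : 0 < r by lra.
have s1 : 0 <= 1 - r by lra.
have p1 : 0 <= (1 - r) * e1 by rewrite mulr_ge0 //; lra.
have p2 : 0 < r * e2 by rewrite mulr_gt0 //; lra.
have p3 : 0 <= (1 - r) * (2^-1 - e1) by rewrite mulr_ge0 //; lra.
have p4 : 0 < r * (2^-1 - e2) by rewrite mulr_gt0 //; lra.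
lra.
Qed.

Lemma hh_itv u s : itv (hh u s).
Proof.
have [_ h1 _ _] := cut1; have [_ h2 _ _] := cut2.
by apply: mixE => //; exact: clamp_itv.
Qed.

Lemma nu_itv t u : itv (nu t u).
Proof.
have /andP[a0 a1] := clamp_itv (Num.min (3 * u) (3 - 3 * u)).
have /andP[c0 c1] := clamp_itv (4 * Num.min (ta t u) (1 - ta t u)).
by rewrite mulr_ge0 //= mulr_ile1.
Qed.

Lemma ta_itv t u : itv (ta t u). Proof. exact: clamp_itv. Qed.

Lemma sq_path_itv s t u : itv (sq_path s t u).1 /\ itv (sq_path s t u).2.
Proof.
split; first by apply: sx_itv; [exact: nu_itv|exact: clamp_itv].
by apply: sv_itv; [exact: nu_itv|exact: ee_itv|exact: hh_itv|apply: sweep_height_itv; exact: ta_itv].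
Qed.

Lemma quarter_nu t u : ta t u = 4^-1 \/ ta t u = 3 / 4 -> nu t u < 1 -> u < 3^-1 \/ 2 / 3 < u.
Proof.
move=> h; rewrite /nu [clamp (4 * _)]clamp_ge1; last first.
 by case: h => ->; [rewrite min_l|rewrite min_r]; lra.
rewrite mulr1 => n1; have [|h1] := ltP u 3^-1; first by left.
right; rewrite ltNge; apply/negP => h2; move: n1; rewrite clamp_ge1 ?ltxx // le_min.
lra.
Qed.

Lemma rr0 u : u <= 3^-1 -> rr u = 0. Proof. by move=> h; apply: clamp_le0; lra. Qed.
Lemma rr1 u : 2 / 3 <= u -> rr u = 1. Proof. by move=> h; apply: clamp_ge1; lra. Qed.
Lemma mix0 x y : mix 0 x y = x. Proof. by rewrite /mix subr0 mul1r mul0r addr0. Qed.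
Lemma mix1 x y : mix 1 x y = y. Proof. by rewrite /mix subrr mul1r mul0r add0r. Qed.

Section Family.
Variable Y : R -> 'R_2 -> M.
Hypothesis cY : continuous (fun z : R * (R * R) => Y z.1 (sq z.2)).
Hypothesis Yc : forall r x, circle x -> Y r x = D0 x.
Hypothesis Y0 : forall x, disc x -> Y 0 x = D1 x.
Hypothesis Y1 : forall x, disc x -> Y 1 x = D2 x.

(** When the arc passes between [D0] and [Y], its leaf has height 0 or 1. Either the disc is [D1] or
    [D2] and the arc lies in its collar, or [nu = 1] and the arc lies in the circle. *)
Lemma sweep_junction s t u : ta t u = 4^-1 \/ ta t u = 3 / 4 ->
 Y (rr u) (sq (sq_path s t u)) = D0 (sq (sq_path s t u)).
Proof.
move=> h; have [hq0 hq1] := @sweep_height_quarter.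
have si := clamp_itv s.
have h01 : sweep_height (ta t u) = 0 \/ sweep_height (ta t u) = 1 by case: h => ->; [left|right].
have qn := quarter_nu h.
have rh1 : nu t u < 1 -> ee u <= clamp s <= 1 - ee u -> hh u (clamp s) = 1.
 move=> /qn[/ltW|/ltW] hu; rewrite /ee /hh; [rewrite (rr0 hu) !mix0|rewrite (rr1 hu) !mix1].
  by have [_ _ h1 _] := cut1; exact: h1.
 by have [_ _ h1 _] := cut2; exact: h1.
have := sweep_collar (nu_itv t u) (ee_itv u) si rh1 h01.
have [i1 i2] := sq_path_itv s t u.
rewrite -[sx _ _ _]/((sq_path s t u).1) -[sv _ _ _ _ _]/((sq_path s t u).2).
move: (sq_path s t u) i1 i2 => [X V] /= i1 i2; rewrite sqE //.
have [n1|n1] := ltP (nu t u) 1; last first.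
 have -> : nu t u = 1 by apply/eqP; rewrite eq_le n1 andbT; case/andP: (nu_itv t u).
 rewrite subrr mul0r subr0 => hb; apply: Yc; apply: sq_disc_circle => //.
 case: hb => hb; [constructor 1|constructor 2|constructor 3|constructor 4]; apply/eqP; rewrite eq_le hb.
 - by case/andP: i1.
 - by case/andP: i1 => _ ->.
 - by case/andP: i2.
 by case/andP: i2 => _ ->.
have en : (1 - nu t u) * ee u <= ee u.
 have /andP[n0 _] := nu_itv t u; have /andP[e0 _] := ee_itv u.
 by have := mulr_ge0 n0 (ltW e0); lra.
move=> hb; have {hb} hb : [\/ X <= ee u, 1 - ee u <= X, V <= ee u | 1 - ee u <= V].
 by case: hb => hb; [constructor 1|constructor 2|constructor 3|constructor 4]; move: hb en; lra.
have dsq : disc (square_disc X V) by exact: sq_disc_in.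
case: (qn n1) => /ltW hu; move: hb; rewrite /ee.
 by rewrite (rr0 hu) Y0 // mix0; exact: collar1.
by rewrite (rr1 hu) Y1 // mix1; exact: collar2.
Qed.

Lemma cont_mix T (r x y : T -> R) : continuous r -> continuous x ->
 continuous y -> continuous (fun z => mix (r z) (x z) (y z)).
Proof. by move=> cr cx cy; rewrite /mix; cont. Qed.

Lemma sweep_continuous : continuous (sweep Y).
Proof.
have [stau1 _ _ _ _] := tch1; have [stau2 _ _ _ _] := tch2.
have [srho1 _ _ _] := cut1; have [srho2 _ _ _] := cut2.
have ct1 := smooth_fun_cont stau1; have ct2 := smooth_fun_cont stau2.
have cr1 := smooth_fun_cont srho1; have cr2 := smooth_fun_cont srho2.
have crr : continuous (fun x : 'R_3 => rr (x 0 2)) by rewrite /rr; cont.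
have cta : continuous (fun x : 'R_3 => ta (x 0 1) (x 0 2)) by rewrite /ta; apply: cont_clampo; apply: cont_mix; cont.
have cee : continuous (fun x : 'R_3 => ee (x 0 2)) by apply: cont_mix; cont.
have chh : continuous (fun x : 'R_3 => hh (x 0 2) (clamp (x 0 0))) by apply: cont_mix; cont.
have cnu : continuous (fun x : 'R_3 => nu (x 0 1) (x 0 2)) by rewrite /nu; cont.
have cp : continuous (fun x : 'R_3 => sq_path (x 0 0) (x 0 1) (x 0 2)).
 apply: cont_pairg.
  apply: cont_sx; [by cont..|move=> x; have := ee_itv (x 0 2) => h].
  lra.
 apply: cont_sv => //; [by cont|exact: (cont_o cta cont_sweep_height)|].
 by move=> x; apply: lt0r_neq0; case/andP: (ee_itv (x 0 2)).
have cD0 : continuous (fun x : 'R_3 => D0 (sq (sq_path (x 0 0) (x 0 1) (x 0 2)))).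
 apply: (cont_disc_o (disc_cont D0_proper)).
  exact: (cont_o cp (@cont_sq)).
 by move=> x; exact: sq_disc.
apply: paste_le => //.
 apply: paste_le => //.
  apply: (cont_o (f := fun x : 'R_3 => (rr (x 0 2), sq_path (x 0 0) (x 0 1) (x 0 2))) _ cY).
  exact: cont_pairg.
 by move=> x h; apply: sweep_junction; right.
move=> x h; rewrite -h; case: ifP => // _; apply: sweep_junction; left; by [].
Qed.

Lemma sq_path_ends t u : sq_path 0 t u = (0, 2^-1) /\ sq_path 1 t u = (1, 2^-1).
Proof.
rewrite /sq_path !clamp_id //.
have [-> ->] := sx_ends (nu t u) (ee_itv u); have [l0 l1] := leg_ends (ee u).
have r0 f e : end_cutoff e f -> f 0 = 0 /\ f 1 = 0 :> R by move=> [_ _ _ [h h0 hf]]; split; apply: hf; lra.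
have [a0 a1] := r0 _ _ cut1; have [c0 c1] := r0 _ _ cut2.
by rewrite /hh /mix a0 a1 c0 c1 !mulr0 addr0 /sv l0 l1 !mulr0 addr0 mul0r addr0.
Qed.

Lemma sweep_circle (x : 'R_3) z : circle z -> (if 4^-1 <= ta (x 0 1) (x 0 2) then
  if ta (x 0 1) (x 0 2) <= 3 / 4 then Y (rr (x 0 2)) z else D0 z else D0 z) = D0 z.
Proof. by case: ifP => // _; case: ifP => // _; exact: Yc. Qed.

Lemma sweep_ends t u : sweep Y (vec3 0 t u) = I0 0 /\ sweep Y (vec3 1 t u) = I0 1.
Proof.
have i2 : itv 2^-1 by lra.
rewrite /sweep !vec3_0 !vec3_1 !vec3_2; have [-> ->] := sq_path_ends t u.
have h0 := @sweep_circle (vec3 0 t u) (square_disc 0 2^-1); have h1 := @sweep_circle (vec3 0 t u) (square_disc 1 2^-1).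
rewrite !vec3_1 !vec3_2 in h0 h1; rewrite !sqE //.
by rewrite h0 ?h1 //; apply: sq_disc_circle => //; [constructor 2|constructor 1].
Qed.

Lemma time_change_itv tau t : time_change tau -> itv t -> itv (tau t : R).
Proof. by move=> [_ t0 t1 tm _] /andP[h0 h1]; rewrite -{1}t0 -t1 !tm. Qed.

Lemma sweep_faces t s : itv t -> itv s ->
 sweep Y (vec3 s t 0) = b1 t s /\ sweep Y (vec3 s t 1) = b2 t s.
Proof.
move=> ti si; rewrite /sweep !vec3_0 !vec3_1 !vec3_2.
have side u D e rho tau : nu t u = 0 -> ee u = e -> hh u s = rho s -> ta t u = tau t -> time_change tau ->
  (forall x, disc x -> Y (rr u) x = D x) -> (if 4^-1 <= ta t u then
   if ta t u <= 3 / 4 then Y (rr u) (sq (sq_path s t u)) else D0 (sq (sq_path s t u)) else D0 (sq (sq_path s t u))) =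
  beta D0 e rho D (tau t) s.
 move=> n0 E hE tE tch YD; rewrite YD; last exact: sq_disc.
 have [i1 i2] := sq_path_itv s t u.
 rewrite [sq_path s t u]surjective_pairing sqE //.
 rewrite /= clamp_id // n0 E hE tE /sx /sv subr0 !mul1r !mul0r !addr0 /beta.
 by case: (4^-1 <= tau t); case: (tau t <= 3 / 4).
have r00 : rr 0 = 0 by apply: rr0.
have r01 : rr 1 = 1 by apply: rr1; lra.
have n0 : clamp (Num.min (3 * 0) (3 - 3 * 0) : R) = 0 by rewrite clamp_le0 //.
have n1 : clamp (Num.min (3 * 1) (3 - 3 * 1) : R) = 0 by rewrite clamp_le0 //.
split; apply: side => //.
- by rewrite /nu n0 mul0r.
- by rewrite /ee r00 mix0.
- by rewrite /hh r00 mix0.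
- by rewrite /ta r00 mix0 clamp_id // time_change_itv.
- by rewrite r00.
- by rewrite /nu n1 mul0r.
- by rewrite /ee r01 mix1.
- by rewrite /hh r01 mix1.
- by rewrite /ta r01 mix1 clamp_id // time_change_itv.
by rewrite r01.
Qed.

Lemma sweep_base u s : itv s -> sweep Y (vec3 s 0 u) = I0 s /\ sweep Y (vec3 s 1 u) = I0 s.
Proof.
move=> si; rewrite /sweep !vec3_0 !vec3_1 !vec3_2.
have [_ t10 t11 _ _] := tch1; have [_ t20 t21 _ _] := tch2.
have i2 : itv 2^-1 by lra.
have -> : ta 0 u = 0 by rewrite /ta t10 t20 /mix !mulr0 addr0 clamp0.
have -> : ta 1 u = 1 by rewrite /ta t11 t21 /mix !mulr1 subrK clamp1.
have -> : (4^-1 <= 0 :> R) = false by lra.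
have -> : (4^-1 <= 1 :> R) by lra.
have -> : (1 <= 3 / 4 :> R) = false by lra.
have E t h : ta t u = h -> nu t u = 0 -> sweep_height h = 2^-1 -> sq_path s t u = (s, 2^-1).
 by move=> E n0 h2; rewrite /sq_path n0 E h2 sv_mid clamp_id // /sx subr0 mul1r mul0r addr0.
have ta0 : ta 0 u = 0 by rewrite /ta t10 t20 /mix !mulr0 addr0 clamp0.
have ta1 : ta 1 u = 1 by rewrite /ta t11 t21 /mix !mulr1 subrK clamp1.
have n0 : nu 0 u = 0 by rewrite /nu ta0 [clamp (4 * _)]clamp_le0 // ?mulr0 //.
have n1 : nu 1 u = 0 by rewrite /nu ta1 [clamp (4 * _)]clamp_le0 // ?mulr0.
rewrite (E 0 0 ta0 n0 sweep_height0) (E 1 1 ta1 n1 sweep_height1).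
by rewrite sqE.
Qed.

Lemma sweep_tame t u : (forall r, tame_disc D0 (Y r)) -> tame I0 (fun s => sweep Y (vec3 s t u)).
Proof.
move=> tY; have tD0 : tame_disc D0 D0 by exact: proper_tame.
have [srho1 _ _ _] := cut1; have [srho2 _ _ _] := cut2.
have cr1 := smooth_fun_cont srho1; have cr2 := smooth_fun_cont srho2.
have cw : continuous (fun s => sq (sq_path s t u)).
 apply: (cont_o (f := fun s => sq_path s t u) _ (@cont_sq)).
 apply: cont_pairg.
  apply: cont_sx; [by cont..|].
  by move=> _; have h := ee_itv u; lra.
 apply: cont_sv; [by cont|by cont|by apply: cont_mix; cont|by cont|by cont|].
 by move=> _; apply: lt0r_neq0; case/andP: (ee_itv u).
have i2 : itv 2^-1 by lra.
have w0 : sq (sq_path 0 t u) = vec2 (-1) 0 by have [-> _] := sq_path_ends t u; rewrite sqE // sq_disc_mid mulr0 sub0r.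
have w1 : sq (sq_path 1 t u) = vec2 1 0.
 by have [_ ->] := sq_path_ends t u; rewrite sqE // sq_disc_mid; congr vec2; lra.
have dw s : disc (sq (sq_path s t u)) by exact: sq_disc.
rewrite (_ : (fun s => _) = (fun s => (if 4^-1 <= ta t u then if ta t u <= 3 / 4 then Y (rr u) else D0 else D0)
  (sq (sq_path s t u)))); last first.
 by apply/funext => s; rewrite /sweep !vec3_0 !vec3_1 !vec3_2; case: ifP => // _; case: ifP.
by case: ifP => _; [case: ifP => _|]; [exact: tY|exact: tD0|exact: tD0].
Qed.

End Family.

Lemma sweep_dax : exists2 A, GH I0 b1 b2 A & b -> dax_sum I0 A = 0.
Proof.
have [Y [cY Yc Y0 Y1 tY]] := path.
have [h1 h10 bm1] := beta_margin e1_itv collar1 cut1.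
have [h2 h20 bm2] := beta_margin e2_itv collar2 cut2.
pose m := Num.min 4^-1 (Num.min h1 h2).
have m0 : 0 < m by rewrite lt_min invr_gt0 ltr0n /= lt_min h10.
have m4 : m <= 4^-1 by rewrite ge_min lexx.
have mh1 : m <= h1 by rewrite !ge_min lexx !orbT.
have mh2 : m <= h2 by rewrite !ge_min lexx !orbT.
have [A hA A0] : exists2 A, GH I0 b1 b2 A &
  (forall t u, itv t -> itv u -> tame I0 (fun s => sweep Y (vec3 s t u))) -> dax_sum I0 A = 0.
 apply: (dax_homotopy (m := m)) => //.
 - exact: sweep_continuous.
 - by move=> t s ti si h; apply: bm1; lra.
 - by move=> t s ti si h; apply: bm2; lra.
 - by move=> t u _ _; exact: sweep_ends.
 - by exact: sweep_faces.
 by move=> u s _ si; exact: sweep_base.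
by exists A => // hb; apply: A0 => t u _ _; apply: sweep_tame; exact: tY.
Qed.

End SweepHomotopy.

(** * Differentials at boundary points, and transversality to the boundary *)

Definition inward n (A : set 'R_n) (x v : 'R_n) :=
 exists2 e : R, 0 < e & forall t, 0 < t < e -> A (x + t *: v).

(** Makes the differential on [A] unique. Two directions are allowed for each basis vector because
    on the circle both a basis vector and its opposite may point out of the disc. *)
Definition fat n (A : set 'R_n) (x : 'R_n) := forall i : 'I_n,
 exists v w (a b : R), [/\ inward A x v, inward A x w & 'e_i = a *: v + b *: w].

Lemma mdiff_uniq n (f : 'R_n -> M) A x c J K : A x -> fat A x ->
 mdiff f A x c J -> mdiff f A x c K -> J = K.
Proof.
move=> Ax ft [_ _ dJ] [_ _ dK]; apply/row_matrixP => i; rewrite !rowE.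
have [v [w [a [b [iv iw ->]]]]] := ft i.
by rewrite !mulmxDl -!scalemxAl (diff_on_inward Ax iv dJ dK) (diff_on_inward Ax iw dJ dK).
Qed.

Lemma cube_fat n (x : 'R_n) : cube n x -> fat (cube n) x.
Proof.
move=> cx i; have [a a0 h] := cube_inward i cx; exists (a *: 'e_i), (a *: 'e_i), a^-1, 0.
by rewrite scalerA mulVf // scale1r scale0r addr0.
Qed.

Lemma nbhs_inward n (A : set 'R_n) x v : nbhs x A -> inward A x v.
Proof.
move=> nA; have [e /= e0 he] := line_near v nA; exists e => // t /andP[t0 te].
by apply: he; rewrite /ball_/= sub0r normrN gtr0_norm.
Qed.

Lemma derive_inward_ge0 n (U : set 'R_n) (f : 'R_n -> R) x v e : open U -> ck 1 U f -> U x ->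
 f x = 0 -> 0 < e -> (forall t, 0 < t < e -> U (x + t *: v) -> 0 <= f (x + t *: v)) -> 0 <= 'D_v f x.
Proof.
move=> oU kf Ux f0 e0 fge; have [_ /(_ v)[df _]] := kf; have dx := cvg_dnbhs_at_right (df x Ux).
have nU : nbhs x U by exact: open_nbhs_nbhs.
apply: (cvgr_to_ge dx).
near=> t; have te : 0 < t < e by apply/andP; split; near: t; [exact: nbhs_right_gt|exact: nbhs_right_lt].
have Ut : U (x + t *: v) by near: t; apply: cvg_within; exact: line_near.
apply: mulr_ge0; last by rewrite /= f0 subr0 [t *: v + x]addrC; exact: fge.
by rewrite invr_ge0 //.
Unshelve. all: end_near. Qed.

Lemma mdiff_inward_ge0 n (f : 'R_n -> M) A x c J v : A x -> boundary (f x) -> inward A x v ->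
 mdiff f A x c J -> 0 <= (v *m J) 0 0.
Proof.
move=> Ax bx [e e0 iv] dm; have cx := mdiff_dom Ax dm.
have [ac dc [U [g [[oU Ux] sg gE Dg]]]] := dm.
have [W [oW Wx] WE] := within_openP dc.
have oUW : open (U `&` W) by exact: openI.
have sgc : ck 1 (U `&` W) (fun y => g y 0 0).
 have /(Ck_coordP _ _ oU)/(_ 0) := sg 1%N; exact: ck_sub.
have Dc : 'D_v (fun y => g y 0 0) x = (v *m J) 0 0.
 by rewrite -Dg derive_row //; apply: diff_derivable; exact: Cinfty_diff sg Ux.
rewrite -Dc; apply: (derive_inward_ge0 oUW sgc _ _ e0) => //.
 by rewrite gE //; apply/boundary_chart.
move=> t te [Ut Wt]; rewrite gE //; last exact: iv.
by apply: chart_half => //; apply: WE => //; exact: iv.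
Qed.

Lemma ge0_limit (a b : R) : (forall e, 0 < e -> 0 <= a + e * b) -> 0 <= a.
Proof.
move=> h; rewrite leNgt; apply/negP => a0.
have [b0|b0] := leP b 0.
 by have := h 1 ltr01; lra.
have e0 : 0 < - a / (2 * b) by rewrite divr_gt0 ?mulr_gt0 // oppr_gt0.
have := h _ e0; rewrite (_ : - a / (2 * b) * b = - a / 2); first by lra.
by field; rewrite lt0r_neq0.
Qed.

(** The inverse chart is a map on a piece of the half-space, so that its differential in the chart
    [d] sends vectors with positive first coordinate to vectors with nonnegative first coordinate.
    For plus or minus ['e_j], with a small multiple of ['e_0] added, this forces [T j 0 = 0]; then
    [T 0 0] is nonzero because [T] is invertible. *)
Lemma chart_change_boundary c d (x : M) : atlas c -> atlas d -> dom c x -> dom d x ->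
 boundary x -> exists T : 'M[R]_4, [/\ T 0 0 != 0, (forall j, j != 0 -> T j 0 = 0) &
  forall n (f : 'R_n -> M) (A : set 'R_n) y J, A y -> f y = x ->
   mdiff f A y c J -> mdiff f A y d (J *m T)].
Proof.
move=> ac ad cx dx bx; have [T T0 hT] := chart_change ac ad cx dx.
have [_ [V oV cV] _ _ _] := atlas_chart ac; pose A := V `&` half_space (R := R).
have Ax : A (c x) by rewrite /A -cV.
have dm : mdiff (chart_inv c) A (c x) c 1%:M.
 split=> //; first by apply: within_all => y; rewrite /A -cV => /(chart_imageK ac)[].
 exists setT, id; split=> //.
 - by apply: Cinfty_row; [exact: openT|move=> j k; exact: ck_coord].
 - by move=> y _; rewrite /A -cV => /(chart_imageK ac)[_ ->].
 by move=> v; rewrite derive_id mulmx1.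
have {}dm : mdiff (chart_inv c) A (c x) d T by have := hT _ _ _ _ _ Ax _ dm; rewrite mul1mx; apply; rewrite chartK.
have c0 : c x 0 0 = 0 by apply/boundary_chart.
have inA (v : 'R_4) : 0 < v 0 0 -> inward A (c x) v.
 move=> v0; have nV : nbhs (c x) V by apply: nbhsO => //; case: Ax.
 have [e e0 he] := nbhs_inward v nV; exists e => // t te; split; first exact: he.
 by rewrite /half_space /= !mxE c0 add0r mulr_ge0 // ltW //; case/andP: te.
have bc : boundary (chart_inv c (c x)) by rewrite chartK.
have ge0 (v : 'R_4) : 0 < v 0 0 -> 0 <= (v *m T) 0 0 by move=> v0; exact: (mdiff_inward_ge0 Ax bc (inA v v0) dm).
have Tj (s : R) (j : 'I_4) : j != 0 -> 0 <= s * T j 0.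
 move=> j0; apply: (@ge0_limit _ (T 0 0)) => e e0.
 have -> : s * T j 0 + e * T 0 0 = ((s *: ('e_j : 'R_4) + e *: 'e_0) *m T) 0 0.
  by rewrite mulmxDl -!scalemxAl -!rowE !mxE.
 by apply: ge0; rewrite !mxE /= eq_sym (negbTE j0) mulr0 add0r mulr1.
have Tj0 (j : 'I_4) : j != 0 -> T j 0 = 0 by move=> j0; have := Tj 1 j j0; have := Tj (-1) j j0; lra.
exists T; split=> //; apply/eqP => T00; move: T0; rewrite -det_tr (@det_row0 4 _ 0) ?ltxx //.
apply/rowP => j; rewrite !mxE; have [->|j0] := eqVneq j 0; [exact: T00|exact: Tj0].
Qed.

(** [proper_embedding] asks for transversality in every chart; this reduces it to one. *)
Lemma transverse_chart n (f : 'R_n -> M) A x c d J K : A x -> fat A x -> boundary (f x) ->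
 mdiff f A x c J -> mdiff f A x d K -> (exists i, J i 0 != 0) -> exists i, K i 0 != 0.
Proof.
move=> Ax ft bx dJ dK [i Ji]; have [ac _ _] := dJ; have [ad _ _] := dK.
have [T [T0 Tj hT]] := chart_change_boundary ac ad (mdiff_dom Ax dJ) (mdiff_dom Ax dK) bx.
have := hT _ _ _ _ _ Ax erefl dJ => /(mdiff_uniq Ax ft dK) ->; exists i.
by rewrite mxE (bigD1 0) //= big1 ?addr0 ?mulf_neq0 // => j /Tj ->; rewrite mulr0.
Qed.

Lemma disc_inward (x v : 'R_2) : disc x -> x 0 0 * v 0 0 + x 0 1 * v 0 1 < 0 -> inward disc x v.
Proof.
rewrite /Defs.disc /=; set d := _ + _ => dx; set n := _ + _ => n0; set q := v 0 0 ^+ 2 + v 0 1 ^+ 2.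
have q0 : 0 <= q by rewrite addr_ge0 // sqr_ge0.
have q1 : 0 < q + 1 by lra.
exists (- n / (q + 1)) => [|t /andP[t0 te]]; first by rewrite divr_gt0 // oppr_gt0.
move: te; rewrite ltr_pdivlMr // => te; rewrite /= !mxE.
have -> : (x 0 0 + t * v 0 0) ^+ 2 + (x 0 1 + t * v 0 1) ^+ 2 = d + t * (2 * n + t * q) by rewrite /d /n /q; ring.
have h : 2 * n + t * q <= 0 by lra.
have := mulr_ge0_le0 (ltW t0) h; lra.
Qed.

Lemma disc_interior (x : 'R_2) : x 0 0 ^+ 2 + x 0 1 ^+ 2 < 1 -> nbhs x disc.
Proof.
move=> x1; pose n2 (x : 'R_2) := x 0 0 ^+ 2 + x 0 1 ^+ 2.
have cn : continuous n2 by rewrite /n2; cont.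
have o1 : nbhs (n2 x) [set a | a < 1] by exact: lt_near.
have h : nbhs x (fun y => n2 y < 1) := cn x _ o1.
by apply: filterS h => y; exact: ltW.
Qed.

Lemma disc_cases (x : 'R_2) : disc x -> circle x \/ nbhs x disc.
Proof.
rewrite /Defs.disc /Defs.circle /= le_eqVlt => /orP[/eqP|h]; first by left.
by right; exact: disc_interior.
Qed.

Lemma circle_inward (x : 'R_2) : circle x -> inward disc x (- x).
Proof.
move=> cx; apply: disc_inward; first exact: circle_disc.
by rewrite !mxE; move: cx; rewrite /Defs.circle /=; lra.
Qed.

Lemma coord_circle (x : 'R_2) i : disc x -> `|x 0 i| <= 1.
Proof.
rewrite /Defs.disc /= => h; have h0 := sqr_ge0 (x 0 0); have h1 := sqr_ge0 (x 0 1).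
have {h} : x 0 i ^+ 2 <= 1 by move: i; apply: I2_ind; lra.
by rewrite ler_norml => h; nra.
Qed.

Lemma disc_fat (x : 'R_2) : disc x -> fat disc x.
Proof.
move=> dx i; have [cx|nx] := disc_cases dx; last first.
 exists 'e_i, 'e_i, 1, 0; split; try exact: nbhs_inward.
 by rewrite scale1r scale0r addr0.
exists ('e_i - 2 *: x), (- x), 1, (-2); split.
- apply: disc_inward => //; have := coord_circle i dx; rewrite ler_norml => /andP[_ xi].
 have -> : x 0 0 * ('e_i - 2 *: x) 0 0 + x 0 1 * ('e_i - 2 *: x) 0 1 = x 0 i - 2.
  have -> : x 0 i = x 0 0 * ('e_i : 'R_2) 0 0 + x 0 1 * ('e_i : 'R_2) 0 1.
   by move: i {xi}; apply: I2_ind; rewrite !mxE /=; ring.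
  have E k : ('e_i - 2 *: x) 0 k = ('e_i : 'R_2) 0 k - 2 * x 0 k by rewrite !mxE.
  have : x 0 0 ^+ 2 + x 0 1 ^+ 2 = 1 by [].
  by rewrite !E; lra.
 lra.
- exact: circle_inward.
by rewrite scale1r scalerN scaleNr opprK subrK.
Qed.

Definition tangent (x : 'R_2) : 'R_2 := vec2 (- x 0 1) (x 0 0).

Lemma tangent_inward (x : 'R_2) s e : circle x -> 0 < e -> inward disc x (s *: tangent x - e *: x).
Proof.
move=> cx e0; apply: disc_inward; first exact: circle_disc.
rewrite !mxE /=.
have -> : x 0 0 * (s * - x 0 1 - e * x 0 0) + x 0 1 * (s * x 0 0 - e * x 0 1) =
 - e * (x 0 0 ^+ 2 + x 0 1 ^+ 2) by ring.
by rewrite (_ : _ + _ = 1) // mulr1 oppr_lt0.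
Qed.

Lemma circle_frame (x v : 'R_2) : circle x ->
 v = (v 0 1 * x 0 0 - v 0 0 * x 0 1) *: tangent x + (v 0 0 * x 0 0 + v 0 1 * x 0 1) *: x.
Proof.
rewrite /Defs.circle /= => cx; apply/rowP; apply: I2_ind; rewrite !mxE /=.
 by rewrite -[LHS]mulr1 -cx; ring.
by rewrite -[LHS]mulr1 -cx; ring.
Qed.

(** The vectors [s *: tangent x - e *: x] with [e > 0] point into the disc for [s] of either sign,
    and letting [e] tend to 0 gives the tangential part. The radial part is nonzero by
    transversality of a proper embedding. *)
Lemma disc_normal (D : 'R_2 -> M) x c J : proper_disc D -> circle x -> mdiff D disc x c J ->
 (tangent x *m J) 0 0 = 0 /\ (x *m J) 0 0 < 0.
Proof.
move=> [_ _ bD tD] cx dm; have dx := circle_disc cx; have bx := (bD x dx).2 cx.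
have ge s e : 0 < e -> 0 <= s * (tangent x *m J) 0 0 + e * - (x *m J) 0 0.
 move=> e0; have := mdiff_inward_ge0 dx bx (tangent_inward s cx e0) dm.
 by rewrite mulmxBl -!scalemxAl !mxE mulrN.
have t0 : (tangent x *m J) 0 0 = 0.
 have h1 : 0 <= 1 * (tangent x *m J) 0 0 by apply: ge0_limit => e; exact: ge.
 have h2 : 0 <= -1 * (tangent x *m J) 0 0 by apply: ge0_limit => e; exact: ge.
 lra.
split=> //; have := ge 0 1 ltr01; rewrite mul0r add0r mul1r oppr_ge0 le_eqVlt => /orP[/eqP x0|//].
have [i /eqP[]] := tD x cx c J dm.
have -> : J i 0 = (('e_i : 'R_2) *m J) 0 0 by rewrite -rowE mxE.
by rewrite (circle_frame 'e_i cx) mulmxDl -!scalemxAl mxE [X in X + _]mxE [X in _ + X]mxE t0 x0 !mulr0 addr0.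
Qed.

(** * Leaves of a disc as proper arcs *)

Section Leaves.
Implicit Types (E : 'R_2 -> M) (s v : R).

(* [(x + sqrt 2 * sqrt (1 - y^2 / 2))^2] and [(sqrt 2 * sqrt (1 - y^2 / 2) - x)^2], in terms of the
  point [z] of the disc with elliptical coordinates [x], [y] *)
Definition rad_p (z : 'R_2) := (w2 + z 0 0) ^+ 2 - z 0 1 ^+ 2.
Definition rad_m (z : 'R_2) := (w2 - z 0 0) ^+ 2 - z 0 1 ^+ 2.
Definition square_inv (z : 'R_2) : R := (Num.sqrt (rad_p z) - Num.sqrt (rad_m z)) / 2.

(** For [0 < v < 1] the radicands stay positive, away from the corners, so that the horizontal
    coordinate [2 * s - 1] extends to a smooth function near the leaf. *)
Lemma square_invP s v : itv s -> 0 < v < 1 -> [/\ 0 < rad_p (square_disc s v),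
 0 < rad_m (square_disc s v) & square_inv (square_disc s v) = 2 * s - 1].
Proof.
move=> si vi; have vi' : itv v by lra.
have w20 : w2 ^+ 2 = 2 by rewrite sqr_sqrtr.
have w0 : 0 <= w2 := sqrtr_ge0 2.
have hy := itv_sqr vi'; have hx := itv_sqr si.
have x1 : -1 <= 2 * s - 1 <= 1 by lra.
have y1 : (2 * v - 1) ^+ 2 < 1 by rewrite expr2; nra.
rewrite /square_inv /rad_p /rad_m !vecE.
set x := 2 * s - 1 in hx x1 *; set y := 2 * v - 1 in hy y1 *; clearbody x y.
have A2 : Num.sqrt (1 - y ^+ 2 / 2) ^+ 2 = 1 - y ^+ 2 / 2 by rewrite sqr_sqrtr // half_sqr_le1.
have B2 : Num.sqrt (1 - x ^+ 2 / 2) ^+ 2 = 1 - x ^+ 2 / 2 by rewrite sqr_sqrtr // half_sqr_le1.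
have A0 := sqrtr_ge0 (1 - y ^+ 2 / 2).
move: (Num.sqrt (1 - y ^+ 2 / 2)) (Num.sqrt (1 - x ^+ 2 / 2)) A2 B2 A0 => A B A2 B2 A0.
have wA : 1 < w2 * A.
 rewrite -(@ltr_pXn2r _ 2%N) ?nnegrE ?mulr_ge0 // exprMn w20; lra.
have -> : (w2 + x * A) ^+ 2 - (y * B) ^+ 2 = (x + w2 * A) ^+ 2.
 apply/eqP; rewrite -subr_eq0; apply/eqP.
 transitivity (w2 ^+ 2 * (1 - A ^+ 2) + x ^+ 2 * (A ^+ 2 - 1) - y ^+ 2 * B ^+ 2); first by ring.
 by rewrite w20 A2 B2; field.
have -> : (w2 - x * A) ^+ 2 - (y * B) ^+ 2 = (w2 * A - x) ^+ 2.
 apply/eqP; rewrite -subr_eq0; apply/eqP.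
 transitivity (w2 ^+ 2 * (1 - A ^+ 2) + x ^+ 2 * (A ^+ 2 - 1) - y ^+ 2 * B ^+ 2); first by ring.
 by rewrite w20 A2 B2; field.
rewrite !sqrtr_sqr !ger0_norm; [|lra|lra].
by split; [rewrite exprn_gt0 //; lra|rewrite exprn_gt0 //; lra|lra].
Qed.

Lemma ck_rad k : ck k setT rad_p /\ ck k setT rad_m.
Proof.
have oT := @openT 'R_2.
have k0 : ck k setT (fun z : 'R_2 => z 0 0) by [].
have k1 : ck k setT (fun z : 'R_2 => z 0 1) by [].
have kw : ck k setT (fun z : 'R_2 => w2) by [].
have kp := ckD oT kw k0; have km := ckB oT kw k0; have k11 := ckM oT k1 k1.
by split; [exact: ckB oT (ckM oT kp kp) k11|exact: ckB oT (ckM oT km km) k11].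
Qed.

Definition inv_dom : set 'R_2 := [set z | 0 < rad_p z /\ 0 < rad_m z].

Lemma open_gt0 T (f : T -> R) : continuous f -> open [set x | 0 < f x].
Proof. by move=> cf; apply: (@open_comp _ _ f [set a | 0 < a]) => [x _|]. Qed.

Lemma inv_dom_open : open inv_dom.
Proof.
by have [kp km] := ck_rad 0; apply: openI; apply: open_gt0 => x; [exact: (ck_cont kp)|exact: (ck_cont km)].
Qed.

Lemma ck_square_inv k : ck k inv_dom square_inv.
Proof.
have oD := inv_dom_open; have [kp km] := ck_rad k.
apply: ckM => //.
by apply: ckB => //; apply: ck_sqrt => // [z []//|]; apply: (ck_sub (U := setT)).
Qed.

Definition leaf n (eta : 'R_n.+1 -> R) (y : 'R_n.+1) := square_disc (y 0 0) (eta y).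

Lemma leaf_smooth n (eta : 'R_n.+1 -> R) : (forall k, ck k setT eta) ->
 exists U, [/\ open U, (forall y : 'R_n.+1, itv (y 0 0) -> itv (eta y) -> U y) & Cinfty U (leaf eta)].
Proof.
move=> se; pose rx (y : 'R_n.+1) := 1 - (2 * y 0 0 - 1) ^+ 2 / 2.
pose ry (y : 'R_n.+1) := 1 - (2 * eta y - 1) ^+ 2 / 2.
have k2 k (f : 'R_n.+1 -> R) : ck k setT f -> ck k setT (fun y => 2 * f y - 1).
 move=> kf; apply: ckB => //.
 by smooth.
have k4 k (f : 'R_n.+1 -> R) : ck k setT f -> ck k setT (fun y => 1 - (2 * f y - 1) ^+ 2 / 2).
 move=> kf; apply: ckB; [exact: openT|exact: ck_cst|].
 apply: ckM => //.
 by apply: (ckM); [exact: openT|exact: k2|exact: k2].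
have kx k : ck k setT rx by apply: k4.
have ky k : ck k setT ry by exact: k4.
have cx : continuous rx by move=> x; exact: (ck_cont (kx 0%N)).
have cy : continuous ry by move=> x; exact: (ck_cont (ky 0%N)).
have oU : open ([set y | 0 < rx y] `&` [set y | 0 < ry y]) by apply: openI; exact: open_gt0.
exists ([set y | 0 < rx y] `&` [set y | 0 < ry y]); split=> //.
 by move=> y /itv_sqr h1 /itv_sqr h2; rewrite /= /rx /ry; lra.
apply: Cinfty_vec2 => // k; apply: ckM => //.
- by apply: (ck_sub (U := setT)) => //; apply: k2.
- by apply: ck_sqrt => // [y []//|]; exact: (ck_sub (U := setT)).
- by apply: (ck_sub (U := setT)) => //; exact: k2.
by apply: ck_sqrt => // [y []//|]; exact: (ck_sub (U := setT)).
Qed.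

Lemma leaf_mdiff n E (eta : 'R_n.+1 -> R) x : proper_disc E -> (forall k, ck k setT eta) ->
 cube n.+1 x -> (\forall y \near within (cube n.+1) (nbhs x), itv (eta y)) ->
 exists c J S, [/\ mdiff E disc (leaf eta x) c J, diff_on (leaf eta) (cube n.+1) x S, row_free J &
  mdiff (fun y => E (leaf eta y)) (cube n.+1) x c (S *m J)].
Proof.
move=> [_ sm _ _] se cx near_eta; have [U [oU hU sU]] := leaf_smooth se.
have [W [oW Wx] WE] := within_openP near_eta.
have ex : itv (eta x) by exact: WE.
have dx : disc (leaf eta x) by apply: sq_disc_in.
have [c [J [dJ fJ]]] := sm _ dx.
have [S dS] := @diff_on_Cinfty n.+1 2 (leaf eta) U (cube n.+1) x oU (hU _ (cx 0) ex) sU.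
exists c, J, S; split=> //; apply: (mdiff_comp cx _ dS dJ).
suff : nbhs x (fun y => cube n.+1 y -> disc (leaf eta y)) by [].
apply: (open_near oW Wx) => y Wy cy; apply: sq_disc_in; first exact: cy.
exact: WE.
Qed.

Lemma leaf_circle s v : itv s -> 0 < v < 1 -> circle (square_disc s v) <-> s = 0 \/ s = 1.
Proof.
move=> si vi; have vi' : itv v by lra.
split; last by move=> h; apply: sq_disc_circle => //; case: h => h; [constructor 1|constructor 2].
rewrite /Defs.circle /= square_discE // => /eqP; rewrite -subr_eq0 addrAC subrr sub0r oppr_eq0 mulf_eq0 => /orP[/eqP h|/eqP h].
 have /eqP : s * (s - 1) = 0 by lra.
 by rewrite mulf_eq0 subr_eq0 => /orP[/eqP|/eqP]; [left|right].
have p : 0 < v * (1 - v) by apply: mulr_gt0; lra.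
lra.
Qed.

(** [square_inv] is a smooth left inverse of the leaf up to an affine map, which gives both
    injectivity and nonzero velocity. Near the ends the leaf is part of the horizontal diameter,
    which meets the circle radially, and [disc_normal] gives transversality. *)
Lemma proper_leaf E (eta : R -> R) : proper_disc E -> smooth1 eta ->
 (forall s, itv s -> 0 < eta s < 1) ->
 (exists2 h, 0 < h & forall s, s <= h \/ 1 - h <= s -> eta s = 2^-1) ->
 proper_arc (fun s => E (square_disc s (eta s))).
Proof.
move=> pE se ei [h h0 hh]; have [iE sm bE tE] := pE.
pose et (x : 'R_1) := eta (x 0 0).
have ket k : ck k setT et by apply: se.
have near_et (x : 'R_1) : \forall y \near within (cube 1) (nbhs x), itv (et y).
 by apply: within_all => y /(_ 0) cy; have := ei _ cy; rewrite /et; lra.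
have [U [oU hU sU]] := leaf_smooth ket.
have et_itv (x : 'R_1) : cube 1 x -> itv (et x) by move=> /(_ 0) cx; have := ei _ cx; rewrite /et; lra.
have imm (x : 'R_1) S : cube 1 x -> diff_on (leaf et) (cube 1) x S -> S != 0.
 move=> cx dS; apply/eqP => S0.
 pose G z : 'R_1 := const_mx (square_inv z).
 have dG : Cinfty inv_dom G.
  apply: Cinfty_row; first exact: inv_dom_open.
  by move=> j k; apply: ck_ext (ck_square_inv k); [exact: inv_dom_open|move=> z _; rewrite mxE].
 have [i1 i2 _] := square_invP (cx 0) (ei _ (cx 0)).
 have [JG dJG] := @diff_on_Cinfty 2 1 G inv_dom setT (leaf et x) inv_dom_open (conj i1 i2) dG.
 have nT : \forall y \near within (cube 1) (nbhs x), [set: 'R_2] (leaf et y) by exact: all_near.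
 have dc := diff_on_comp cx nT dS dJG.
 have da : diff_on (fun y : 'R_1 => G (leaf et y)) (cube 1) x (const_mx 2 : 'M[R]_1).
  pose a (y : 'R_1) : 'R_1 := 2 *: y + const_mx (-1).
  exists setT, a; split=> //.
  - apply: Cinfty_row; [exact: openT|move=> j k].
   apply: (ck_ext); [exact: openT|by move=> y _; rewrite !mxE|].
   by smooth.
  - move=> y _ cy; have [_ _ E'] := square_invP (cy 0) (ei _ (cy 0)).
   by apply/rowP => j; rewrite !mxE (ord1 j).
  move=> v; rewrite (@derive_affine _ _ a x v (2 *: v)).
   by apply/rowP => j; rewrite !mxE big_ord1 !mxE (ord1 j) mulrC.
  by move=> t; apply/rowP => j; rewrite !mxE; ring.
 have := diff_on_basis cx (fun i => cube_inward i cx) dc da; rewrite S0 mul0mx => /matrixP/(_ 0 0).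
 by rewrite !mxE => /eqP; rewrite eq_sym pnatr_eq0.
split.
- move=> x y; rewrite !inE => cx cy /= exy.
 have /(congr1 square_inv) : square_disc (x 0 0) (et x) = square_disc (y 0 0) (et y).
  by apply: iE; rewrite ?inE //; apply: sq_disc_in; [exact: cx|exact: et_itv|exact: cy|exact: et_itv].
 have [_ _ ->] := square_invP (cx 0) (ei _ (cx 0)); have [_ _ ->] := square_invP (cy 0) (ei _ (cy 0)).
 by move=> xy; apply/rowP => j; rewrite (ord1 j); lra.
- move=> x cx; have [c [J [S [dJ dS fJ dm]]]] := leaf_mdiff pE ket cx (near_et x).
 exists c, (S *m J); split=> //; rewrite /row_free rank_rV eqb1.
 apply: contra (imm x S cx dS) => /eqP SJ; apply/eqP/(row_free_inj fJ).
 by rewrite /= mul0mx.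
- move=> x cx; have dx : disc (square_disc (x 0 0) (et x)) by apply: sq_disc_in; [exact: cx|exact: et_itv].
 apply: (iff_trans (bE _ dx)); apply: leaf_circle; [exact: cx|exact: ei (cx 0)].
move=> x /= hx c J dm.
have cx : cube 1 x by apply/cube1P; case: hx => ->.
have nh : \forall y \near within (cube 1) (nbhs x), leaf et y = vec2 (2 * y 0 0 - 1) 0.
 suff : nbhs x (fun y : 'R_1 => y 0 0 < h \/ 1 - h < y 0 0).
  apply: filterS => y hy _; rewrite /leaf /et hh ?sq_disc_mid //.
  by case: hy => /ltW; [left|right].
 case: hx => hx.
  have n0 : nbhs (x 0 0) [set a | a < h] by apply: lt_near; rewrite hx.
  have n1 : nbhs x (fun y : 'R_1 => y 0 0 < h) := @cont_coord 1 0 x _ n0.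
  by apply: filterS n1 => y; left.
 have n0 : nbhs (x 0 0) [set a | 1 - h < a] by apply: gt_near; lra.
 have n1 : nbhs x (fun y : 'R_1 => 1 - h < y 0 0) := @cont_coord 1 0 x _ n0.
 by apply: filterS n1 => y; right.
have [c' [J' [S [dJ' _ fJ _]]]] := leaf_mdiff pE ket cx (near_et x).
have dS : diff_on (leaf et) (cube 1) x (vec2 2 0).
 pose a (y : 'R_1) : 'R_2 := y 0 0 *: vec2 2 0 + vec2 (-1) 0.
 apply: (diff_on_eq (f := a)).
  by apply: filterS nh => y /= ->; apply/rowP; apply: I2_ind; rewrite !mxE /=; lra.
 exists setT, a; split=> //.
 - apply: Cinfty_row; [exact: openT|move=> j k].
  apply: (ck_ext (f := fun y : 'R_1 => y 0 0 * vec2 2 0 0 j + vec2 (-1) 0 0 j)); [exact: openT|by move=> y _; rewrite !mxE|].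
  by smooth.
 move=> v; rewrite (@derive_affine _ _ a x v (v 0 0 *: vec2 2 0)).
  by apply/rowP => j; rewrite !mxE big_ord1 !mxE.
 by move=> t; apply/rowP => j; rewrite !mxE; ring.
have dx : disc (leaf et x) by apply: sq_disc_in; [exact: cx|exact: et_itv].
have dm' : mdiff (fun y => E (leaf et y)) (cube 1) x c' (vec2 2 0 *m J').
 apply: (mdiff_comp cx _ dS dJ').
 by apply: within_all => y cy; apply: sq_disc_in; [exact: cy|exact: et_itv].
have lx : leaf et x = vec2 (2 * x 0 0 - 1) 0 by rewrite /leaf /et hh ?sq_disc_mid //; lra.
have cc : circle (leaf et x) by rewrite /Defs.circle /= lx !vecE; case: hx => ->; ring.
have bx : boundary (E (leaf et x)) by apply/(bE _ dx).
apply: (transverse_chart cx (cube_fat cx) bx dm' dm).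
exists 0; have [_ n0] := disc_normal pE cc dJ'.
have -> : (vec2 2 0 *m J') 0 0 = 2 * (2 * x 0 0 - 1) * (leaf et x *m J') 0 0.
 have -> : vec2 2 0 = (2 * (2 * x 0 0 - 1)) *: leaf et x.
  by rewrite lx; apply/rowP; apply: I2_ind; rewrite !mxE /=; case: hx => ->; ring.
 by rewrite -scalemxAl mxE.
apply: mulf_neq0; last by rewrite lt_eqF.
lra.
Qed.

End Leaves.

(** * The loop of a disc as a loop of embedded arcs *)

Section BetaLoop.
Variable D0 : 'R_2 -> M.
Local Notation I0 := (core_arc D0).
Hypothesis D0_proper : proper_disc D0.

Variables (D : 'R_2 -> M) (e : R) (rho tau : R -> R).
Hypothesis D_proper : proper_disc D.
Hypothesis e_itv : 0 < e < 2^-1.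
Hypothesis collar : agrees_on_collar D0 e D.
Hypothesis cut : end_cutoff e rho.
Hypothesis tch : time_change tau.

Lemma smooth1_cst (a : R) : smooth1 (fun=> a).
Proof. by move=> n k U f oU kf; exact: ck_cst. Qed.

Lemma core_arc_Emb : Emb I0 I0.
Proof.
split; last by exists 1.
apply: (proper_leaf (eta := fun=> 2^-1)) => //; first exact: smooth1_cst.
 by move=> s _; lra.
by exists 1.
Qed.

Lemma core_arc_loop : Emb_loop I0 (fun=> I0).
Proof.
split=> //; last by move=> t _; exact: core_arc_Emb.
move=> x cx; have near_itv : \forall y \near within (cube 2) (nbhs x), itv 2^-1.
 by apply: within_all => y _; lra.
have [c [J [S [_ _ _ dm]]]] := leaf_mdiff (eta := fun=> 2^-1) D0_proper (fun k => ck_cst _ _ _) cx near_itv.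
by exists c, (S *m J).
Qed.

Definition level (h s : R) := 2^-1 + (1 - 2 * e) * rho s * (h - 2^-1).

Lemma level_itv h s : itv h -> 0 < level h s < 1.
Proof.
have [_ r01 _ _] := cut; have /andP[r0 r1] := r01 s; have ei := e_itv.
move=> /andP[h0 h1]; rewrite /level.
have c0 : 0 <= (1 - 2 * e) * rho s by apply: mulr_ge0; lra.
have c1 : (1 - 2 * e) * rho s < 1.
 have d0 : 0 <= 1 - 2 * e by lra.
 have := ler_wpM2l d0 r1; lra.
have e1 := ler_wpM2l c0 h1; have e0 := mulr_ge0 c0 h0.
lra.
Qed.

Lemma level_collar h s : h = 0 \/ h = 1 -> itv s -> D (square_disc s (level h s)) = D0 (square_disc s (level h s)).
Proof.
move=> h01 si; have hi : itv h by case: h01 => ->; rewrite lexx ler01.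
have /andP[l0 l1] := level_itv s hi; have li : itv (level h s) by lra.
apply: collar => //.
have [se|se] := leP s e; first by constructor 1.
have [se'|se'] := leP (1 - e) s; first by constructor 2.
have [_ _ r1 _] := cut; rewrite /level r1; last by lra.
by case: h01 => ->; [constructor 3|constructor 4]; lra.
Qed.

Lemma beta_arc t : itv t -> exists2 E, proper_disc E &
 beta D0 e rho D t = fun s => E (square_disc s (level (sweep_height t) s)).
Proof.
by exists (if 4^-1 <= t <= 3 / 4 then D else D0); [case: ifP|].
Qed.

Lemma beta_proper t : itv t -> proper_arc (beta D0 e rho D t).
Proof.
move=> ti; have [E pE ->] := beta_arc ti; have hi := sweep_height_itv ti.
have [sr _ _ [h h0 rh]] := cut.
apply: (proper_leaf) => //.
- move=> n k U f oU kf; apply: ckD => //.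
 apply: ckM => //.
 by apply: ckM => //; exact: smooth_fun_smooth1.
- by move=> s _; exact: level_itv.
by exists h => // s sh; rewrite /level rh // mulr0 mul0r addr0.
Qed.

(** Three overlapping intervals of [t], on each of which the arcs lie in a single disc at a height
    affine in [tau t]. Near the two overlaps [tau] rests and the arc lies where [D] and [D0] agree,
    by [level_collar]. *)
Lemma beta_loop : Emb_loop I0 (fun t => beta D0 e rho D (tau t)).
Proof.
have [st t0 t1 tm [h h0 th]] := tch; have [sr _ _ _] := cut; have ei := e_itv.
have ti t : itv t -> itv (tau t) by move=> /andP[a b]; rewrite -{1}t0 -t1 !tm.
split; last first.
- move=> s si; rewrite t0 t1 /beta.
 rewrite ?ifF; last 2 first.
 + lra.
 + lra.
 by rewrite sweep_height0 sweep_height1 subrr mulr0 addr0.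
- move=> t hti; split; first by apply: beta_proper; exact: ti.
 have [m m0 hm] := beta_margin ei collar cut.
 by exists m => // s si; exact: hm.
have q4 : tau 4^-1 = 4^-1 by have [E _] := th 4^-1; rewrite E // subrr normr0.
have q34 : tau (3 / 4) = 3 / 4 by have [_ E] := th (3 / 4); rewrite E // subrr normr0.
have tq t : t < 4^-1 + h -> tau t <= 4^-1.
 move=> lt; have [h1|h1] := leP t 4^-1.
  by rewrite -q4; exact: tm.
 by have [E _] := th t; rewrite E // ltr_norml; lra.
have tq' t : 4^-1 - h < t -> 4^-1 <= tau t.
 move=> lt; have [h1|h1] := leP 4^-1 t.
  by rewrite -q4; exact: tm.
 by have [E _] := th t; rewrite E // ltr_norml; lra.
have tr t : t < 3 / 4 + h -> tau t <= 3 / 4.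
 move=> lt; have [h1|h1] := leP t (3 / 4).
  by rewrite -q34; exact: tm.
 by have [_ E] := th t; rewrite E // ltr_norml; lra.
have tr' t : 3 / 4 - h < t -> 3 / 4 <= tau t.
 move=> lt; have [h1|h1] := leP (3 / 4) t.
  by rewrite -q34; exact: tm.
 by have [_ E] := th t; rewrite E // ltr_norml; lra.
have piece (E : 'R_2 -> M) (a b : R) (V : set R) (x : 'R_2) : proper_disc E -> cube 2 x -> open V -> V (x 0 1) ->
  (forall t, itv t -> V t -> itv (a + b * tau t) /\
   forall s, itv s -> E (square_disc s (level (a + b * tau t) s)) = beta D0 e rho D (tau t) s) ->
  exists c J, mdiff (fun x : 'R_2 => beta D0 e rho D (tau (x 0 1)) (x 0 0)) (cube 2) x c J.
 move=> pE cx oV Vx hV.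
 pose eta (x : 'R_2) := level (a + b * tau (x 0 1)) (x 0 0).
 have nV : nbhs x (fun y : 'R_2 => V (y 0 1)) by exact: near_coord.
 have near_eta : \forall y \near within (cube 2) (nbhs x), itv (eta y).
  suff : nbhs x (fun y => cube 2 y -> itv (eta y)) by [].
  apply: filterS nV => y Vy cy; have [hi _] := hV _ (cy 1) Vy.
  by have := level_itv (y 0 0) hi; rewrite /eta; lra.
 have keta k : ck k setT eta.
  have oT := @openT 'R_2.
  have k0 : ck k setT (fun y : 'R_2 => rho (y 0 0)) by apply: smooth_fun_smooth1 .
  have k1 : ck k setT (fun y : 'R_2 => tau (y 0 1)) by apply: smooth_fun_smooth1 .
  by smooth.
 have [c [J [S [_ _ _ dm]]]] := leaf_mdiff pE keta cx near_eta.
 exists c, (S *m J); apply: mdiff_eq dm.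
 suff : nbhs x (fun y => cube 2 y -> E (leaf eta y) = beta D0 e rho D (tau (y 0 1)) (y 0 0)) by [].
 by apply: filterS nV => y Vy cy; have [_ ->] := hV _ (cy 1) Vy.
move=> x cx; have [x1|x1] := ltP (x 0 1) (4^-1 + h).
 apply: (piece D0 2^-1 (-2) [set t | t < 4^-1 + h] x) => // t hti /tq tt.
 have /andP[tt0 _] := ti t hti; have Eh : 2^-1 + -2 * tau t = sweep_height (tau t).
  by rewrite /sweep_height tt; ring.
 rewrite Eh; split=> [|s si]; first by apply: sweep_height_itv; exact: ti.
 rewrite /beta -/(level _ _); case: ifP => // /andP[tt' _].
 have E4 : tau t = 4^-1 by apply/eqP; rewrite eq_le tt.
 by apply/esym/level_collar => //; left; rewrite E4; exact: sweep_height_quarter.1.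
have [x2|x2] := ltP (x 0 1) (3 / 4 + h).
 apply: (piece D (- 2^-1) 2 [set t | 4^-1 - h < t /\ t < 3 / 4 + h] x) => //.
 - by apply: openI.
 - by split=> //; lra.
 move=> t hti [/tq' q1 /tr q2].
 have Eh : - 2^-1 + 2 * tau t = sweep_height (tau t).
  rewrite /sweep_height q2; case: ifP => q3; last by ring.
  by have -> : tau t = 4^-1; [apply/eqP; rewrite eq_le q3|lra].
 rewrite Eh; split=> [|s si]; first by apply: sweep_height_itv; exact: ti.
 by rewrite /beta q1 q2.
apply: (piece D0 (5 / 2) (-2) [set t | 3 / 4 - h < t] x) => //; first by rewrite /=; lra.
move=> t hti /tr' tt; have Eh : 5 / 2 + -2 * tau t = sweep_height (tau t).
 rewrite /sweep_height ifF; last by rewrite //; lra.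
 case: ifP => q; last by ring.
 lra.
rewrite Eh; split=> [|s si]; first by apply: sweep_height_itv; exact: ti.
rewrite /beta -/(level _ _); case: ifP => // /andP[_ tt'].
have E4 : tau t = 3 / 4 by apply/eqP; rewrite eq_le tt'.
by apply/esym/level_collar => //; right; rewrite E4; exact: sweep_height_quarter.2.
Qed.

End BetaLoop.

(** * Estimates near the circle, and slow cutoffs *)

Lemma derive_bound n (U : set 'R_n) (f : 'R_n -> R) x : open U -> ck 1 U f -> U x ->
 exists2 B, 0 < B & forall v, `|'D_v f x| <= B * `|v|.
Proof.
move=> oU kf Ux; exists (\sum_i `|'D_('e_i) f x| + 1).
 by rewrite ltr_wpDl // sumr_ge0.
move=> v; rewrite (ck_derive v oU kf Ux) mulrDl mul1r ler_wpDr // mulr_suml.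
apply: le_trans (ler_norm_sum _ _ _) _; apply: ler_sum => i _.
by rewrite normrM mulrC ler_wpM2l // norm_coord_le.
Qed.

Lemma derive_near n (U : set 'R_n) (f : 'R_n -> R) x e : open U -> ck 1 U f -> U x -> 0 < e ->
 exists2 s, 0 < s & forall z, `|z - x| < s -> U z /\ forall v, `|'D_v f z - 'D_v f x| <= e * `|v|.
Proof.
move=> oU kf Ux e0; pose c := e / n.+1%:R; have c0 : 0 < c by rewrite divr_gt0.
have h : \forall z \near x, forall i : 'I_n, `|'D_('e_i) f x - 'D_('e_i) f z| < c.
 apply: near_forall => i; have [_ /(_ 'e_i)[_ k0]] := kf.
 have cc : {for x, continuous ('D_('e_i) f)} by exact: (k0.1 x Ux).
 exact: (cont_dist cc c0).
have nU : nbhs x U by exact: open_nbhs_nbhs.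
have /nbhs_normP[s /= s0 hs] := nbhsI2 h nU; exists s => // z zs.
have [hz Uz] : (forall i : 'I_n, `|'D_('e_i) f x - 'D_('e_i) f z| < c) /\ U z by apply: hs; rewrite /ball_/= distrC.
split=> // v; rewrite !(ck_derive v oU kf) // -sumrB.
have -> : \sum_i (v 0 i * 'D_('e_i) f z - v 0 i * 'D_('e_i) f x) =
  \sum_i v 0 i * (\row_i ('D_('e_i) f z - 'D_('e_i) f x)) 0 i.
 by apply: eq_bigr => i _; rewrite mxE mulrBr.
apply: le_trans (row_dot_le (a := `|v|) (b := c) _ _ _ _) _ => //; try exact: ltW.
- by exact: norm_coord_le.
- by move=> i; rewrite mxE distrC ltW.
rewrite mulrCA mulrC ler_wpM2r // mulrC mulrAC ler_pdivrMr // ler_pM2l // ler_nat.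
exact: leqnSn.
Qed.

(** Defining function of the circle, positive inside; near the circle it is the distance to it up to
    constants. *)
Definition gap (z : 'R_2) : R := 1 - (z 0 0 ^+ 2 + z 0 1 ^+ 2).

Lemma gap_disc z : disc z <-> 0 <= gap z.
Proof. by rewrite subr_ge0. Qed.

Lemma gap_circle z : circle z <-> gap z = 0.
Proof.
by rewrite /gap /Defs.circle /=; split=> [->|/subr0_eq ->//]; rewrite subrr.
Qed.

Lemma ck_gap k : ck k setT gap.
Proof.
have oT := @openT 'R_2; apply: ckB => //.
by apply: ckD => //; apply: (ckM) .
Qed.

Lemma derive_gap z v : 'D_v gap z = - 2 * (z 0 0 * v 0 0 + z 0 1 * v 0 1).
Proof.
have d i : is_derive z v (fun y : 'R_2 => y 0 i) (v 0 i) by exact: is_derive_coord.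
have q i : is_derive z v (fun y : 'R_2 => y 0 i ^+ 2) (2 * z 0 i * v 0 i).
 have := is_deriveM (d i) (d i); rewrite -mulrDr mulr2n; move=> [h1 h2].
 split; first exact: h1.
 lra.
have h := is_deriveB (is_derive_cst (1 : R) z v) (is_deriveD (q 0) (q 1)).
have [_ E] := h; rewrite [LHS]E; ring.
Qed.

Lemma disc_dot (z v : 'R_2) : disc z -> `|z 0 0 * v 0 0 + z 0 1 * v 0 1| <= 2 * `|v|.
Proof.
move=> dz; apply: le_trans (ler_normD _ _) _; rewrite !normrM.
have h i : `|z 0 i| * `|v 0 i| <= `|v|.
 have := ler_pM (normr_ge0 _) (normr_ge0 _) (coord_circle i dz) (norm_coord_le v i).
 lra.
by have := h 0; have := h 1; lra.
Qed.

Lemma gap_near (x z : 'R_2) : circle x -> gap z <= 4 * `|z - x|.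
Proof.
move=> cx; have := disc_dot (z - x) (circle_disc cx); rewrite ler_norml => /andP[h _].
have -> : gap z = - 2 * (x 0 0 * (z - x) 0 0 + x 0 1 * (z - x) 0 1) - ((z - x) 0 0 ^+ 2 + (z - x) 0 1 ^+ 2).
 rewrite /gap !mxE -[X in X - _](_ : x 0 0 ^+ 2 + x 0 1 ^+ 2 = 1) //; ring.
have := sqr_ge0 ((z - x) 0 0); have := sqr_ge0 ((z - x) 0 1).
move: h; set a := _ + _; lra.
Qed.

Lemma circle_proj (z : 'R_2) : disc z -> gap z < 1 -> exists y, [/\ circle y, `|y - z| <= gap z &
 forall t, itv t -> disc (z + t *: (y - z))].
Proof.
move=> dz g1; pose n := z 0 0 ^+ 2 + z 0 1 ^+ 2; pose r := Num.sqrt n.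
have n0 : 0 < n by move: g1; rewrite /gap -/n; lra.
have n1 : n <= 1 by [].
have r2 : r ^+ 2 = n by rewrite sqr_sqrtr // ltW.
have r0 : 0 < r by rewrite sqrtr_gt0.
have r1 : r <= 1 by rewrite -sqrtr1 ler_sqrt.
have rn : n <= r by rewrite -r2 ler_piMl // ltW.
have zr i : `|z 0 i| <= r.
 rewrite -sqrtr_sqr ler_sqrt; last exact: ltW.
 have h0 := sqr_ge0 (z 0 0); have h1 := sqr_ge0 (z 0 1).
 by rewrite /n; move: i; apply: I2_ind; lra.
have cy : circle (r^-1 *: z) by rewrite /Defs.circle /= !mxE !exprMn -mulrDr exprVn r2 mulVf // gt_eqF.
exists (r^-1 *: z); split=> //.
 have -> : r^-1 *: z - z = (r^-1 - 1) *: z by rewrite scalerBl scale1r.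
 have ri : 0 <= r^-1 - 1 by rewrite subr_ge0 invf_ge1.
 rewrite normrZ ger0_norm //; apply: le_trans (_ : (r^-1 - 1) * r <= _).
  by apply: ler_wpM2l => //; apply: norm_row_le; [exact: ltW|exact: zr].
 by rewrite mulrBl mulVf ?gt_eqF // mul1r lerB.
move=> t ti; have -> : z + t *: (r^-1 *: z - z) = (1 - t) *: z + t *: (r^-1 *: z).
 by rewrite scalerBr scalerBl scale1r addrCA addrC.
by apply: disc_segment => //; exact: circle_disc.
Qed.

(** The segment from [z] to its radial projection has length at most [gap z], and [G] vanishes at
    its end on the circle. *)
Lemma collar_lipschitz (U : set 'R_2) (G : 'R_2 -> R) x : open U -> ck 1 U G -> U x ->
 circle x -> (forall y, U y -> circle y -> G y = 0) ->
 exists s L, [/\ 0 < s, 0 < L & forall z, disc z -> `|z - x| < s -> U z /\ `|G z| <= L * gap z].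
Proof.
move=> oU kG Ux cx G0; have [B B0 hB] := derive_bound oU kG Ux.
have [s s0 hs] := derive_near oU kG Ux ltr01.
pose s' := Num.min (s / 5) 5^-1; have s'0 : 0 < s' by rewrite lt_min divr_gt0 //=.
exists s', (B + 1); split=> //; first by rewrite addr_gt0.
move=> z dz; rewrite lt_min => /andP[zs z5].
have gz := gap_near z cx; have g1 : gap z < 1 by lra.
have [y [cy yz seg]] := circle_proj dz g1.
have near t : itv t -> `|z + t *: (y - z) - x| < s.
 move=> /andP[t0 t1]; rewrite addrAC; apply: le_lt_trans (ler_normD _ _) _.
 rewrite normrZ ger0_norm //.
 have : t * `|y - z| <= `|y - z| by rewrite ler_piMl.
 lra.
have zs' : `|z - x| < s by lra.
split; first by have [] := hs z zs'.
have inU t : itv t -> U (z + t *: (y - z)) by move=> /near/hs[].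
have Uy : U y by have := inU 1; rewrite scale1r addrC subrK; apply.
have [|c c01 E] := @mvt_line _ G z (y - z).
 by move=> t /inU Ut; have [_ /(_ (y - z))[d _]] := kG; exact: d.
have ci : itv c by lra.
move: E; rewrite [z + _]addrC subrK (G0 y Uy cy) sub0r => /(congr1 Num.norm); rewrite normrN => ->.
have [_ /(_ (y - z)) h1] := hs _ (near c ci); have h2 := hB (y - z).
have h3 : `|'D_(y - z) G (z + c *: (y - z))| <= (B + 1) * `|y - z|.
 rewrite -[X in `|X|](subrK ('D_(y - z) G x)); apply: le_trans (ler_normD _ _) _.
 by rewrite mulrDl; lra.
apply: le_trans h3 _; rewrite ler_wpM2l //; lra.
Qed.

Lemma derive_gap_tangent x : circle x -> forall s e, 'D_(s *: tangent x - e *: x) gap x = 2 * e.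
Proof.
move=> cx s e; rewrite derive_gap !mxE /=.
have -> : x 0 0 * (s * - x 0 1 - e * x 0 0) + x 0 1 * (s * x 0 0 - e * x 0 1) =
 - e * (x 0 0 ^+ 2 + x 0 1 ^+ 2) by ring.
by rewrite (_ : _ + _ = 1) //; ring.
Qed.

(** As [|G| <= L * gap], the function [L * gap - G] is nonnegative on the disc near [x] and vanishes
    at [x]; so its derivatives in the inward directions [a *: tangent x - e *: x] are nonnegative,
    for both signs of [a] and arbitrarily small [e]. *)
Lemma tangent_derive0 (U : set 'R_2) (G : 'R_2 -> R) x : open U -> ck 1 U G -> U x ->
 circle x -> (forall y, U y -> circle y -> G y = 0) -> 'D_(tangent x) G x = 0.
Proof.
move=> oU kG Ux cx G0; have [s [L [s0 L0 hL]]] := collar_lipschitz oU kG Ux cx G0.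
pose f y := L * gap y - G y.
have kf : ck 1 U f.
 apply: (ckB oU _ kG); apply: (ckM oU (ck_cst _ _ _)).
 exact: (ck_sub (@subsetT _ U) (ck_gap 1)).
have g0 : gap x = 0 by exact/gap_circle.
have lin (a b : R) (v w : 'R_2) : 'D_(a *: v - b *: w) G x = a * 'D_v G x - b * 'D_w G x.
 have dG := ck1_diff oU kG Ux.
 by rewrite !deriveE // linearB !linearZ.
have key (a e : R) : 0 < e -> 0 <= - a * 'D_(tangent x) G x + e * (2 * L + 'D_x G x).
 move=> e0; have [d d0 hd] := tangent_inward a cx e0.
 have Wo : open (U `&` [set z | `|z - x| < s]) by apply: openI => //; exact: norm_ball_open.
 have kf' : ck 1 (U `&` [set z | `|z - x| < s]) f by apply: ck_sub kf => z [].
 have Wx : (U `&` [set z | `|z - x| < s]) x by split=> //=; rewrite subrr normr0.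
 have := derive_inward_ge0 (v := a *: tangent x - e *: x) Wo kf' Wx _ d0.
 have -> : 'D_(a *: tangent x - e *: x) f x = L * (2 * e) - (a * 'D_(tangent x) G x - e * 'D_x G x).
  have d1 : derivable gap x (a *: tangent x - e *: x) by have [_ /(_ (a *: tangent x - e *: x))[h _]] := ck_gap 1; exact: h.
  have d2 : derivable G x (a *: tangent x - e *: x) by have [_ /(_ (a *: tangent x - e *: x))[h _]] := kG; exact: h.
  rewrite -lin -(derive_gap_tangent cx a).
  have d1' : derivable (L \*: gap) x (a *: tangent x - e *: x) by exact: derivableZ.
  by rewrite (deriveB d1' d2) (deriveZ L d1).
 rewrite /f g0 (G0 x Ux cx) mulr0 subr0 => /(_ erefl) h.
 have {h} : 0 <= L * (2 * e) - (a * 'D_(tangent x) G x - e * 'D_x G x).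
  apply: h => t te [_ ts]; rewrite subr_ge0; have [_] := hL _ (hd t te) ts.
  by rewrite ler_norml => /andP[].
 by lra.
have h1 : 0 <= - 1 * 'D_(tangent x) G x by apply: ge0_limit (fun e => key 1 e).
have h2 : 0 <= - (-1) * 'D_(tangent x) G x by apply: ge0_limit (fun e => key (-1) e).
lra.
Qed.

(* The two differentials agree on the tangent of the circle, and both have an
  inward normal component; so all their columnwise convex combinations are
  injective, uniformly. *)
Lemma columnwise_mix (x : 'R_2) (A B : 'M[R]_(2, 4)) : circle x -> row_free A ->
 tangent x *m A = tangent x *m B -> (tangent x *m A) 0 0 = 0 ->
 (x *m A) 0 0 < 0 -> (x *m B) 0 0 < 0 ->
 exists2 e, 0 < e & forall (v : 'R_2) (l : 'I_4 -> R), (forall j, itv (l j)) ->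
  (forall j, `|(v *m A) 0 j + l j * ((v *m B) 0 j - (v *m A) 0 j)| <= e * `|v|) -> v = 0.
Proof.
move=> cx fA tAB t0 xA xB.
have tn : tangent x != 0.
 apply/eqP => /rowP h; move: cx; rewrite /Defs.circle /=.
 have := h 0; have := h 1; rewrite !mxE /= => -> /eqP; rewrite oppr_eq0 => /eqP ->.
 lra.
have [j1 wj] : exists j1, (tangent x *m A) 0 j1 != 0.
 apply: contrapT => no; move/eqP: tn; apply; apply: (row_free_inj fA); rewrite /= mul0mx.
 by apply/rowP => j; rewrite [RHS]mxE; apply/eqP; apply: contrapT => /negP h; apply: no; exists j.
pose b := `|(tangent x *m A) 0 j1|; have b0 : 0 < b by rewrite normr_gt0.
pose a := Num.min (- (x *m A) 0 0) (- (x *m B) 0 0).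
have a0 : 0 < a by rewrite lt_min !oppr_gt0 xA.
have aA : a <= - (x *m A) 0 0 by rewrite ge_min lexx.
have aB : a <= - (x *m B) 0 0 by rewrite ge_min lexx orbT.
pose C := `|(x *m A) 0 j1| + `|(x *m B) 0 j1|.
have C0 : 0 <= C by rewrite addr_ge0.
(* The normal column 0 bounds the radial part of [v] by [e * |v| / a], then column [j1] bounds the
   tangential part; the sum is at most [e * K * |v|], and [e * K = 1/2]. *)
pose K := a^-1 + (1 + C / a) / b.
have K0 : 0 < K by rewrite addr_gt0 ?invr_gt0 // divr_gt0 // ltr_pwDl // divr_ge0 // ltW.
exists (2 * K)^-1; first by rewrite invr_gt0 mulr_gt0.
move=> v l li hv; set e := (2 * K)^-1 in hv.
have e0 : 0 < e by rewrite invr_gt0 mulr_gt0.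
pose al := v 0 1 * x 0 0 - v 0 0 * x 0 1; pose be := v 0 0 * x 0 0 + v 0 1 * x 0 1.
have vE : v = al *: tangent x + be *: x by exact: circle_frame.
have form j : (v *m A) 0 j + l j * ((v *m B) 0 j - (v *m A) 0 j) =
  al * (tangent x *m A) 0 j + be * ((1 - l j) * (x *m A) 0 j + l j * (x *m B) 0 j).
 rewrite {1 2 3}vE !mulmxDl -!scalemxAl -tAB !mxE; ring.
have N0 := normr_ge0 v.
have hbe : `|be| * a <= e * `|v|.
 apply: le_trans (hv 0); rewrite form t0 mulr0 add0r normrM ler_wpM2l //.
 have /andP[l0 l1] := li 0; have l1' : 0 <= 1 - l 0 by rewrite subr_ge0.
 have h1 := ler_wpM2l l1' aA; have h2 := ler_wpM2l l0 aB.
 by rewrite ler_normr; apply/orP; right; move: h1 h2; rewrite !mulrN; lra.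
have hal : `|al| * b <= e * `|v| + `|be| * C.
 have := hv j1; rewrite form => h.
 rewrite -normrM -[X in `|X|](addrK (be * ((1 - l j1) * (x *m A) 0 j1 + l j1 * (x *m B) 0 j1))).
 apply: le_trans (ler_normB _ _) _; rewrite lerD // normrM ler_wpM2l //.
 apply: le_trans (ler_normD _ _) _; rewrite !normrM.
 have /andP[l0 l1] := li j1; have l1' : 0 <= 1 - l j1 by rewrite subr_ge0.
 rewrite (ger0_norm l0) (ger0_norm l1') /C lerD // ler_piMl //; lra.
have hn : `|v| <= `|al| + `|be|.
 apply: norm_row_le => //.
 move=> i; rewrite {1}vE mxE [X in `|X + _|]mxE [X in `|_ + X|]mxE.
 apply: le_trans (ler_normD _ _) _; rewrite !normrM; have xc i' := coord_circle i' (circle_disc cx).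
 apply: lerD; rewrite ler_piMr //.
 by move: i; apply: I2_ind; rewrite !mxE /= ?normrN.
have hbe' : `|be| <= e * `|v| / a by rewrite ler_pdivlMr.
have hal' : `|al| <= (e * `|v| + e * `|v| / a * C) / b.
 rewrite ler_pdivlMr //; apply: le_trans hal _; rewrite lerD2l ler_wpM2r //.
have fin : `|v| <= e * K * `|v|.
 apply: le_trans hn _; apply: le_trans (lerD hal' hbe') _.
 by rewrite le_eqVlt; apply/orP; left; apply/eqP; rewrite /K; field; rewrite !gt_eqF.
have eK : e * K = 2^-1 by rewrite /e; field; rewrite gt_eqF.
apply/eqP; rewrite -normr_le0; move: fin; rewrite eK; lra.
Qed.

(** The derivative of [k (gap z)] gets multiplied by the difference of two maps that agree on the
    circle, which is of order [gap z]; the bound on [t * dk] makes this product small. Rescaling an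
    ordinary cutoff would only keep it bounded. *)
Definition slow_cutoff (k : R -> R) (s : R) :=
 [/\ smooth1 k, (forall t, itv (k t)), (forall t, s <= t -> k t = 0) &
   forall t : R, exists2 dk : R, is_derive t 1 k dk & `|t * dk| <= s].

Lemma slow_cutoffW k (s s' : R) : s <= s' -> slow_cutoff k s -> slow_cutoff k s'.
Proof.
move=> ss [sk k01 k0 dk]; split=> // [t st|t]; first by apply: k0; exact: le_trans st.
by have [d hd hb] := dk t; exists d => //; exact: le_trans ss.
Qed.

Lemma step_derive_bound : exists2 B, 0 < B & forall x : R, exists dx : R, [/\ is_derive x 1 (@step) dx, `|dx| <= B &
 dx != 0 -> itv x].
Proof.
have ss : smooth_fun (@step) by apply: smooth1_smooth_fun; exact: smooth1_step.
have D (x : R) : is_derive x 1 (@step) (derive1 (@step) x) by apply: DeriveDef; [exact: (ss 0%N x)|rewrite derive1E].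
have cD : continuous (derive1 (@step)).
 by move=> x; apply: differentiable_continuous; apply/derivable1_diffP; exact: (ss 1%N x).
have off x : x < 0 \/ 1 < x -> derive1 (@step) x = 0.
 move=> h; rewrite derive1E.
 have E : {near x, (fun=> step x) =1 @step}.
  case: h => h.
   have nx : nbhs x [set y | y < 0] by exact: lt_near.
   by apply: filterS nx => y /= y0; rewrite !step_le0 ?ltW.
  have nx : nbhs x [set y | 1 < y] by exact: gt_near.
  by apply: filterS nx => y /= y0; rewrite !step_ge1 ?ltW.
 by rewrite -(near_eq_derive (f := fun=> step x)) ?derive_cst.
have [|c _ hc] := @EVT_max R (fun x => `|derive1 (@step) x|) 0 1 ler01.
 apply: cont_within => x; apply: (continuous_comp); first exact: cD.
 exact: norm_continuous.
exists (`|derive1 (@step) c| + 1) => //.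
move=> x; exists (derive1 (@step) x); split=> //.
 have [x0|x0] := ltP x 0; first by rewrite off ?normr0 //; left.
 have [x1|x1] := ltP 1 x; first by rewrite off ?normr0 //; right.
 by have := hc x; rewrite in_itv /= x0 x1 => /(_ isT); lra.
move=> d0; apply/andP; split; rewrite leNgt; apply/negP => h; move: d0; rewrite off ?eqxx //; [left|right]; by [].
Qed.

Lemma sum_at_most_one n (a : 'I_n -> R) B : 0 <= B -> (forall i, `|a i| <= B) ->
 (forall i j, a i != 0 -> a j != 0 -> i = j) -> `|\sum_i a i| <= B.
Proof.
move=> B0 aB h; have [[i ai]|no] := pselect (exists i, a i != 0).
 rewrite (bigD1 i) //= big1 ?addr0 // => j ji; apply/eqP; apply: contraT => aj.
 by move: ji; rewrite (h j i aj ai) eqxx.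
rewrite big1 ?normr0 // => i _; apply/eqP; apply: contraT => ai; case: no; by exists i.
Qed.

(* an average of cutoffs at the scales [s / 4 ^ j]; at each [t] at most one of
  them varies *)
Lemma slow_cutoff_ex (s : R) : 0 < s -> exists2 k, slow_cutoff k s & exists2 d, 0 < d & forall t, t <= d -> k t = 1.
Proof.
move=> s0; have [B B0 hB] := step_derive_bound.
(* At each [t] at most one of the [n] averaged cutoffs varies, and [t] times its derivative is at
   most [2 * B]; hence [n > 2 * B / s]. *)
pose n := (Num.truncn (2 * B / s)).+1.
have Bs0 : 0 <= 2 * B / s by rewrite divr_ge0 ?mulr_ge0 // ltW.
have hn : 2 * B / s < n%:R by rewrite -natr1; have /andP[_] := truncn_itv Bs0.
have n0 : 0 < n%:R :> R by [].
pose c (j : 'I_n) : R := 2 * 4 ^+ j / s.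
have c0 j : 0 < c j by rewrite divr_gt0 // //.
pose b j t := step (2 - c j * t).
have b01 j t : itv (b j t) := step01 _.
pose k t := n%:R^-1 * \sum_j b j t.
have cst1 : n%:R^-1 * \sum_(j < n) (1 : R) = 1 by rewrite sumr_const card_ord mulVf // gt_eqF.
exists k; last first.
 exists (s / (2 * 4 ^+ n)); first by rewrite // mulr_gt0 //.
 move=> t td; rewrite /k -[RHS]cst1; congr (_ * _); apply: eq_bigr => j _.
 apply: step_ge1; have c1 : c j * t <= 1; last by lra.
 apply: le_trans (_ : c j * (s / (2 * 4 ^+ n)) <= _); first by rewrite ler_pM2l.
 have -> : c j * (s / (2 * 4 ^+ n)) = 4 ^+ j / 4 ^+ n by rewrite /c; field; rewrite ?gt_eqF //.
 by rewrite ler_pdivrMr // mul1r ler_eXn2l ?ltr1n // ltnW.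
split.
- move=> m l U f oU kf; apply: (ckM oU (ck_cst _ _ _)).
 apply: ck_sum => // j; apply: (smooth1_step oU).
 by smooth.
- move=> t; rewrite /k mulr_ge0 ?invr_ge0 ?(ltW n0) ?sumr_ge0 //=; last by move=> j _; case/andP: (b01 j t).
 rewrite -[leRHS]cst1 ler_pM2l ?invr_gt0 //; apply: ler_sum => j _; by case/andP: (b01 j t).
- move=> t st; rewrite /k big1 ?mulr0 // => j _; apply: step_le0; rewrite subr_le0.
 apply: le_trans (_ : c j * s <= _); last by rewrite ler_pM2l.
 by rewrite divfK ?gt_eqF // ler_peMr // exprn_ege1 // ler1n.
move=> t.
have D j : exists2 d : R, is_derive t 1 (b j) (d * - c j) & `|d| <= B /\ (d != 0 -> itv (2 - c j * t)).
 have [d [hd dB dz]] := hB (2 - c j * t); exists d => //.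
 apply: (@is_derive1_comp R (@step) (fun t => 2 - c j * t) t).
 have h := is_deriveB (is_derive_cst (2 : R) t 1) (is_deriveZ (c j) (is_derive_id t (1 : R))).
 by apply: is_derive_eq h _; rewrite sub0r -[_ *: _]/(_ * _) mulr1.
have D' j : exists d : R, is_derive t 1 (b j) (d * - c j) /\ (`|d| <= B /\ (d != 0 -> itv (2 - c j * t))).
 by have [d h1 h2] := D j; exists d.
have [d hd] := choice D'.
exists (n%:R^-1 * \sum_j (d j * - c j)).
 have h := is_deriveZ (n%:R^-1) (@is_derive_sum R R R n b t 1 (fun j => d j * - c j) (fun j => (hd j).1)).
 have -> : k = n%:R^-1 \*: \sum_j b j by rewrite /= fct_sumE.
 exact: h.
rewrite mulrCA normrM ger0_norm // mulrC ler_pdivrMr // mulr_sumr.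
apply: le_trans (_ : 2 * B <= _); last first.
 by rewrite [s * _]mulrC ltW // -ltr_pdivrMr.
have inr j : d j != 0 -> 1 <= c j * t <= 2 by move=> /(hd j).2.2; lra.
apply: sum_at_most_one.
- by rewrite mulr_ge0 // ltW.
- move=> j; have [->|dj] := eqVneq (d j) 0; first by rewrite mul0r mulr0 normr0 mulr_ge0 // ltW.
 have /andP[u1 u2] := inr j dj.
 rewrite mulrC mulrN mulNr normrN -mulrA normrM mulrC ler_pM //; last by have [_ []] := hd j.
 by rewrite ger0_norm //; lra.
move=> i j; have nz l : t * (d l * - c l) != 0 -> d l != 0 by apply: contraNneq => ->; rewrite mul0r mulr0.
move=> /nz/inr/andP[i1 i2] /nz/inr/andP[j1 j2].
have t0 : 0 < t by rewrite -(pmulr_rgt0 _ (c0 i)); lra.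
have lt (l m : 'I_n) : (l < m)%N -> 1 <= c l * t -> c m * t <= 2 -> False.
 move=> lm l1 m2; have : 4 * (c l * t) <= c m * t.
  rewrite mulrA ler_pM2r //; have -> : 4 * c l = 2 * 4 ^+ l.+1 / s by rewrite /c exprS; ring.
  by rewrite ler_pM2r ?invr_gt0 // ler_pM2l // ler_eXn2l ?ltr1n.
 lra.
by apply/val_inj; have [/lt h|/lt h|//] := ltngtP i j; case: h.
Qed.

(** * Interpolation of two maps along the circle *)

Section MixedMap.

Variable xi : 'R_2 -> R.
Hypothesis xi_smooth : forall k, ck k setT xi.
Hypothesis xi_itv : forall z, itv (xi z).

Definition weight (k : R -> R) (r : R) (z : 'R_2) := r * xi z * k (gap z).

Lemma weight_itv k s r z : slow_cutoff k s -> itv r -> itv (weight k r z).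
Proof.
move=> [_ k01 _ _] /andP[r0 r1]; have /andP[x0 x1] := xi_itv z; have /andP[k0 k1] := k01 (gap z).
by rewrite !mulr_ge0 //= !mulr_ile1 // mulr_ge0.
Qed.

Lemma ck_weight k s r n : slow_cutoff k s -> ck n setT (weight k r).
Proof.
move=> [sk _ _ _]; have oT := @openT 'R_2.
apply: (ckM oT); first exact: (ckM oT (ck_cst _ _ _) (xi_smooth _)).
exact: (sk 2%N n setT gap oT (@ck_gap n)).
Qed.

(** Besides the interpolation of the two derivatives there is the derivative of the weight times
    [g - f]. Since [|g - f| <= L * gap], this term is at most a constant times [e * |v|], uniformly
    in all the cutoffs that are slow for [e]. *)
Lemma column_estimate (U : set 'R_2) (f g : 'R_2 -> R) x eps : open U -> (forall k, ck k U f) ->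
 (forall k, ck k U g) -> U x -> circle x -> (forall y, U y -> circle y -> f y = g y) -> 0 < eps ->
 exists2 e, 0 < e & forall k r z v, slow_cutoff k e -> itv r -> disc z -> `|z - x| < e -> U z /\
  `|'D_v (fun y => f y + weight k r y * (g y - f y)) z -
   ('D_v f x + weight k r z * ('D_v g x - 'D_v f x))| <= eps * `|v|.
Proof.
move=> oU kf kg Ux cx fg eps0; pose G y := g y - f y.
have kG k : ck k U G by exact: (ckB oU (kg k) (kf k)).
have G0 y : U y -> circle y -> G y = 0 by move=> Uy cy; rewrite /G fg // subrr.
have e4 : 0 < eps / 4 by lra.
have [s1 s10 h1] := derive_near oU (kf 1%N) Ux e4.
have [s2 s20 h2] := derive_near oU (kG 1%N) Ux e4.
have [s3 [L [s30 L0 h3]]] := collar_lipschitz oU (kG 1%N) Ux cx G0.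
have Tx : [set: 'R_2] x by [].
have [B B0 hB] := derive_bound (@openT _) (xi_smooth 1%N) Tx.
have [s4 s40 h4] := derive_near (@openT _) (xi_smooth 1%N) Tx ltr01.
pose a := eps / 4 / ((B + 1) * L); pose b := eps / 4 / (4 * L).
have a0 : 0 < a by rewrite divr_gt0 // mulr_gt0 // addr_gt0.
have b0 : 0 < b by rewrite divr_gt0 // mulr_gt0.
pose e := Num.min (Num.min (Num.min s1 s2) (Num.min s3 s4)) (Num.min a b).
exists e; first by rewrite !lt_min s10 s20 s30 s40 a0.
have ea : e <= a by rewrite !ge_min lexx !orbT.
have eb : e <= b by rewrite !ge_min lexx !orbT.
move=> k r z v sk ri dz; rewrite !lt_min => /andP[/andP[/andP[z1 z2] /andP[z3 z4]] _].
have [Uz hf] := h1 z z1; split=> //.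
have [_ hG] := h2 z z2; have [_ hL] := h3 z dz z3; have [_ hx] := h4 z z4.
have [_ k01 k0 /(_ (gap z))[dk Dk hk]] := sk.
have gz : 0 <= gap z by exact/gap_disc.
have df : derivable f z v by have [_ /(_ v)[d _]] := kf 1%N; exact: d.
have dG : derivable G z v by have [_ /(_ v)[d _]] := kG 1%N; exact: d.
have dxi : derivable xi z v by have [_ /(_ v)[d _]] := xi_smooth 1%N; exact: d.
have dgap : derivable gap z v by have [_ /(_ v)[d _]] := @ck_gap 1%N; exact: d.
have Dkg : is_derive z v (k \o gap) (dk * 'D_v gap z) by exact: is_derive_comp1.
pose w := weight k r.
have Dw : is_derive z v w (r * ('D_v xi z * k (gap z) + xi z * (dk * 'D_v gap z))).
 have h := is_deriveZ r (is_deriveM (DeriveDef dxi erefl) Dkg).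
 have -> : w = r \*: (xi * (k \o gap)) by apply/funext => y; rewrite /w /weight /= -mulrA.
 have [h1' h2'] := h; split; first exact: h1'.
 rewrite h2' -[LHS]/(r * (xi z * (dk * 'D_v gap z) + k (gap z) * 'D_v xi z)); ring.
have DP : 'D_v (fun y => f y + w y * (g y - f y)) z = 'D_v f z + w z * 'D_v G z +
  r * ('D_v xi z * k (gap z) + xi z * (dk * 'D_v gap z)) * G z.
 have [_ E] := is_deriveD (DeriveDef df erefl) (is_deriveM Dw (DeriveDef dG erefl)).
 rewrite [LHS]E -[LHS]/('D_v f z + (w z * 'D_v G z + G z * (r * ('D_v xi z * k (gap z) + xi z * (dk * 'D_v gap z))))).
 by rewrite addrA [G z * _]mulrC.
have DGx : 'D_v G x = 'D_v g x - 'D_v f x.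
 have d1 : derivable f x v by have [_ /(_ v)[d _]] := kf 1%N; exact: d.
 have d2 : derivable g x v by have [_ /(_ v)[d _]] := kg 1%N; exact: d.
 exact: deriveB.
rewrite -/w -DGx DP.
have -> : 'D_v f z + w z * 'D_v G z + r * ('D_v xi z * k (gap z) + xi z * (dk * 'D_v gap z)) * G z -
  ('D_v f x + w z * 'D_v G x) = ('D_v f z - 'D_v f x) + w z * ('D_v G z - 'D_v G x) +
  r * k (gap z) * 'D_v xi z * G z + r * xi z * (dk * 'D_v gap z) * G z by ring.
have /andP[w0 w1] : itv (w z) := weight_itv z sk ri.
have /andP[r0 r1] := ri; have /andP[kk0 kk1] := k01 (gap z); have /andP[x0 x1] := xi_itv z.
have N0 := normr_ge0 v.
have t2 : `|w z * ('D_v G z - 'D_v G x)| <= eps / 4 * `|v|.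
 by rewrite normrM ger0_norm //; apply: le_trans (hG v); rewrite ler_piMl.
have t3 : `|r * k (gap z) * 'D_v xi z * G z| <= eps / 4 * `|v|.
 have [ge|lt] := leP e (gap z).
  by rewrite k0 // mulr0 !mul0r normr0 mulr_ge0 // ltW.
 have xv : `|'D_v xi z| <= (B + 1) * `|v|.
  rewrite -[X in `|X|](subrK ('D_v xi x)); apply: le_trans (ler_normD _ _) _.
  by rewrite mulrDl addrC lerD.
 rewrite 2!normrM; have : `|r * k (gap z)| <= 1.
  by rewrite ger0_norm ?mulr_ge0 // mulr_ile1.
 move=> rk; have : `|r * k (gap z)| * `|'D_v xi z| * `|G z| <= 1 * ((B + 1) * `|v|) * (L * e).
  apply: ler_pM; rewrite //; first exact: ler_pM.
  by apply: le_trans hL _; rewrite ler_pM2l // ltW.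
 move=> h; apply: le_trans h _; rewrite mul1r.
 have -> : (B + 1) * `|v| * (L * e) = ((B + 1) * L * e) * `|v| by ring.
 by rewrite ler_wpM2r // mulrC -ler_pdivlMr ?mulr_gt0 // addr_gt0.
have t4 : `|r * xi z * (dk * 'D_v gap z) * G z| <= eps / 4 * `|v|.
 have gv : `|'D_v gap z| <= 4 * `|v|.
  rewrite derive_gap normrM normrN normr_nat.
  have := disc_dot v dz; move: (_ + _) => q hq.
  have -> : 4 * `|v| = 2 * (2 * `|v|) by ring.
  by rewrite ler_pM2l.
 have rx : `|r * xi z| <= 1 by rewrite ger0_norm ?mulr_ge0 // mulr_ile1.
 have -> : r * xi z * (dk * 'D_v gap z) * G z = r * xi z * 'D_v gap z * (dk * G z) by ring.
 rewrite 2!normrM.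
 have dG' : `|dk * G z| <= L * e.
  rewrite normrM; apply: le_trans (ler_wpM2l (normr_ge0 dk) hL) _.
  have -> : `|dk| * (L * gap z) = L * `|gap z * dk| by rewrite normrM (ger0_norm gz); ring.
  by rewrite ler_pM2l.
 have h : `|r * xi z| * `|'D_v gap z| * `|dk * G z| <= 1 * (4 * `|v|) * (L * e).
  by apply: ler_pM; rewrite //; exact: ler_pM.
 apply: le_trans h _; rewrite mul1r.
 have -> : 4 * `|v| * (L * e) = (4 * L * e) * `|v| by ring.
 by rewrite ler_wpM2r // mulrC -ler_pdivlMr ?mulr_gt0.
have t1 := hf v.
apply: le_trans (ler_normD _ _) _; apply: le_trans (lerD (ler_normD _ _) (lexx _)) _.
apply: le_trans (lerD (lerD (ler_normD _ _) (lexx _)) (lexx _)) _; lra.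
Qed.

(** By the mean value theorem each coordinate of a difference of values is a derivative at its own
    intermediate point, with its own weight: this is why [columnwise_mix] allows a different
    coefficient in each column. Injectivity of [P] and of its differential follow from the same
    estimate. *)
Lemma mixed_injective (U : set 'R_2) (F F0 : 'R_2 -> 'R_4) x (A B : 'M[R]_(2, 4)) :
 open U -> Cinfty U F -> Cinfty U F0 -> U x -> circle x ->
 (forall y, U y -> circle y -> F y = F0 y) ->
 (forall v, 'D_v F x = v *m A) -> (forall v, 'D_v F0 x = v *m B) ->
 row_free A -> (tangent x *m A) 0 0 = 0 -> (x *m A) 0 0 < 0 -> (x *m B) 0 0 < 0 ->
 exists2 e, 0 < e & forall k r, slow_cutoff k e -> itv r ->
  let P y := F y + weight k r y *: (F0 y - F y) in
  [/\ forall z, disc z -> `|z - x| < e -> U z,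
   forall z z', disc z -> disc z' -> `|z - x| < e -> `|z' - x| < e -> P z = P z' -> z = z' &
   forall z, disc z -> `|z - x| < e -> forall v, 'D_v P z = 0 -> v = 0].
Proof.
move=> oU sF sF0 Ux cx FF DA DB fA tA xA xB.
have kF j k : ck k U (fun y => F y 0 j) by have /(Ck_coordP _ _ oU) := sF k.
have kF0 j k : ck k U (fun y => F0 y 0 j) by have /(Ck_coordP _ _ oU) := sF0 k.
have cA v j : 'D_v (fun y => F y 0 j) x = (v *m A) 0 j.
 by rewrite -DA derive_row //; apply: diff_derivable; exact: Cinfty_diff sF Ux.
have cB v j : 'D_v (fun y => F0 y 0 j) x = (v *m B) 0 j.
 by rewrite -DB derive_row //; apply: diff_derivable; exact: Cinfty_diff sF0 Ux.
have tAB : tangent x *m A = tangent x *m B.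
 apply/rowP => j; apply/eqP; rewrite -subr_eq0 -cA -cB.
 have dF : derivable (fun y => F y 0 j) x (tangent x) by have [_ /(_ (tangent x))[d _]] := kF j 1%N; exact: d.
 have dF0 : derivable (fun y => F0 y 0 j) x (tangent x) by have [_ /(_ (tangent x))[d _]] := kF0 j 1%N; exact: d.
 have := @tangent_derive0 U (fun y => F y 0 j - F0 y 0 j) x oU (ckB oU (kF j _) (kF0 j _)) Ux cx _.
 rewrite (deriveB dF dF0) => -> // y Uy cy.
 by rewrite FF // subrr.
have [eps eps0 mixP] := columnwise_mix cx fA tAB tA xA xB.
have est j := @column_estimate U _ _ x eps oU (kF j) (kF0 j) Ux cx
 (fun y Uy cy => congr1 (fun w : 'R_4 => w 0 j) (FF y Uy cy)) eps0.
have h j : exists e, 0 < e /\ forall k r z v, slow_cutoff k e -> itv r ->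
  disc z -> `|z - x| < e -> U z /\
  `|'D_v (fun y => F y 0 j + weight k r y * (F0 y 0 j - F y 0 j)) z -
   ((v *m A) 0 j + weight k r z * ((v *m B) 0 j - (v *m A) 0 j))| <= eps * `|v|.
 by have [e e0 he] := est j; exists e; split=> // k r z v; rewrite -cA -cB; exact: he.
have [ej hej] := choice h.
pose e := Num.min (Num.min (ej 0) (ej 1)) (Num.min (ej 2) (ej 3)).
have ee j : e <= ej j by move: j; apply: I4_ind; rewrite !ge_min lexx ?orbT.
exists e; first by rewrite !lt_min !(hej _).1.
move=> k r sk ri P.
have {}est z v j : disc z -> `|z - x| < e -> U z /\ `|'D_v (fun y => P y 0 j) z -
   ((v *m A) 0 j + weight k r z * ((v *m B) 0 j - (v *m A) 0 j))| <= eps * `|v|.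
 move=> dz zx; have [_ hj] := hej j.
 have -> : (fun y => P y 0 j) = (fun y => F y 0 j + weight k r y * (F0 y 0 j - F y 0 j)).
  by apply/funext => y; rewrite !mxE.
 by apply: hj => //; [exact: slow_cutoffW (ee j) sk|exact: lt_le_trans (ee j)].
have kP j : ck 1 U (fun y => P y 0 j).
 apply: (ck_ext oU (f := fun y => F y 0 j + weight k r y * (F0 y 0 j - F y 0 j))).
  by move=> y _; rewrite !mxE.
 apply: (ckD oU (kF j _)); apply: (ckM oU _ (ckB oU (kF0 j _) (kF j _))).
 exact: (ck_sub (@subsetT _ U) (ck_weight _ _ sk)).
split.
- by move=> z dz zx; have [] := est z 0 0 dz zx.
- move=> z z' dz dz' zx zx' PP.
 have seg t : itv t -> disc (z + t *: (z' - z)) /\ `|z + t *: (z' - z) - x| < e.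
  move=> ti; split.
   have -> : z + t *: (z' - z) = (1 - t) *: z + t *: z' by rewrite scalerBr scalerBl scale1r addrCA addrC.
   exact: disc_segment.
  exact: ball_seg.
 have mv j : exists t, itv t /\ 'D_(z' - z) (fun y => P y 0 j) (z + t *: (z' - z)) = 0.
  have [|t t01 E] := @mvt_line _ (fun y => P y 0 j) z (z' - z).
   move=> t /seg[dt nt]; have [Ut _] := est _ 0 0 dt nt.
   by have [_ /(_ (z' - z))[d _]] := kP j; exact: d.
  exists t; split; first by case/andP: t01 => /ltW-> /ltW->.
  by rewrite -E [z + _]addrC subrK PP subrr.
 have [t ht] := choice mv.
 apply/esym/eqP; rewrite -subr_eq0; apply/eqP.
 apply: (mixP _ (fun j => weight k r (z + t j *: (z' - z)))).
  by move=> j; exact: weight_itv sk ri.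
 move=> j; have [ti tE] := ht j; have [dt nt] := seg _ ti.
 by have [_] := est _ (z' - z) j dt nt; rewrite tE sub0r normrN.
move=> z dz zx v DP; have [Uz _] := est z 0 0 dz zx.
have dP : derivable P z v.
 apply: diff_derivable; apply: (@Ck1_diff _ _ U P z oU _ Uz).
 by apply/(Ck_coordP _ _ oU).
apply: (mixP _ (fun j => weight k r z)); first by move=> j; exact: weight_itv sk ri.
move=> j; have [_] := est z v j dz zx.
by rewrite -(derive_row j dP) DP mxE sub0r normrN.
Qed.

End MixedMap.

(** * Interpolation of two discs in a chart *)

Section LocalStep.

Lemma chart_data (E : 'R_2 -> M) c x : proper_disc E -> disc x -> atlas c -> dom c (E x) ->
 exists U F, [/\ open U, U x, Cinfty U F,
  forall y, U y -> disc y -> dom c (E y) /\ F y = c (E y) & row_free (jac F x)].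
Proof.
move=> [_ sm _ _] dx ac cx; have [c' [J' [dm' fJ]]] := sm x dx; have [ac' _ _] := dm'.
have [T T0 hT] := chart_change ac' ac (mdiff_dom dx dm') cx.
have dm := hT _ _ _ _ _ dx erefl dm'; have [_ dc [U [F [[oU Ux] sF FE DF]]]] := dm.
have [W [oW Wx] WE] := within_openP dc.
have oUW : open (U `&` W) by exact: openI.
exists (U `&` W), F; split=> //; first by apply: (Cinfty_sub oU oUW _ sF) => y [].
 by move=> y [Uy Wy] dy; split; [exact: WE|exact: FE].
have -> : jac F x = J' *m T.
 apply/row_matrixP => i; rewrite !rowE -DF; apply/esym.
 exact: (derive_jac _ oU (sF 1%N) Ux).
apply: inj_row_free => v vJ; apply: (row_free_inj fJ); rewrite mul0mx.
have uT : T \in unitmx by rewrite unitmxE unitfE gt_eqF.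
by have := congr1 (mulmx^~ (invmx T)) vJ; rewrite /= mul0mx mulmxA (mulmxK uT).
Qed.

Lemma chart_data_mdiff (E : 'R_2 -> M) c (U : set 'R_2) F y : atlas c -> open U -> Cinfty U F ->
 (forall z, U z -> disc z -> dom c (E z) /\ F z = c (E z)) -> U y ->
 mdiff E disc y c (jac F y).
Proof.
move=> ac oU sF UE Uy; split=> //.
 suff : nbhs y (fun z => disc z -> dom c (E z)) by [].
 by apply: (open_near oU Uy) => z Uz dz; have [] := UE z Uz dz.
exists U, F; split=> //; first by move=> z Uz dz; have [] := UE z Uz dz.
by move=> v; exact: (derive_jac _ oU (sF 1%N) Uy).
Qed.

Variables (D0 D : 'R_2 -> M) (c : chart R M) (xi : 'R_2 -> R).
Hypothesis D0_proper : proper_disc D0.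
Hypothesis D_proper : proper_disc D.
Hypothesis D_circle : forall x, circle x -> D x = D0 x.
Hypothesis ac : atlas c.
Hypothesis xi_smooth : forall k, ck k setT xi.
Hypothesis xi_itv : forall z, itv (xi z).

Lemma chart_pair x O : circle x -> dom c (D0 x) -> nbhs (D0 x) O -> exists W F F0,
 [/\ open W /\ W x, Cinfty W F /\ Cinfty W F0,
  forall y, W y -> disc y -> (dom c (D y) /\ F y = c (D y)) /\ (dom c (D0 y) /\ F0 y = c (D0 y)),
  forall y w, W y -> disc y -> itv w -> (c @` dom c) (F y + w *: (F0 y - F y)) /\
   O (chart_inv c (F y + w *: (F0 y - F y))) &
  row_free (jac F x) /\ row_free (jac F0 x)].
Proof.
move=> cx cD0 nO; have dx := circle_disc cx.
have cD : dom c (D x) by rewrite D_circle.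
have [U [F [oU Ux sF UE fF]]] := chart_data D_proper dx ac cD.
have [U0 [F0 [oU0 U0x sF0 U0E fF0]]] := chart_data D0_proper dx ac cD0.
have [_ [V oV cV] _ _ _] := atlas_chart ac.
have [Vx _] : (V `&` half_space (R := R)) (c (D0 x)) by rewrite -cV.
have nV : nbhs (c (D0 x)) V by exact: open_nbhs_nbhs.
have /nbhs_normP[d /= d0 hd] := nbhsI2 nV (chart_inv_near ac cD0 nO).
have near (U' : set 'R_2) (G : 'R_2 -> 'R_4) : open U' -> U' x -> Cinfty U' G -> G x = c (D0 x) ->
  open [set y | U' y /\ `|G y - c (D0 x)| < d].
 move=> oU' U'x sG Gx.
 have -> : [set y | U' y /\ `|G y - c (D0 x)| < d] = U' `&` G @^-1` [set v | `|v - c (D0 x)| < d] by [].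
 by apply: open_preimage => //; [exact: norm_ball_open|move=> y Uy; exact: Cinfty_cont sG Uy].
have Fx : F x = c (D0 x) by have [_ ->] := UE x Ux dx; rewrite D_circle.
have F0x : F0 x = c (D0 x) by have [_ ->] := U0E x U0x dx.
pose W := [set y | U y /\ `|F y - c (D0 x)| < d] `&` [set y | U0 y /\ `|F0 y - c (D0 x)| < d].
have oW : open W by apply: openI; exact: near.
exists W, F, F0; split=> //.
- by split=> //; split; split; rewrite ?Fx ?F0x ?subrr ?normr0.
- by split; [apply: (Cinfty_sub oU oW _ sF) => y [[]]|apply: (Cinfty_sub oU0 oW _ sF0) => y [_ []]].
- by move=> y [[Uy _] [U0y _]] dy; split; [exact: UE|exact: U0E].
move=> y w [[Uy yF] [U0y yF0]] dy wi.
have [Vy Oy] : (V `&` (fun v => (c @` dom c) v -> O (chart_inv c v))) (F y + w *: (F0 y - F y)).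
 by apply: hd; rewrite /ball_/= distrC; exact: ball_seg.
have iy : (c @` dom c) (F y + w *: (F0 y - F y)).
 rewrite cV; split=> //; rewrite /half_space /= !mxE.
 have [cy ->] := UE y Uy dy; have [c0y ->] := U0E y U0y dy.
 have h := chart_half ac cy; have h0 := chart_half ac c0y; have /andP[w0 w1] := wi.
 have w1' : 0 <= 1 - w by rewrite subr_ge0.
 by have := mulr_ge0 w1' h; have := mulr_ge0 w0 h0; lra.
by split=> //; exact: Oy.
Qed.

Definition mixed k r := pert c D (fun z => weight xi k r z *: (c (D0 z) - c (D z))).

Definition cylinder : set 'R_3 := [set x | disc (vec2 (x 0 0) (x 0 1)) /\ 0 <= x 0 2 <= 1].

(** What an isotopy through proper discs has to satisfy at one time and one point; injectivity, the
    global condition, is treated apart. The last clause is smoothness in space and time together. *)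
Definition proper_at (H : R -> 'R_2 -> M) (r : R) (z : 'R_2) :=
 [/\ exists c J, mdiff (H r) disc z c J /\ row_free J,
   boundary (H r z) <-> circle z,
   circle z -> forall d K, mdiff (H r) disc z d K -> exists i, K i 0 != 0,
   circle z -> H r z = D0 z &
   exists d K, mdiff (fun y : 'R_3 => H (y 0 2) (vec2 (y 0 0) (y 0 1))) cylinder (vec3 (z 0 0) (z 0 1) r) d K].

Lemma derive_mix (U : set 'R_2) (f g w : 'R_2 -> R) z v : open U -> ck 1 U f -> ck 1 U g -> ck 1 U w -> U z ->
 f z = g z -> 'D_v (fun y => f y + w y * (g y - f y)) z = 'D_v f z + w z * ('D_v g z - 'D_v f z).
Proof.
move=> oU kf kg kw Uz fg.
have df : derivable f z v by have [_ /(_ v)[d _]] := kf; exact: d.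
have dg : derivable g z v by have [_ /(_ v)[d _]] := kg; exact: d.
have dw : derivable w z v by have [_ /(_ v)[d _]] := kw; exact: d.
have [_ E] := is_deriveD (DeriveDef df erefl) (is_deriveM (DeriveDef dw erefl) (is_deriveB (DeriveDef dg erefl) (DeriveDef df erefl))).
rewrite [LHS]E -[LHS]/('D_v f z + (w z * ('D_v g z - 'D_v f z) + (g z - f z) * 'D_v w z)).
by rewrite fg subrr mul0r addr0.
Qed.

Lemma weight_convex (w a b : R) : a + w * (b - a) = (1 - w) * a + w * b. Proof. ring. Qed.

(** The normal coordinate of the interpolation is a convex combination of two nonnegative ones that
    vanish only on the circle, with radial derivatives of the same sign there. The immersion and the
    injectivity come from [mixed_injective], and smoothness in time from the weight being linear in
    [r]. *)
Lemma mixed_local x : circle x -> dom c (D0 x) -> exists2 e, 0 < e & forall k r, slow_cutoff k e -> itv r ->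
 [/\ forall z z', disc z -> disc z' -> `|z - x| < e -> `|z' - x| < e ->
    mixed k r z = mixed k r z' -> z = z',
  forall z, disc z -> `|z - x| < e -> proper_at (mixed k) r z &
  forall z, disc z -> `|z - x| < e -> xi z = 1 -> k (gap z) = 1 -> mixed k 1 z = D0 z].
Proof.
move=> cx cD0; have dx := circle_disc cx.
have [W [F [F0 [[oW Wx] [sF sF0] WE Wi [fF fF0]]]]] := chart_pair cx cD0 (filterT).
have WD y : W y -> disc y -> dom c (D y) /\ F y = c (D y) by move=> Wy dy; have [] := WE y Wy dy.
have WD0 y : W y -> disc y -> dom c (D0 y) /\ F0 y = c (D0 y) by move=> Wy dy; have [] := WE y Wy dy.
have dmF y : W y -> mdiff D disc y c (jac F y) by exact: chart_data_mdiff.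
have dmF0 y : W y -> mdiff D0 disc y c (jac F0 y) by exact: chart_data_mdiff.
have FF y : W y -> circle y -> F y = F0 y.
 move=> Wy cy; have dy := circle_disc cy; have [_ ->] := WD y Wy dy; have [_ ->] := WD0 y Wy dy.
 by rewrite D_circle.
have DF y v : W y -> 'D_v F y = v *m jac F y by move=> Wy; exact: (derive_jac _ oW (sF 1%N) Wy).
have DF0 y v : W y -> 'D_v F0 y = v *m jac F0 y by move=> Wy; exact: (derive_jac _ oW (sF0 1%N) Wy).
have [tF xF] := disc_normal D_proper cx (dmF x Wx); have [tF0 xF0] := disc_normal D0_proper cx (dmF0 x Wx).
have [e e0 he] := mixed_injective xi_smooth xi_itv oW sF sF0 Wx cx FF (fun v => DF x v Wx) (fun v => DF0 x v Wx) fF tF xF xF0.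
exists e => // k r sk ri; have [inW injP immP] := he k r sk ri.
pose P r y := F y + weight xi k r y *: (F0 y - F y).
have wi r' z : itv r' -> itv (weight xi k r' z) by move=> ri'; exact: (weight_itv xi_itv z sk ri').
have mP r' z : itv r' -> disc z -> W z -> dom c (mixed k r' z) /\ c (mixed k r' z) = P r' z.
 move=> ri' dz Wz; have [cz Fz] := WD z Wz dz; have [c0z F0z] := WD0 z Wz dz.
 have [iz _] := Wi z _ Wz dz (wi r' z ri').
 rewrite /P Fz F0z; apply: pertE => //.
 by rewrite -Fz -F0z.
have kF j n : ck n W (fun y => F y 0 j) by have /(Ck_coordP _ _ oW) := sF n.
have kF0 j n : ck n W (fun y => F0 y 0 j) by have /(Ck_coordP _ _ oW) := sF0 n.
have kw r' n : ck n W (weight xi k r') by exact: (ck_sub (@subsetT _ W) (ck_weight xi_smooth r' n sk)).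
have sP : Cinfty W (P r).
 apply: Cinfty_row => // j n; apply: (ck_ext oW (f := fun y => F y 0 j + weight xi k r y * (F0 y 0 j - F y 0 j))).
  by move=> y _; rewrite !mxE.
 by apply: (ckD oW (kF j n)); apply: (ckM oW (kw r n)); exact: (ckB oW (kF0 j n) (kF j n)).
have dmP y : W y -> mdiff (mixed k r) disc y c (jac (P r) y).
 by apply: (chart_data_mdiff ac oW sP) => z Wz dz; have [h1 h2] := mP r z ri dz Wz.
have DP y v : W y -> 'D_v (P r) y = v *m jac (P r) y by move=> Wy; exact: (derive_jac _ oW (sP 1%N) Wy).
have bP z : disc z -> W z -> boundary (mixed k r z) <-> circle z.
 move=> dz Wz; have [cm Em] := mP r z ri dz Wz.
 have [cz Fz] := WD z Wz dz; have [c0z F0z] := WD0 z Wz dz.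
 have [_ _ bD _] := D_proper; have [_ _ bD0 _] := D0_proper.
 have h := chart_half ac cz; have h0 := chart_half ac c0z; have /andP[w0 w1] := wi r z ri.
 have w1' : 0 <= 1 - weight xi k r z by rewrite subr_ge0.
 have E : c (mixed k r z) 0 0 = (1 - weight xi k r z) * c (D z) 0 0 + weight xi k r z * c (D0 z) 0 0.
  by rewrite Em !mxE Fz F0z weight_convex.
 split=> [/(boundary_chart ac cm)|cz'].
  have p1 := mulr_ge0 w1' h; have p2 := mulr_ge0 w0 h0.
  rewrite E => /eqP; rewrite (paddr_eq0 p1 p2); move: (weight xi k r z) => wt; rewrite !mulf_eq0 => /andP[/orP[w|/eqP z0] /orP[w'|/eqP z0']].
  - by move: w w'; rewrite subr_eq0 => /eqP <-; rewrite oner_eq0.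
  - by apply/(bD0 z dz)/(boundary_chart ac c0z).
  - by apply/(bD z dz)/(boundary_chart ac cz).
  by apply/(bD z dz)/(boundary_chart ac cz).
 have := (bD z dz).2 cz' => /(boundary_chart ac cz) z0.
 have := (bD0 z dz).2 cz' => /(boundary_chart ac c0z) z0'.
 by apply/(boundary_chart ac cm); rewrite E z0 z0' !mulr0 addr0.
split.
- move=> z z' dz dz' zx zx' E; apply: injP => //.
 have Wz := inW z dz zx; have Wz' := inW z' dz' zx'.
 have [_ Ez] := mP r z ri dz Wz; have [_ Ez'] := mP r z' ri dz' Wz'.
 by rewrite -/(P r z) -Ez E.
- move=> z dz zx; have Wz := inW z dz zx; split.
 + exists c, (jac (P r) z); split; first exact: dmP.
  by apply: inj_row_free => v vJ; apply: (immP z dz zx); rewrite DP.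
 + exact: bP.
 + move=> cz d K dK; apply: (transverse_chart dz (disc_fat dz) _ (dmP z Wz) dK).
   exact/(bP z dz Wz).
  apply: contrapT => no; have J0 i : jac (P r) z i 0 = 0.
   by apply/eqP; apply: contrapT => /negP h; apply: no; exists i.
  have [_ n1] := disc_normal D_proper cz (dmF z Wz); have [_ n2] := disc_normal D0_proper cz (dmF0 z Wz).
  have : (z *m jac (P r) z) 0 0 = 0 by rewrite mxE big1 // => i _; rewrite J0 mulr0.
  rewrite -DP // derive_row; last by apply: diff_derivable; exact: Cinfty_diff sP Wz.
  have -> : (fun y => P r y 0 0) = (fun y => F y 0 0 + weight xi k r y * (F0 y 0 0 - F y 0 0)).
   by apply/funext => y; rewrite !mxE.
  rewrite (derive_mix _ oW (kF 0 _) (kF0 0 _) (kw r _) Wz); last by rewrite FF.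
  rewrite -!derive_row ?DF ?DF0 //; first last.
  * by apply: diff_derivable; exact: Cinfty_diff sF Wz.
  * by apply: diff_derivable; exact: Cinfty_diff sF0 Wz.
  have /andP[w0 w1] := wi r z ri; rewrite weight_convex.
  move: n1 n2 w0 w1; set a := (_ *m _) 0 0; set b := (_ *m _) 0 0; set w := weight _ _ _ _ => n1 n2 w0 w1 E.
  have w1' : 0 <= 1 - w by rewrite subr_ge0.
  have h1 : (1 - w) * a <= 0 by rewrite mulr_ge0_le0 // ltW.
  have h2 : w * b <= 0 by rewrite mulr_ge0_le0 // ltW.
  have /eqP : w * b = 0 by lra.
  rewrite mulf_eq0 (lt_eqF n2) orbF => /eqP wz; move: E; rewrite wz subr0 mul1r mul0r addr0 => az.
  by move: n1; rewrite az ltxx.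
 + move=> cz; have [c1 E1] := mP r z ri dz Wz; have [c0z F0z] := WD0 z Wz dz.
  by rewrite -(chartK ac c1) E1 /P FF // subrr scaler0 addr0 F0z chartK.
 pose pr (y : 'R_3) : 'R_2 := vec2 (y 0 0) (y 0 1).
 have spr : Cinfty setT pr by exact: Cinfty_vec2.
 have cpr : continuous pr by move=> y; exact: (Cinfty_cont spr).
 pose U3 := pr @^-1` W.
 have oU3 : open U3 by apply: (@open_comp _ _ pr W) => // y _.
 have pz : pr (vec3 (z 0 0) (z 0 1) r) = z by rewrite /pr !vecE -vec2_eta.
 have U3z : U3 (vec3 (z 0 0) (z 0 1) r) by rewrite /U3 /= pz.
 pose P3 (y : 'R_3) := P (y 0 2) (pr y).
 have comp (f : 'R_2 -> R) n : ck n W f -> ck n U3 (fun y => f (pr y)).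
  move=> kf; apply: (ck_comp oU3 oW _ kf); first by move=> y.
  exact: (Cinfty_sub (@openT _) oU3 (@subsetT _ U3) spr n).
 have sP3 : Cinfty U3 P3.
  apply: Cinfty_row => // j n.
  apply: (ck_ext oU3 (f := fun y => F (pr y) 0 j + y 0 2 * weight xi k 1 (pr y) * (F0 (pr y) 0 j - F (pr y) 0 j))).
   by move=> y _; rewrite !mxE /weight mul1r !mulrA.
  apply: (ckD oU3); first exact: (comp (fun y => F y 0 j)).
  apply: (ckM oU3); last by apply: (ckB oU3); [exact: (comp (fun y => F0 y 0 j))|exact: (comp (fun y => F y 0 j))].
  by apply: ckM => //; exact: comp.
 have cyl y : U3 y -> cylinder y -> dom c (mixed k (y 0 2) (pr y)) /\ c (mixed k (y 0 2) (pr y)) = P3 y.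
  by move=> Uy [dy ry]; exact: mP.
 exists c, (jac P3 (vec3 (z 0 0) (z 0 1) r)); split=> //.
  suff : nbhs (vec3 (z 0 0) (z 0 1) r : 'R_3) (fun y => cylinder y -> dom c (mixed k (y 0 2) (pr y))) by [].
  by apply: (open_near oU3 U3z) => y Uy cy; have [] := cyl y Uy cy.
 exists U3, P3; split=> //; first by move=> y Uy cy; have [_ <-] := cyl y Uy cy.
 by move=> v; exact: (derive_jac _ oU3 (sP3 1%N) U3z).
move=> z dz zx x1 k1; have Wz := inW z dz zx;
have [c1 E1] := mP 1 z itv1 dz Wz; have [c0z F0z] := WD0 z Wz dz.
by rewrite -(chartK ac c1) E1 /P /weight x1 k1 !mulr1 scale1r addrC subrK F0z chartK.
Qed.

Lemma mixed_open x O : circle x -> dom c (D0 x) -> nbhs (D0 x) O -> exists2 e, 0 < e &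
 forall k s r z, slow_cutoff k s -> itv r -> disc z -> `|z - x| < e -> O (mixed k r z).
Proof.
move=> cx cD0 nO; have [W [F [F0 [[oW Wx] _ WE Wi _]]]] := chart_pair cx cD0 nO.
have nW : nbhs x W by exact: open_nbhs_nbhs.
have /nbhs_normP[e /= e0 he] := nW; exists e => // k s r z sk ri dz zx.
have Wz : W z by apply: he; rewrite /ball_/= distrC.
have [[cz Fz] [c0z F0z]] := WE z Wz dz.
have [_] := Wi z _ Wz dz (weight_itv xi_itv z sk ri); rewrite Fz F0z.
by rewrite /mixed /pert; case: asboolP.
Qed.

Lemma mixed_off k r z : weight xi k r z = 0 \/ D z = D0 z -> mixed k r z = D z.
Proof. by move=> h; apply: pert0 => //; case: h => ->; rewrite ?scale0r // subrr scaler0. Qed.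

End LocalStep.

(** * Isotopies with prescribed end maps *)

Section Isotopy.
Variable D0 : 'R_2 -> M.
Local Notation proper_at := (proper_at D0).
Implicit Types D : 'R_2 -> M.

(** Unlike in [isotopic_discs], the end maps themselves are prescribed and not only their images, so
    that isotopies can be composed. *)
Definition isotopy D D' := exists H : R -> 'R_2 -> M, [/\ H 0 = D, H 1 = D',
 forall r, itv r -> set_inj disc (H r) & forall r z, itv r -> disc z -> proper_at H r z].

Lemma family_proper (H : R -> 'R_2 -> M) r : itv r -> set_inj disc (H r) ->
 (forall z, disc z -> proper_at H r z) -> proper_disc (H r).
Proof.
move=> ri iH h; split=> //.
- by move=> z /h[].
- by move=> z /h[].
by move=> z cz; have [_ _ hz _ _] := h z (circle_disc cz); exact: hz.
Qed.

Lemma isotopy_isotopic D D' : isotopy D D' -> isotopic_discs D D' /\ proper_disc D' /\ forall x, circle x -> D' x = D0 x.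
Proof.
move=> [H [H0 H1 iH pH]];
have hc r x : itv r -> circle x -> H r x = D0 x.
 by move=> ri cx; have [_ _ _ h _] := pH r x ri (circle_disc cx); exact: h.
split; last first.
 by rewrite -H1; split=> [|x cx]; [apply: family_proper => //; [exact: iH|move=> z; exact: pH]|exact: hc].
exists H; split.
- move=> x [dx ri]; have [_ _ _ _ [d [K dK]]] := pH _ _ ri dx.
 by exists d, K; move: dK; rewrite !vecE -vec3_eta.
- by move=> r ri; apply: family_proper => //; [exact: iH|move=> z; exact: pH].
- by move=> r x ri cx; rewrite // -H0 -H1 !hc.
- by rewrite H0.
by rewrite H1.
Qed.

Lemma proper_at_stationary (H : R -> 'R_2 -> M) D r z e : proper_disc D -> (forall x, circle x -> D x = D0 x) ->
 0 < e -> (forall r w, itv r -> disc w -> `|w - z| < e -> H r w = D w) -> itv r -> disc z -> proper_at H r z.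
Proof.
move=> pD DD e0 HD ri dz; have [_ sm bD tD] := pD.
have zz : `|z - z| < e by rewrite subrr normr0.
have nz : nbhs z (fun w => `|w - z| < e) by exact: nbhs_norm_lt.
have HrD : \forall w \near within disc (nbhs z), H r w = D w.
 suff : nbhs z (fun w => disc w -> H r w = D w) by [].
 by apply: filterS nz => w we dw; exact: HD.
have DHr : \forall w \near within disc (nbhs z), D w = H r w by apply: filterS HrD => w ->.
have [c [J [dJ fJ]]] := sm z dz; split.
- by exists c, J; split=> //; exact: mdiff_eq dJ.
- by rewrite HD //; exact: bD.
- by move=> cz d K dK; apply: (tD z cz d K); exact: mdiff_eq dK.
- by move=> cz; rewrite HD // DD.
pose pr (y : 'R_3) : 'R_2 := vec2 (y 0 0) (y 0 1).
have spr : Cinfty setT pr by exact: Cinfty_vec2.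
have pz : pr (vec3 (z 0 0) (z 0 1) r) = z by rewrite /pr !vecE -vec2_eta.
have cz : cylinder (vec3 (z 0 0) (z 0 1) r) by rewrite /cylinder /= !vecE -vec2_eta.
have [S dS] := @diff_on_Cinfty 3 2 pr setT (@cylinder) (vec3 (z 0 0) (z 0 1) r) (@openT _) Logic.I spr.
rewrite -pz in dJ.
have cd : \forall y \near within (@cylinder) (nbhs (vec3 (z 0 0) (z 0 1) r)), disc (pr y).
 by apply: within_all => y [].
have dm := mdiff_comp cz cd dS dJ.
exists c, (S *m J); apply: mdiff_eq dm.
suff : nbhs (vec3 (z 0 0) (z 0 1) r : 'R_3) (fun y => cylinder y -> D (pr y) = H (y 0 2) (pr y)) by [].
have cpr : {for vec3 (z 0 0) (z 0 1) r, continuous pr} by exact: (Cinfty_cont spr).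
have nz' : nbhs (pr (vec3 (z 0 0) (z 0 1) r)) (fun w => `|w - z| < e) by rewrite pz.
have nz3 : nbhs (vec3 (z 0 0) (z 0 1) r : 'R_3) (fun y => `|pr y - z| < e) := cpr _ nz'.
by apply: filterS nz3 => y ye [dy ry]; rewrite HD.
Qed.

Lemma isotopy_refl D : proper_disc D -> (forall x, circle x -> D x = D0 x) -> isotopy D D.
Proof.
move=> pD DD; exists (fun=> D); split=> //; first by move=> r _; have [] := pD.
by move=> r z ri dz; apply: (proper_at_stationary (D := D)).
Qed.

(** Both isotopies are slowed down by [mu], so that the concatenation is stationary for
    [1/3 < r < 2/3]; both formulas hold there, whence smoothness at the junction. *)
Lemma isotopy_trans D D' D'' : isotopy D D' -> isotopy D' D'' -> isotopy D D''.
Proof.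
move=> [H [H0 H1 iH pH]] [G [G0 G1 iG pG]].
pose K r := if r <= 2^-1 then H (mu (2 * r)) else G (mu (2 * r - 1)).
have KH r : r < 2 / 3 -> K r = H (mu (2 * r)).
 rewrite /K; case: ifP => // /negbT; rewrite -ltNge => h1 h2.
 by rewrite [mu (2 * r - 1)]mu0 ?[mu (2 * r)]mu1 ?G0 //; lra.
have KG r : 3^-1 < r -> K r = G (mu (2 * r - 1)).
 rewrite /K; case: ifP => // h1 h2.
 by rewrite [mu (2 * r - 1)]mu0 ?[mu (2 * r)]mu1 ?G0 //; lra.
have smooth (F : R -> 'R_2 -> M) (a : R) r z (V : set R) : (forall r z, itv r -> disc z -> proper_at F r z) ->
  open V -> V r -> (forall r, V r -> K r = F (mu (2 * r - a))) -> itv r -> disc z ->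
  exists d S, mdiff (fun y : 'R_3 => K (y 0 2) (vec2 (y 0 0) (y 0 1))) (@cylinder) (vec3 (z 0 0) (z 0 1) r) d S.
 move=> pF oV Vr KF ri dz; have [_ _ _ _ [d [J dJ]]] := pF _ z (mu_itv (2 * r - a)) dz.
 pose g (y : 'R_3) : 'R_3 := vec3 (y 0 0) (y 0 1) (mu (2 * y 0 2 - a)).
 have sg : Cinfty setT g.
  apply: Cinfty_vec3 => // n.
  apply: smooth1_mu => //.
  by smooth.
 have cz : cylinder (vec3 (z 0 0) (z 0 1) r) by rewrite /cylinder /= !vecE -vec2_eta.
 have gz : g (vec3 (z 0 0) (z 0 1) r) = vec3 (z 0 0) (z 0 1) (mu (2 * r - a)) by rewrite /g !vecE.
 have [S dS] := @diff_on_Cinfty 3 3 g setT (@cylinder) (vec3 (z 0 0) (z 0 1) r) (@openT _) Logic.I sg.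
 rewrite -gz in dJ.
 have gc : \forall y \near within (@cylinder) (nbhs (vec3 (z 0 0) (z 0 1) r)), cylinder (g y).
  by apply: within_all => y [dy ry]; rewrite /cylinder /= !vecE; split=> //; exact: mu_itv.
 exists d, (S *m J); apply: mdiff_eq (mdiff_comp cz gc dS dJ).
 suff : nbhs (vec3 (z 0 0) (z 0 1) r : 'R_3) (fun y => cylinder y ->
   F (g y 0 2) (vec2 (g y 0 0) (g y 0 1)) = K (y 0 2) (vec2 (y 0 0) (y 0 1))) by [].
 have nV : nbhs (vec3 (z 0 0) (z 0 1) r : 'R_3) (fun y => V (y 0 2)) by apply: near_coord => //; rewrite vecE.
 by apply: filterS nV => y Vy _; rewrite KF // !vecE.
exists K; split.
- by rewrite KH ?mu0 //; lra.
- by rewrite KG ?mu1 //; lra.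
- by move=> r ri; rewrite /K; case: ifP => _; [apply: iH|apply: iG]; exact: mu_itv.
move=> r z ri dz.
have [K1 K2 K3 K4] : [/\ exists c J, mdiff (K r) disc z c J /\ row_free J, boundary (K r z) <-> circle z,
  circle z -> forall d J, mdiff (K r) disc z d J -> exists i, J i 0 != 0 & circle z -> K r z = D0 z].
 by rewrite /K; case: ifP => _; [have [] := pH _ z (mu_itv (2 * r)) dz|have [] := pG _ z (mu_itv (2 * r - 1)) dz].
split=> //; have [r1|r1] := ltP r (2 / 3).
 apply: (smooth H 0 r z [set a | a < 2 / 3]) => //.
 by move=> r' h; rewrite subr0; exact: KH.
apply: (smooth G 1 r z [set a | 3^-1 < a]) => //; rewrite /=; lra.
Qed.

End Isotopy.

(** * Isotoping a disc to agree with the base disc on a collar *)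

Section Collar.
Variable D0 : 'R_2 -> M.
Hypothesis D0_proper : proper_disc D0.

Lemma cont_gap : continuous gap.
Proof. by move=> z; exact: (ck_cont (@ck_gap 0)). Qed.

Section Step.
Variables (D : 'R_2 -> M) (c : chart R M) (z0 : 'R_2) (rho : R) (xi : 'R_2 -> R).
Hypothesis D_proper : proper_disc D.
Hypothesis D_circle : forall x, circle x -> D x = D0 x.
Hypothesis ac : atlas c.
Hypothesis rho0 : 0 < rho.
Hypothesis room : forall x, circle x -> `|x - z0| <= 3 * rho -> dom c (D0 x).
Hypothesis xi_smooth : forall k, ck k setT xi.
Hypothesis xi_itv : forall z, itv (xi z).
Hypothesis xi_supp : forall z, xi z != 0 -> `|z - z0| < 2 * rho.
Local Notation mixed := (mixed D0 D c xi).

Definition rim : set 'R_2 := cball z0 (3 * rho) `&` circle.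

Lemma rim_compact : compact rim.
Proof.
apply: compact_closedI; first exact: cball_compact.
have -> : circle = gap @^-1` [set a | a = 0] by apply/seteqP; split=> x /gap_circle.
apply: closed_preimage; first exact: cont_gap.
exact: closed_eq.
Qed.

Lemma mixed_near k s r z : slow_cutoff k s -> s <= rho -> s <= 2^-1 -> disc z -> mixed k r z <> D z ->
 exists x, [/\ rim x, `|z - x| <= gap z & gap z < s].
Proof.
move=> [_ _ k0 _] sr s2 dz ne; have wn : weight xi k r z != 0.
 by apply/eqP => w0; apply: ne; apply: mixed_off => //; left.
have xn : xi z != 0 by apply: contraNneq wn => h; rewrite /weight h mulr0 mul0r.
have gs : gap z < s.
 rewrite ltNge; apply/negP => h; move/eqP: wn; apply.
 by rewrite /weight k0 // mulr0.
have g1 : gap z < 1 by lra.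
have [y [cy yz _]] := circle_proj dz g1; exists y; split=> //; last by rewrite distrC.
split=> //; rewrite /cball /=; have h := xi_supp xn.
have -> : y - z0 = (y - z) + (z - z0) by rewrite addrA subrK.
by apply: le_trans (ler_normD _ _) _; lra.
Qed.

Lemma local_uniform : exists2 e, 0 < e & forall x, rim x -> forall k r, slow_cutoff k e -> itv r ->
 [/\ forall z z', disc z -> disc z' -> `|z - x| < e -> `|z' - x| < e -> mixed k r z = mixed k r z' -> z = z',
  forall z, disc z -> `|z - x| < e -> proper_at D0 (mixed k) r z &
  forall z, disc z -> `|z - x| < e -> xi z = 1 -> k (gap z) = 1 -> mixed k 1 z = D0 z].
Proof.
apply: (compact_small).
 exact: rim_compact.
move=> x [xr cx].
have [e e0 he] := mixed_local D0_proper D_proper D_circle ac xi_smooth xi_itv cx (room cx xr).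
exists (e / 2); first lra.
move=> y e' yx /andP[e'0 e'e] k r sk ri.
have ne z : `|z - y| < e' -> `|z - x| < e.
 move=> zy; have -> : z - x = (z - y) + (y - x) by rewrite addrA subrK.
 by apply: le_lt_trans (ler_normD _ _) _; lra.
have le : e' <= e by lra.
have [h1 h2 h3] := he k r (slow_cutoffW le sk) ri; split.
- by move=> z z' dz dz' /ne zx /ne zx'; exact: h1.
- by move=> z dz /ne; exact: h2.
by move=> z dz /ne; exact: h3.
Qed.

Lemma mixed_target z O : disc z -> nbhs (D z) O -> exists2 d, 0 < d & forall k s r w, s <= d -> slow_cutoff k s ->
 itv r -> disc w -> `|w - z| < d -> O (mixed k r w).
Proof.
move=> dz nO; have cD := disc_cont D_proper.
have nD : nbhs z (fun w => disc w -> O (D w)) by have /subspace_continuousP/(_ z dz _ nO) := cD.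
have /nbhs_normP[d1 /= d10 hd1] := nD.
have OD w : disc w -> `|w - z| < d1 -> O (D w) by move=> dw wz; apply: hd1 => //; rewrite /ball_/= distrC.
have [cz|ncz] := pselect (circle z); last first.
 have g0 : 0 < gap z.
  rewrite lt_neqAle; apply/andP; split; last exact/gap_disc.
  by apply/negP => /eqP h; apply: ncz; apply/gap_circle.
 have g2 : 0 < gap z / 2 by lra.
 have cg : {for z, continuous gap} by exact: cont_gap.
 have ng : nbhs z (fun w => `|gap z - gap w| < gap z / 2) by exact: (cont_dist cg g2).
 have /nbhs_normP[d2 /= d20 hd2] := ng.
 exists (Num.min d1 (Num.min d2 (gap z / 2))); first by rewrite !lt_min d10 d20.
 move=> k s r w; rewrite le_min => /andP[_]; rewrite le_min => /andP[_ sg] sk ri dw.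
 rewrite !lt_min => /andP[w1 /andP[w2 _]]; rewrite mixed_off //; first exact: OD.
 have [_ _ k0 _] := sk; left; rewrite /weight k0 ?mulr0 //.
 have : `|gap z - gap w| < gap z / 2 by apply: hd2; rewrite /ball_/= distrC.
 by rewrite ltr_norml => /andP[_]; lra.
have [zr|zr] := leP `|z - z0| (3 * rho).
 have nO' : nbhs (D0 z) O by rewrite -D_circle.
 have [d d0 hd] := mixed_open D0_proper D_proper D_circle ac xi_itv cz (room cz zr) nO'.
 by exists d => // k s r w _ sk ri dw wz; exact: hd sk ri dw wz.
exists (Num.min d1 rho); first by rewrite lt_min d10.
move=> k s r w _ sk ri dw; rewrite lt_min => /andP[w1 w2]; rewrite mixed_off //; first exact: OD.
left; rewrite /weight; have [->|xn] := eqVneq (xi w) 0; first by rewrite mulr0 mul0r.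
exfalso; have := xi_supp xn; have : `|z - z0| <= `|z - w| + `|w - z0|.
 by have -> : z - z0 = (z - w) + (w - z0) by [rewrite addrA subrK]; exact: ler_normD.
by rewrite [`|z - w|]distrC; lra.
Qed.

(** Distinct points have images under [D] with disjoint neighbourhoods, which by [mixed_target]
    still contain the images under [mixed] of nearby points when the cutoff is thin; compactness of
    the set of pairs makes this uniform. *)
Lemma mixed_separated e : 0 < e -> exists2 d, 0 < d & forall k r z z', slow_cutoff k d -> itv r -> disc z -> disc z' ->
 e <= `|z - z'| -> mixed k r z <> mixed k r z'.
Proof.
move=> e0; pose P d (p : 'R_2 * 'R_2) := forall k r, slow_cutoff k d -> itv r -> disc p.1 -> disc p.2 ->
 e <= `|p.1 - p.2| -> mixed k r p.1 <> mixed k r p.2.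
have [|[z z'] [dz dz']|d d0 hd] := @compact_small _ (disc `*` disc) P.
- exact: compact_setX (@disc_compact) (@disc_compact).
- rewrite /= in dz dz'.
 have fst_le (p : 'R_2 * 'R_2) : `|p.1 - z| <= `|p - (z, z')| by rewrite le_max lexx.
 have snd_le (p : 'R_2 * 'R_2) : `|p.2 - z'| <= `|p - (z, z')| by rewrite le_max lexx orbT.
 have [zz|zz] := eqVneq z z'.
  exists (e / 2); first lra.
  move=> p d pe _ k r _ _ _ _ pp; exfalso; have := fst_le p; have := snd_le p; rewrite -zz.
  have : `|p.1 - p.2| <= `|p.1 - z| + `|z - p.2|.
   by have -> : p.1 - p.2 = (p.1 - z) + (z - p.2) by [rewrite addrA subrK]; exact: ler_normD.
  by rewrite [`|z - p.2|]distrC; move: pe; rewrite -zz; lra.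
 have Dne : D z != D z'.
  apply: contraNneq zz => E; apply/eqP; have [iD _ _ _] := D_proper.
  by apply: iD; rewrite ?inE.
 have hM := @manifold_hausdorff R M; rewrite open_hausdorff in hM.
 have [[A B] /= [zA zB] [oA oB AB]] := hM _ _ Dne; rewrite !inE in zA zB.
 have [d1 d10 hd1] := mixed_target dz (nbhsO oA zA).
 have [d2 d20 hd2] := mixed_target dz' (nbhsO oB zB).
 exists (Num.min d1 d2); first by rewrite lt_min d10.
 move=> p d; rewrite !lt_min => /andP[p1 p2] /andP[_ /andP[dd1 dd2]] k r sk ri dp1 dp2 _ E.
 have h1 : A (mixed k r p.1) by apply: (hd1 k d) => //; [exact: ltW|exact: le_lt_trans p1].
 have h2 : B (mixed k r p.2) by apply: (hd2 k d) => //; [exact: ltW|exact: le_lt_trans p2].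
 by move/eqP/seteqP: AB => [/(_ (mixed k r p.1))+ _]; apply; split=> //; rewrite E.
exists d => // k r z z' sk ri dz dz'; exact: (hd (z, z') (conj dz dz') k r sk ri dz dz').
Qed.

(** Injectivity is global. Points at distance at least [e / 2] are kept apart by [mixed_separated];
    of two closer points either none has moved, or both lie near one point of [rim], where
    [local_uniform] applies. *)
Lemma collar_step : exists D', [/\ isotopy D0 D D', forall z, D z = D0 z -> D' z = D0 z &
 exists2 d, 0 < d & forall z, disc z -> `|z - z0| < rho -> xi z = 1 -> gap z <= d -> D' z = D0 z].
Proof.
have [e e0 he] := local_uniform; have e2 : 0 < e / 2 by lra.
have [d d0 hd] := mixed_separated e2.
pose s := Num.min (Num.min (e / 2) d) (Num.min rho 2^-1).
have s0 : 0 < s by rewrite !lt_min e2 d0 rho0 invr_gt0 ltr0n.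
have se : s <= e / 2 by rewrite !ge_min lexx.
have sd : s <= d by rewrite !ge_min lexx orbT.
have sr : s <= rho by rewrite !ge_min lexx !orbT.
have s2 : s <= 2^-1 by rewrite !ge_min lexx !orbT.
have see : s <= e by lra.
have [k sk [g g0 hk]] := slow_cutoff_ex s0.
have ske := slow_cutoffW see sk; have skd := slow_cutoffW sd sk.
have near r z : disc z -> mixed k r z <> D z -> exists2 x, rim x & `|z - x| < e / 2.
 move=> dz /(mixed_near sk sr s2 dz)[x [rx zx gs]]; exists x => //.
 exact: le_lt_trans zx (lt_le_trans gs se).
have w0 z : weight xi k 0 z = 0 by rewrite /weight !mul0r.
exists (mixed k 1); split.
- exists (mixed k); split=> //.
 + by apply/funext => z; apply: mixed_off => //; left.
 + move=> r ri z z'; rewrite !inE => dz dz' E.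
  have [far|close] := leP (e / 2) `|z - z'|; first by case: (hd k r z z' skd ri dz dz' far E).
  have inj x : rim x -> `|z - x| < e -> `|z' - x| < e -> z = z'.
   by move=> rx zx zx'; have [h _ _] := he x rx k r ske ri; exact: h.
  have [Ez|/(near r z dz)[x rx zx]] := pselect (mixed k r z = D z); last first.
   apply: (inj x rx); first by lra.
   have -> : z' - x = (z' - z) + (z - x) by rewrite addrA subrK.
   by apply: le_lt_trans (ler_normD _ _) _; rewrite distrC; lra.
  have [Ez'|/(near r z' dz')[x rx zx]] := pselect (mixed k r z' = D z'); last first.
   apply: (inj x rx); last by lra.
   have -> : z - x = (z - z') + (z' - x) by rewrite addrA subrK.
   by apply: le_lt_trans (ler_normD _ _) _; lra.
  have [iD _ _ _] := D_proper; apply: iD; rewrite ?inE //.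
  by rewrite -Ez -Ez'.
 move=> r z ri dz; have [[x rx zx]|no] := pselect (exists2 x, rim x & `|z - x| < e).
  by have [_ h _] := he x rx k r ske ri; exact: h.
 apply: (proper_at_stationary (D := D) (e := e / 2)) => // r' w ri' dw wz.
 apply: contrapT => /(near r' w dw)[x rx wx]; apply: no; exists x => //.
 have -> : z - x = (z - w) + (w - x) by rewrite addrA subrK.
 by apply: le_lt_trans (ler_normD _ _) _; rewrite distrC; lra.
- by move=> z E; rewrite mixed_off //; right.
exists (Num.min g (s / 2)); first by rewrite lt_min g0 divr_gt0.
move=> z dz zr x1; rewrite le_min => /andP[gg gs].
have g1 : gap z < 1 by lra.
have [y [cy yz _]] := circle_proj dz g1.
have ry : rim y.
 split=> //; rewrite /cball /=; have -> : y - z0 = (y - z) + (z - z0) by rewrite addrA subrK.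
 by apply: le_trans (ler_normD _ _) _; lra.
have [_ _ h] := he y ry k 1 ske itv1; apply: h => //; last exact: hk.
by rewrite distrC; lra.
Qed.

End Step.

Definition collarable (A : set 'R_2) := forall D, proper_disc D -> (forall x, circle x -> D x = D0 x) ->
 exists D', [/\ isotopy D0 D D', forall z, D z = D0 z -> D' z = D0 z &
  exists2 d, 0 < d & forall z, disc z -> A z -> gap z <= d -> D' z = D0 z].

(** Agreement with [D0] at a point survives all later steps, so that collars over finitely many
    small sets add up, with the smallest of their depths. *)
Lemma disc_collarable : collarable disc.
Proof.
(* On a set away from the circle there are no points of small [gap], and the constant isotopy will
   do. *)
have stay (A : set 'R_2) d : 0 < d -> (forall z, disc z -> A z -> d < gap z) -> collarable A.
 move=> d0 h D pD DD; exists D; split=> //; first exact: isotopy_refl.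
 by exists d => // z dz /(h z dz) h1 h2; exfalso; lra.
apply: compact_ind.
- exact: disc_compact.
- by apply: (stay _ 1) => // z _ [].
- move=> A B AB cB D pD DD; have [D' [iso keep [d d0 hd]]] := cB D pD DD.
 by exists D'; split=> //; exists d => // z dz /AB; exact: hd.
- move=> A B cA cB D pD DD.
 have [D' [iso keep [d d0 hd]]] := cA D pD DD.
 have [_ [pD' DD']] := isotopy_isotopic iso.
 have [D'' [iso' keep' [d' d'0 hd']]] := cB D' pD' DD'.
 exists D''; split; first exact: isotopy_trans iso iso'.
  by move=> z /keep; exact: keep'.
 exists (Num.min d d'); first by rewrite lt_min d0.
 move=> z dz AB; rewrite le_min => /andP[g1 g2].
 by case: AB => h; [apply: keep'; exact: hd|exact: hd'].
move=> x dx; have [cx|ncx] := pselect (circle x); last first.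
 have g0 : 0 < gap x.
  rewrite lt_neqAle; apply/andP; split; last exact/gap_disc.
  by apply/negP => /eqP h; apply: ncx; apply/gap_circle.
 have g2 : 0 < gap x / 2 by lra.
 have cg : {for x, continuous gap} by exact: cont_gap.
 have ng : nbhs x (fun w => `|gap x - gap w| < gap x / 2) by exact: (cont_dist cg g2).
 exists (fun w => `|gap x - gap w| < gap x / 2) => //; apply: (stay _ (gap x / 2)) => // z _.
 by rewrite ltr_norml; lra.
have [c ac cD0] := atlas_cover (D0 x).
have nc : nbhs (D0 x) (dom c) by exact: chart_nbhs.
have nD : nbhs x (fun w => disc w -> dom c (D0 w)) by have /subspace_continuousP/(_ x dx _ nc) := disc_cont D0_proper.
have /nbhs_normP[d /= d0 hd] := nD.
pose rho := d / 4; have rho0 : 0 < rho by rewrite divr_gt0.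
have room y : circle y -> `|y - x| <= 3 * rho -> dom c (D0 y).
 move=> cy yx; apply: hd; last exact: circle_disc.
 by rewrite /ball_/= distrC; apply: le_lt_trans yx _; rewrite /rho; lra.
have [xi [sx xi01 x1 xs]] := bump_ex x rho0.
exists [set z | `|z - x| < rho]; first exact: nbhs_norm_lt.
move=> D pD DD; have [D' [iso keep [g g0 hg]]] := collar_step pD DD ac rho0 room sx xi01 xs.
by exists D'; split=> //; exists g => // z dz zr gz; apply: hg => //; exact: x1.
Qed.

Lemma collar_ex D : proper_disc D -> (forall x, circle x -> D x = D0 x) -> exists D' e,
 [/\ proper_disc D', isotopic_discs D D', 0 < e < 2^-1 & agrees_on_collar D0 e D'].
Proof.
move=> pD DD; have [D' [iso _ [d d0 hd]]] := disc_collarable pD DD.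
(* In square coordinates [gap] is a product of two factors [1 - (2 * t - 1) ^+ 2], each in the unit
   interval and at most [4 * t] and [4 * (1 - t)]; hence [d / 4]. *)
have [iso' [pD' _]] := isotopy_isotopic iso; pose e := Num.min 4^-1 (d / 4).
have e4 : e <= 4^-1 by rewrite ge_min lexx.
have ed : e <= d / 4 by rewrite ge_min lexx orbT.
have e0 : 0 < e by rewrite lt_min invr_gt0 ltr0n /= divr_gt0.
exists D', e; split=> //; first by lra.
move=> s v si vi h; have ds := sq_disc_in si vi; apply: hd => //.
have E : gap (square_disc s v) = (1 - (2 * s - 1) ^+ 2) * (1 - (2 * v - 1) ^+ 2).
 have -> : gap (square_disc s v) = 1 - (square_disc s v 0 0 ^+ 2 + square_disc s v 0 1 ^+ 2) by [].
 by rewrite square_discE //; ring.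
have par t : itv t -> [/\ 0 <= 1 - (2 * t - 1) ^+ 2, 1 - (2 * t - 1) ^+ 2 <= 1,
  t <= e -> 1 - (2 * t - 1) ^+ 2 <= d & 1 - e <= t -> 1 - (2 * t - 1) ^+ 2 <= d].
 move=> ti; have hq := itv_sqr ti; have h0 := sqr_ge0 (2 * t - 1); have h1 := sqr_ge0 t; have h2 := sqr_ge0 (1 - t).
 by split=> [||te|te]; lra.
have [s0 s1 sl sh] := par s si; have [v0 v1 vl vh] := par v vi.
rewrite E; case: h => h.
- by apply: le_trans (sl h); rewrite ler_piMr.
- by apply: le_trans (sh h); rewrite ler_piMr.
- by apply: le_trans (vl h); rewrite ler_piMl.
by apply: le_trans (vh h); rewrite ler_piMl.
Qed.

End Collar.

(** * Existence of the auxiliary functions *)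

Lemma end_cutoff_ex (e : R) : 0 < e < 2^-1 -> exists rho, end_cutoff e rho.
Proof.
move=> ei; pose rho (s : R) := step (2 * s / e - 1) * step (2 * (1 - s) / e - 1).
have e0 : 0 < e by lra.
exists rho; split.
- apply: smooth1_smooth_fun => n k U f oU kf.
 have k1 (g : 'R_n -> R) : ck k U g -> ck k U (fun x => 2 * g x / e - 1).
  move=> kg; apply: (ckB oU _ (ck_cst _ _ _)); apply: (ckM oU _ (ck_cst _ _ _)).
  by smooth.
 apply: (ckM oU).
  by apply: (smooth1_step oU); exact: k1.
 apply: (smooth1_step oU); apply: (k1 (fun x => 1 - f x)).
 by smooth.
- move=> s; have /andP[a0 a1] := @step01 (2 * s / e - 1); have /andP[b0 b1] := @step01 (2 * (1 - s) / e - 1).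
 by rewrite mulr_ge0 //= mulr_ile1.
- by move=> s si; rewrite /rho !step_ge1 ?mulr1 // lerBrDr ler_pdivlMr //; lra.
exists (e / 2); first lra.
move=> s [h|h]; rewrite /rho.
 by rewrite step_le0 ?mul0r // subr_le0 ler_pdivrMr //; lra.
by rewrite [step (2 * (1 - s) / e - 1)]step_le0 ?mulr0 // subr_le0 ler_pdivrMr //; lra.
Qed.

Lemma time_change_ex : exists tau : R -> R, time_change tau.
Proof.
(* Three smooth steps of heights [1/4], [1/2], [1/4] on [[0, 1/8]], [[3/8, 1/2]], [[7/8, 1]]; in
   between [tau] rests at [1/4] and at [3/4]. *)
pose tau (t : R) := 4^-1 * step (8 * t) + 2^-1 * step (8 * t - 3) + 4^-1 * step (8 * t - 7).
exists tau; split.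
- apply: smooth1_smooth_fun => n k U f oU kf.
 have k1 (a : R) : ck k U (fun x => 8 * f x - a) by smooth.
 have k2 (a b : R) : ck k U (fun x => b * step (8 * f x - a)).
  by apply: (ckM oU (ck_cst _ _ _)); exact: (smooth1_step oU).
 apply: (ckD oU _ (k2 7 4^-1)); apply: (ckD oU _ (k2 3 2^-1)).
 apply: (ck_ext oU _ (k2 0 4^-1)) => x _; by rewrite subr0.
- by rewrite /tau !step_le0 //; lra.
- by rewrite /tau !step_ge1; lra.
- move=> x y xy; rewrite /tau; apply: lerD; first apply: lerD; rewrite ler_wpM2l ?invr_ge0 //; apply: step_homo; lra.
exists 8^-1 => //.
move=> t; rewrite !ltr_norml /tau; split=> h.
 by rewrite [step (8 * t)]step_ge1 ?[step (8 * t - 3)]step_le0 ?[step (8 * t - 7)]step_le0; lra.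
by rewrite [step (8 * t)]step_ge1 ?[step (8 * t - 3)]step_ge1 ?[step (8 * t - 7)]step_le0; lra.
Qed.

(** * Comparison of the loops of two discs *)

Section Phi.
Variable D0 : 'R_2 -> M.
Local Notation I0 := (core_arc D0).
Hypothesis D0_proper : proper_disc D0.

Let I0_loop := core_arc_loop D0_proper.

Lemma disc_loop_ex D : disc_homotopic D0 D -> exists a, disc_loop D0 D a.
Proof.
move=> hD; have DD := homotopic_circle hD; have [pD _] := hD.
have [D' [e [pD' iso ei ag]]] := collar_ex D0_proper pD DD.
have [rho cut] := end_cutoff_ex ei; have [tau tch] := time_change_ex.
exists (fun t => beta D0 e rho D' (tau t)), D', e, rho, tau; split=> //.
by apply: Emb_loop_refl; exact: beta_loop.
Qed.

Lemma isotopic_refl (D : 'R_2 -> M) : proper_disc D -> isotopic_discs D D.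
Proof.
move=> pD; exists (fun=> D); split=> //.
move=> x [dx ri]; have [_ sm _ _] := pD.
have [c [J [dJ _]]] := sm _ dx.
pose pr (y : 'R_3) : 'R_2 := vec2 (y 0 0) (y 0 1).
have spr : Cinfty setT pr by exact: Cinfty_vec2.
have [S dS] := @diff_on_Cinfty 3 2 pr setT (@cylinder) x (@openT _) Logic.I spr.
have cd : \forall y \near within (@cylinder) (nbhs x), disc (pr y) by apply: within_all => y [].
by exists c, (S *m J); exact: (mdiff_comp (conj dx ri) cd dS dJ).
Qed.

Lemma loop_inj a t : Emb_loop I0 a -> itv t -> set_inj unit_itv (a t).
Proof. by move=> [_ h _] ti; have [pa _] := h t ti; exact: proper_arc_inj. Qed.

(** The null homotopy of [a1] is continued by a homotopy to the loop of the collared disc [E], by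
    the sweep to the loop of [E1], and by a homotopy to [a2]. The outer ones are isotopies of count
    0, and the sweep has count 0 under [b]. Collared discs, cutoffs and time changes may differ on
    the two sides, so that independence of these choices is included. *)
Lemma disc_loop_value b D D1 a1 a2 z : disc_path D0 b D D1 -> proper_disc D1 ->
 (forall x, circle x -> D1 x = D0 x) -> proper_disc D -> (forall x, circle x -> D x = D0 x) ->
 disc_loop D0 D a1 -> disc_loop D0 D1 a2 -> dax_value I0 a1 z ->
 exists z', dax_value I0 a2 z' /\ (b -> z' = z).
Proof.
move=> path pD1 DD1 pD DD.
move=> [E [e [rho [tau [pE iso [ei ag] [cut tch] hom]]]]].
move=> [E1 [e1 [rho1 [tau1 [pE1 iso1 [ei1 ag1] [cut1 tch1] hom1]]]]] hz.
have pEE1 : disc_path D0 b E E1.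
 apply: (disc_path_trans (D' := D)).
  by apply: disc_path_sym; exact: isotopic_path.
 by apply: (disc_path_trans path); exact: isotopic_path.
have l1 := beta_loop D0_proper pE ei ag cut tch; have l2 := beta_loop D0_proper pE1 ei1 ag1 cut1 tch1.
have [A hA A0] := sweep_dax D0_proper I0_loop pEE1 ei ei1 ag ag1 cut cut1 tch tch1 l1 l2.
have [B hB B0] := GH_Emb hom; have [C hC C0] := GH_Emb hom1.
have la1 : Emb_loop I0 a1 by have [_ h _] := hom.
have [hB' B0'] := GH_rev hB.
have [h1 E1'] := GH_glue hB' hA (fun t => loop_inj l1).
have [h2 E2'] := GH_glue h1 hC (fun t => loop_inj l2).
move/dax_valueE: hz => [Z hZ ->].
have [h3 E3'] := GH_glue hZ h2 (fun t => loop_inj la1).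
exists (dax_sum I0 (glue_family Z (glue_family (glue_family (rev_family B) A) C))).
split; first by apply/dax_valueE; eexists; [exact: h3|].
by move=> hb; rewrite E3' E2' E1' B0' B0 C0 A0 // oppr0 !addr0.
Qed.

Lemma core_tame : tame_disc D0 D0.
Proof. exact: proper_tame. Qed.

(** All the arcs lie in [D0]. Scaling their deviation from middle height by [u] contracts the loop
    through arcs in [D0], which are tame because [D0] is injective, so that the count is 0. *)
Lemma trivial_loop_value e rho tau : 0 < e < 2^-1 -> end_cutoff e rho -> time_change tau ->
 dax_value I0 (fun t => beta D0 e rho D0 (tau t)) 0.
Proof.
move=> ei cut tch; have ag : agrees_on_collar D0 e D0 by [].
have lb := beta_loop D0_proper D0_proper ei ag cut tch.
have [h h0 bm] := beta_margin ei ag cut.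
pose m := Num.min 4^-1 h.
have m0 : 0 < m by rewrite lt_min invr_gt0 ltr0n.
have m4 : m <= 4^-1 by rewrite ge_min lexx.
have mh : m <= h by rewrite ge_min lexx orbT.
have [srho rho01 _ [d d0 rd]] := cut; have [stau t0 t1 tm _] := tch.
have i2 : itv 2^-1 by lra.
pose lev s t u := 2^-1 + clamp u * ((1 - 2 * e) * rho (clamp s) * (sweep_height (clamp (tau t)) - 2^-1)).
pose K (x : 'R_3) := D0 (sq (x 0 0, lev (x 0 0) (x 0 1) (x 0 2))).
have KE s t u : K (vec3 s t u) = D0 (sq (s, lev s t u)) by rewrite /K !vecE.
have levi s t u : itv (lev s t u).
 have /andP[u0 u1] := clamp_itv u; have hi := sweep_height_itv (clamp_itv (tau t)).
 have := level_itv ei cut (clamp s) hi; rewrite /level /lev.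
 move: (_ * _ * (_ - _)) => q /andP[q0 q1].
 have [qp|qn] := leP 0 q.
  have := mulr_ge0 u0 qp; have := ler_wpM2r qp u1; lra.
 have := mulr_ge0_le0 u0 (ltW qn); have := ler_wnM2r (ltW qn) u1; lra.
have rho_ends : rho 0 = 0 /\ rho 1 = 0 by split; apply: rd; [left|right]; lra.
have clev T (f g k : T -> R) : continuous f -> continuous g -> continuous k ->
  continuous (fun x => lev (f x) (g x) (k x)).
 move=> cf cg ck; have cr := smooth_fun_cont srho; have ct := smooth_fun_cont stau.
 have csh := cont_sweep_height; by rewrite /lev; cont.
have cD0 T (f : T -> R * R) : continuous f -> continuous (fun x => D0 (sq (f x))).
 move=> cf; apply: (cont_disc_o (w := fun x => sq (f x)) (disc_cont D0_proper)).
  exact: (cont_o cf (@cont_sq)).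
 by move=> x; exact: sq_disc.
have ends t u : K (vec3 0 t u) = I0 0 /\ K (vec3 1 t u) = I0 1.
 rewrite !KE /lev (clamp_id itv0) (clamp_id itv1) rho_ends.1 rho_ends.2 !mulr0 !mul0r !mulr0 !addr0.
 by rewrite !sqE.
have [A hA A0] : exists2 A, GH I0 (fun=> I0) (fun t => beta D0 e rho D0 (tau t)) A &
  (forall t u, itv t -> itv u -> tame I0 (fun s => K (vec3 s t u))) -> dax_sum I0 A = 0.
 apply: (dax_homotopy I0_loop m0 m4 I0_loop lb).
 - apply: cD0; apply: cont_pairg; [|apply: clev]; exact: cont_coord.
 - by [].
 - by move=> t s _ si hs; apply: bm => //; case: hs => hs; [left|right]; lra.
 - by [].
 - move=> t s ti si; rewrite !KE; split.
   by rewrite /lev clamp0 mul0r addr0 sqE.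
  have tti : itv (tau t) by case/andP: ti => a b; rewrite -{1}t0 -t1 !tm.
  rewrite sqE // /lev clamp1 mul1r !clamp_id // /beta.
  by case: ifP.
 move=> u s _ si; rewrite !KE /lev t0 t1 (clamp_id itv0) (clamp_id itv1) sweep_height0 sweep_height1 subrr !mulr0 addr0.
 by rewrite sqE.
apply/dax_valueE; exists A => //; rewrite A0 // => t u _ _.
have -> : (fun s => K (vec3 s t u)) = (fun s => D0 (sq (s, lev s t u))) by apply/funext => s.
apply: core_tame.
- by apply: (cont_o (f := fun s => (s, lev s t u)) _ (@cont_sq)); apply: cont_pairg; [|apply: clev].
- by move=> s; exact: sq_disc.
- rewrite /lev (clamp_id itv0) rho_ends.1 !mulr0 !mul0r mulr0 addr0 sqE // sq_disc_mid mulr0 sub0r //.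
rewrite /lev (clamp_id itv1) rho_ends.2 !mulr0 !mul0r mulr0 addr0 sqE // sq_disc_mid mulr1.
by congr vec2; lra.
Qed.

Lemma core_disc_loop : exists2 a, disc_loop D0 D0 a & dax_value I0 a 0.
Proof.
have ei : 0 < (4^-1 : R) < 2^-1 by lra.
have [rho cut] := end_cutoff_ex ei; have [tau tch] := time_change_ex.
exists (fun t => beta D0 4^-1 rho D0 (tau t)); last exact: trivial_loop_value.
exists D0, 4^-1, rho, tau; split=> //; first exact: isotopic_refl.
by apply: Emb_loop_refl; exact: beta_loop.
Qed.

(** A loop of [D0] has a value, and the homotopy from [D0] to [D] transports its null homotopy. The
    intermediate discs are not known to be tame, so that the value itself is not controlled. *)
Lemma disc_loop_has_value D a : disc_homotopic D0 D -> disc_loop D0 D a -> exists z, dax_value I0 a z.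
Proof.
move=> hD la; have [a0 l0 v0] := core_disc_loop; have [pD _] := hD.
have [z [hz _]] := disc_loop_value (homotopic_path hD) pD (homotopic_circle hD) D0_proper (fun x _ => erefl) l0 la v0.
by exists z.
Qed.

Lemma isotopic_same_coset D D1 a a1 z z1 : disc_homotopic D0 D -> disc_homotopic D0 D1 -> isotopic_discs D D1 ->
 disc_loop D0 D a -> disc_loop D0 D1 a1 -> dax_value I0 a z -> dax_value I0 a1 z1 ->
 dax_coset I0 z = dax_coset I0 z1.
Proof.
move=> hD hD1 iso la la1 hz hz1; have [pD _] := hD; have [pD1 _] := hD1.
have DD := homotopic_circle hD; have DD1 := homotopic_circle hD1.
have path := isotopic_path D0_proper True pD pD1 DD iso.
have [z' [hz' /(_ Logic.I) E]] := disc_loop_value path pD1 DD1 pD DD la la1 hz.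
apply: dax_coset_eq => //; rewrite -E; apply: (dax_valueB _ hz' hz1) => t.
by apply: loop_inj; have [E1 [e [rho [tau [_ _ _ _ [_ h _]]]]]] := la1.
Qed.

End Phi.

End Dax.

Theorem corollary0p5 (R : realType) (M : oriented_manifold4 R)
    (M_connected : connected [set: M])
    (D0 : 'rV[R]_2 -> M) (D0_proper : proper_disc D0) :
  exists phi : disc_isotopy_class D0 -> dax_quotient (core_arc D0),
    is_phi phi /\
    (forall (D : 'rV[R]_2 -> M) (hD : disc_homotopic D0 D),
       phi (class_of_disc hD) <> dax_coset (core_arc D0) 0 ->
       ~ isotopic_discs D D0).
Proof.
(* A class is a set of discs: a representative, a loop for it and a value of that loop are chosen
   for each class. *)
have pick (X : disc_isotopy_class D0) : exists z : Zpi1 (core_arc D0), exists D (hD : disc_homotopic D0 D) a,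
  [/\ X = class_of_disc hD, disc_loop D0 D a & dax_value (core_arc D0) a z].
 case: X => X hX; have [D hD XE] := hX.
 have [a la] := disc_loop_ex D0_proper hD; have [z hz] := disc_loop_has_value D0_proper hD la.
 exists z, D, hD, a; split=> //.
 by apply: (eq_sig_hprop (fun _ => @Prop_irrelevance _)).
have [f hf] := choice pick.
have main D (hD : disc_homotopic D0 D) a z : disc_loop D0 D a -> dax_value (core_arc D0) a z ->
  dax_coset (core_arc D0) (f (class_of_disc hD)) = dax_coset (core_arc D0) z.
 move=> la hz; have [D1 [hD1 [a1 [E la1 hz1]]]] := hf (class_of_disc hD).
 have [pD _] := hD.
 (* [D] belongs to its own class, which as a set is also the class of the chosen representative
    [D1]; so [D1] is isotopic to [D]. *)
 have [_ iso] : sval (class_of_disc hD1) D by rewrite -E; split=> //; exact: isotopic_refl.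
 exact: (isotopic_same_coset D0_proper hD1 hD iso la1 la hz1 hz).
exists (fun X => dax_coset (core_arc D0) (f X)); split.
 move=> D hD; split; [exact: disc_loop_ex|by move=> a; exact: disc_loop_has_value|].
 by exact: main.
move=> D hD ne iso; apply: ne; have [a la] := disc_loop_ex D0_proper hD.
(* A loop of [D0] has value 0, and the isotopy from [D] to [D0], read backwards, transports this
   value to a loop of [D]. *)
have [a0 l0 v0] := core_disc_loop D0_proper; have [pD _] := hD; have DD := homotopic_circle hD.
have path := disc_path_sym (isotopic_path D0_proper True pD D0_proper DD iso).
have [z [hz /(_ Logic.I) E]] := disc_loop_value D0_proper path pD DD D0_proper (fun x _ => erefl) l0 la v0.
by rewrite (main D hD a z la hz) E.
Qed.
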